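(* Let $X$ be a complete SMOS. Put $B_{M_\infty(X)}^+ := \{x\in M_\infty(X)^+:\|x\|\le 1\}$ and $U_X:=\{u-v: u,v\in B_{M_\infty(X)}^+\}$. Let $\mathcal{N}_X$ be the set of all matrix norms on $X^*$ of the form $\lambda^*$, where $\lambda$ is a matrix norm on $X$ with $\lambda\ge\|\cdot\|$ and $\lambda\sim\|\cdot\|$, and let $\mathcal{N}_X^{\mathrm{sys}}$ be the set of those $\lambda^*\in\mathcal{N}_X$ such that $X^*$ becomes a dual operator system under the dual matrix cone and the matrix norm $\lambda^*$. (a) The following statements are equivalent. (1) $X^*$ is a dual quasi-operator system. (2) $U_X$ is a zero neighborhood of the normed space $M_\infty(X)^{\mathrm{sa}}$. (3) The norm closure $\overline{U_X}$ of $U_X$ is a zero neighborhood of $M_\infty(X)^{\mathrm{sa}}$. (4) $\mathcal{N}_X^{\mathrm{sys}}\neq\emptyset$. (b) Suppose that $X^*$ is a dual quasi-operator system, and for $f\in M_\infty(X^* )$ set $$\|f\|^{\mathrm d}:=\big\|\mu_{X^*}^{(\infty)}(f)\big\|=\sup\big\{\big\|\theta_f^{(n)}(x)\big\|: x\in M_n(X)^+;\ \|x\|\le 1;\ n\in\mathbb{N}\big\}.$$ Then $\|\cdot\|^{\mathrm d}$ is the largest element in $\mathcal{N}_X^{\mathrm{sys}}$.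
   Context: Matrices. For a complex vector space $X$ identify $M_n(X)\subseteq M_{n+1}(X)$ (upper left corner) and put $M_\infty(X)=\bigcup_n M_n(X)$. For linear $\varphi:X\to Y$, $\varphi^{(\infty)}([x_{i,j}])=[\varphi(x_{i,j})]$ on $M_\infty(X)$ and $\varphi^{(n)}=\varphi^{(\infty)}|_{M_n(X)}$. An operator space is a complex vector space $X$ with a norm on $M_\infty(X)$ (a matrix norm) such that $\|\sum_k a_k^*x_kb_k\|\le\|\sum_k a_k^*a_k\|^{1/2}\|\sum_k b_k^*b_k\|^{1/2}\max_k\|x_k\|$ for all finite families $a_k,b_k\in M_\infty(\mathbb{C})$, $x_k\in M_\infty(X)$. A linear map $\varphi$ between operator spaces is completely bounded / a complete contraction / a complete isometry / a complete embedding if $\varphi^{(\infty)}$ is bounded / contractive / isometric / bounded and bounded below ($\inf_{\|x\|=1}\|\varphi^{(\infty)}(x)\|>0$). SMOS and MOS. A semi-matrix ordered operator space (SMOS) is an operator space $X$ with an involution $*$ such that $[x_{i,j}]\mapsto[x_{j,i}^*]$ is isometric on $M_\infty(X)$, and a norm-closed subset (matrix cone) $M_\infty(X)^+\subseteq M_\infty(X)^{\mathrm{sa}}:=\{x:x^*=x\}$ with $\sum_k a_k^*x_ka_k\in M_\infty(X)^+$ for all finite families $a_k\in M_\infty(\mathbb{C})$, $x_k\in M_\infty(X)^+$. Put $M_n(X)^+=M_n(X)\cap M_\infty(X)^+$, similarly $M_n(X)^{\mathrm{sa}}$. It is complete if $X$ is norm-complete. It is a MOS if $M_\infty(X)^+\cap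 -M_\infty(X)^+=\{0\}$. For SMOSs, a $*$-preserving linear map $\varphi:X\to Y$ is completely positive if $\varphi^{(\infty)}(M_\infty(X)^+)\subseteq M_\infty(Y)^+$; completely order monomorphic if it is injective and, for $x\in M_\infty(X)^{\mathrm{sa}}$, $x\in M_\infty(X)^+\Leftrightarrow\varphi^{(\infty)}(x)\in M_\infty(Y)^+$; a MOS isomorphism if it is a bijective completely order monomorphic complete embedding. $\mathrm{CC}^+(X,Y)$ denotes the set of completely positive complete contractions. An operator system is a self-adjoint subspace of some $\mathcal{L}(\mathfrak{H})$ (bounded operators on a Hilbert space) with the induced matrix norm, involution and matrix cone. Duals. For $f=[f_{i,j}]\in M_\infty(X^* )$ let $\theta_f(x)=[f_{i,j}(x)]$ ($x\in X$), a map $X\to M_\infty(\mathbb{C})$. The dual space $X^*$ of a SMOS $X$ is always the SMOS with involution $f^*(x)=\overline{f(x^* )}$, i.e. $[f_{i,j}]^*=[(f_{j,i})^*]$, dual matrix norm $\|f\|=\sup\{\|\theta_f^{(\infty)}(x)\|:x\in M_\infty(X),\|x\|\le1\}$ and dual matrix cone $M_\infty(X^* )^+=\{f\in M_\infty(X^* )^{\mathrm{sa}}:\theta_f\text{ is completely positive}\}$. Dual objects. A SMOS (resp. MOS) $D$ is a dual SMOS (resp. dual MOS) if there is a $*$-invariant norm-closed subspace $D_\#\subseteq D^*$ (a predual) such that the canonical map $D\to(D_\#)^*$ is a surjective complete isometry, and $M_\infty(D)^+$ is closed under the weak-$*$ topology $\sigma(M_\infty(D),M_\infty(D_\#))$ (entrywise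 $\sigma(D,D_\#)$-convergence). For complete $X$, $X^*$ is a dual SMOS with predual $X$. A dual MOS $D$ is a dual quasi-operator system (resp. dual operator system) if there is a weak-$*$-homeomorphic (resp. weak-$*$-homeomorphic completely isometric) MOS isomorphism from $D$ onto a weak-$*$-closed (self-adjoint) subspace of some $\mathcal{L}(\mathfrak{H})$. The map $\mu_D$. For a dual MOS $D$ with predual $D_\#$, let $\mathcal{WQ}^D_n$ be the set of $\sigma(D,D_\#)$-continuous maps in $\mathrm{CC}^+(D,M_n(\mathbb{C}))$, let $N(D)=\bigoplus^{\ell_\infty}_{n\in\mathbb{N}}\ell_\infty(\mathcal{WQ}^D_n;M_n(\mathbb{C}))$ (a von Neumann algebra), and let $\mu_D:D\to N(D)$ be $\mu_D(x)=(\mu_D(x)_n)_n$ with $\mu_D(x)_n(\varphi)=\varphi(x)$. Matrix norms. For a matrix norm $\lambda$ on the operator space $(X,\|\cdot\|)$, $\lambda\sim\|\cdot\|$ means that the identity map $(X,\lambda)\to(X,\|\cdot\|)$ is a complete embedding; then $(X,\lambda)^*=X^*$ as vector spaces and $\lambda^*$ denotes the dual matrix norm on $(X,\lambda)^*$. ''Largest'' refers to the pointwise order of matrix norms on $M_\infty(X^* )$. *)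

(* Defs.v *)
(* The complex numbers are R[i] over an arbitrary R : realType. *)
From HB Require Import structures.
From mathcomp Require Import all_boot all_order all_algebra.
From mathcomp Require Import sesquilinear spectral.
From mathcomp Require Import complex ring lra.
From mathcomp Require Import all_classical all_reals all_analysis.

Set Implicit Arguments.
Unset Strict Implicit.
Unset Printing Implicit Defensive.

Import Order.TTheory GRing.Theory Num.Theory numFieldNormedType.Exports.
Local Open Scope classical_set_scope.
Local Open Scope ring_scope.

Section InfiniteMatrices.
Context {R : realType}.

Definition finsupp (X : lmodType R[i]) : {pred (nat -> nat -> X)} :=
  fun x => `[< exists n, forall i j, (n <= i)%N || (n <= j)%N -> x i j = 0 >].

Lemma finsupp_submod_closed (X : lmodType R[i]) : submod_closed (@finsupp X).
Proof.
split=> [|c x y]; first by apply/asboolP; exists 0%N.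
move=> /asboolP[n xn] /asboolP[m ym]; apply/asboolP; exists (maxn n m) => i j.
rewrite !geq_max => ij.
have /xn x0 : (n <= i)%N || (n <= j)%N.
  by case/orP: ij => /andP[-> _] //; rewrite orbT.
have /ym y0 : (m <= i)%N || (m <= j)%N.
  by case/orP: ij => /andP[_ ->] //; rewrite orbT.
by transitivity (c *: x i j + y i j) => //; rewrite x0 y0 scaler0 addr0.
Qed.

HB.instance Definition _ (X : lmodType R[i]) :=
  GRing.isSubmodClosed.Build R[i] (nat -> nat -> X) (@finsupp X)
    (finsupp_submod_closed X).

(* M_oo(X); the subspace M_n(X) is [Mn n] below *)
Record Moo (X : lmodType R[i]) :=
  MkMoo { mentry :> nat -> nat -> X; _ : mentry \in @finsupp X }.

HB.instance Definition _ (X : lmodType R[i]) := [isSub for @mentry X].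
HB.instance Definition _ (X : lmodType R[i]) := [Choice of Moo X by <:].
HB.instance Definition _ (X : lmodType R[i]) :=
  [SubChoice_isSubLmodule of Moo X by <:].

Definition Mn (X : lmodType R[i]) (n : nat) : set (Moo X) :=
  [set x : Moo X | forall i j, (n <= i)%N || (n <= j)%N -> x i j = 0].

(* The matrix with entries g i j. The default value 0 is taken only if g is not
   finitely supported, which does not occur in the uses below. *)
Definition minf {X : lmodType R[i]} (g : nat -> nat -> X) : Moo X :=
  insubd (0 : Moo X) g.

(* phi^(oo), for phi with phi 0 = 0 *)
Definition mmap {X Y : lmodType R[i]} (phi : X -> Y) (x : Moo X) : Moo Y :=
  minf (fun i j => phi (x i j)).

(* x as an element of M_1(X) *)
Definition mx1 {X : lmodType R[i]} (x : X) : Moo X :=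
  minf (fun i j => if (i == 0%N) && (j == 0%N) then x else 0).

(* a^* x b *)
Definition msand {X : lmodType R[i]} (a : Moo R[i]) (x : Moo X) (b : Moo R[i]) :
  Moo X :=
  minf (fun i j => \sum_(k \in [set: nat]) \sum_(l \in [set: nat])
                     ((a k i)^* * b l j) *: x k l).

(* a^* b *)
Definition madjmul (a b : Moo R[i]) : Moo R[i] :=
  minf (fun i j => \sum_(k \in [set: nat]) ((a k i)^* * b k j)).

End InfiniteMatrices.

(* The data of a SMOS; the axioms are [is_smos]. They are kept apart because one
   dual space carries several matrix norms, see [dual_with]. *)
Record smosData (R : realType) := SmosData {
  smos_sort :> lmodType R[i];
  mnorm : Moo smos_sort -> R;
  star : smos_sort -> smos_sort;
  mcone : set (Moo smos_sort)
}.
Arguments mnorm {R} s _.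
Arguments star {R} s _.
Arguments mcone {R} s _.

Section Basics.
Context {R : realType}.

Definition norm1 (X : smosData R) (x : X) : R := mnorm X (mx1 x).

Definition mstar (X : smosData R) (x : Moo X) : Moo X :=
  minf (fun i j => star X (x j i)).

Definition msa (X : smosData R) : set (Moo X) := [set x : Moo X | mstar x = x].

End Basics.

Section InnerProduct.
Context {R : realType} {H : lmodType R[i]} (dot : {dot H for Num.conj}).

Definition hnorm (v : H) : R := Num.sqrt (complex.Re (dot v v)).

(* Matrices over a space V acting on H by [act]: the norm and the positivity of
   operators on the sums of m copies of H, m arbitrary. *)
Definition op_mnorm (V : lmodType R[i]) (act : V -> H -> H) (y : Moo V) : R :=
  sup [set r | exists m (xi : 'I_m -> H), \sum_(i < m) hnorm (xi i) ^+ 2 <= 1 /\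
    r = Num.sqrt (\sum_(i < m) hnorm (\sum_(j < m) act (y i j) (xi j)) ^+ 2)].

Definition op_mpos (V : lmodType R[i]) (act : V -> H -> H) : set (Moo V) :=
  [set y : Moo V | forall m (xi : 'I_m -> H),
     0 <= \sum_(i < m) \sum_(j < m) dot (act (y i j) (xi j)) (xi i)].

Definition op_bounded (T : H -> H) :=
  exists K : R, forall v, hnorm (T v) <= K * hnorm v.

Lemma hnorm_sqr v : hnorm v ^+ 2 = complex.Re (dot v v).
Proof.
rewrite sqr_sqrtr //; have := dnorm_ge0 dot v.
by case: (dot v v) => a b; rewrite lecE => /andP[].
Qed.

Lemma hnormZ c v : hnorm (c *: v) = Normc.normc c * hnorm v.
Proof.
apply/eqP; rewrite -(@eqrXn2 _ 2) ?mulr_ge0 ?sqrtr_ge0 //; last first.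
  by case: c => a b; rewrite sqrtr_ge0.
rewrite exprMn !hnorm_sqr dnormZ.
case: c => a b; case: (dot v v) => x y.
rewrite [`|_|]/= /Normc.normc sqr_sqrtr ?addr_ge0 ?sqr_ge0 //.
rewrite -rmorphXn /= sqr_sqrtr ?addr_ge0 ?sqr_ge0 //.
by rewrite mul0r subr0.
Qed.

Lemma hnormD_le v w : hnorm (v + w) <= 2 * (hnorm v + hnorm w).
Proof.
have nn u : 0 <= hnorm u by exact: sqrtr_ge0.
rewrite -(@ler_pXn2r _ 2) ?nnegrE ?mulr_ge0 ?addr_ge0 //.
have par : hnorm (v + w) ^+ 2 + hnorm (v - w) ^+ 2 =
           2 * hnorm v ^+ 2 + 2 * hnorm w ^+ 2.
  rewrite !hnorm_sqr dnormD dnormB.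
  case: (dot v v) => a a'; case: (dot w w) => b b'.
  by case: (dot v w) => c c' /=; ring.
have := sqr_ge0 (hnorm (v - w)); have := nn v; have := nn w.
nra.
Qed.

Lemma op_boundedP c T U : op_bounded T -> op_bounded U ->
  op_bounded (fun v => c *: T v + U v).
Proof.
move=> [K hK] [L hL]; exists (2 * (Normc.normc c * K + L)) => v.
apply: (le_trans (hnormD_le _ _)); rewrite -mulrA ler_pM2l // hnormZ mulrDl.
rewrite lerD // -mulrA ler_wpM2l //.
by case: c => a b; rewrite sqrtr_ge0.
Qed.

End InnerProduct.

Section MatrixAlgebras.
Context {R : realType}.

(* Row vectors are used for the columns of C^n, as [dotmx] is defined on rows. *)
Definition mxact n (A : 'M[R[i]]_n) (v : 'rV[R[i]]_n) : 'rV[R[i]]_n :=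
  v *m A^T.

Definition mx_smos (n : nat) : smosData R :=
  @SmosData R 'M[R[i]]_n
    (op_mnorm (@dotmx R[i] n) (@mxact n))
    (fun A => map_mx Num.conj A^T)
    (op_mpos (@dotmx R[i] n) (@mxact n)).

Definition corner n (a : Moo R[i]) : 'M[R[i]]_n := \matrix_(i, j) a i j.

(* M_oo(C), as the union of the increasing sequence of the M_n(C) *)
Definition Moo_smos : smosData R :=
  @SmosData R (Moo R[i])
    (fun y => sup [set mnorm (mx_smos n) (mmap (corner n) y) | n in [set: nat]])
    (fun a => minf (fun i j => (a j i)^*))
    [set y | forall n, mcone (mx_smos n) (mmap (corner n) y)].

(* the norm of M_oo(C) *)
Definition cnorm (a : Moo R[i]) : R := norm1 (X := Moo_smos) a.

End MatrixAlgebras.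

Section Structures.
Context {R : realType}.

Definition matrix_norm (X : lmodType R[i]) (N : Moo X -> R) :=
  [/\ forall x, N x = 0 -> x = 0,
      forall x y, N (x + y) <= N x + N y,
      forall c x, N (c *: x) = Normc.normc c * N x
    & forall m (a b : 'I_m -> Moo R[i]) (x : 'I_m -> Moo X),
        N (\sum_(k < m) msand (a k) (x k) (b k)) <=
        Num.sqrt (cnorm (\sum_(k < m) madjmul (a k) (a k))) *
        Num.sqrt (cnorm (\sum_(k < m) madjmul (b k) (b k))) *
        \big[Num.max/0]_(k < m) N (x k)].

Definition norm_closure (V : lmodType R[i]) (N : V -> R) (A : set V) : set V :=
  [set x | forall e, 0 < e -> exists2 y, A y & N (x - y) < e].

Definition norm_closed (V : lmodType R[i]) (N : V -> R) (A : set V) :=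
  norm_closure N A `<=` A.

Definition norm_complete (V : lmodType R[i]) (N : V -> R) :=
  forall u : nat -> V,
    (forall e, 0 < e -> exists n0, forall n m, (n0 <= n)%N -> (n0 <= m)%N ->
       N (u n - u m) < e) ->
    exists l, forall e, 0 < e -> exists n0, forall n, (n0 <= n)%N ->
       N (u n - l) < e.

Definition is_smos (X : smosData R) :=
  [/\ matrix_norm (mnorm X),
      (forall c (x y : X), star X (c *: x + y) = c^* *: star X x + star X y) /\
        involutive (star X),
      forall x : Moo X, mnorm X (mstar x) = mnorm X x,
      mcone X `<=` @msa R X /\ norm_closed (mnorm X) (mcone X)
    & forall m (a : 'I_m -> Moo R[i]) (x : 'I_m -> Moo X),
        (forall k, mcone X (x k)) ->
        mcone X (\sum_(k < m) msand (a k) (x k) (a k))].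

Definition complete_smos (X : smosData R) := norm_complete (@norm1 R X).

Definition is_mos (X : smosData R) :=
  is_smos X /\ forall x, mcone X x -> mcone X (- x) -> x = 0.

End Structures.

Section Maps.
Context {R : realType}.

(* phi is linear throughout; NX and NY are matrix norms *)
Definition complete_contraction (X Y : lmodType R[i]) (NX : Moo X -> R)
    (NY : Moo Y -> R) (phi : X -> Y) :=
  forall x, NY (mmap phi x) <= NX x.

Definition complete_isometry (X Y : lmodType R[i]) (NX : Moo X -> R)
    (NY : Moo Y -> R) (phi : X -> Y) :=
  forall x, NY (mmap phi x) = NX x.

Definition complete_embedding (X Y : lmodType R[i]) (NX : Moo X -> R)
    (NY : Moo Y -> R) (phi : X -> Y) :=
  (exists K, forall x, NY (mmap phi x) <= K * NX x) /\
  (0 < ereal_inf [set (NY (mmap phi x))%:E | x in [set x | NX x = 1%R]])%E.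

Definition star_linear (X Y : smosData R) (phi : X -> Y) :=
  linear phi /\ forall x, phi (star X x) = star Y (phi x).

Definition completely_positive (X Y : smosData R) (phi : X -> Y) :=
  star_linear phi /\ forall x, mcone X x -> mcone Y (mmap phi x).

Definition order_monomorphic (X Y : smosData R) (phi : X -> Y) :=
  [/\ star_linear phi, injective phi
    & forall x, msa x -> (mcone X x <-> mcone Y (mmap phi x))].

Definition mos_isomorphism (X Y : smosData R) (phi : X -> Y) :=
  [/\ bijective phi, order_monomorphic phi
    & complete_embedding (mnorm X) (mnorm Y) phi].

Definition CCpos (X Y : smosData R) : set (X -> Y) :=
  [set phi | completely_positive phi /\
             complete_contraction (mnorm X) (mnorm Y) phi].

Definition homeomorphism (S T : topologicalType) (phi : S -> T) :=
  continuous phi /\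
  exists psi : T -> S, [/\ cancel phi psi, cancel psi phi & continuous psi].

End Maps.

Record subsp (R : realType) (V : lmodType R[i]) (S : submodClosed V) :=
  SubSp { subsp_val :> V; _ : subsp_val \in S }.
Arguments subsp_val {R V S} _.

HB.instance Definition _ (R : realType) (V : lmodType R[i])
  (S : submodClosed V) := [isSub for @subsp_val R V S].
HB.instance Definition _ (R : realType) (V : lmodType R[i])
  (S : submodClosed V) := [Choice of subsp S by <:].
HB.instance Definition _ (R : realType) (V : lmodType R[i])
  (S : submodClosed V) := [SubChoice_isSubLmodule of subsp S by <:].

(* A self-adjoint subspace with the induced structure *)
Definition sub_smos (R : realType) (X : smosData R) (S : submodClosed X) :
    smosData R :=
  @SmosData R (subsp S)
    (fun x => mnorm X (mmap (subsp_val (S := S)) x))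
    (fun x => insubd (0 : subsp S) (star X x))
    [set x | mcone X (mmap (subsp_val (S := S)) x)].

Section DualSpace.
Context {R : realType}.

Definition bounded_functional (V : lmodType R[i]) (p : V -> R) :
    {pred (V -> R[i])} :=
  fun f => `[< scalar f /\ exists K, forall x, Normc.normc (f x) <= K * p x >].

Lemma bounded_functional_submod_closed (V : lmodType R[i]) (p : V -> R) :
  submod_closed (bounded_functional p).
Proof.
split=> [|c f g].
  apply/asboolP; split=> [a x y|]; first by rewrite /= mulr0 addr0.
  by exists 0 => x; rewrite mul0r Normc.normc0.
move=> /asboolP[lf [K fK]] /asboolP[lg [L gL]]; apply/asboolP; split.
  move=> a x y.
  rewrite -[LHS]/(c * f (a *: x + y) + g (a *: x + y)).
  rewrite -[RHS]/(a * (c * f x + g x) + (c * f y + g y)).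
  by rewrite lf lg; ring.
exists (Normc.normc c * K + L) => x.
apply: (le_trans (le_normcD _ _)); rewrite mulrDl lerD // Normc.normcM -mulrA.
by rewrite ler_wpM2l //; case: c => a b; rewrite sqrtr_ge0.
Qed.

HB.instance Definition _ (V : lmodType R[i]) (p : V -> R) :=
  GRing.isSubmodClosed.Build R[i] (V -> R[i]) (bounded_functional p)
    (bounded_functional_submod_closed p).

(* The Banach dual of (V, p). For lam ~ ||.|| the space (X, lam)^* is this same
   type, with p the norm of X. *)
Record bdfun (V : lmodType R[i]) (p : V -> R) :=
  BdFun { bdfun_val :> V -> R[i]; _ : bdfun_val \in bounded_functional p }.

HB.instance Definition _ (V : lmodType R[i]) (p : V -> R) :=
  [isSub for @bdfun_val V p].
HB.instance Definition _ (V : lmodType R[i]) (p : V -> R) :=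
  [Choice of bdfun p by <:].
HB.instance Definition _ (V : lmodType R[i]) (p : V -> R) :=
  [SubChoice_isSubLmodule of bdfun p by <:].

Definition theta (V : lmodType R[i]) (p : V -> R) (f : Moo (bdfun p)) (x : V) :
    Moo R[i] :=
  minf (fun i j => f i j x).

Definition dual_norm (V : lmodType R[i]) (p : V -> R) (lam : Moo V -> R)
    (f : Moo (bdfun p)) : R :=
  sup [set mnorm Moo_smos (mmap (theta f) x) | x in [set x | lam x <= 1]].

Section Duals.
Variable X : smosData R.
Local Notation X' := (bdfun (@norm1 R X)).

Definition dual_star (f : X') : X' := insubd (0 : X') (fun x => (f (star X x))^*).

Definition dual_cone : set (Moo X') :=
  [set f : Moo X' | minf (fun i j => dual_star (f j i)) = f /\
           completely_positive (theta f : X -> Moo_smos)].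

(* X^* with the dual involution and cone, and with the matrix norm nu *)
Definition dual_with (nu : Moo X' -> R) : smosData R :=
  @SmosData R X' nu dual_star dual_cone.

Definition dual : smosData R := dual_with (dual_norm (mnorm X)).

End Duals.
End DualSpace.

Section WeakStar.
Context {R : realType}.

(* The initial topology on V with respect to a set F of functions V -> C. *)
Definition weak_topology_of (V : choiceType) (F : set (V -> R[i])) :
    topologicalType :=
  initial_topology
    (fun x : V => (fun g : set_type F => \val g x) : {ptws set_type F -> R[i]^o}).

Variables (D : smosData R) (P : set (dual D)).

(* sigma(D, P) *)
Definition weakstar : topologicalType :=
  weak_topology_of [set g : D -> R[i] |
    exists2 phi : bdfun (@norm1 R D), P phi & g = phi].

(* sigma(M_oo(D), M_oo(P)) *)
Definition Moo_weakstar : topologicalType :=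
  weak_topology_of [set g : Moo D -> R[i] |
    exists2 phi : bdfun (@norm1 R D), P phi & exists i j, g = fun x => phi (x i j)].

(* the canonical map D -> S^*, S a subspace of D^* *)
Definition canonical_map (S : submodClosed (dual D)) (x : D) :
    dual (sub_smos (X := dual D) S) :=
  insubd (0 : bdfun (@norm1 R (sub_smos (X := dual D) S)))
    (fun phi => (subsp_val phi : bdfun (@norm1 R D)) x).

Definition is_predual :=
  exists S : submodClosed (dual D),
    [/\ forall phi, phi \in S <-> P phi,
        forall phi, P phi -> P (star (dual D) phi),
        norm_closed (@norm1 R (dual D)) P,
        forall g, exists x, canonical_map S x = g
      & complete_isometry (mnorm D) (mnorm (dual (sub_smos (X := dual D) S)))
          (canonical_map S)].

Definition dual_smos :=
  [/\ is_smos D, is_predual & closed (mcone D : set Moo_weakstar)].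

Definition dual_mos := dual_smos /\ is_mos D.

End WeakStar.

Record hilbert (R : realType) := Hilbert {
  hsort :> lmodType R[i];
  hdot : {dot hsort for Num.conj};
  hilbert_complete : norm_complete (hnorm hdot)
}.
Arguments hdot {R} h.

Section Operators.
Context {R : realType} (H : hilbert R).

Definition bounded_operator : {pred (H -> H)} :=
  fun T => `[< linear T /\ op_bounded (hdot H) T >].

Lemma bounded_operator_submod_closed : submod_closed bounded_operator.
Proof.
split=> [|c T U].
  apply/asboolP; split=> [a x y|]; first by rewrite /= scaler0 addr0.
  exists 0 => v; rewrite mul0r -[X in hnorm _ X](scale0r (0 : H)) hnormZ.
  by rewrite Normc.normc0 mul0r.
move=> /asboolP[lT bT] /asboolP[lU bU]; apply/asboolP; split.
  move=> a x y.
  rewrite -[LHS]/(c *: T (a *: x + y) + U (a *: x + y)).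
  rewrite -[RHS]/(a *: (c *: T x + U x) + (c *: T y + U y)).
  by rewrite lT lU !scalerDr !scalerA addrACA [a * c]mulrC.
exact: op_boundedP.
Qed.

HB.instance Definition _ :=
  GRing.isSubmodClosed.Build R[i] (H -> H) bounded_operator
    bounded_operator_submod_closed.

Record bdop := BdOp { bdop_val :> H -> H; _ : bdop_val \in bounded_operator }.

HB.instance Definition _ := [isSub for bdop_val].
HB.instance Definition _ := [Choice of bdop by <:].
HB.instance Definition _ := [SubChoice_isSubLmodule of bdop by <:].

(* The adjoint; it exists by the Riesz representation theorem. *)
Definition adjoint (T : bdop) : bdop :=
  xget 0 [set T' : bdop | forall v w, hdot H (T v) w = hdot H v (T' w)].

Definition LH : smosData R :=
  @SmosData R bdop (op_mnorm (hdot H) bdop_val) adjoint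
    (op_mpos (hdot H) bdop_val).

Definition square_summable (xi : nat -> H) :=
  cvgn (series (fun k => hnorm (hdot H) (xi k) ^+ 2)).

(* The predual of L(H): the functionals T |-> sum_k <T xi_k, eta_k> with
   square summable sequences xi and eta. *)
Definition normal_functionals : set (bdop -> R[i]) :=
  [set g | exists xi eta, [/\ square_summable xi, square_summable eta
     & forall T : bdop,
         series (fun k => hdot H (T (xi k)) (eta k) : R[i]^o) @ \oo
           --> (g T : R[i]^o)]].

Definition LH_weakstar : topologicalType := weak_topology_of normal_functionals.

(* A subspace of L(H) with the relative weak-* topology *)
Definition subsp_weakstar (W : submodClosed LH) : topologicalType :=
  initial_topology (subsp_val : subsp W -> LH_weakstar).

End Operators.

Section DualOperatorSystems.
Context {R : realType} (D : smosData R) (P : set (dual D)).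

(* phi is a weak-*-homeomorphic MOS isomorphism from D, with predual P, onto the
   weak-*-closed self-adjoint subspace W of L(H) *)
Definition dual_representation (H : hilbert R) (W : submodClosed (LH H))
    (phi : D -> sub_smos W) :=
  [/\ forall T : bdop H, T \in W -> adjoint T \in W,
      closed ([set T | T \in W] : set (LH_weakstar H)),
      mos_isomorphism phi
    & homeomorphism (phi : weakstar P -> subsp_weakstar W)].

Definition dual_quasi_operator_system :=
  dual_mos P /\
  exists (H : hilbert R) (W : submodClosed (LH H)) (phi : D -> sub_smos W),
    dual_representation phi.

Definition dual_operator_system :=
  dual_mos P /\
  exists (H : hilbert R) (W : submodClosed (LH H)) (phi : D -> sub_smos W),
    dual_representation phi /\
    complete_isometry (mnorm D) (mnorm (sub_smos W)) phi.

End DualOperatorSystems.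

Section ProductOfMatrixAlgebras.
Context {R : realType} {I : Type} (n : I -> nat).

Definition mxfam := forall i, 'M[R[i]]_(n i).

HB.instance Definition _ := gen_eqMixin mxfam.
HB.instance Definition _ := gen_choiceMixin mxfam.

Program Definition mxfam_zmodMixin := @GRing.isZmodule.Build mxfam
  (fun=> 0) (fun y i => - y i) (fun y z i => y i + z i) _ _ _ _.
Next Obligation. by move=> x y z; apply: functional_extensionality_dep => i; rewrite addrA. Qed.
Next Obligation. by move=> x y; apply: functional_extensionality_dep => i; rewrite addrC. Qed.
Next Obligation. by move=> x; apply: functional_extensionality_dep => i; rewrite add0r. Qed.
Next Obligation. by move=> x; apply: functional_extensionality_dep => i; rewrite addNr. Qed.
HB.instance Definition _ := mxfam_zmodMixin.

Program Definition mxfam_lmodMixin := @GRing.Zmodule_isLmodule.Build R[i] mxfam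
  (fun c y i => c *: y i) _ _ _ _.
Next Obligation. by move=> c d x; apply: functional_extensionality_dep => i; rewrite scalerA. Qed.
Next Obligation. by move=> x; apply: functional_extensionality_dep => i; rewrite scale1r. Qed.
Next Obligation. by move=> c x y; apply: functional_extensionality_dep => i; rewrite scalerDr. Qed.
Next Obligation. by move=> x c d; apply: functional_extensionality_dep => i; rewrite scalerDl. Qed.
HB.instance Definition _ := mxfam_lmodMixin.

Definition bounded_fam : {pred mxfam} :=
  fun y => `[< exists K : R, forall i (v : 'rV[R[i]]_(n i)),
     hnorm (@dotmx _ _) (mxact (y i) v) <= K * hnorm (@dotmx _ _) v >].

Lemma bounded_fam_submod_closed : submod_closed bounded_fam.
Proof.
split=> [|c y z].
  apply/asboolP; exists 0 => i v; rewrite mul0r.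
  rewrite /mxact trmx0 mulmx0 -[X in hnorm _ X](scale0r (0 : 'rV_(n i))).
  by rewrite hnormZ Normc.normc0 mul0r.
move=> /asboolP[K yK] /asboolP[L zL]; apply/asboolP.
exists (2 * (Normc.normc c * K + L)) => i v.
rewrite -[mxact _ v]/(v *m (c *: y i + z i)^T) linearP /= mulmxDr -scalemxAr.
apply: (le_trans (hnormD_le _ _ _)); rewrite -mulrA ler_pM2l // hnormZ mulrDl.
rewrite lerD //; last exact: zL.
rewrite -mulrA ler_wpM2l //; last exact: yK.
by case: c => a b; rewrite sqrtr_ge0.
Qed.

HB.instance Definition _ :=
  GRing.isSubmodClosed.Build R[i] mxfam bounded_fam bounded_fam_submod_closed.

Record linf := Linf { linf_val : mxfam; _ : linf_val \in bounded_fam }.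

HB.instance Definition _ := [isSub for linf_val].
HB.instance Definition _ := [Choice of linf by <:].
HB.instance Definition _ := [SubChoice_isSubLmodule of linf by <:].

Definition linf_smos : smosData R :=
  @SmosData R linf
    (fun Y => sup [set mnorm (mx_smos (n i))
                     (mmap (fun y : linf => linf_val y i) Y) | i in [set: I]])
    (fun y => insubd (0 : linf) (fun i => star (mx_smos (n i)) (linf_val y i)))
    [set Y : Moo linf | forall i, mcone (mx_smos (n i))
                     (mmap (fun y : linf => linf_val y i) Y)].

End ProductOfMatrixAlgebras.

Section Mu.
Context {R : realType} (D : smosData R) (P : set (dual D)).

Definition WQ (n : nat) : set (D -> 'M[R[i]]_n) :=
  [set phi | @CCpos R D (mx_smos n) phi /\
             continuous (phi : weakstar P -> 'M[R[i]^o]_n)].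
Arguments WQ n _ : clear implicits.

Definition WQ_index := {n : nat & set_type (WQ n)}.

Definition ND : smosData R := linf_smos (fun i : WQ_index => projT1 i).

Definition mu (x : D) : ND :=
  insubd (0 : linf (fun i : WQ_index => projT1 i))
    (fun i : WQ_index => \val (projT2 i) x).

End Mu.

Section Main.
Context {R : realType} (X : smosData R).
Local Notation X' := (bdfun (@norm1 R X)).

Definition unit_cone : set (Moo X) :=
  [set x | mcone X x /\ mnorm X x <= 1].

Definition U_ : set (Moo X) :=
  [set x | exists u v, [/\ unit_cone u, unit_cone v & x = u - v]].

Definition zero_nbhd_sa (A : set (Moo X)) :=
  exists2 e, 0 < e & forall x, msa x -> mnorm X x < e -> A x.

(* The canonical image of X in the dual of (X^*, nu) *)
Definition predual (nu : Moo X' -> R) : set (dual (dual_with nu)) :=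
  [set phi : bdfun (@norm1 R (dual_with nu)) |
    exists x : X, forall f : X', phi f = f x].
Arguments predual nu _ : clear implicits.

Definition N_ : set (Moo X' -> R) :=
  [set nu | exists lam : Moo X -> R,
    [/\ matrix_norm lam, forall x, mnorm X x <= lam x,
        complete_embedding lam (mnorm X) id & nu = dual_norm lam]].

Definition N_sys : set (Moo X' -> R) :=
  [set nu | N_ nu /\ dual_operator_system (predual nu)].

Definition dual_predual : set (dual (dual X)) := predual (dual_norm (mnorm X)).

Definition d_norm (f : Moo X') : R :=
  mnorm (ND dual_predual) (mmap (mu dual_predual) f).

End Main.

Arguments U_ {R} X _.
Arguments N_ {R} X _.
Arguments N_sys {R} X _.
Arguments dual_predual {R} X _.

(* Main.v *)
(** A weak-* continuous positive representation of X^* on a Hilbert space turns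
    a finite orthonormal family e_k into the positive matrix x over X given by
    f(x_kl) = <phi(f) e_l, e_k>, whose norm is controlled by that of phi. So if
    X^* is a dual quasi-operator system, the dual norm is equivalent to
    ||f||^d = sup ||theta_f(x)|| over the unit cone, and separating a point from
    the matrix convex set U_X by a matrix over X^* shows that the closure of U_X
    is a zero neighborhood; completeness of the spaces M_n(X) removes the closure
    by successive approximation. Conversely, if U_X is a zero neighborhood, the
    unit cone spans X with control of the coefficients, and the direct sum of the
    blocks [f(x_ij)] over the unit cone is a weak-* homeomorphic complete order
    isomorphism onto a weak-* closed space of operators on an l2 space. Its norm
    is exactly ||f||^d, which is the dual norm of
    max(||.||, sup {||theta_f(.)|| : ||f||^d <= 1}). For any nu in N_sys the
    matrices x above lie in the unit cone, because nu <= ||.||^*; hence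
    nu <= ||.||^d. *)
From HB Require Import structures.
Require Import Defs.
From mathcomp Require Import all_boot all_order all_algebra complex.
From mathcomp Require Import sesquilinear spectral ring lra finmap.
From mathcomp Require Import all_classical all_reals all_analysis.

Set Implicit Arguments.
Unset Strict Implicit.
Unset Printing Implicit Defensive.

Import Order.TTheory GRing.Theory Num.Theory numFieldNormedType.Exports.
Local Open Scope classical_set_scope.
Local Open Scope ring_scope.

(** The separation of a point from a matrix convex set is the hard step: Hahn-Banach yields a real
    functional on M_oo(X), whereas a matrix over the dual of X is wanted. Therefore pairs (x, b)
    with b a scalar matrix are separated, and the second component becomes a positive functional rho
    with G(a^* x a) <= rho(a^* a). The form rho(v^* u), perturbed by eps to make it definite, has a
    Gram-Schmidt basis, and G evaluated between basis vectors gives the entries of f. The same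
    separation theorem is applied to three sets: the cone (bipolar theorem), the self-adjoint unit
    ball (norm duality) and U_X. Completeness of X enters in two ways: limits of evaluations at
    points of X are again evaluations, and geometric series converge in each M_n(X). Matrices over
    M_n(C) and M_oo(C) are treated as four-index arrays, that is, as forms on C^m (x) C^n.
    Exchanging the two tensor factors exchanges the roles of x and f in the pairing, so that one
    computation serves X and its dual. *)

Local Notation nc := Normc.normc.

(** * Complex scalars and inner products *)

Section Conjugation.
Variable C : numClosedFieldType.
Implicit Types z w : C.

Lemma conjM z w : (z * w)^* = z^* * w^*.
Proof. exact: rmorphM. Qed.

Lemma conjD z w : (z + w)^* = z^* + w^*.
Proof. exact: rmorphD. Qed.

Lemma conjN z : (- z)^* = - z^*.
Proof. exact: rmorphN. Qed.

Lemma conj_sum (I : Type) (r : seq I) (P : pred I) (F : I -> C) :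
  (\sum_(i <- r | P i) F i)^* = \sum_(i <- r | P i) (F i)^*.
Proof. by apply: (big_morph _ conjD); rewrite conjC0. Qed.

End Conjugation.

Section Scalars.
Context {R : realType}.
Implicit Types (z w : R[i]).

Lemma nc_ge0 z : 0 <= nc z.
Proof. by case: z => a b; rewrite sqrtr_ge0. Qed.

Lemma nc0 : nc (0 : R[i]) = 0. Proof. exact: Normc.normc0. Qed.

Lemma nc1 : nc (1 : R[i]) = 1. Proof. exact: Normc.normc1. Qed.

Lemma ncM z w : nc (z * w) = nc z * nc w. Proof. exact: Normc.normcM. Qed.

Lemma ncD z w : nc (z + w) <= nc z + nc w. Proof. exact: le_normcD. Qed.

Lemma ncN z : nc (- z) = nc z. Proof. exact: normcN. Qed.

Lemma ncB z w : nc (z - w) <= nc z + nc w.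
Proof. by rewrite -(ncN w) ncD. Qed.

Lemma nc_conj z : nc z^* = nc z.
Proof. by case: z => a b /=; rewrite sqrrN. Qed.

Lemma nc_real (r : R) : nc r%:C%C = `|r|.
Proof. by rewrite /= expr0n addr0 sqrtr_sqr. Qed.

Lemma sqr_nc z : ((nc z ^+ 2)%:C)%C = z * z^*.
Proof.
case: z => a b; rewrite /= sqr_sqrtr ?addr_ge0 ?sqr_ge0 //.
by apply/eqP; rewrite eq_complex /=; apply/andP; split; apply/eqP; ring.
Qed.

Lemma nc_sum (I : Type) (r : seq I) (P : pred I) (F : I -> R[i]) :
  nc (\sum_(i <- r | P i) F i) <= \sum_(i <- r | P i) nc (F i).
Proof.
elim/big_rec2: _ => [|i x y _ xy]; first by rewrite nc0.
by rewrite (le_trans (ncD _ _)) // lerD2l.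
Qed.

Lemma Re_le_nc z : complex.Re z <= nc z.
Proof.
case: z => a b /=; apply: (le_trans (ler_norm a)).
by rewrite -sqrtr_sqr ler_wsqrtr // lerDl sqr_ge0.
Qed.

Lemma ReD z w : complex.Re (z + w) = complex.Re z + complex.Re w.
Proof. by case: z; case: w. Qed.

Lemma ReN z : complex.Re (- z) = - complex.Re z.
Proof. by case: z. Qed.

Lemma ReB z w : complex.Re (z - w) = complex.Re z - complex.Re w.
Proof. by rewrite ReD ReN. Qed.

Lemma ReZ (t : R) z : complex.Re (t%:C%C * z) = t * complex.Re z.
Proof. by case: z => a b /=; rewrite mul0r subr0. Qed.

Lemma Re_conj z : complex.Re z^* = complex.Re z.
Proof. by case: z. Qed.

Lemma Re_sum (I : Type) (r : seq I) (P : pred I) (F : I -> R[i]) :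
  complex.Re (\sum_(i <- r | P i) F i) = \sum_(i <- r | P i) complex.Re (F i).
Proof. by apply: (big_morph _ ReD). Qed.

Lemma ge0_complexE z : (0 <= z) = (0 <= complex.Re z) && (complex.Im z == 0).
Proof. by case: z => a b; rewrite lecE /= andbC. Qed.

Lemma rcM (s t : R) : ((s * t)%:C%C : R[i]) = s%:C%C * t%:C%C.
Proof. by apply/eqP; rewrite eq_complex /= !mulr0 !mul0r subr0 addr0 !eqxx. Qed.

Lemma rcD (s t : R) : ((s + t)%:C%C : R[i]) = s%:C%C + t%:C%C.
Proof. by apply/eqP; rewrite eq_complex /= addr0 !eqxx. Qed.

Lemma phase z : exists2 u : R[i], nc u = 1 & u * z = (nc z)%:C%C.
Proof.
have [->|z0] := eqVneq z 0; first by exists 1; rewrite ?nc1 // mulr0 nc0.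
have n0 : nc z != 0 by apply: contraNneq z0 => /Normc.eq0_normc ->.
exists (((nc z)^-1)%:C%C * z^*).
  rewrite ncM nc_real nc_conj ger0_norm ?invr_ge0 ?nc_ge0 //.
  by rewrite mulVf.
by rewrite -mulrA [z^* * z]mulrC -sqr_nc -rmorphM /= expr2 mulKf.
Qed.

Lemma real_CS (I : Type) (r : seq I) (a b : I -> R) :
  \sum_(i <- r) a i * b i <=
  Num.sqrt (\sum_(i <- r) a i ^+ 2) * Num.sqrt (\sum_(i <- r) b i ^+ 2).
Proof.
set S := \sum_(i <- r) a i * b i.
set A := \sum_(i <- r) a i ^+ 2; set B := \sum_(i <- r) b i ^+ 2.
have A0 : 0 <= A by apply: sumr_ge0 => i _; exact: sqr_ge0.
have B0 : 0 <= B by apply: sumr_ge0 => i _; exact: sqr_ge0.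
rewrite -sqrtrM //; apply: (le_trans (ler_norm _)); rewrite -sqrtr_sqr.
apply: ler_wsqrtr.
(* Lagrange's identity: this double sum equals 2 (A B - S^2). *)
have : 0 <= \sum_(i <- r) \sum_(j <- r) (a i * b j - a j * b i) ^+ 2.
  by apply: sumr_ge0 => i _; apply: sumr_ge0 => j _; exact: sqr_ge0.
have -> : \sum_(i <- r) \sum_(j <- r) (a i * b j - a j * b i) ^+ 2 =
   \sum_(i <- r) \sum_(j <- r) (a i ^+ 2 * b j ^+ 2) +
   \sum_(i <- r) \sum_(j <- r) (b i ^+ 2 * a j ^+ 2) -
   (\sum_(i <- r) \sum_(j <- r) ((a i * b i) * (a j * b j))) *+ 2.
  rewrite -big_split -sumrMnl -sumrB; apply: eq_bigr => i _ /=.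
  rewrite -big_split -sumrMnl -sumrB; apply: eq_bigr => j _ /=; ring.
rewrite -!big_distrlr /= -/A -/B -/S [B * A]mulrC -mulr2n -mulrnBl pmulrn_lge0 //.
by rewrite subr_ge0 expr2.
Qed.

(** [sup] is 0 on the empty set; the condition [0 <= K] covers that case. *)
Lemma sup_le (E : set R) (K : R) : 0 <= K -> (forall x, E x -> x <= K) -> sup E <= K.
Proof.
move=> K0 EK; have [->|/set0P E0] := eqVneq E set0; first by rewrite sup0.
by apply: ge_sup.
Qed.

Lemma le_sup (E : set R) (K x : R) : (forall x, E x -> x <= K) -> E x -> x <= sup E.
Proof. by move=> EK Ex; apply: ub_le_sup => //; exists K => y /EK. Qed.

Lemma sup_ge0 (E : set R) : (forall x, E x -> 0 <= x) -> 0 <= sup E.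
Proof.
move=> E0; have [sE|nsE] := pselect (has_sup E); last by rewrite sup_out.
have [[x Ex] _] := sE.
by apply: (le_trans (E0 _ Ex)); apply: ub_le_sup => //; case: sE.
Qed.

Lemma le_eps (a b : R) : (forall e, 0 < e -> a <= b + e) -> a <= b.
Proof. by move=> h; apply/ler_addgt0Pr. Qed.

Lemma inv_small (e : R) : 0 < e -> exists n0, forall n, (n0 <= n)%N -> (n.+1%:R)^-1 < e.
Proof.
move=> e0; exists (Num.bound e^-1) => n n0n.
rewrite -[e]invrK ltf_pV2 ?posrE ?invr_gt0 ?ltr0Sn //.
apply: lt_le_trans (archi_boundP _) _; first by rewrite invr_ge0 ltW.
by rewrite ler_nat ltnW // ltnS.
Qed.

Lemma nc_i : nc ('i%C : R[i]) = 1.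
Proof. by rewrite /Normc.normc /= expr0n expr1n add0r sqrtr1. Qed.

Lemma conj_i : ('i%C : R[i])^* = - 'i%C.
Proof. by apply/eqP; rewrite eq_complex /= oppr0 !eqxx. Qed.

Lemma mul_ii : ('i%C : R[i]) * 'i%C = -1.
Proof. by rewrite -expr2 sqr_i. Qed.

End Scalars.

#[global] Arguments Normc.normc [R] _ : simpl never.

Section Hnorm.
Context {R : realType} {H : lmodType R[i]} (dot : {dot H for Num.conj}).
Local Notation hn := (hnorm dot).

Lemma hnorm_ge0 v : 0 <= hn v. Proof. exact: sqrtr_ge0. Qed.

Lemma dot_sqr v : dot v v = ((hn v ^+ 2)%:C)%C.
Proof.
rewrite hnorm_sqr; have := dnorm_ge0 dot v; rewrite ge0_complexE.
by case: (dot v v) => a b /= /andP[_ /eqP ->].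
Qed.

Lemma hnorm0 : hn 0 = 0.
Proof. by rewrite -(scale0r (0 : H)) hnormZ nc0 mul0r. Qed.

Lemma hnorm_eq0 v : hn v = 0 -> v = 0.
Proof. by move=> h; apply/eqP; rewrite -(dnorm_eq0 dot) dot_sqr h expr0n. Qed.

Lemma dot_conj v w : dot w v = (dot v w)^*.
Proof. by rewrite hermC expr0 mul1r. Qed.

Lemma dotZl c v w : dot (c *: v) w = c * dot v w.
Proof. by rewrite linearZl_LR. Qed.

Lemma dotZr c v w : dot v (c *: w) = c^* * dot v w.
Proof. by rewrite linearZr_LR. Qed.

Lemma dotDl u v w : dot (u + v) w = dot u w + dot v w.
Proof. by rewrite linearDl. Qed.

Lemma dotDr u v w : dot u (v + w) = dot u v + dot u w.
Proof. by rewrite linearDr. Qed.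

Lemma dotBl u v w : dot (u - v) w = dot u w - dot v w.
Proof. by rewrite linearBl. Qed.

Lemma dotBr u v w : dot u (v - w) = dot u v - dot u w.
Proof. by rewrite linearBr. Qed.

Lemma dot0l w : dot 0 w = 0.
Proof. by rewrite linear0l. Qed.

Lemma dot0r w : dot w 0 = 0.
Proof. by rewrite linear0r. Qed.

Lemma conjC_real (t : R) : (t%:C%C : R[i])^* = t%:C%C.
Proof. by apply/eqP; rewrite eq_complex /= oppr0 !eqxx. Qed.

Lemma dot_CS v w : nc (dot v w) <= hn v * hn w.
Proof.
have [w0|w0] := eqVneq (hn w) 0.
  by rewrite w0 (hnorm_eq0 w0) linear0r nc0 mulr0.
have w2 : 0 < hn w ^+ 2 by rewrite exprn_gt0 // lt0r w0 hnorm_ge0.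
pose t := (hn w ^+ 2)^-1; pose d := dot v w.
(* The vector is the component of v orthogonal to w. *)
have := sqr_ge0 (hn (v - (t%:C%C * d) *: w)).
have -> : hn (v - (t%:C%C * d) *: w) ^+ 2 = hn v ^+ 2 - t * nc d ^+ 2.
  have E : dot v ((t%:C%C * d) *: w) = (t * nc d ^+ 2)%:C%C.
    by rewrite dotZr rmorphM /= conjC_real rcM sqr_nc mulrAC mulrA.
  rewrite [LHS]hnorm_sqr dnormB E conjC_real ReB !ReD -!hnorm_sqr hnormZ ncM.
  rewrite nc_real ger0_norm ?invr_ge0 ?sqr_ge0 //= !exprMn /t.
  set x := hn w in w0 w2 *; set y := nc d; field.
  by [].
rewrite subr_ge0 /t => h.
rewrite -(@ler_pXn2r _ 2) ?nnegrE ?mulr_ge0 ?hnorm_ge0 ?nc_ge0 // exprMn.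
by rewrite mulrC -ler_pdivrMl.
Qed.

Lemma hnormD v w : hn (v + w) <= hn v + hn w.
Proof.
rewrite -(@ler_pXn2r _ 2) ?nnegrE ?addr_ge0 ?hnorm_ge0 //.
have : hn (v + w) ^+ 2 = hn v ^+ 2 + hn w ^+ 2 + complex.Re (dot v w) *+ 2.
  rewrite [in LHS]hnorm_sqr dnormD !ReD -!hnorm_sqr Re_conj; ring.
have := le_trans (Re_le_nc _) (dot_CS v w).
move=> h ->; rewrite sqrrD; nra.
Qed.

Lemma hnormN v : hn (- v) = hn v.
Proof. by rewrite -scaleN1r hnormZ ncN nc1 mul1r. Qed.

Lemma hnorm_sum (I : Type) (r : seq I) (P : pred I) (F : I -> H) :
  hn (\sum_(i <- r | P i) F i) <= \sum_(i <- r | P i) hn (F i).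
Proof.
elim/big_rec2: _ => [|i x y _ xy]; first by rewrite hnorm0.
by rewrite (le_trans (hnormD _ _)) // lerD2l.
Qed.

Lemma dot_suml (I : Type) (r : seq I) (P : pred I) (F : I -> H) w :
  dot (\sum_(i <- r | P i) F i) w = \sum_(i <- r | P i) dot (F i) w.
Proof. by rewrite linear_sumlz. Qed.

Lemma dot_sumr (I : Type) (r : seq I) (P : pred I) (F : I -> H) w :
  dot w (\sum_(i <- r | P i) F i) = \sum_(i <- r | P i) dot w (F i).
Proof. by rewrite linear_sumr. Qed.

End Hnorm.

(** * Matrices over a vector space *)

Section Entries.
Context {R : realType}.
Implicit Types X Y : lmodType R[i].

Lemma sum_finsupp (V : nmodType) n (F : nat -> V) :
  (forall k, (n <= k)%N -> F k = 0) ->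
  \sum_(k \in [set: nat]) F k = \sum_(k < n) F k.
Proof.
move=> F0; rewrite fsbig_ord; symmetry; apply: fsbig_widen => // k /= [_].
by move=> /negP; rewrite -leqNgt => /F0.
Qed.

Lemma mooP X (x y : Moo X) : (forall i j, x i j = y i j) -> x = y.
Proof.
move=> xy; apply/val_inj/functional_extensionality_dep => i.
by apply/functional_extensionality_dep => j; exact: xy.
Qed.

Lemma mooD X (x y : Moo X) i j : (x + y) i j = x i j + y i j. Proof. by []. Qed.
Lemma mooN X (x : Moo X) i j : (- x) i j = - x i j. Proof. by []. Qed.
Lemma mooZ X (c : R[i]) (x : Moo X) i j : (c *: x) i j = c *: x i j. Proof. by []. Qed.
Lemma moo0 X i j : (0 : Moo X) i j = 0. Proof. by []. Qed.

Lemma moo_sum X (I : Type) (r : seq I) (P : pred I) (F : I -> Moo X) i j :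
  (\sum_(k <- r | P k) F k) i j = \sum_(k <- r | P k) F k i j.
Proof. by apply: (big_morph (fun x : Moo X => x i j) (fun x y => mooD x y i j)). Qed.

Lemma moo_finsupp X (x : Moo X) : exists n, Mn n x.
Proof. by case: x => x xf; have /asboolP[n xn] := xf; exists n. Qed.

Lemma minfE X (g : nat -> nat -> X) n :
  (forall i j, (n <= i)%N || (n <= j)%N -> g i j = 0) ->
  forall i j, minf g i j = g i j.
Proof.
move=> g0 i j; rewrite /minf.
by have /= -> // := @insubdK _ _ (Moo X) 0 g; apply/asboolP; exists n.
Qed.

Lemma Mn_le X (x : Moo X) n m : (n <= m)%N -> Mn n x -> Mn m x.
Proof.
by move=> nm xn i j /orP[] h; apply: xn; rewrite (leq_trans nm h) ?orbT.
Qed.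

Lemma mmapE X Y (phi : X -> Y) (x : Moo X) : phi 0 = 0 ->
  forall i j, mmap phi x i j = phi (x i j).
Proof. by move=> p0; have [n xn] := moo_finsupp x; apply: (@minfE _ _ n) => i j /xn ->. Qed.

Lemma mx1E X (x : X) i j : mx1 x i j = if (i == 0%N) && (j == 0%N) then x else 0.
Proof. by apply: (@minfE _ _ 1) => -[|p] [|q]. Qed.

Lemma mstarE (X : smosData R) (x : Moo X) i j : star X 0 = 0 ->
  mstar x i j = star X (x j i).
Proof.
move=> s0; have [n xn] := moo_finsupp x.
by apply: (@minfE _ _ n) => p q; rewrite orbC => /xn ->.
Qed.

Lemma msandE X n m (a : Moo R[i]) (x : Moo X) (b : Moo R[i]) i j :
  (forall k l, (n <= k)%N || (m <= l)%N -> x k l = 0) ->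
  msand a x b i j = \sum_(k < n) \sum_(l < m) ((a k i)^* * b l j) *: x k l.
Proof.
move=> xn; have E p q : \sum_(k \in [set: nat]) \sum_(l \in [set: nat])
     ((a k p)^* * b l q) *: x k l =
  \sum_(k < n) \sum_(l < m) ((a k p)^* * b l q) *: x k l.
  rewrite (@sum_finsupp _ n); last first.
    by move=> k nk; rewrite (@sum_finsupp _ 0) ?big_ord0 // => l _; rewrite xn ?nk // scaler0.
  apply: eq_bigr => k _; rewrite (@sum_finsupp _ m) // => l ml.
  by rewrite xn ?ml ?orbT // scaler0.
have [N1 aN] := moo_finsupp a; have [N2 bN] := moo_finsupp b.
rewrite /msand (@minfE _ _ (maxn N1 N2)) ?E // => p q.
rewrite !geq_max => pq; rewrite E big1 // => k _; rewrite big1 // => l _.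
case/orP: pq => /andP[h1 h2].
  by rewrite aN ?h1 ?orbT // conjC0 mul0r scale0r.
by rewrite bN ?h2 ?orbT // mulr0 scale0r.
Qed.

Lemma madjmulE n (a b : Moo R[i]) i j :
  (forall k l, (n <= k)%N -> a k l = 0) ->
  madjmul a b i j = \sum_(k < n) (a k i)^* * b k j.
Proof.
move=> an; have E p q : \sum_(k \in [set: nat]) (a k p)^* * b k q =
   \sum_(k < n) (a k p)^* * b k q.
  by apply: sum_finsupp => k nk; rewrite an // conjC0 mul0r.
have [N1 aN] := moo_finsupp a; have [N2 bN] := moo_finsupp b.
rewrite /madjmul (@minfE _ _ (maxn N1 N2)) ?E // => p q.
rewrite !geq_max => pq; rewrite E big1 // => k _.
case/orP: pq => /andP[h1 h2].
  by rewrite aN ?h1 ?orbT // conjC0 mul0r.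
by rewrite bN ?h2 ?orbT // mulr0.
Qed.

(** The compression to the upper left n x n corner; the cut-off guarantees finite support, so the
    default value of [minf] never occurs. *)
Definition mtr X n (g : nat -> nat -> X) : Moo X :=
  minf (fun i j => if (i < n)%N && (j < n)%N then g i j else 0).

Lemma mtrE X n (g : nat -> nat -> X) i j :
  mtr n g i j = if (i < n)%N && (j < n)%N then g i j else 0.
Proof. by apply: (@minfE _ _ n) => p q /orP[] h; rewrite !ltnNge h //= andbF. Qed.

Lemma mtr_Mn X n (g : nat -> nat -> X) : Mn n (mtr n g).
Proof. by move=> i j /orP[] h; rewrite mtrE !ltnNge h //= andbF. Qed.

Lemma Mn_mtr X n (x : Moo X) : Mn n x -> x = mtr n x.
Proof.
move=> xn; apply: mooP => i j; rewrite mtrE; case: ifP => // /negbT.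
by rewrite negb_and -!leqNgt => /xn.
Qed.

Lemma MnD X n (x y : Moo X) : Mn n x -> Mn n y -> Mn n (x + y).
Proof. by move=> xn yn i j h; rewrite mooD xn // yn // addr0. Qed.

Lemma MnZ X n (c : R[i]) (x : Moo X) : Mn n x -> Mn n (c *: x).
Proof. by move=> xn i j h; rewrite mooZ xn // scaler0. Qed.

Lemma MnN X n (x : Moo X) : Mn n x -> Mn n (- x).
Proof. by move=> xn i j h; rewrite mooN xn // oppr0. Qed.

Lemma common_Mn X m (x : 'I_m -> Moo X) : exists n, forall k, Mn n (x k).
Proof.
have h k := moo_finsupp (x k).
exists (\max_(k < m) projT1 (cid (h k))) => k.
by apply: Mn_le (projT2 (cid (h k))); rewrite leq_bigmax.
Qed.

Definition munit i j : Moo R[i] :=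
  mtr (maxn i j).+1 (fun p q => ((p == i) && (q == j))%:R).

Lemma munitE i j p q : munit i j p q = ((p == i) && (q == j))%:R.
Proof.
rewrite mtrE !ltnS !leq_max; case: (eqVneq p i) => [->|]; last by case: ifP.
by case: (eqVneq q j) => [->|]; rewrite ?leqnn ?orbT //=; case: ifP.
Qed.

Definition mone n : Moo R[i] := mtr n (fun p q => (p == q)%:R).

Lemma moneE n p q : mone n p q = ((p == q) && (p < n)%N)%:R.
Proof.
rewrite mtrE; case: eqVneq => [->|] /=; last by case: ifP.
by rewrite andbb; case: ifP.
Qed.

End Entries.

Section OrdSums.
Context {R : realType}.

Lemma eq_sum_ord (V : nmodType) n m (F : nat -> V) :
  (forall k, (n <= k)%N -> F k = 0) -> (forall k, (m <= k)%N -> F k = 0) ->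
  \sum_(k < n) F k = \sum_(k < m) F k.
Proof. by move=> /sum_finsupp <- /sum_finsupp <-. Qed.

Lemma le_sum_widen n m (F : nat -> R) : (n <= m)%N -> (forall k, 0 <= F k) ->
  \sum_(k < n) F k <= \sum_(k < m) F k.
Proof.
move=> nm F0; rewrite (big_ord_widen _ _ nm) big_mkcond /=.
by apply: ler_sum => i _; case: ifP.
Qed.

Lemma le_sum_ord n m (F : nat -> R) : (forall k, 0 <= F k) ->
  (forall k, (m <= k)%N -> F k = 0) -> \sum_(k < n) F k <= \sum_(k < m) F k.
Proof.
move=> F0 Fm; rewrite (@eq_sum_ord _ m (maxn n m)) //.
  by apply: le_sum_widen => //; rewrite leq_maxl.
by move=> k; rewrite geq_max => /andP[_ /Fm].
Qed.

Lemma le_sum_term n (F : nat -> R) k : (forall k, 0 <= F k) -> (k < n)%N ->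
  F k <= \sum_(j < n) F j.
Proof.
move=> F0 kn; rewrite (bigD1 (Ordinal kn)) //= lerDl.
by apply: sumr_ge0.
Qed.

End OrdSums.

Lemma lin0 (K : pzRingType) (U W : lmodType K) (f : U -> W) : linear f -> f 0 = 0.
Proof.
move=> /(_ 1 0 0); rewrite !scale1r addr0 => /eqP.
by rewrite -[X in X == _]addr0 (inj_eq (addrI _)) eq_sym => /eqP.
Qed.

Lemma linD (K : pzRingType) (U W : lmodType K) (f : U -> W) : linear f ->
  forall x y, f (x + y) = f x + f y.
Proof. by move=> lf x y; have := lf 1 x y; rewrite !scale1r. Qed.

Lemma linZ (K : pzRingType) (U W : lmodType K) (f : U -> W) : linear f ->
  forall c x, f (c *: x) = c *: f x.
Proof. by move=> lf c x; have := lf c x 0; rewrite (lin0 lf) !addr0. Qed.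

Lemma linN (K : pzRingType) (U W : lmodType K) (f : U -> W) : linear f ->
  forall x, f (- x) = - f x.
Proof. by move=> lf x; rewrite -scaleN1r (linZ lf) scaleN1r. Qed.

Lemma linB (K : pzRingType) (U W : lmodType K) (f : U -> W) : linear f ->
  forall x y, f (x - y) = f x - f y.
Proof. by move=> lf x y; rewrite (linD lf) (linN lf). Qed.

Lemma lin_sum (K : pzRingType) (U W : lmodType K) (f : U -> W) : linear f ->
  forall (I : Type) (r : seq I) (P : pred I) (F : I -> U),
  f (\sum_(k <- r | P k) F k) = \sum_(k <- r | P k) f (F k).
Proof. by move=> lf I r P F; apply: big_morph; [exact: linD|exact: lin0]. Qed.

Section OperatorForms.
Context {R : realType} {H : lmodType R[i]} (dot : {dot H for Num.conj}).
Variables (V : lmodType R[i]) (act : V -> H -> H).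
Local Notation hn := (hnorm dot).

Definition hsq m (xi : 'I_m -> H) : R := \sum_(i < m) hn (xi i) ^+ 2.

(** The sesquilinear form of the operator matrix y on the m-fold sum of H. Its moduli give
    [op_mnorm] and its diagonal values give [op_mpos]. *)
Definition opf (y : Moo V) m (xi eta : 'I_m -> H) : R[i] :=
  \sum_(i < m) \sum_(j < m) dot (act (y i j) (xi j)) (eta i).

Lemma hsq_ge0 m (xi : 'I_m -> H) : 0 <= hsq xi.
Proof. by apply: sumr_ge0 => i _; exact: sqr_ge0. Qed.

Lemma hn_le_hsq m (xi : 'I_m -> H) i : hsq xi <= 1 -> hn (xi i) <= 1.
Proof.
move=> h; rewrite -(@ler_pXn2r _ 2) ?nnegrE ?hnorm_ge0 ?ler01 // expr1n.
apply: le_trans h; rewrite /hsq (bigD1 i) //= lerDl.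
by apply: sumr_ge0 => j _; exact: sqr_ge0.
Qed.

Lemma sum_dot_CS m (u v : 'I_m -> H) :
  nc (\sum_(i < m) dot (u i) (v i)) <= Num.sqrt (hsq u) * Num.sqrt (hsq v).
Proof.
apply: (le_trans (nc_sum _ _ _)).
apply: le_trans (real_CS _ _ _).
by apply: ler_sum => i _; exact: dot_CS.
Qed.

Lemma op_mnorm_le (y : Moo V) (K : R) : 0 <= K ->
  (forall m (xi eta : 'I_m -> H), hsq xi <= 1 -> hsq eta <= 1 ->
     nc (opf y xi eta) <= K) -> op_mnorm dot act y <= K.
Proof.
move=> K0 yK; apply: sup_le => // r [m [xi [xi1 ->]]].
pose u i := \sum_(j < m) act (y i j) (xi j).
rewrite -/(hsq (fun i : 'I_m => u i)); set s := hsq _.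
have [->|s0] := eqVneq s 0; first by rewrite sqrtr0.
have s_gt0 : 0 < s by rewrite lt0r s0 hsq_ge0.
have t0 : 0 < Num.sqrt s by rewrite sqrtr_gt0.
(* Testing against the normalized image u / |u| turns the form into the norm |u| itself. *)
have := yK m xi (fun i => ((Num.sqrt s)^-1)%:C%C *: u i) xi1.
have -> : hsq (fun i : 'I_m => ((Num.sqrt s)^-1)%:C%C *: u i) = 1.
  rewrite /hsq; under eq_bigr do rewrite hnormZ nc_real ger0_norm ?invr_ge0 ?sqrtr_ge0 // exprMn.
  by rewrite -mulr_sumr -/(hsq (fun i : 'I_m => u i)) -/s exprVn sqr_sqrtr ?hsq_ge0 // mulVf.
move=> /(_ (lexx _)); suff -> : opf y xi (fun i => ((Num.sqrt s)^-1)%:C%C *: u i) =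
   (Num.sqrt s)%:C%C by rewrite nc_real ger0_norm ?sqrtr_ge0.
rewrite /opf; under eq_bigr do rewrite -dot_suml -/(u _) dotZr conjC_real dot_sqr -rcM.
rewrite -(big_morph (fun t : R => t%:C%C : R[i]) (@rcD R) (erefl _)) -mulr_sumr -/s.
by rewrite -/(hsq (fun i : 'I_m => u i)) -/s -[X in _ * X](@sqr_sqrtr _ s) ?hsq_ge0 // expr2 mulKf ?gt_eqF.
Qed.

Section Bounded.
Variables (y : Moo V) (N : nat).
Hypothesis yN : forall i j, (N <= i)%N || (N <= j)%N -> forall v, act (y i j) v = 0.
Hypothesis yl : forall i j, linear (act (y i j)).
Hypothesis yb : forall i j, exists K : R, forall v, hn (act (y i j) v) <= K * hn v.

(** The supremum in [op_mnorm] is informative only once it is known to be finite. Only N x N entries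
    act, so bounds k_ij for them give one constant for all sizes m. *)
Lemma op_mnorm_bounded : exists K : R, forall m (xi : 'I_m -> H), hsq xi <= 1 ->
  Num.sqrt (\sum_(i < m) hn (\sum_(j < m) act (y i j) (xi j)) ^+ 2) <= K.
Proof.
have yb' i : exists k : nat -> R, (forall j, 0 <= k j) /\
    forall j v, hn (act (y i j) v) <= k j * hn v.
  exists (fun j => Num.max 0 (projT1 (cid (yb i j)))); split=> [j|j v].
    by rewrite le_max lexx.
  apply: (le_trans (projT2 (cid (yb i j)) v)).
  by apply: ler_wpM2r; rewrite ?hnorm_ge0 // le_max lexx orbT.
pose k i j := if (i < N)%N && (j < N)%N then projT1 (cid (yb' i)) j else 0.
have k0 i j : 0 <= k i j by rewrite /k; case: ifP => // _; case: (projT2 (cid (yb' i))).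
have yk i j v : hn (act (y i j) v) <= k i j * hn v.
  rewrite /k; case: ifP => [_|/negbT]; first by case: (projT2 (cid (yb' i))).
  by rewrite negb_and -!leqNgt => /yN ->; rewrite hnorm0 mul0r.
exists (Num.sqrt (\sum_(i < N) (\sum_(j < N) k i j) ^+ 2)) => m xi xi1.
apply: ler_wsqrtr.
apply: (le_trans _ (@le_sum_ord _ m N (fun i : nat => (\sum_(j < N) k i j) ^+ 2) _ _)); last 2 first.
- by move=> i; exact: sqr_ge0.
- move=> i Ni; rewrite big1 ?expr0n // => j _.
  by rewrite /k ltnNge Ni.
apply: ler_sum => i _.
rewrite ler_pXn2r ?nnegrE ?hnorm_ge0 ?sumr_ge0 //.
apply: (le_trans (hnorm_sum _ _ _ _)).
apply: (le_trans _ (@le_sum_ord _ m N (k i) (k0 i) _)); last first.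
  by move=> j Nj; rewrite /k [(j < N)%N]ltnNge Nj andbF.
apply: ler_sum => j _; apply: (le_trans (yk _ _ _)).
by apply: ler_piMr => //; exact: hn_le_hsq.
Qed.

Lemma op_mnorm_act m (xi : 'I_m -> H) :
  Num.sqrt (\sum_(i < m) hn (\sum_(j < m) act (y i j) (xi j)) ^+ 2) <=
  op_mnorm dot act y * Num.sqrt (hsq xi).
Proof.
have actZ i j c v : act (y i j) (c *: v) = c *: act (y i j) v.
  by have := yl i j c v 0; rewrite addr0 (lin0 (yl i j)) addr0.
have [s0|s0] := eqVneq (hsq xi) 0.
  have xi0 i : xi i = 0.
    apply: (@hnorm_eq0 _ _ dot); apply/eqP; rewrite -sqrf_eq0.
    move/eqP: s0; rewrite psumr_eq0 => [/allP/(_ i)|]; last by move=> *; exact: sqr_ge0.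
    by rewrite mem_index_enum /= => ->.
  rewrite s0 sqrtr0 mulr0 big1 ?sqrtr0 // => i _.
  rewrite big1 ?hnorm0 ?expr0n // => j _.
  by rewrite xi0 (lin0 (yl i j)).
have s_gt0 : 0 < hsq xi by rewrite lt0r s0 hsq_ge0.
pose t := Num.sqrt (hsq xi); have t0 : 0 < t by rewrite sqrtr_gt0.
pose xi' i := (t^-1)%:C%C *: xi i.
have xi'1 : hsq xi' <= 1.
  rewrite /hsq; under eq_bigr do rewrite hnormZ nc_real ger0_norm ?invr_ge0 ?sqrtr_ge0 // exprMn.
  by rewrite -mulr_sumr -/(hsq _) exprVn sqr_sqrtr ?hsq_ge0 // mulVf.
rewrite -ler_pdivrMr // -/t.
have [K yK] := op_mnorm_bounded.
apply: (@le_sup _ _ K) => [r [m' [xi2 [h ->]]]|]; first exact: yK.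
exists m, xi'; split=> //; rewrite -[t^-1]ger0_norm ?invr_ge0 ?ltW // mulrC.
rewrite -sqrtr_sqr -sqrtrM ?sqr_ge0 //; congr Num.sqrt; rewrite mulr_sumr.
apply: eq_bigr => i _; under [in RHS]eq_bigr do rewrite /xi' actZ.
by rewrite -scaler_sumr hnormZ nc_real exprMn real_normK ?num_real.
Qed.

Lemma op_mnorm_form m (xi eta : 'I_m -> H) :
  nc (opf y xi eta) <=
  op_mnorm dot act y * (Num.sqrt (hsq xi) * Num.sqrt (hsq eta)).
Proof.
rewrite /opf; under eq_bigr do rewrite -dot_suml.
apply: (le_trans (sum_dot_CS _ _)); rewrite mulrA ler_wpM2r ?sqrtr_ge0 //.
exact: op_mnorm_act.
Qed.

End Bounded.

Lemma op_mnorm_ge0 (y : Moo V) : 0 <= op_mnorm dot act y.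
Proof. by apply: sup_ge0 => x [m [xi [_ ->]]]; exact: sqrtr_ge0. Qed.

End OperatorForms.

(** * Matrices over M_oo(C) as sesquilinear forms *)

Lemma exchange4 (V : nmodType) m n p q (F : nat -> nat -> nat -> nat -> V) :
  \sum_(i < m) \sum_(j < n) \sum_(k < p) \sum_(l < q) F i j k l =
  \sum_(k < p) \sum_(l < q) \sum_(i < m) \sum_(j < n) F i j k l.
Proof.
under eq_bigr do rewrite exchange_big.
rewrite exchange_big; apply: eq_bigr => k _ /=.
by under eq_bigr do rewrite exchange_big; rewrite exchange_big.
Qed.

Arguments exchange4 {V m n p q} F.

Section Arrays.
Context {R : realType}.
Local Notation arr := (nat -> nat -> nat -> nat -> R[i]).
Local Notation vec := (nat -> nat -> R[i]).
Implicit Types (y z : arr) (xi eta : vec).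

(* The matrix over M_oo(C) with entries y k l, as a sesquilinear form on C^m (x) C^n. *)
Definition afm y m n xi eta : R[i] :=
  \sum_(k < m) \sum_(l < m) \sum_(p < n) \sum_(q < n)
    (eta k p)^* * y k l p q * xi l q.

Definition n2 m n xi : R := \sum_(k < m) \sum_(p < n) nc (xi k p) ^+ 2.

(** States that the norm of y is at most K. It is stronger than [anorm y <= K], which also holds for
    K >= 0 when the supremum is infinite, because [sup] is then 0. *)
Definition ale y (K : R) := forall m n xi eta, n2 m n xi <= 1 -> n2 m n eta <= 1 ->
  nc (afm y m n xi eta) <= K.

Definition anorm y : R :=
  sup [set r | exists m n xi eta, [/\ n2 m n xi <= 1, n2 m n eta <= 1
                                    & r = nc (afm y m n xi eta)]].

Definition apos y := forall m n xi, 0 <= afm y m n xi xi.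

Lemma n2_ge0 m n xi : 0 <= n2 m n xi.
Proof. by apply: sumr_ge0 => k _; apply: sumr_ge0 => p _; exact: sqr_ge0. Qed.

Lemma n2Z m n (t : R[i]) xi : n2 m n (fun k p => t * xi k p) = nc t ^+ 2 * n2 m n xi.
Proof.
rewrite /n2 mulr_sumr; apply: eq_bigr => k _; rewrite mulr_sumr.
by apply: eq_bigr => p _; rewrite ncM exprMn.
Qed.

Lemma n2_0 m n : n2 m n (fun _ _ => 0) = 0.
Proof. by apply: big1 => k _; apply: big1 => p _; rewrite nc0 expr0n. Qed.

Lemma n2_flip m n xi : n2 m n xi = n2 n m (fun k p => xi p k).
Proof. exact: exchange_big. Qed.

Lemma afm_flip y m n xi eta :
  afm y m n xi eta = afm (fun k l p q => y p q k l) n m (fun k p => xi p k) (fun k p => eta p k).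
Proof. by rewrite /afm (exchange4 (fun k l p q => (eta k p)^* * y k l p q * xi l q)). Qed.

Lemma afm_lin c y z m n xi eta :
  afm (fun k l p q => c * y k l p q + z k l p q) m n xi eta =
  c * afm y m n xi eta + afm z m n xi eta.
Proof.
rewrite /afm mulr_sumr -big_split /=; apply: eq_bigr => k _.
rewrite mulr_sumr -big_split /=; apply: eq_bigr => l _.
rewrite mulr_sumr -big_split /=; apply: eq_bigr => p _.
rewrite mulr_sumr -big_split /=; apply: eq_bigr => q _; ring.
Qed.

Lemma afmZ y m n s t xi eta :
  afm y m n (fun k p => s * xi k p) (fun k p => t * eta k p) =
  s * t^* * afm y m n xi eta.
Proof.
rewrite /afm mulr_sumr; apply: eq_bigr => k _; rewrite mulr_sumr.
apply: eq_bigr => l _; rewrite mulr_sumr; apply: eq_bigr => p _.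
rewrite mulr_sumr; apply: eq_bigr => q _; rewrite conjM /=; ring.
Qed.

Lemma afm_conj y m n xi eta :
  (afm y m n xi eta)^* = afm (fun k l p q => (y l k q p)^*) m n eta xi.
Proof.
rewrite /afm [RHS]exchange_big conj_sum; apply: eq_bigr => k _ /=.
rewrite conj_sum; apply: eq_bigr => l _ /=.
rewrite [RHS]exchange_big conj_sum; apply: eq_bigr => p _ /=.
rewrite conj_sum; apply: eq_bigr => q _ /=.
by rewrite !conjM conjCK; ring.
Qed.

Lemma eq_afm y z m n xi eta : (forall k l p q, y k l p q = z k l p q) ->
  afm y m n xi eta = afm z m n xi eta.
Proof.
move=> yz; apply: eq_bigr => k _; apply: eq_bigr => l _; apply: eq_bigr => p _.
by apply: eq_bigr => q _; rewrite yz.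
Qed.

Lemma eq_afmv y m n xi xi' eta eta' :
  (forall k p, (k < m)%N -> (p < n)%N -> xi k p = xi' k p) ->
  (forall k p, (k < m)%N -> (p < n)%N -> eta k p = eta' k p) ->
  afm y m n xi eta = afm y m n xi' eta'.
Proof.
move=> h h'; apply: eq_bigr => k _; apply: eq_bigr => l _; apply: eq_bigr => p _.
by apply: eq_bigr => q _; rewrite h ?h'.
Qed.

Lemma arrP y z : (forall k l p q, y k l p q = z k l p q) -> y = z.
Proof. by move=> yz; do 4! (apply/funext => ?); exact: yz. Qed.

(** The terms vanish outside either box, so the four ranges are exchanged one at a time, from the
    innermost index outwards. *)
Lemma afm_resize y m n m' n' xi eta :
  (forall k l p q, [|| m <= k, m <= l, n <= p | n <= q]%N ->
     (eta k p)^* * y k l p q * xi l q = 0) ->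
  (forall k l p q, [|| m' <= k, m' <= l, n' <= p | n' <= q]%N ->
     (eta k p)^* * y k l p q * xi l q = 0) ->
  afm y m n xi eta = afm y m' n' xi eta.
Proof.
move=> h h'; pose F k l p q := (eta k p)^* * y k l p q * xi l q.
have Eq k l p : \sum_(q < n) F k l p q = \sum_(q < n') F k l p q.
  by apply: eq_sum_ord => q nq; [apply: h|apply: h']; rewrite nq !orbT.
have Ep k l : \sum_(p < n) \sum_(q < n) F k l p q = \sum_(p < n') \sum_(q < n') F k l p q.
  transitivity (\sum_(p < n) \sum_(q < n') F k l p q); first by apply: eq_bigr.
  apply: (@eq_sum_ord _ _ _ (fun p => \sum_(q < n') F k l p q)) => p np.
    by apply: big1 => q _; apply: h; rewrite np !orbT.
  by apply: big1 => q _; apply: h'; rewrite np !orbT.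
have El k : \sum_(l < m) \sum_(p < n) \sum_(q < n) F k l p q =
            \sum_(l < m') \sum_(p < n') \sum_(q < n') F k l p q.
  transitivity (\sum_(l < m) \sum_(p < n') \sum_(q < n') F k l p q); first by apply: eq_bigr.
  apply: (@eq_sum_ord _ _ _ (fun l => \sum_(p < n') \sum_(q < n') F k l p q)) => l ml.
    by apply: big1 => p _; apply: big1 => q _; apply: h; rewrite ml !orbT.
  by apply: big1 => p _; apply: big1 => q _; apply: h'; rewrite ml !orbT.
transitivity (\sum_(k < m) \sum_(l < m') \sum_(p < n') \sum_(q < n') F k l p q).
  by apply: eq_bigr => k _; exact: El.
apply: (@eq_sum_ord _ _ _ (fun k => \sum_(l < m') \sum_(p < n') \sum_(q < n') F k l p q)) => k mk.
  by apply: big1 => l _; apply: big1 => p _; apply: big1 => q _; apply: h; rewrite mk.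
by apply: big1 => l _; apply: big1 => p _; apply: big1 => q _; apply: h'; rewrite mk.
Qed.

Lemma ale0 y K : ale y K -> 0 <= K.
Proof. by move=> /(_ 0%N 0%N (fun _ _ => 0) (fun _ _ => 0)); rewrite n2_0 => /(_ ler01 ler01); apply: le_trans; exact: nc_ge0. Qed.

Lemma ale_form y K : ale y K -> forall m n xi eta,
  nc (afm y m n xi eta) <= K * (Num.sqrt (n2 m n xi) * Num.sqrt (n2 m n eta)).
Proof.
move=> yK m n xi eta.
have K0 := ale0 yK.
have z v : n2 m n v = 0 -> forall k p, (k < m)%N -> (p < n)%N -> v k p = 0.
  move=> v0 k p km pn; apply: Normc.eq0_normc; apply/eqP; rewrite -sqrf_eq0 eq_le sqr_ge0 andbT.
  rewrite -v0 /n2 (bigD1 (Ordinal km)) //= (bigD1 (Ordinal pn)) //= -addrA lerDl.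
  by rewrite addr_ge0 //; apply: sumr_ge0 => i _; rewrite ?sqr_ge0 //; apply: sumr_ge0 => j _; rewrite sqr_ge0.
have [x0|x0] := eqVneq (n2 m n xi) 0.
  rewrite x0 sqrtr0 mul0r mulr0 (@eq_afmv _ _ _ _ (fun _ _ => 0) _ eta) //; last exact: z.
  by rewrite /afm big1 ?nc0 // => k _; do 3! (apply: big1 => ? _); rewrite mulr0.
have [e0|e0] := eqVneq (n2 m n eta) 0.
  rewrite e0 sqrtr0 !mulr0 (@eq_afmv _ _ _ _ xi _ (fun _ _ => 0)) //; last exact: z.
  by rewrite /afm big1 ?nc0 // => k _; do 3! (apply: big1 => ? _); rewrite conjC0 !mul0r.
set s := Num.sqrt _; set t := Num.sqrt _.
have s0 : 0 < s by rewrite sqrtr_gt0 lt0r x0 n2_ge0.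
have t0 : 0 < t by rewrite sqrtr_gt0 lt0r e0 n2_ge0.
have := yK m n (fun k p => (s^-1)%:C%C * xi k p) (fun k p => (t^-1)%:C%C * eta k p).
have nr (r : R) : nc (r%:C%C) ^+ 2 = r ^+ 2 by rewrite nc_real real_normK ?num_real.
rewrite !n2Z !nr !exprVn !sqr_sqrtr ?n2_ge0 // !mulVf // => /(_ (lexx _) (lexx _)).
rewrite afmZ conjC_real !ncM !nc_real !ger0_norm ?invr_ge0 ?(ltW s0) ?(ltW t0) //.
rewrite -mulrA !ler_pdivrMl // => /le_trans; apply.
by rewrite [t * _]mulrC [s * K]mulrC -mulrA.
Qed.

Lemma anorm_ge0 y : 0 <= anorm y.
Proof. by apply: sup_ge0 => _ [m [n [xi [eta [_ _ ->]]]]]; exact: nc_ge0. Qed.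

Lemma anorm_le y K : ale y K -> anorm y <= K.
Proof.
move=> yK; apply: sup_le; first exact: ale0 yK.
by move=> _ [m [n [xi [eta [h h' ->]]]]]; exact: yK.
Qed.

Lemma ale_anorm y K : ale y K -> ale y (anorm y).
Proof.
move=> yK m n xi eta h h'; apply: (@le_sup _ _ K).
  by move=> _ [m' [n' [xi' [eta' [? ? ->]]]]]; exact: yK.
by exists m, n, xi, eta.
Qed.

Lemma aleW y K L : K <= L -> ale y K -> ale y L.
Proof. by move=> KL yK m n xi eta h h'; apply: le_trans KL; exact: yK. Qed.

Lemma ale_lin c y z K L : ale y K -> ale z L ->
  ale (fun k l p q => c * y k l p q + z k l p q) (nc c * K + L).
Proof.
move=> yK zL m n xi eta h h'; rewrite afm_lin (le_trans (ncD _ _)) // lerD ?zL //.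
by rewrite ncM ler_wpM2l ?nc_ge0 ?yK.
Qed.

Lemma ale_flip y K : ale y K -> ale (fun k l p q => y p q k l) K.
Proof. by move=> yK m n xi eta h h'; rewrite afm_flip; apply: yK; rewrite -n2_flip. Qed.

Lemma ale_star y K : ale y K -> ale (fun k l p q => (y l k q p)^*) K.
Proof. by move=> yK m n xi eta h h'; rewrite -afm_conj nc_conj; apply: yK. Qed.

Lemma anorm_flip y : anorm (fun k l p q => y p q k l) = anorm y.
Proof.
congr (sup _); apply/seteqP; split=> r [m [n [xi [eta [h h' ->]]]]];
  exists n, m, (fun k p => xi p k), (fun k p => eta p k);
  by split; [rewrite -n2_flip|rewrite -n2_flip|rewrite afm_flip].
Qed.

Lemma ale_finsupp y N :
  (forall k l p q, [|| N <= k, N <= l, N <= p | N <= q]%N -> y k l p q = 0) ->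
  exists K, ale y K.
Proof.
move=> yN; exists (\sum_(k < N) \sum_(l < N) \sum_(p < N) \sum_(q < N) nc (y k l p q)).
move=> m n xi eta h h'.
(* Extended by 0 outside the m x n box, the vectors can be summed over the fixed box of side N, and
   their entries are still at most 1 in modulus. *)
pose ct (v : vec) k p := if (k < m)%N && (p < n)%N then v k p else 0.
have ct1 v k p : n2 m n v <= 1 -> nc (ct v k p) <= 1.
  move=> v1; rewrite /ct; case: ifP => [/andP[km pn]|_]; last by rewrite nc0.
  rewrite -(@ler_pXn2r _ 2) ?nnegrE ?nc_ge0 ?ler01 // expr1n; apply: le_trans v1.
  rewrite /n2 (bigD1 (Ordinal km)) //= (bigD1 (Ordinal pn)) //= -addrA lerDl.
  by rewrite addr_ge0 //; apply: sumr_ge0 => i _; rewrite ?sqr_ge0 //; apply: sumr_ge0 => j _; rewrite sqr_ge0.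
have -> : afm y m n xi eta = afm y N N (ct xi) (ct eta).
  rewrite (@eq_afmv _ _ _ _ (ct xi) _ (ct eta)); first last.
  - by move=> k p km pn; rewrite /ct km pn.
  - by move=> k p km pn; rewrite /ct km pn.
  apply: afm_resize => k l p q; last by move=> /yN ->; rewrite mulr0 mul0r.
  rewrite /ct => /or4P[]; rewrite leqNgt => /negbTE ->;
    by rewrite ?andbF /= ?conjC0 ?mul0r ?mulr0.
do 4! (apply: (le_trans (nc_sum _ _ _)); apply: ler_sum => ? _).
rewrite !ncM nc_conj -[leRHS]mulr1 -[X in _ <= X * 1]mul1r.
by rewrite !ler_pM ?mulr_ge0 ?nc_ge0 ?ct1.
Qed.

(** The column of the matrices b_1, ..., b_r, cut to their first N rows, has squared norm at most B;
    equivalently, sum_k b_k^* b_k <= B as forms. *)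
Definition rowbd r (b : 'I_r -> vec) N (B : R) := forall m (v : nat -> R[i]),
  \sum_(k < r) \sum_(l < N) nc (\sum_(j < m) b k l j * v j) ^+ 2 <=
  B * \sum_(j < m) nc (v j) ^+ 2.

(** The scalar matrices act on the outer tensor factor only, so they can be moved from the array to
    the vectors. *)
Lemma afm_sand r N (a b : 'I_r -> vec) (y : 'I_r -> arr) m n xi eta :
  afm (fun i j p q => \sum_(k < r) \sum_(l < N) \sum_(l' < N)
          ((a k l i)^* * b k l' j) * y k l l' p q) m n xi eta =
  \sum_(k < r) afm (y k) N n (fun l q => \sum_(j < m) b k l j * xi j q)
                         (fun l p => \sum_(i < m) a k l i * eta i p).
Proof.
rewrite (_ : \sum_(k < r) _ = \sum_(k < r) \sum_(p < n) \sum_(q < n) \sum_(l < N) \sum_(l' < N)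
  (\sum_(i < m) a k l i * eta i p)^* * y k l l' p q * (\sum_(j < m) b k l' j * xi j q)); last first.
  apply: eq_bigr => k _; by rewrite /afm (exchange4 (fun l l' p q =>
  (\sum_(i < m) a k l i * eta i p)^* * y k l l' p q * (\sum_(j < m) b k l' j * xi j q))).
set z := (X in afm X _ _ _ _); transitivity (\sum_(p < n) \sum_(q < n) \sum_(i < m) \sum_(j < m)
  (eta i p)^* * z i j p q * xi j q).
  by rewrite /afm (exchange4 (fun i j p q => (eta i p)^* * z i j p q * xi j q)).
rewrite [RHS]exchange_big /=; apply: eq_bigr => p _.
rewrite [RHS]exchange_big /=; apply: eq_bigr => q _.
rewrite /z (eq_bigr (fun i : 'I_m => \sum_(k < r) \sum_(j < m) \sum_(l < N) \sum_(l' < N)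
   (eta i p)^* * (((a k l i)^* * b k l' j) * y k l l' p q) * xi j q)); last first.
  move=> i _; rewrite exchange_big /=; apply: eq_bigr => j _.
  rewrite mulr_sumr mulr_suml; apply: eq_bigr => k _.
  rewrite mulr_sumr mulr_suml; apply: eq_bigr => l _.
  by rewrite mulr_sumr mulr_suml.
rewrite exchange_big /=; apply: eq_bigr => k _.
rewrite (exchange4 (fun i j l l' => (eta i p)^* * (((a k l i)^* * b k l' j) * y k l l' p q) * xi j q)).
apply: eq_bigr => l _; apply: eq_bigr => l' _.
rewrite conj_sum /= mulr_suml mulr_suml; apply: eq_bigr => i _.
rewrite mulr_sumr; apply: eq_bigr => j _; rewrite conjM /=; ring.
Qed.

Lemma n2_rowbd r N (b : 'I_r -> vec) B m n xi : rowbd b N B ->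
  \sum_(k < r) n2 N n (fun l q => \sum_(j < m) b k l j * xi j q) <= B * n2 m n xi.
Proof.
move=> bB; rewrite [n2 m n xi]n2_flip /n2.
under eq_bigr do rewrite exchange_big.
rewrite exchange_big mulr_sumr; apply: ler_sum => q _ /=.
exact: (bB m (fun j => xi j q)).
Qed.

Lemma rowbd_ge0 r N (b : 'I_r -> vec) B : rowbd b N B -> 0 <= B.
Proof.
move=> /(_ 1%N (fun=> 1)); rewrite !big_ord1 nc1 expr1n mulr1; apply: le_trans.
by apply: sumr_ge0 => k _; apply: sumr_ge0 => l _; exact: sqr_ge0.
Qed.

(** The operator space inequality for arrays. It is Cauchy-Schwarz over k, the squared lengths of
    the transformed vectors being summable to A and B by the row bounds. *)
Lemma ale_sand r N (a b : 'I_r -> vec) (y : 'I_r -> arr) A B M :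
  0 <= M -> rowbd a N A -> rowbd b N B -> (forall k, ale (y k) M) ->
  ale (fun i j p q => \sum_(k < r) \sum_(l < N) \sum_(l' < N)
          ((a k l i)^* * b k l' j) * y k l l' p q) (Num.sqrt A * Num.sqrt B * M).
Proof.
move=> M0 aA bB yM m n xi eta x1 e1; rewrite afm_sand.
apply: (le_trans (nc_sum _ _ _)).
apply: (@le_trans _ _ (\sum_(k < r) M *
   (Num.sqrt (n2 N n (fun l q => \sum_(j < m) b k l j * xi j q)) *
    Num.sqrt (n2 N n (fun l p => \sum_(i < m) a k l i * eta i p))))).
  by apply: ler_sum => k _; exact: ale_form.
rewrite -mulr_sumr mulrC ler_wpM2r //.
apply: (le_trans (real_CS _ _ _)); rewrite [leLHS]mulrC.
have E (v : 'I_r -> vec) : \sum_(k < r) Num.sqrt (n2 N n (v k)) ^+ 2 = \sum_(k < r) n2 N n (v k).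
  by apply: eq_bigr => k _; rewrite sqr_sqrtr ?n2_ge0.
rewrite !E.
apply: ler_pM; rewrite ?sqrtr_ge0 //; apply: ler_wsqrtr.
  by apply: (le_trans (n2_rowbd _ _ _ aA)); rewrite ler_piMr // (rowbd_ge0 aA).
by apply: (le_trans (n2_rowbd _ _ _ bB)); rewrite ler_piMr // (rowbd_ge0 bB).
Qed.

Lemma apos_sand r N (a : 'I_r -> vec) (y : 'I_r -> arr) :
  (forall k, apos (y k)) ->
  apos (fun i j p q => \sum_(k < r) \sum_(l < N) \sum_(l' < N)
          ((a k l i)^* * a k l' j) * y k l l' p q).
Proof. by move=> yp m n xi; rewrite afm_sand; apply: sumr_ge0 => k _; exact: yp. Qed.

Lemma apos_flip y : apos y -> apos (fun k l p q => y p q k l).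
Proof. by move=> yp m n xi; rewrite afm_flip; exact: yp. Qed.

End Arrays.

Section MatrixArrays.
Context {R : realType}.
Local Notation arr := (nat -> nat -> nat -> nat -> R[i]).
Local Notation vec := (nat -> nat -> R[i]).

Definition natfun (V : zmodType) m (xi : 'I_m -> V) (k : nat) : V :=
  if insub k is Some k' then xi k' else 0.

Lemma natfunE (V : zmodType) m (xi : 'I_m -> V) (k : 'I_m) : natfun xi k = xi k.
Proof. by rewrite /natfun valK. Qed.

Lemma natfun0 (V : zmodType) m (xi : 'I_m -> V) k : (m <= k)%N -> natfun xi k = 0.
Proof. by move=> mk; rewrite /natfun insubF // ltnNge mk. Qed.

Definition mxarr n (Y : Moo 'M[R[i]]_n) : arr := fun k l p q =>
  natfun (fun p' : 'I_n => natfun (fun q' : 'I_n => Y k l p' q') q) p.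

Lemma mxarrE n (Y : Moo 'M[R[i]]_n) k l (p q : 'I_n) : mxarr Y k l p q = Y k l p q.
Proof. by rewrite /mxarr !natfunE. Qed.

Lemma mxarr0 n (Y : Moo 'M[R[i]]_n) k l p q : (n <= p)%N || (n <= q)%N -> mxarr Y k l p q = 0.
Proof.
move=> /orP[] h; rewrite /mxarr; first by rewrite natfun0.
by rewrite /natfun; case: insub => // ?; rewrite insubF // ltnNge h.
Qed.

Lemma dotmx_sum n (u v : 'rV[R[i]]_n) : dotmx u v = \sum_(p < n) u 0 p * (v 0 p)^*.
Proof. by rewrite dotmxE mxE; apply: eq_bigr => p _; rewrite !mxE. Qed.

Lemma dotmx_norm n (u : 'rV[R[i]]_n) : hnorm (@dotmx _ n) u ^+ 2 = \sum_(p < n) nc (u 0 p) ^+ 2.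
Proof.
rewrite hnorm_sqr /= dotmx_sum Re_sum; apply: eq_bigr => p _.
by rewrite -sqr_nc.
Qed.

Lemma mxactE n (A : 'M[R[i]]_n) v p : mxact A v 0 p = \sum_(q < n) v 0 q * A p q.
Proof. by rewrite /mxact mxE; apply: eq_bigr => q _; rewrite mxE. Qed.

Lemma mxact_linear n (A : 'M[R[i]]_n) : linear (mxact A).
Proof. by move=> c u v; rewrite /mxact mulmxDl scalemxAl. Qed.

Lemma mxact_bounded n (A : 'M[R[i]]_n) :
  exists K : R, forall v, hnorm (@dotmx _ n) (mxact A v) <= K * hnorm (@dotmx _ n) v.
Proof.
set S := \sum_(p < n) \sum_(q < n) nc (A p q) ^+ 2.
have S_ge0 : 0 <= S by apply: sumr_ge0 => p _; apply: sumr_ge0 => q _; exact: sqr_ge0.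
exists (Num.sqrt S) => v.
rewrite -(@ler_pXn2r _ 2) ?nnegrE ?mulr_ge0 ?hnorm_ge0 ?sqrtr_ge0 // exprMn.
rewrite (sqr_sqrtr S_ge0).
apply: (@le_trans _ _ (\sum_(p < n) nc (mxact A v 0 p) ^+ 2)).
  by rewrite -(dotmx_norm (mxact A v)).
apply: (@le_trans _ _ (S * (\sum_(p < n) nc (v 0 p) ^+ 2))); last first.
  by rewrite -(dotmx_norm v).
rewrite mulr_suml; apply: ler_sum => p _; rewrite mxactE.
apply: (@le_trans _ _ ((\sum_(q < n) nc (v 0 q) * nc (A p q)) ^+ 2)).
  rewrite ler_pXn2r ?nnegrE ?nc_ge0 //; last first.
    by apply: sumr_ge0 => q _; rewrite mulr_ge0 ?nc_ge0.
  by apply: (le_trans (nc_sum _ _ _)); apply: ler_sum => q _; rewrite ncM.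
have S0 (f : 'I_n -> R) : 0 <= \sum_(q < n) f q ^+ 2.
  by apply: sumr_ge0 => q _; exact: sqr_ge0.
apply: (@le_trans _ _ ((Num.sqrt (\sum_(q < n) nc (v 0 q) ^+ 2) * Num.sqrt (\sum_(q < n) nc (A p q) ^+ 2)) ^+ 2)).
  rewrite ler_pXn2r ?nnegrE ?mulr_ge0 ?sqrtr_ge0 //; first exact: real_CS.
  by apply: sumr_ge0 => q _; rewrite mulr_ge0 ?nc_ge0.
by rewrite exprMn !sqr_sqrtr // mulrC.
Qed.

Lemma opf_afm n (Y : Moo 'M[R[i]]_n) m (xi eta : vec) :
  opf (@dotmx _ n) (@mxact _ n) Y (fun k : 'I_m => \row_(q < n) xi k q)
      (fun k : 'I_m => \row_(q < n) eta k q) = afm (mxarr Y) m n xi eta.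
Proof.
apply: eq_bigr => k _; apply: eq_bigr => l _; rewrite /= dotmx_sum.
apply: eq_bigr => p _; rewrite mxactE mulr_suml; apply: eq_bigr => q _.
by rewrite mxarrE !mxE; ring.
Qed.

Lemma hsq_n2 n m (xi : vec) :
  hsq (@dotmx _ n) (fun k : 'I_m => \row_(q < n) xi k q) = n2 m n xi.
Proof.
apply: eq_bigr => k _; rewrite dotmx_norm; apply: eq_bigr => p _.
by rewrite mxE.
Qed.

Definition ctv n (xi : vec) : vec := fun k p => if (p < n)%N then xi k p else 0.

Lemma n2_ctv m n n' xi : n2 m n (ctv n' xi) <= n2 m n' xi.
Proof.
apply: ler_sum => k _.
have -> : \sum_(p < n') nc (xi k p) ^+ 2 = \sum_(p < n') nc (ctv n' xi k p) ^+ 2.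
  by apply: eq_bigr => p _; rewrite /ctv ltn_ord.
apply: (@le_sum_ord _ n n' (fun p => nc (ctv n' xi k p) ^+ 2)) => p.
  exact: sqr_ge0.
by move=> np; rewrite /ctv ltnNge np nc0 expr0n.
Qed.

(** An array that comes from M_n(C) vanishes for inner indices beyond n, so every inner dimension n'
    can be replaced by n once the vectors are cut at n'. *)
Lemma mxarr_resize n (Y : Moo 'M[R[i]]_n) m n' xi eta :
  afm (mxarr Y) m n' xi eta = afm (mxarr Y) m n (ctv n' xi) (ctv n' eta).
Proof.
transitivity (afm (mxarr Y) m n' (ctv n' xi) (ctv n' eta)).
  by apply: eq_afmv => k p _ pn; rewrite /ctv pn.
pose Z : arr := fun k l p q => if (k < m)%N && (l < m)%N then mxarr Y k l p q else 0.
have ZE v w j : afm (mxarr Y) m j v w = afm Z m j v w.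
  apply: eq_bigr => k _; apply: eq_bigr => l _; apply: eq_bigr => p _.
  by apply: eq_bigr => q _; rewrite /Z !ltn_ord.
rewrite !ZE; apply: afm_resize => k l p q.
  move=> /or4P[] h; rewrite /Z /ctv ?[(k < m)%N]ltnNge ?[(l < m)%N]ltnNge ?h /= ?andbF ?mulr0 ?mul0r //.
  - by rewrite [(p < n')%N]ltnNge h conjC0 !mul0r.
  - by rewrite [(q < n')%N]ltnNge h mulr0.
move=> /or4P[] h; rewrite /Z ?[(k < m)%N]ltnNge ?[(l < m)%N]ltnNge ?h /= ?andbF ?mulr0 ?mul0r //.
- by rewrite mxarr0 ?h // if_same mulr0 mul0r.
- by rewrite mxarr0 ?h ?orbT // if_same mulr0 mul0r.
Qed.

Lemma row_natfun n m (xi : 'I_m -> 'rV[R[i]]_n) (k : 'I_m) :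
  \row_(q < n) natfun (fun q' : 'I_n => natfun xi k 0 q') q = xi k.
Proof. by apply/rowP => q; rewrite mxE !natfunE. Qed.

Lemma mxarr_Mn n (Y : Moo 'M[R[i]]_n) : exists N, forall i j,
  (N <= i)%N || (N <= j)%N -> forall v, mxact (Y i j) v = 0.
Proof.
have [N YN] := moo_finsupp Y; exists N => i j /YN -> v.
by rewrite /mxact trmx0 mulmx0.
Qed.

Lemma ale_mxarr n (Y : Moo 'M[R[i]]_n) : ale (mxarr Y) (mnorm (mx_smos n) Y).
Proof.
move=> m n' xi eta x1 e1; rewrite mxarr_resize -opf_afm.
have [N YN] := mxarr_Mn Y.
apply: (le_trans (op_mnorm_form YN _ _ _ _)).
- by move=> i j; exact: mxact_linear.
- by move=> i j; exact: mxact_bounded.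
rewrite !hsq_n2 -[X in _ <= X]mulr1 ler_wpM2l ?op_mnorm_ge0 //.
rewrite -[1]mulr1 ler_pM ?sqrtr_ge0 //; rewrite -sqrtr1 ler_wsqrtr //.
  exact: le_trans (n2_ctv _ _ _ _) x1.
exact: le_trans (n2_ctv _ _ _ _) e1.
Qed.

Lemma mx_normE n (Y : Moo 'M[R[i]]_n) : mnorm (mx_smos n) Y = anorm (mxarr Y).
Proof.
apply/eqP; rewrite eq_le; apply/andP; split; last first.
  by apply: anorm_le; exact: ale_mxarr.
apply: op_mnorm_le; first exact: anorm_ge0.
move=> m xi eta x1 e1.
pose fx (v : 'I_m -> 'rV[R[i]]_n) (k q : nat) : R[i] :=
  natfun (fun q' : 'I_n => natfun v k 0 q') q.
have E (v : 'I_m -> 'rV[R[i]]_n) : v = fun k : 'I_m => \row_(q < n) fx v k q.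
  by apply/funext => k; rewrite row_natfun.
have h := ale_anorm (ale_mxarr Y).
rewrite (E xi) (E eta) opf_afm; apply: h.
  by move: x1; rewrite {1}(E xi) hsq_n2.
by move: e1; rewrite {1}(E eta) hsq_n2.
Qed.

Lemma mx_coneE n (Y : Moo 'M[R[i]]_n) : mcone (mx_smos n) Y <-> apos (mxarr Y).
Proof.
split=> [Yp m n' xi|Yp m xi].
  by rewrite mxarr_resize -opf_afm; exact: Yp.
pose fx (v : 'I_m -> 'rV[R[i]]_n) (k q : nat) : R[i] :=
  natfun (fun q' : 'I_n => natfun v k 0 q') q.
have E (v : 'I_m -> 'rV[R[i]]_n) : v = fun k : 'I_m => \row_(q < n) fx v k q.
  by apply/funext => k; rewrite row_natfun.
by rewrite (E xi); rewrite -/(opf _ _ _ _ _) opf_afm.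
Qed.

Definition moarr (y : Moo (Moo R[i])) : arr := fun k l p q => y k l p q.

Lemma moarr_finsupp y : exists N, forall k l p q,
  [|| N <= k, N <= l, N <= p | N <= q]%N -> moarr y k l p q = 0.
Proof.
have [N yN] := moo_finsupp y.
have h k l := moo_finsupp (y k l).
pose M := (\max_(k < N) \max_(l < N) projT1 (cid (h k l)))%N.
exists (maxn N M) => k l p q; rewrite !geq_max => klpq.
have [kl|] := boolP ((N <= k)%N || (N <= l)%N); first by rewrite /moarr yN.
rewrite negb_or -!ltnNge => /andP[kN lN].
rewrite ![(N <= k)%N]leqNgt ![(N <= l)%N]leqNgt kN lN /= in klpq.
have yM : Mn M (y k l).
  apply: Mn_le (projT2 (cid (h k l))).
  apply: leq_trans (leq_bigmax (Ordinal kN)).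
  exact: leq_trans (leq_bigmax (Ordinal lN)).
by apply: yM; case/orP: klpq => /andP[_ ->]; rewrite ?orbT.
Qed.

Lemma ale_moarr_ex y : exists K, ale (moarr y) K.
Proof. by have [N yN] := moarr_finsupp y; exact: ale_finsupp yN. Qed.

Lemma mxarr_corner n (y : Moo (Moo R[i])) k l p q :
  mxarr (mmap (corner n) y) k l p q = if (p < n)%N && (q < n)%N then y k l p q else 0.
Proof.
case: ifP => [/andP[pn qn]|/negbT].
  rewrite -[p]/(nat_of_ord (Ordinal pn)) -[q]/(nat_of_ord (Ordinal qn)) mxarrE.
  rewrite mmapE ?mxE //.
  by apply/matrixP => i j; rewrite !mxE.
by rewrite negb_and -!leqNgt => /mxarr0.
Qed.

Lemma ale_corner n y K : ale (moarr y) K -> ale (mxarr (mmap (corner n) y)) K.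
Proof.
move=> yK m n' xi eta x1 e1; rewrite mxarr_resize.
rewrite (_ : afm _ _ _ _ _ = afm (moarr y) m n (ctv n' xi) (ctv n' eta)).
  apply: yK; first exact: le_trans (n2_ctv _ _ _ _) x1.
  exact: le_trans (n2_ctv _ _ _ _) e1.
apply: eq_bigr => k _; apply: eq_bigr => l _; apply: eq_bigr => p _.
by apply: eq_bigr => q _; rewrite mxarr_corner !ltn_ord.
Qed.

Lemma corner_afm n y m xi eta :
  afm (moarr y) m n xi eta = afm (mxarr (mmap (corner n) y)) m n xi eta.
Proof.
apply: eq_bigr => k _; apply: eq_bigr => l _; apply: eq_bigr => p _.
by apply: eq_bigr => q _; rewrite mxarr_corner !ltn_ord.
Qed.

(** The corners exhaust the array and each of them is a compression of it, so the supremum over n is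
    already contained in the supremum over all forms. *)
Lemma moo_normE y : mnorm Moo_smos y = anorm (moarr y).
Proof.
have [K yK] := ale_moarr_ex y; have y1 := ale_anorm yK.
apply/eqP; rewrite eq_le; apply/andP; split.
  apply: sup_le; first exact: anorm_ge0.
  by move=> _ [n _ <-]; rewrite mx_normE; apply: anorm_le; exact: ale_corner.
apply: anorm_le => m n xi eta x1 e1; rewrite corner_afm.
have h := @ale_mxarr n (mmap (corner n) y).
apply: (le_trans (h _ _ _ _ x1 e1)).
apply: (@le_sup _ _ (anorm (moarr y))); last by exists n.
by move=> _ [n' _ <-]; rewrite mx_normE; apply: anorm_le; exact: ale_corner.
Qed.

Lemma moo_coneE y : mcone Moo_smos y <-> apos (moarr y).
Proof.
split=> [yp m n xi|yp n].
  by have /mx_coneE h := yp n; rewrite corner_afm; exact: h.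
apply/mx_coneE => m n' xi; rewrite mxarr_resize.
rewrite (_ : afm _ _ _ _ _ = afm (moarr y) m n (ctv n' xi) (ctv n' xi)); first exact: yp.
apply: eq_bigr => k _; apply: eq_bigr => l _; apply: eq_bigr => p _.
by apply: eq_bigr => q _; rewrite mxarr_corner !ltn_ord.
Qed.

Lemma ale_moarr y : ale (moarr y) (mnorm Moo_smos y).
Proof. by have [K yK] := ale_moarr_ex y; rewrite moo_normE; exact: ale_anorm yK. Qed.

Definition cf (a : Moo R[i]) m (v w : nat -> R[i]) : R[i] :=
  \sum_(i < m) \sum_(j < m) (w i)^* * a i j * v j.

Lemma cnorm_ge0 (a : Moo R[i]) : 0 <= cnorm a.
Proof. by rewrite /cnorm /norm1 moo_normE anorm_ge0. Qed.

Lemma moarr_mx1 (a : Moo R[i]) k l p q :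
  moarr (mx1 a) k l p q = if (k == 0%N) && (l == 0%N) then a p q else 0.
Proof. by rewrite /moarr mx1E; case: ifP. Qed.

Lemma afm_mx1 (a : Moo R[i]) m n xi eta :
  afm (moarr (mx1 a)) m.+1 n xi eta = cf a n (xi 0%N) (eta 0%N).
Proof.
rewrite /afm big_ord_recl [X in _ + X]big1 ?addr0 => [|k _].
  rewrite big_ord_recl [X in _ + X]big1 ?addr0 => [|l _].
    apply: eq_bigr => p _; apply: eq_bigr => q _.
    by rewrite moarr_mx1.
  by apply: big1 => p _; apply: big1 => q _; rewrite moarr_mx1 /= mulr0 mul0r.
apply: big1 => l _.
by apply: big1 => p _; apply: big1 => q _; rewrite moarr_mx1 /= mulr0 mul0r.
Qed.

Lemma cnorm_form (a : Moo R[i]) m v w : nc (cf a m v w) <=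
  cnorm a * (Num.sqrt (\sum_(i < m) nc (v i) ^+ 2) * Num.sqrt (\sum_(i < m) nc (w i) ^+ 2)).
Proof.
have := ale_form (ale_moarr (mx1 a)) 1 m (fun=> v) (fun=> w).
by rewrite afm_mx1 /n2 !big_ord1.
Qed.

Lemma cnorm_le (a : Moo R[i]) (K : R) : 0 <= K ->
  (forall m (v w : nat -> R[i]), \sum_(i < m) nc (v i) ^+ 2 <= 1 -> \sum_(i < m) nc (w i) ^+ 2 <= 1 ->
     nc (cf a m v w) <= K) -> cnorm a <= K.
Proof.
move=> K0 aK; rewrite /cnorm /norm1 moo_normE; apply: anorm_le => -[|m] n xi eta x1 e1.
  by rewrite /afm big_ord0 nc0.
have h (v : vec) : n2 m.+1 n v <= 1 -> \sum_(i < n) nc (v 0%N i) ^+ 2 <= 1.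
  apply: le_trans; rewrite /n2 big_ord_recl lerDl.
  by apply: sumr_ge0 => k _; apply: sumr_ge0 => p _; exact: sqr_ge0.
by rewrite afm_mx1; apply: aK; exact: h.
Qed.

Lemma cf_madjmul r (b : 'I_r -> Moo R[i]) N m v w :
  (forall k i j, (N <= i)%N -> b k i j = 0) ->
  cf (\sum_(k < r) madjmul (b k) (b k)) m v w =
  \sum_(k < r) \sum_(l < N) (\sum_(i < m) b k l i * w i)^* * (\sum_(j < m) b k l j * v j).
Proof.
move=> bN.
rewrite /cf (eq_bigr (fun i : 'I_m => \sum_(k < r) \sum_(j < m) \sum_(l < N)
   (b k l i * w i)^* * (b k l j * v j))); last first.
  move=> i _; rewrite exchange_big; apply: eq_bigr => j _ /=.
  rewrite moo_sum mulr_sumr mulr_suml; apply: eq_bigr => k _.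
  rewrite (@madjmulE _ N); last by move=> *; exact: bN.
  rewrite mulr_sumr mulr_suml; apply: eq_bigr => l _.
  by rewrite conjM; ring.
rewrite exchange_big; apply: eq_bigr => k _ /=.
under eq_bigr do rewrite exchange_big.
rewrite exchange_big; apply: eq_bigr => l _ /=.
rewrite conj_sum mulr_suml; apply: eq_bigr => i _.
by rewrite mulr_sumr.
Qed.

Lemma cf_sumsq r (b : 'I_r -> Moo R[i]) N m v :
  (forall k i j, (N <= i)%N -> b k i j = 0) ->
  cf (\sum_(k < r) madjmul (b k) (b k)) m v v =
  (\sum_(k < r) \sum_(l < N) nc (\sum_(j < m) b k l j * v j) ^+ 2)%:C%C.
Proof.
move=> bN; rewrite (cf_madjmul _ _ _ bN).
rewrite (big_morph (fun t : R => t%:C%C : R[i]) (@rcD R) (erefl _)); apply: eq_bigr => k _.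
rewrite (big_morph (fun t : R => t%:C%C : R[i]) (@rcD R) (erefl _)); apply: eq_bigr => l _.
by rewrite sqr_nc mulrC.
Qed.

Lemma rows_common r (b : 'I_r -> Moo R[i]) : exists N, forall k i j, (N <= i)%N -> b k i j = 0.
Proof. by have [N bN] := common_Mn b; exists N => k i j Ni; rewrite bN ?Ni. Qed.

(** One half of the C*-identity for the column of the b_k: the form of sum_k b_k^* b_k at (v, v) is
    the squared length of the image of v. The other half, [cnorm_rowbd], is Cauchy-Schwarz for the
    form at (v, w). *)
Lemma rowbd_cnorm r (b : 'I_r -> Moo R[i]) N :
  rowbd (fun k => b k) N (cnorm (\sum_(k < r) madjmul (b k) (b k))).
Proof.
have [M bM] := rows_common b; move=> m v.
have := cnorm_form (\sum_(k < r) madjmul (b k) (b k)) m v v.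
rewrite (cf_sumsq _ _ bM) -expr2 sqr_sqrtr; last first.
  by apply: sumr_ge0 => i _; exact: sqr_ge0.
rewrite nc_real; apply: le_trans; apply: le_trans (ler_norm _).
apply: ler_sum => k _.
apply: (@le_sum_ord _ N M (fun l => nc (\sum_(j < m) b k l j * v j) ^+ 2)) => l.
  exact: sqr_ge0.
by move=> Ml; rewrite big1 ?nc0 ?expr0n // => j _; rewrite bM // mul0r.
Qed.

Lemma cnorm_rowbd r (b : 'I_r -> Moo R[i]) N B :
  (forall k i j, (N <= i)%N -> b k i j = 0) -> rowbd (fun k => b k) N B ->
  cnorm (\sum_(k < r) madjmul (b k) (b k)) <= B.
Proof.
move=> bN bB; have B0 := rowbd_ge0 bB; apply: cnorm_le => // m v w v1 w1.
rewrite (cf_madjmul _ _ _ bN) pair_big /=.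
apply: (le_trans (nc_sum _ _ _)); rewrite (eq_bigr (fun p : 'I_r * 'I_N =>
   nc (\sum_(i < m) b p.1 p.2 i * w i) * nc (\sum_(i < m) b p.1 p.2 i * v i))); last first.
  by move=> p _; rewrite ncM nc_conj.
apply: (le_trans (real_CS _ _ _)).
rewrite -(pair_big xpredT xpredT (fun k l => nc (\sum_(i < m) b k (nat_of_ord l) i * w i) ^+ 2)) /=.
rewrite -(pair_big xpredT xpredT (fun k l => nc (\sum_(i < m) b k (nat_of_ord l) i * v i) ^+ 2)) /=.
rewrite -[X in _ <= X](sqr_sqrtr B0) expr2 ler_pM ?sqrtr_ge0 // ler_wsqrtr //.
  by apply: le_trans (bB _ _) _; rewrite ler_piMr.
by apply: le_trans (bB _ _) _; rewrite ler_piMr.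
Qed.

End MatrixArrays.

(** * Matrix units, corner projections and columns *)

Section UnitMatrices.
Context {R : realType}.

Lemma sum_delta (m : nat) (j0 : nat) (v : nat -> R[i]) :
  \sum_(j < m) (nat_of_ord j == j0)%:R * v j = if (j0 < m)%N then v j0 else 0.
Proof.
case: ifP => [jm|/negbT]; last first.
  rewrite -leqNgt => mj; apply: big1 => j _.
  by rewrite ltn_eqF ?mul0r // (leq_trans (ltn_ord j)).
rewrite (bigD1 (Ordinal jm)) //= eqxx mul1r big1 ?addr0 // => j /negbTE nj.
by rewrite (_ : (nat_of_ord j == j0) = false) ?mul0r //; exact: nj.
Qed.

Lemma rowbd_munit N i j : rowbd (fun _ : 'I_1 => munit i j : nat -> nat -> R[i]) N 1.
Proof.
move=> m v; rewrite big_ord1 mul1r.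
have E l : nc (\sum_(j0 < m) munit i j l j0 * v j0) ^+ 2 =
    if (l == i) && (j < m)%N then nc (v j) ^+ 2 else 0.
  under eq_bigr do rewrite munitE.
  case: eqP => _ /=; last by rewrite big1 ?nc0 ?expr0n // => k _; rewrite mul0r.
  by rewrite sum_delta; case: ifP => //; rewrite nc0 expr0n.
under eq_bigr do rewrite E.
case: (ltnP j m) => jm; last first.
  rewrite big1; first by apply: sumr_ge0 => k _; exact: sqr_ge0.
  by move=> k _; rewrite andbF.
apply: le_trans (le_sum_term (F:=fun j => nc (v j) ^+ 2) (fun k => sqr_ge0 _) jm).
apply: (@le_trans _ _ (\sum_(k < i.+1) if (nat_of_ord k == i) then nc (v j) ^+ 2 else 0)).
  under eq_bigr do rewrite andbT.
  apply: (@le_sum_ord _ N i.+1 (fun k => if k == i then nc (v j) ^+ 2 else 0)) => k.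
    by case: ifP => // _; exact: sqr_ge0.
  by move=> ik; rewrite gtn_eqF.
rewrite big_ord_recr /= eqxx big1 ?add0r // => k _.
by rewrite ltn_eqF.
Qed.

Lemma rowbd_mone N n : rowbd (fun _ : 'I_1 => mone n : nat -> nat -> R[i]) N 1.
Proof.
move=> m v; rewrite big_ord1 mul1r.
have E l : nc (\sum_(j0 < m) mone n l j0 * v j0) ^+ 2 =
    if (l < n)%N && (l < m)%N then nc (v l) ^+ 2 else 0.
  under eq_bigr do rewrite moneE eq_sym.
  case: (ltnP l n) => _ /=; last first.
    by rewrite big1 ?nc0 ?expr0n // => k _; rewrite andbF mul0r.
  under eq_bigr do rewrite andbT.
  by rewrite sum_delta; case: ifP => //; rewrite nc0 expr0n.
under eq_bigr do rewrite E.
apply: (le_trans (@le_sum_ord _ N m (fun l => if (l < n)%N && (l < m)%N then nc (v l) ^+ 2 else 0) _ _)).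
- by move=> k; case: ifP => // _; exact: sqr_ge0.
- by move=> k mk; rewrite [(k < m)%N]ltnNge mk andbF.
by apply: ler_sum => k _; case: ifP => // _; exact: sqr_ge0.
Qed.

(** The vector v as a first column: a sandwich by columns compresses a matrix over X to a 1 x 1
    matrix, see [msand_colv]. *)
Definition colv m (v : nat -> R[i]) : Moo R[i] :=
  mtr m.+1 (fun k j => if (k < m)%N && (j == 0%N) then v k else 0).

Lemma colvE m v k j : colv m v k j = if (k < m)%N && (j == 0%N) then v k else 0.
Proof.
rewrite mtrE; case: (boolP ((k < m)%N && (j == 0%N))) => [/andP[km /eqP ->]|]; last by case: ifP.
by rewrite (ltn_trans km).
Qed.

Lemma rowbd_colv N m v : rowbd (fun _ : 'I_1 => colv m v : nat -> nat -> R[i]) N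
  (\sum_(k < m) nc (v k) ^+ 2).
Proof.
move=> m' w; rewrite big_ord1.
have E l : nc (\sum_(j < m') colv m v l j * w j) ^+ 2 =
  if (l < m)%N && (0 < m')%N then nc (v l) ^+ 2 * nc (w 0%N) ^+ 2 else 0.
  rewrite (eq_bigr (fun j : 'I_m' => (nat_of_ord j == 0%N)%:R * (if (l < m)%N then v l * w j else 0))).
    rewrite (sum_delta m' 0 (fun j => if (l < m)%N then v l * w j else 0)).
    case: (0 < m')%N; case: (l < m)%N; rewrite /= ?ncM ?exprMn ?nc0 ?expr0n //.
  move=> j _; rewrite colvE; case: (l < m)%N; rewrite ?mulr0 ?mul0r //=.
  by case: eqP => _; rewrite ?mul1r ?mul0r.
under eq_bigr do rewrite E.
apply: (le_trans (@le_sum_ord _ N m (fun l => if (l < m)%N && (0 < m')%N then nc (v l) ^+ 2 * nc (w 0%N) ^+ 2 else 0) _ _)).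
- by move=> k; case: ifP => // _; rewrite mulr_ge0 ?sqr_ge0.
- by move=> k mk; rewrite ltnNge mk.
case: (ltnP 0 m') => m0; last first.
  rewrite big1 ?mulr_ge0 //; last by move=> k _; rewrite andbF.
    by apply: sumr_ge0 => k _; exact: sqr_ge0.
  by apply: sumr_ge0 => k _; exact: sqr_ge0.
rewrite mulr_suml; apply: ler_sum => k _; rewrite ltn_ord /= ler_wpM2l ?sqr_ge0 //.
exact: (le_sum_term (F:=fun j => nc (w j) ^+ 2) (fun k => sqr_ge0 _) m0).
Qed.

Lemma cnorm_rowbd1 (b : Moo R[i]) B :
  (forall N, rowbd (fun _ : 'I_1 => b : nat -> nat -> R[i]) N B) ->
  cnorm (\sum_(k < 1) madjmul b b) <= B.
Proof.
move=> bB; have [N bN] := moo_finsupp b.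
by apply: (@cnorm_rowbd _ 1 (fun _ => b) N) => // k i j Ni; rewrite bN ?Ni.
Qed.

End UnitMatrices.

(** * Consequences of the operator space inequality *)

Section MatrixNormTheory.
Context {R : realType} (X : lmodType R[i]) (N : Moo X -> R).
Hypothesis HN : matrix_norm N.

Let N1 := let: And4 h _ _ _ := HN in h.
Let ND := let: And4 _ h _ _ := HN in h.
Let NZ := let: And4 _ _ h _ := HN in h.
Let NR := let: And4 _ _ _ h := HN in h.

Lemma matrix_norm0 : N 0 = 0.
Proof. by rewrite -(scale0r (0 : Moo X)) NZ nc0 mul0r. Qed.

Lemma matrix_normN x : N (- x) = N x.
Proof. by rewrite -scaleN1r NZ ncN nc1 mul1r. Qed.

Lemma matrix_normB x y : N (x - y) <= N x + N y.
Proof. by rewrite -(matrix_normN y) ND. Qed.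

Lemma matrix_norm_distC x y : N (x - y) = N (y - x).
Proof. by rewrite -matrix_normN opprB. Qed.

Lemma matrix_norm_ge0 x : 0 <= N x.
Proof.
have := matrix_normB x x; rewrite subrr matrix_norm0 -mulr2n.
by rewrite pmulrn_lge0.
Qed.

Lemma matrix_norm_sum (I : Type) (r : seq I) (P : pred I) (F : I -> Moo X) :
  N (\sum_(i <- r | P i) F i) <= \sum_(i <- r | P i) N (F i).
Proof.
elim/big_rec2: _ => [|i x y _ xy]; first by rewrite matrix_norm0.
by rewrite (le_trans (ND _ _)) // lerD2l.
Qed.

Lemma matrix_norm_sand m (a b : 'I_m -> Moo R[i]) (x : 'I_m -> Moo X) A B M :
  cnorm (\sum_(k < m) madjmul (a k) (a k)) <= A ->
  cnorm (\sum_(k < m) madjmul (b k) (b k)) <= B ->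
  0 <= M -> (forall k, N (x k) <= M) ->
  N (\sum_(k < m) msand (a k) (x k) (b k)) <= Num.sqrt A * Num.sqrt B * M.
Proof.
move=> aA bB M0 xM; apply: (le_trans (NR _ _ _)).
have mx : \big[Num.max/0]_(k < m) N (x k) <= M by apply: bigmax_le.
rewrite !ler_pM ?mulr_ge0 ?sqrtr_ge0 ?ler_wsqrtr //.
by elim/big_ind: _ => // [u v u0 v0|k _]; rewrite ?matrix_norm_ge0 // le_max u0.
Qed.

Lemma matrix_norm_sand1 (a b : Moo R[i]) (x : Moo X) A B :
  (forall K, rowbd (fun _ : 'I_1 => a : nat -> nat -> R[i]) K A) ->
  (forall K, rowbd (fun _ : 'I_1 => b : nat -> nat -> R[i]) K B) ->
  N (msand a x b) <= Num.sqrt A * Num.sqrt B * N x.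
Proof.
move=> aA bB; have := @matrix_norm_sand 1 (fun=> a) (fun=> b) (fun=> x) A B (N x).
rewrite [\sum_(k < 1) msand _ _ _]big_ord1; apply => //.
- exact: cnorm_rowbd1.
- exact: cnorm_rowbd1.
- exact: matrix_norm_ge0.
Qed.

(** Extracting an entry and putting it at another place are both sandwiches by matrix units. Hence
    the norm of an entry is bounded by the norm of the matrix, and the matrix by the sum over its
    entries. *)
Lemma msand_munit (x : Moo X) i j p q :
  msand (munit i p) x (munit j q) = minf (fun k l => if (k == p) && (l == q) then x i j else 0).
Proof.
apply: mooP => k l; have [n xn] := moo_finsupp x.
rewrite (@minfE _ _ _ (maxn p q).+1); last first.
  by move=> k' l' /orP[] h; case: andP => // -[/eqP kp /eqP lq]; move: h;
     rewrite ?kp ?lq gtn_max ltnn ?andbF.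
pose M := (n + i.+1 + j.+1)%N.
rewrite (@msandE _ _ M M); last first.
  by move=> a b h; apply: xn; move: h; rewrite /M -!addnA => /orP[] h;
     rewrite (leq_trans (leq_addr _ _) h) ?orbT.
have iM : (i < M)%N := leq_trans (leq_addl n i.+1) (leq_addr _ _).
have jM : (j < M)%N := leq_addl _ _.
rewrite (bigD1 (Ordinal iM)) //= [X in _ + X]big1 ?addr0; last first.
  move=> a; rewrite -val_eqE /= => /negbTE ai; apply: big1 => b _.
  by rewrite munitE ai /= conjC0 mul0r scale0r.
rewrite (bigD1 (Ordinal jM)) //= [X in _ + X]big1 ?addr0; last first.
  move=> b; rewrite -val_eqE /= => /negbTE bj.
  by rewrite [munit j q _ _]munitE bj /= mulr0 scale0r.
rewrite !munitE !eqxx /=; case: (k == p); rewrite ?conjC0 ?mul0r ?scale0r //=.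
by rewrite conjC1 mul1r; case: (l == q); rewrite ?scale1r ?scale0r.
Qed.

Lemma mx1_entry (x : Moo X) i j : mx1 (x i j) = msand (munit i 0) x (munit j 0).
Proof. by rewrite msand_munit. Qed.

Lemma norm_entry (x : Moo X) i j : N (mx1 (x i j)) <= N x.
Proof.
rewrite mx1_entry (le_trans (matrix_norm_sand1 _ (fun K => rowbd_munit K i 0) (fun K => rowbd_munit K j 0))) //.
by rewrite sqrtr1 !mul1r.
Qed.

Lemma sum_entries n (x : Moo X) : Mn n x ->
  x = \sum_(i < n) \sum_(j < n) msand (munit 0 i) (mx1 (x i j)) (munit 0 j).
Proof.
move=> xn; apply: mooP => k l; rewrite moo_sum.
under eq_bigr do rewrite moo_sum.
have E (i j : nat) : msand (munit 0 i) (mx1 (x i j)) (munit 0 j) k l =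
    if (k == i) && (l == j) then x i j else 0.
  rewrite msand_munit mx1E /= (@minfE _ _ _ (maxn i j).+1) //.
  by move=> k' l' /orP[] h; case: andP => // -[/eqP kp /eqP lq]; move: h;
     rewrite ?kp ?lq gtn_max ltnn ?andbF.
under eq_bigr do (under eq_bigr do rewrite E).
have [/andP[kn ln]|] := boolP ((k < n) && (l < n))%N; last first.
  rewrite negb_and -!leqNgt => kl; rewrite xn // big1 // => i _; rewrite big1 // => j _.
  case: andP => // -[/eqP ki /eqP lj].
  by move: kl; rewrite ki lj leqNgt ltn_ord leqNgt ltn_ord.
rewrite (bigD1 (Ordinal kn)) //= [X in _ + X]big1 ?addr0; last first.
  move=> i; rewrite -val_eqE /= eq_sym => /negbTE ki.
  by rewrite big1 // => j _; rewrite ki.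
rewrite (bigD1 (Ordinal ln)) //= [X in _ + X]big1 ?addr0 ?eqxx // => j.
by rewrite -val_eqE /= => /negbTE jl; rewrite [l == _]eq_sym jl ?andbF.
Qed.

Lemma norm_le_entries n (x : Moo X) : Mn n x ->
  N x <= \sum_(i < n) \sum_(j < n) N (mx1 (x i j)).
Proof.
move=> xn; rewrite {1}(sum_entries xn).
apply: (le_trans (matrix_norm_sum _ _ _)); apply: ler_sum => i _.
apply: (le_trans (matrix_norm_sum _ _ _)); apply: ler_sum => j _.
rewrite (le_trans (matrix_norm_sand1 _ (fun K => rowbd_munit K 0 i) (fun K => rowbd_munit K 0 j))) //.
by rewrite sqrtr1 !mul1r.
Qed.

Lemma msand_colv m (x : Moo X) v w :
  msand (colv m v) x (colv m w) = mx1 (\sum_(k < m) \sum_(l < m) ((v k)^* * w l) *: x k l).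
Proof.
apply: mooP => i j; rewrite mx1E; have [n xn] := moo_finsupp x.
rewrite (@msandE _ _ (n + m) (n + m)); last first.
  move=> a b h; apply: xn; case/orP: h => h;
     by rewrite (leq_trans (leq_addr _ _) h) ?orbT.
case: (boolP ((i == 0%N) && (j == 0%N))) => [/andP[/eqP -> /eqP ->]|ij]; last first.
  move: ij; rewrite negb_and => /orP[] /negbTE h; apply: big1 => k _; apply: big1 => l _;
    by rewrite !colvE h andbF ?conjC0 ?mulr0 ?mul0r scale0r.
pose F k l := ((colv m v k 0%N)^* * colv m w l 0%N) *: x k l.
transitivity (\sum_(k < m) \sum_(l < n + m) F k l).
  apply: (@eq_sum_ord _ _ _ (fun k => \sum_(l < n + m) F k l)) => k kl; apply: big1 => l _.
    by rewrite /F colvE ltnNge (leq_trans (leq_addl _ _) kl) /= conjC0 mul0r scale0r.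
  by rewrite /F colvE ltnNge kl /= conjC0 mul0r scale0r.
apply: eq_bigr => k _; transitivity (\sum_(l < m) F k l).
  apply: (@eq_sum_ord _ _ _ (F k)) => l kl.
    by rewrite /F [colv m w _ _]colvE ltnNge (leq_trans (leq_addl _ _) kl) /= mulr0 scale0r.
  by rewrite /F [colv m w _ _]colvE ltnNge kl /= mulr0 scale0r.
by apply: eq_bigr => l _; rewrite /F !colvE !ltn_ord.
Qed.

(** The combination is the 1 x 1 compression of x by the columns v and w. This estimate is what
    makes single bounded functionals act boundedly on matrices. *)
Lemma norm_comb m (x : Moo X) (v w : nat -> R[i]) :
  N (mx1 (\sum_(k < m) \sum_(l < m) ((v k)^* * w l) *: x k l)) <=
  Num.sqrt (\sum_(k < m) nc (v k) ^+ 2) * Num.sqrt (\sum_(k < m) nc (w k) ^+ 2) * N x.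
Proof.
rewrite -(msand_colv m x v w).
by apply: matrix_norm_sand1 => K; exact: rowbd_colv.
Qed.

Lemma msand_mone n (x : Moo X) : msand (mone n) x (mone n) = mtr n x.
Proof.
apply: mooP => i j; rewrite mtrE; have [M xM] := moo_finsupp x.
rewrite (@msandE _ _ (M + i.+1) (M + j.+1)); last first.
  by move=> a b h; apply: xM; case/orP: h => h; rewrite (leq_trans (leq_addr _ _) h) ?orbT.
have iM : (i < M + i.+1)%N by rewrite leq_addl.
have jM : (j < M + j.+1)%N by rewrite leq_addl.
rewrite (bigD1 (Ordinal iM)) //= [X in _ + X]big1 ?addr0; last first.
  move=> a; rewrite -val_eqE /= => /negbTE ai; apply: big1 => b _.
  by rewrite moneE ai /= conjC0 mul0r scale0r.
rewrite (bigD1 (Ordinal jM)) //= [X in _ + X]big1 ?addr0; last first.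
  move=> b; rewrite -val_eqE /= => /negbTE bj.
  by rewrite [mone n _ j]moneE bj /= mulr0 scale0r.
rewrite !moneE !eqxx /=; case: (i < n)%N; rewrite ?conjC0 ?mul0r ?scale0r //=.
by rewrite conjC1 mul1r; case: (j < n)%N; rewrite ?scale1r ?scale0r.
Qed.

Lemma norm_mtr n (x : Moo X) : N (mtr n x) <= N x.
Proof.
rewrite -msand_mone (le_trans (matrix_norm_sand1 _ (fun K => rowbd_mone K n) (fun K => rowbd_mone K n))) //.
by rewrite sqrtr1 !mul1r.
Qed.

End MatrixNormTheory.

(** * Matrix norms defined by families of test matrices *)

Section SupNorms.
Context {R : realType} (Y : lmodType R[i]) (T : Type) (S : set T).
Variable beta : T -> nat -> nat -> Y -> R[i].
Local Notation arr := (nat -> nat -> nat -> nat -> R[i]).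

Definition barr s (x : Moo Y) : arr := fun k l p q => beta s p q (x k l).

(** Each s gives a matrix of linear functionals on Y, indexed by p and q. The construction is used
    in both directions of the duality: elements of M_oo(X) test the dual ([dual_norm_supN]), and
    matrices of functionals test X ([block_lam]). *)
Definition supN (x : Moo Y) : R := sup [set anorm (barr s x) | s in S].

Hypothesis beta_lin : forall s p q, S s -> forall c x y,
  beta s p q (c *: x + y) = c * beta s p q x + beta s p q y.

Lemma beta0 s p q : S s -> beta s p q 0 = 0.
Proof. by move=> Ss; exact: (@lin0 _ _ R[i]^o _ (beta_lin p q Ss)). Qed.

Lemma barr_lin s c x y : S s ->
  barr s (c *: x + y) = fun k l p q => c * barr s x k l p q + barr s y k l p q.
Proof. by move=> Ss; apply: arrP => k l p q; rewrite /barr mooD mooZ beta_lin. Qed.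

Lemma barr_sand s N m (a b : 'I_m -> Moo R[i]) (x : 'I_m -> Moo Y) : S s ->
  (forall k, Mn N (x k)) ->
  barr s (\sum_(k < m) msand (a k) (x k) (b k)) =
  fun i j p q => \sum_(k < m) \sum_(l < N) \sum_(l' < N)
          ((a k l i)^* * b k l' j) * barr s (x k) l l' p q.
Proof.
move=> Ss xN; apply: arrP => i j p q; rewrite /barr moo_sum.
have bl := @lin_sum _ _ R[i]^o _ (beta_lin p q Ss).
have bz := @linZ _ _ R[i]^o _ (beta_lin p q Ss).
rewrite bl; apply: eq_bigr => k _; rewrite (@msandE _ _ N N); last exact: xN.
by rewrite bl; apply: eq_bigr => l _; rewrite bl; apply: eq_bigr => l' _; rewrite bz.
Qed.

Hypothesis beta_bd : forall x, exists K, forall s, S s -> ale (barr s x) K.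

Lemma supN_le x K : 0 <= K -> (forall s, S s -> ale (barr s x) K) -> supN x <= K.
Proof. by move=> K0 xK; apply: sup_le => // _ [s Ss <-]; apply: anorm_le; exact: xK. Qed.

Lemma supN_ale x s : S s -> ale (barr s x) (supN x).
Proof.
move=> Ss; have [K xK] := beta_bd x.
apply: aleW (ale_anorm (xK _ Ss)); apply: (@le_sup _ _ K); last by exists s.
by move=> _ [t St <-]; apply: anorm_le; exact: xK.
Qed.

Lemma supN_ge0 x : 0 <= supN x.
Proof. by apply: sup_ge0 => _ [s _ <-]; exact: anorm_ge0. Qed.

Hypothesis beta_sep : forall x : Y, (forall s p q, S s -> beta s p q x = 0) -> x = 0.

Lemma ale_entry (y : arr) K k l p q : ale y K -> nc (y k l p q) <= K.
Proof.
move=> yK.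
pose dl (a b : nat) : nat -> nat -> R[i] := fun i j => ((i == a) && (j == b))%:R.
pose m := (maxn k l).+1; pose n := (maxn p q).+1.
have km : (k < m)%N by rewrite ltnS leq_maxl.
have lm : (l < m)%N by rewrite ltnS leq_maxr.
have pn : (p < n)%N by rewrite ltnS leq_maxl.
have qn : (q < n)%N by rewrite ltnS leq_maxr.
have n2dl a b : (a < m)%N -> (b < n)%N -> n2 m n (dl a b) <= 1.
  move=> am bn; rewrite /n2 (bigD1 (Ordinal am)) //= (bigD1 (Ordinal bn)) //= /dl !eqxx nc1 expr1n.
  rewrite !big1 ?addr0 // => i; rewrite -val_eqE /= => /negbTE ia.
    by apply: big1 => j _; rewrite ia nc0 expr0n.
  by rewrite ia nc0 expr0n.
have := yK m n (dl l q) (dl k p) (n2dl _ _ lm qn) (n2dl _ _ km pn).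
suff -> : afm y m n (dl l q) (dl k p) = y k l p q by [].
rewrite /afm (bigD1 (Ordinal km)) //= [X in _ + X]big1 ?addr0 => [|i]; last first.
  rewrite -val_eqE /= => /negbTE ik; do 3! (apply: big1 => ? _).
  by rewrite /dl ik conjC0 !mul0r.
rewrite (bigD1 (Ordinal lm)) //= [X in _ + X]big1 ?addr0 => [|i]; last first.
  rewrite -val_eqE /= => /negbTE ik; do 2! (apply: big1 => ? _).
  by rewrite /dl ik mulr0.
rewrite (bigD1 (Ordinal pn)) //= [X in _ + X]big1 ?addr0 => [|i]; last first.
  rewrite -val_eqE /= => /negbTE ik; do 1! (apply: big1 => ? _).
  by rewrite /dl ik andbF conjC0 !mul0r.
rewrite (bigD1 (Ordinal qn)) //= [X in _ + X]big1 ?addr0 => [|i]; last first.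
  by rewrite -val_eqE /= => /negbTE ik; rewrite /dl ik andbF mulr0.
by rewrite /dl !eqxx conjC1 mul1r mulr1.
Qed.

Lemma supN_matrix_norm : matrix_norm supN.
Proof.
have Z c x : supN (c *: x) <= nc c * supN x.
  apply: supN_le => [|s Ss]; first by rewrite mulr_ge0 ?nc_ge0 ?supN_ge0.
  have := barr_lin c x 0 Ss; rewrite addr0 => ->.
  have b0 : ale (barr s 0) 0.
    move=> m n xi eta _ _; rewrite /afm big1 ?nc0 // => k _; do 3! (apply: big1 => ? _).
    by rewrite /barr moo0 beta0 // mulr0 mul0r.
  by rewrite -[X in ale _ X]addr0; apply: ale_lin b0; exact: supN_ale.
split.
- move=> x x0; apply: mooP => i j; apply: beta_sep => s p q Ss.
  have := ale_entry i j p q (supN_ale x Ss); rewrite x0 => h.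
  by apply: Normc.eq0_normc; apply/le_anti; rewrite h nc_ge0.
- move=> x y; apply: supN_le => [|s Ss]; first by rewrite addr_ge0 ?supN_ge0.
  have := barr_lin 1 x y Ss; rewrite scale1r => ->.
  rewrite -[supN x]mul1r -[X in X * _](@nc1 R).
  by apply: ale_lin; exact: supN_ale.
- move=> c x; apply/eqP; rewrite eq_le Z /=.
  have [->|c0] := eqVneq c 0; first by rewrite nc0 mul0r supN_ge0.
  have := Z c^-1 (c *: x); rewrite scalerA mulVf // scale1r Normc.normcV.
  rewrite ler_pdivlMl // lt0r nc_ge0 andbT.
  by apply: contraNneq c0 => /Normc.eq0_normc ->.
- move=> m a b x.
  have max0 : 0 <= \big[Num.max/0]_(k < m) supN (x k).
    by elim/big_ind: _ => // [u v u0 v0|k _]; rewrite ?supN_ge0 // le_max u0.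
  apply: supN_le => [|s Ss]; first by rewrite !mulr_ge0 ?sqrtr_ge0.
  have [N xN] := common_Mn x; rewrite (barr_sand a b Ss xN).
  apply: (@ale_sand R m N (fun k => a k) (fun k => b k) (fun k => barr s (x k)) _ _ _ max0 (rowbd_cnorm a N) (rowbd_cnorm b N)).
  move=> k; apply: aleW (supN_ale (x k) Ss).
  exact: (le_bigmax_cond _ (fun k => supN (x k))).
Qed.

End SupNorms.

(** * Matrices of functionals and the dual matrix norm *)

Section Functionals.
Context {R : realType} (V : lmodType R[i]) (p : V -> R).
Implicit Types (f g : bdfun p).

Lemma bdP f : scalar f /\ exists K, forall x, nc (f x) <= K * p x.
Proof. by case: f => f fP; exact/asboolP. Qed.

Lemma bd_lin f : scalar f. Proof. by case: (bdP f). Qed.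

Lemma bd0 f : f 0 = 0. Proof. exact: (@lin0 _ _ R[i]^o _ (bd_lin f)). Qed.

Lemma bdD f x y : f (x + y) = f x + f y.
Proof. exact: (@linD _ _ R[i]^o _ (bd_lin f)). Qed.

Lemma bdZ f (c : R[i]) x : f (c *: x) = c * f x.
Proof. exact: (@linZ _ _ R[i]^o _ (bd_lin f)). Qed.

Lemma bdB f x y : f (x - y) = f x - f y.
Proof. exact: (@linB _ _ R[i]^o _ (bd_lin f)). Qed.

Lemma bd_sum f (I : Type) (r : seq I) (P : pred I) (F : I -> V) :
  f (\sum_(k <- r | P k) F k) = \sum_(k <- r | P k) f (F k).
Proof. exact: (@lin_sum _ _ R[i]^o _ (bd_lin f)). Qed.

Lemma bd_ext f g : (forall x, f x = g x) -> f = g.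
Proof. by move=> fg; apply/val_inj/funext. Qed.

Lemma bd_ex (g : V -> R[i]) : scalar g -> (exists K, forall x, nc (g x) <= K * p x) ->
  exists f : bdfun p, forall x, f x = g x.
Proof.
by move=> gl gb; have gP : g \in bounded_functional p by [apply/asboolP]; exists (BdFun gP).
Qed.

Lemma bd_insub (g : V -> R[i]) : scalar g -> (exists K, forall x, nc (g x) <= K * p x) ->
  forall x, insubd (0 : bdfun p) g x = g x.
Proof.
move=> gl gb x; have gP : g \in bounded_functional p by apply/asboolP.
by rewrite /insubd insubT.
Qed.

Lemma bd_funD f g x : (f + g) x = f x + g x. Proof. by []. Qed.
Lemma bd_funN f x : (- f) x = - f x. Proof. by []. Qed.
Lemma bd_funZ (c : R[i]) f x : (c *: f) x = c * f x. Proof. by []. Qed.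
Lemma bd_fun0 x : (0 : bdfun p) x = 0. Proof. by []. Qed.

Lemma bd_fun_sum (I : Type) (r : seq I) (P : pred I) (F : I -> bdfun p) x :
  (\sum_(k <- r | P k) F k) x = \sum_(k <- r | P k) F k x.
Proof. by apply: (big_morph (fun f : bdfun p => f x) (fun f g => bd_funD f g x)). Qed.

(** The matrix theta_f^(oo)(x) as an array. The outer indices belong to x and the inner ones to f,
    so the flip of the tensor factors interchanges the two. *)
Definition parr (f : Moo (bdfun p)) (x : Moo V) : nat -> nat -> nat -> nat -> R[i] :=
  fun k l a b => f a b (x k l).

Lemma thetaE (f : Moo (bdfun p)) x i j : theta f x i j = f i j x.
Proof.
have [n fn] := moo_finsupp f; apply: (@minfE _ _ _ n) => k l /fn ->.
exact: bd_fun0.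
Qed.

Lemma theta_linear (f : Moo (bdfun p)) : linear (theta f : V -> Moo R[i]).
Proof.
by move=> c x y; apply: mooP => i j; rewrite mooD mooZ !thetaE bdD bdZ.
Qed.

Lemma moarr_theta (f : Moo (bdfun p)) (x : Moo V) : moarr (mmap (theta f) x) = parr f x.
Proof.
apply: arrP => k l a b; rewrite /moarr mmapE ?thetaE //.
exact: (lin0 (theta_linear f)).
Qed.

Lemma mnorm_theta (f : Moo (bdfun p)) (x : Moo V) :
  mnorm Moo_smos (mmap (theta f) x) = anorm (parr f x).
Proof. by rewrite moo_normE moarr_theta. Qed.

Lemma mcone_theta (f : Moo (bdfun p)) (x : Moo V) :
  mcone Moo_smos (mmap (theta f) x) <-> apos (parr f x).
Proof. by rewrite moo_coneE moarr_theta. Qed.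

Lemma parr_linx (f : Moo (bdfun p)) (c : R[i]) x y :
  parr f (c *: x + y) = fun k l a b => c * parr f x k l a b + parr f y k l a b.
Proof. by apply: arrP => k l a b; rewrite /parr mooD mooZ bdD bdZ. Qed.

Lemma parr_linf (c : R[i]) (f g : Moo (bdfun p)) x :
  parr (c *: f + g) x = fun k l a b => c * parr f x k l a b + parr g x k l a b.
Proof. by apply: arrP => k l a b; rewrite /parr mooD mooZ bd_funD bd_funZ. Qed.

Lemma afm_parr (f : Moo (bdfun p)) x m n xi eta :
  afm (parr f x) m n xi eta = \sum_(a < n) \sum_(b < n)
    f a b (\sum_(k < m) \sum_(l < m) ((eta k a)^* * xi l b) *: x k l).
Proof.
rewrite /afm (exchange4 (fun k l a b => (eta k a)^* * parr f x k l a b * xi l b)).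
apply: eq_bigr => a _; apply: eq_bigr => b _; rewrite bd_sum; apply: eq_bigr => k _.
rewrite bd_sum; apply: eq_bigr => l _; rewrite bdZ /parr; ring.
Qed.

End Functionals.

Section DualNorms.
Context {R : realType} (X : smosData R).
Hypothesis HN : matrix_norm (mnorm X).
Local Notation X' := (bdfun (@norm1 R X)).
Local Notation N := (mnorm X).

Let NZ (c : R[i]) x : N (c *: x) = nc c * N x.
Proof. by case: HN => _ _ h _; exact: h. Qed.

Lemma norm1_ge0 (x : X) : 0 <= norm1 x.
Proof. exact: matrix_norm_ge0. Qed.

Lemma mx1D (V : lmodType R[i]) (x y : V) : mx1 (x + y) = mx1 x + mx1 y.
Proof. by apply: mooP => i j; rewrite mooD !mx1E; case: ifP; rewrite ?addr0. Qed.

Lemma mx1Z (V : lmodType R[i]) (c : R[i]) (x : V) : mx1 (c *: x) = c *: mx1 x.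
Proof. by apply: mooP => i j; rewrite mooZ !mx1E; case: ifP; rewrite ?scaler0. Qed.

Lemma Mn_mx1 (V : lmodType R[i]) (x : V) : Mn 1 (mx1 x).
Proof. by move=> i j ij; rewrite mx1E; case: i ij => [|i]; case: j. Qed.

Lemma norm1D (x y : X) : norm1 (x + y) <= norm1 x + norm1 y.
Proof. by rewrite /norm1 mx1D; case: HN => _ h _ _; exact: h. Qed.

Lemma norm1Z (c : R[i]) (x : X) : norm1 (c *: x) = nc c * norm1 x.
Proof. by rewrite /norm1 mx1Z NZ. Qed.

Lemma norm1_eq0 (x : X) : norm1 x = 0 -> x = 0.
Proof.
case: HN => h _ _ _ /h x0; have := mx1E x 0 0; rewrite x0 /= => <-.
by [].
Qed.

Lemma bd_bound (f : X') : exists2 K, 0 <= K & forall x : X, nc (f x) <= K * norm1 x.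
Proof.
have [_ [K fK]] := bdP f; exists (Num.max 0 K); first by rewrite le_max lexx.
move=> x; apply: le_trans (fK x) _; apply: ler_wpM2r; first exact: norm1_ge0.
by rewrite le_max lexx orbT.
Qed.

(** A finite matrix of bounded functionals is completely bounded: [afm_parr] writes its form as a
    sum over the entries of f, each applied to a compression of x that [norm_comb] controls. This
    makes all the dual norms below finite suprema. *)
Lemma parr_bounded (f : Moo X') : exists2 K, 0 <= K & forall x, ale (parr f x) (K * N x).
Proof.
have [n fn] := moo_finsupp f.
pose c a b := if (a < n)%N && (b < n)%N then s2val (cid2 (bd_bound (f a b))) else 0.
have c0 a b : 0 <= c a b by rewrite /c; case: ifP => // _; exact: (s2valP (cid2 (bd_bound (f a b)))).
have fc a b x : nc (f a b x) <= c a b * norm1 x.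
  rewrite /c; case: ifP => [_|/negbT]; first exact: (s2valP' (cid2 (bd_bound (f a b)))).
  by rewrite negb_and -!leqNgt => /fn ->; rewrite bd_fun0 nc0 mul0r.
exists (\sum_(a < n) \sum_(b < n) c a b).
  by apply: sumr_ge0 => a _; apply: sumr_ge0.
move=> x m n' xi eta x1 e1; rewrite afm_parr.
apply: (@le_trans _ _ (\sum_(a < n') \sum_(b < n') c a b * N x)).
  apply: (le_trans (nc_sum _ _ _)); apply: ler_sum => a _.
  apply: (le_trans (nc_sum _ _ _)); apply: ler_sum => b _.
  apply: (le_trans (fc _ _ _)); rewrite ler_wpM2l //.
  apply: (le_trans (norm_comb HN m x (fun k => eta k a) (fun k => xi k b))).
  have s1 (v : nat -> nat -> R[i]) (q : 'I_n') : n2 m n' v <= 1 -> Num.sqrt (\sum_(k < m) nc (v k q) ^+ 2) <= 1.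
    move=> v1; rewrite -sqrtr1 ler_wsqrtr //; apply: le_trans v1.
    rewrite /n2; apply: ler_sum => k _; rewrite (bigD1 q) //= lerDl.
    by apply: sumr_ge0 => i _; exact: sqr_ge0.
  rewrite -[X in _ <= X]mul1r ler_wpM2r ?(matrix_norm_ge0 HN) //.
  by rewrite -[X in _ <= X]mul1r ler_pM ?sqrtr_ge0 // ?(s1 eta) ?(s1 xi).
have cN a b : 0 <= c a b * N x by rewrite mulr_ge0 // (matrix_norm_ge0 HN).
rewrite mulr_suml.
apply: (@le_trans _ _ (\sum_(a < n') \sum_(b < n) c a b * N x)).
  apply: ler_sum => a _; apply: (@le_sum_ord _ n' n (fun b => c a b * N x)) => // b nb.
  by rewrite /c [(b < n)%N]ltnNge nb andbF mul0r.
under [leRHS]eq_bigr do rewrite mulr_suml.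
apply: (@le_sum_ord _ n' n (fun a => \sum_(b < n) c a b * N x)) => [a|a na].
  by apply: sumr_ge0.
by rewrite big1 // => b _; rewrite /c ltnNge na mul0r.
Qed.

Section Equivalent.
Variable lam : Moo X -> R.
Hypotheses (Hlam : matrix_norm lam) (lam_ge : forall x, N x <= lam x).

Let lamZ (c : R[i]) x : lam (c *: x) = nc c * lam x.
Proof. by case: Hlam => _ _ h _; exact: h. Qed.

Let S : set (Moo X) := [set x | lam x <= 1].
Let beta (x : Moo X) a b (f : X') := f (x a b).

Let beta_lin (s : Moo X) (a b : nat) : S s -> forall c (x y : X'),
  beta s a b (c *: x + y) = c * beta s a b x + beta s a b y.
Proof. by move=> _ c f g; rewrite /beta bd_funD bd_funZ. Qed.

Let barrE x f : barr beta x f = fun k l a b => parr f x a b k l.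
Proof. by []. Qed.

(** The elements of the unit ball of lam serve as test matrices on the dual. The flip is needed
    because in [parr] the indices of x come first, whereas in [barr] those of the argument f do. *)
Lemma dual_norm_supN : dual_norm lam = supN S beta :> (Moo X' -> R).
Proof.
apply/funext => f; congr (sup _); apply/seteqP; split=> r [x Sx <-]; exists x => //.
  by rewrite mnorm_theta barrE -anorm_flip.
by rewrite mnorm_theta barrE -anorm_flip.
Qed.

Let beta_bd (f : Moo X') : exists K, forall s, S s -> ale (barr beta s f) K.
Proof.
have [K K0 fK] := parr_bounded f; exists K => s Ss; rewrite barrE.
apply: (@ale_flip _ (parr f s)); apply: aleW (fK s).
by rewrite ler_piMr // (le_trans (lam_ge _)).
Qed.

Lemma dual_norm_matrix : matrix_norm (dual_norm lam : Moo X' -> R).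
Proof.
rewrite dual_norm_supN; apply: supN_matrix_norm => // f fz; apply: bd_ext => x.
have l0 : 0 < lam (mx1 x) + 1 by rewrite ltr_wpDl ?(matrix_norm_ge0 Hlam).
(* A positive multiple of x in the unit ball of lam; adding 1 in the denominator covers the case
   where x has norm 0. *)
have Ss : S (mx1 (((lam (mx1 x) + 1)^-1)%:C%C *: x)).
  rewrite /S /= mx1Z lamZ nc_real ger0_norm ?invr_ge0 ?(ltW l0) //.
  by rewrite ler_pdivrMl // mulr1 lerDl.
have /eqP := fz _ 0%N 0%N Ss; rewrite /beta mx1E /= bdZ mulf_eq0 => /orP[|/eqP -> //].
by rewrite eq_complex /= invr_eq0 gt_eqF.
Qed.

Lemma dual_norm_le (f : Moo X') K : 0 <= K ->
  (forall x, lam x <= 1 -> ale (parr f x) K) -> dual_norm lam f <= K.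
Proof.
move=> K0 fK; rewrite dual_norm_supN; apply: supN_le => // x Sx.
by rewrite barrE; apply: (@ale_flip _ (parr f x)); exact: fK.
Qed.

Lemma dual_norm_ale1 (f : Moo X') x : lam x <= 1 -> ale (parr f x) (dual_norm lam f).
Proof.
move=> x1; rewrite dual_norm_supN; have := supN_ale beta_bd f x1.
by move=> /ale_flip.
Qed.

Lemma dual_norm_ge0 (f : Moo X') : 0 <= dual_norm lam f.
Proof. exact: (matrix_norm_ge0 dual_norm_matrix). Qed.

Lemma ale_scale (y : nat -> nat -> nat -> nat -> R[i]) (c : R[i]) K : ale y K ->
  ale (fun k l a b => c * y k l a b) (nc c * K).
Proof.
move=> yK m n xi eta x1 e1; have := afm_lin c y (fun _ _ _ _ => 0) m n xi eta.
rewrite (@eq_afm _ _ (fun k l a b => c * y k l a b)); last by move=> *; rewrite addr0.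
move=> ->; rewrite (_ : afm (fun _ _ _ _ => 0) m n xi eta = 0) ?addr0; last first.
  by apply: big1 => k _; do 3! (apply: big1 => ? _); rewrite mulr0 mul0r.
by rewrite ncM ler_wpM2l ?nc_ge0 ?yK.
Qed.

Lemma dual_norm_ale (f : Moo X') x : ale (parr f x) (dual_norm lam f * lam x).
Proof.
have [x0|x0] := eqVneq (lam x) 0.
  have -> : x = 0 by case: Hlam => h _ _ _; exact: h.
  move=> m n xi eta _ _; rewrite /afm big1 ?nc0 ?mulr_ge0 ?dual_norm_ge0 ?(matrix_norm_ge0 Hlam) //.
  by move=> k _; do 3! (apply: big1 => ? _); rewrite /parr moo0 bd0 mulr0 mul0r.
have l0 : 0 < lam x by rewrite lt0r x0 (matrix_norm_ge0 Hlam).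
have h : lam (((lam x)^-1)%:C%C *: x) <= 1.
  by rewrite lamZ nc_real ger0_norm ?invr_ge0 ?(ltW l0) // mulVf.
have := ale_scale (lam x)%:C%C (dual_norm_ale1 f h).
rewrite nc_real ger0_norm ?(ltW l0) // mulrC.
suff -> : (fun k l a b => (lam x)%:C%C * parr f (((lam x)^-1)%:C%C *: x) k l a b) = parr f x by [].
apply: arrP => k l a b; rewrite /parr mooZ bdZ mulrA -rcM mulfV //.
by rewrite (_ : (1%:C%C : R[i]) = 1) ?mul1r.
Qed.

End Equivalent.

End DualNorms.

(** * Separation *)

Section HahnBanach.
Context {R : realType} {V : lmodType R[i]}.
Implicit Types (p q : V -> R).

Definition sublinear p := (forall x y, p (x + y) <= p x + p y) /\
  (forall (t : R) x, 0 < t -> p (t%:C%C *: x) <= t * p x).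

Lemma rc1 : (1%:C%C : R[i]) = 1. Proof. by []. Qed.
Lemma rc0 : (0%:C%C : R[i]) = 0. Proof. by []. Qed.

Lemma sublinear0 p : sublinear p -> p 0 = 0.
Proof.
move=> [_ pZ]; have := pZ 2 0 (ltr0Sn _ _); have := pZ (2^-1) 0.
rewrite !scaler0 invr_gt0 => /(_ (ltr0Sn _ _)); lra.
Qed.

Lemma sublinearZ p (t : R) x : sublinear p -> 0 <= t -> p (t%:C%C *: x) = t * p x.
Proof.
move=> sp; rewrite le_eqVlt => /predU1P[<-|t0].
  by rewrite rc0 scale0r mul0r sublinear0.
apply/eqP; rewrite eq_le (proj2 sp) //=.
have ti : 0 < t^-1 by rewrite invr_gt0.
have := proj2 sp _ (t%:C%C *: x) ti.
by rewrite scalerA -rcM mulVf ?gt_eqF // rc1 scale1r ler_pdivlMl.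
Qed.

Lemma sublinear_opp p x : sublinear p -> - p (- x) <= p x.
Proof.
move=> sp; have := proj1 sp x (- x); rewrite subrr (sublinear0 sp); lra.
Qed.

(** A sublinear minorant of p whose value at [- x0] is at most [- p x0]. A minimal sublinear
    functional coincides with all its tilts, and this forces additivity. *)
Definition tilt p x0 x : R := inf [set p (x + t%:C%C *: x0) - t * p x0 | t in [set t : R | 0 <= t]].

Lemma tilt_lb p x0 x t : sublinear p -> 0 <= t -> - p (- x) <= p (x + t%:C%C *: x0) - t * p x0.
Proof.
move=> sp t0; rewrite -(sublinearZ x0 sp t0).
have := proj1 sp (x + t%:C%C *: x0) (- x); rewrite addrAC subrr add0r; lra.
Qed.

Lemma tilt_le p x0 x t : sublinear p -> 0 <= t -> tilt p x0 x <= p (x + t%:C%C *: x0) - t * p x0.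
Proof.
move=> sp t0; apply: ge_inf; last by exists t.
by exists (- p (- x)) => _ [s s0 <-]; exact: tilt_lb.
Qed.

Lemma tilt_le0 p x0 x : sublinear p -> tilt p x0 x <= p x.
Proof. by move=> sp; have := tilt_le x0 x sp (lexx 0); rewrite rc0 scale0r addr0 mul0r subr0. Qed.

Lemma tilt_ge p x0 x K : (forall t, 0 <= t -> K <= p (x + t%:C%C *: x0) - t * p x0) ->
  K <= tilt p x0 x.
Proof.
move=> h; apply: lb_le_inf; first by exists (p (x + 0%:C%C *: x0) - 0 * p x0); exists 0 => //=; exact: lexx.
by move=> _ [t t0 <-]; exact: h.
Qed.

Lemma sublinear_tilt p x0 : sublinear p -> sublinear (tilt p x0).
Proof.
move=> sp; split=> [x y|t x t0].
  rewrite -lerBlDr; apply: tilt_ge => s s0; rewrite lerBlDr [leRHS]addrC -lerBlDr.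
  apply: tilt_ge => t t0; rewrite lerBlDr.
  apply: le_trans (tilt_le x0 (x + y) sp (addr_ge0 s0 t0)) _.
  rewrite rcD scalerDl addrACA.
  have := proj1 sp (x + s%:C%C *: x0) (y + t%:C%C *: x0); lra.
rewrite mulrC -ler_pdivrMr //; apply: tilt_ge => s s0.
rewrite ler_pdivrMr //.
apply: le_trans (tilt_le x0 _ sp (mulr_ge0 (ltW t0) s0)) _.
rewrite rcM -scalerA -scalerDr (sublinearZ _ sp (ltW t0)); lra.
Qed.

(** Hahn-Banach through minimal sublinear functionals instead of extensions from subspaces: Zorn's
    lemma is applied to the sublinear functionals below [tilt p x0]. *)
Theorem sublinear_majorized p x0 : sublinear p -> exists F : V -> R,
  [/\ forall x y, F (x + y) = F x + F y, forall (t : R) x, F (t%:C%C *: x) = t * F x,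
      forall x, F x <= p x & F x0 = p x0].
Proof.
move=> sp; pose p' := tilt p x0; have sp' : sublinear p' := sublinear_tilt x0 sp.
pose T := {q : V -> R | sublinear q /\ forall x, q x <= p' x}.
pose Q (q q' : T) := `[< forall x, sval q' x <= sval q x >].
have [||||m mmax] := @Zorn T Q.
- by move=> q; apply/asboolP.
- move=> q1 q2 q3 /asboolP h1 /asboolP h2; apply/asboolP => x.
  exact: le_trans (h2 x) (h1 x).
- move=> [q1 h1] [q2 h2] /asboolP /= l1 /asboolP /= l2; apply: eq_exist.
  by apply/funext => x; apply/le_anti; rewrite l1 l2.
- move=> A Atot; have [[q0 Aq0]|A0] := pselect (exists q : T, A q); last first.
    have t0 : sublinear p' /\ forall x, p' x <= p' x by split.
    exists (exist _ p' t0) => q Aq; apply/asboolP => x; exfalso.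
    by apply: A0; exists q.
  (* The pointwise infimum of a chain is subadditive because of any two members one lies below the
     other. *)
  pose i x := inf [set sval q x | q in A].
  have lb x : has_lbound [set sval q x | q in A].
    exists (- p' (- x)) => _ [q Aq <-]; have [sq qp] := proj2_sig q.
    apply: le_trans (sublinear_opp x sq); rewrite lerN2; exact: qp.
  have ile (q : T) x : A q -> i x <= sval q x by move=> Aq; apply: ge_inf => //; exists q.
  have ige K x : (forall q : T, A q -> K <= sval q x) -> K <= i x.
    move=> h; apply: lb_le_inf; first by exists (sval q0 x); exists q0.
    by move=> _ [q Aq <-]; exact: h.
  have si : sublinear i /\ forall x, i x <= p' x.
    split; last first.
      by move=> x; apply: le_trans (ile _ _ Aq0) _; exact: (proj2 (proj2_sig q0)).
    split=> [x y|t x t0].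
      rewrite -lerBlDr; apply: (ige) => q1 A1; rewrite lerBlDr [leRHS]addrC -lerBlDr.
      apply: (ige) => q2 A2; rewrite lerBlDr.
      have [/asboolP h|/asboolP h] := Atot _ _ A1 A2.
        apply: le_trans (ile _ _ A2) _; have := (proj1 (proj1 (proj2_sig q2))) x y.
        have := h x; lra.
      apply: le_trans (ile _ _ A1) _; have := (proj1 (proj1 (proj2_sig q1))) x y.
      have := h y; lra.
    rewrite mulrC -ler_pdivrMr //; apply: (ige) => q Aq; rewrite ler_pdivrMr // mulrC.
    by apply: le_trans (ile _ _ Aq) _; exact: (proj2 (proj1 (proj2_sig q))).
  by exists (exist _ i si) => q Aq; apply/asboolP => x; exact: ile.
case: m mmax => m [sm mp] mmax.
have madd x y : m (x + y) = m x + m y.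
  apply/eqP; rewrite eq_le (proj1 sm) /=.
  have st : sublinear (tilt m y) /\ forall x, tilt m y x <= p' x.
    split; first exact: sublinear_tilt.
    by move=> z; apply: le_trans (mp z); exact: tilt_le0.
  have Qt : Q (exist _ m (conj sm mp)) (exist _ (tilt m y) st).
    by apply/asboolP => z /=; exact: tilt_le0.
  have tm : tilt m y = m := congr1 sval (mmax _ Qt).
  (* By minimality m is its own tilt at y, so m x <= m (x + y) - m y: the missing
     superadditivity. *)
  by have := tilt_le y x sm ler01; rewrite tm rc1 scale1r mul1r lerBrDr.
have m0 := sublinear0 sm.
have mN x : m (- x) = - m x by apply/eqP; rewrite -addr_eq0 -madd addNr m0.
exists m; split=> //.
- move=> t x; have [t0|t0] := leP 0 t; first exact: sublinearZ.
  have := @sublinearZ m (- t) x sm; rewrite oppr_ge0 => /(_ (ltW t0)).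
  by rewrite (_ : (- t)%:C%C = - t%:C%C :> R[i]) ?scaleNr ?mN ?mulNr => [/oppr_inj|] //; apply/eqP; rewrite eq_complex /= oppr0 !eqxx.
- by move=> x; apply: le_trans (mp x) _; exact: tilt_le0.
apply/eqP; rewrite eq_le; apply/andP; split.
  by apply: le_trans (mp x0) _; exact: tilt_le0.
(* Starting from the tilt at x0 pays off here: m (- x0) <= p 0 - p x0. *)
have := le_trans (mp (- x0)) (tilt_le x0 (- x0) sp ler01).
by rewrite rc1 scale1r addNr mul1r (sublinear0 sp) sub0r mN lerN2.
Qed.

End HahnBanach.

Section GramSchmidt.
Context {R : realType} (V : lmodType R[i]) (b : V -> V -> R[i]).
Hypothesis bl : forall c u v w, b (c *: u + v) w = c * b u w + b v w.
Hypothesis bh : forall u v, b v u = (b u v)^*.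
Hypothesis bp : forall u, u != 0 -> 0 < b u u.

Let bsl w := @lin_sum _ _ R[i]^o _ (fun c u v => bl c u v w).
Let bzl w := @linZ _ _ R[i]^o _ (fun c u v => bl c u v w).
Let bBl w := @linB _ _ R[i]^o _ (fun c u v => bl c u v w).
Let b0l w := @lin0 _ _ R[i]^o _ (fun c u v => bl c u v w).

(** Dependent vectors are skipped, so r can be smaller than m; S holds the coordinates of z. The
    form b is abstract because it is the inner product of a Hilbert space in one application and a
    perturbed state on scalar matrices in the other. *)
Lemma gram_schmidt (z : nat -> V) m : exists r (x : nat -> V) (S : nat -> nat -> R[i]),
  (forall i j, (i < r)%N -> (j < r)%N -> b (x i) (x j) = (i == j)%:R) /\
  forall k, (k < m)%N -> z k = \sum_(j < r) S k j *: x j.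
Proof.
elim: m => [|m [r [x [S [xo zS]]]]]; first by exists 0%N, (fun=> 0), (fun _ _ => 0).
pose u := z m - \sum_(j < r) b (z m) (x j) *: x j.
have ux i : (i < r)%N -> b u (x i) = 0.
  move=> ir; rewrite /u bBl bsl (bigD1 (Ordinal ir)) //= bzl xo // eqxx.
  rewrite /GRing.scale /= mulr1 big1 ?addr0 ?subrr // => j.
  by rewrite -val_eqE /= => /negbTE ji; rewrite bzl xo // ji /GRing.scale /= mulr0.
have [u0|u0] := eqVneq u 0.
  exists r, x, (fun k j => if k == m then b (z m) (x j) else S k j); split=> // k.
  rewrite ltnS leq_eqVlt => /predU1P[->|km].
    rewrite eqxx; apply/eqP; rewrite -subr_eq0 -/u u0 //.
  by rewrite ltn_eqF //; exact: zS.
have ub := bp u0; set t := Num.sqrt (complex.Re (b u u)).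
have buE : b u u = (complex.Re (b u u))%:C%C.
  move: ub; rewrite ltcE; case: (b u u) => p q /= /andP[/eqP -> _].
  by [].
have rb : 0 < complex.Re (b u u) by move: ub; rewrite ltcE => /andP[_].
have t0 : 0 < t by rewrite sqrtr_gt0.
have tt : t * t = complex.Re (b u u) by rewrite -expr2 sqr_sqrtr ?ltW.
pose y := (t^-1)%:C%C *: u.
pose x' j := if j == r then y else x j.
exists r.+1, x', (fun k j => if j == r then (if k == m then t%:C%C else 0)
   else if k == m then b (z m) (x j) else S k j).
have yx i : (i < r)%N -> b y (x i) = 0.
  by move=> ir; rewrite /y bzl ux // /GRing.scale /= mulr0.
have yy : b y y = 1.
  rewrite /y bzl bh bzl {1}/GRing.scale /= conjM conjC_real.
  rewrite buE conjC_real -!rcM -tt mulKf ?gt_eqF // mulVf ?gt_eqF //.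
have spl i : (i < r.+1)%N -> i = r \/ (i < r)%N by rewrite ltnS leq_eqVlt => /predU1P.
split=> [i j|k].
  rewrite /x' => /spl[->|ir] /spl[->|jr].
  - by rewrite eqxx.
  - by rewrite eqxx ltn_eqF // yx // gtn_eqF.
  - by rewrite eqxx ltn_eqF // bh yx // conjC0.
  - by rewrite (ltn_eqF ir) (ltn_eqF jr) xo.
rewrite big_ord_recr /= /x' eqxx.
rewrite ltnS leq_eqVlt => /predU1P[->|km].
  rewrite eqxx /y scalerA -rcM mulfV ?gt_eqF // rc1 scale1r.
  rewrite [X in X + _](_ : _ = \sum_(j < r) b (z m) (x j) *: x j); first by rewrite addrC subrK.
  by apply: eq_bigr => j _; rewrite (ltn_eqF (ltn_ord j)).
rewrite (ltn_eqF km) scale0r addr0 zS //; apply: eq_bigr => j _.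
by rewrite (ltn_eqF (ltn_ord j)).
Qed.

End GramSchmidt.

Section ConeSeparation.
Context {R : realType} (V : lmodType R[i]) (n : V -> R) (G : set V).
Hypotheses (ns : sublinear n) (n0 : forall x, 0 <= n x) (nN : forall x, n (- x) = n x).
Hypotheses (G0 : G 0) (GD : forall x y, G x -> G y -> G (x + y)).
Hypothesis GZ : forall (t : R) x, 0 < t -> G x -> G (t%:C%C *: x).

(** The functional p x is the distance from x to -G. A linear F below p with F (- w) = p (- w) is
    nonnegative on G, since p vanishes on -G, and it satisfies F (- w) >= d. *)
Lemma cone_separation w d : 0 < d -> (forall g, G g -> d <= n (w - g)) ->
  exists F : V -> R, [/\ forall x y, F (x + y) = F x + F y,
    forall (t : R) x, F (t%:C%C *: x) = t * F x, forall x, `|F x| <= n x,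
    forall g, G g -> 0 <= F g & F w < 0].
Proof.
move=> d0 wd; pose p x := inf [set n (x + g) | g in G].
have ple x g : G g -> p x <= n (x + g).
  by move=> Gg; apply: ge_inf; [exists 0 => _ [h _ <-]|exists g].
have pge x K : (forall g, G g -> K <= n (x + g)) -> K <= p x.
  move=> h; apply: lb_le_inf; first by exists (n (x + 0)); exists 0.
  by move=> _ [g Gg <-]; exact: h.
have ps : sublinear p.
  split=> [x y|t x t0].
    rewrite -lerBlDr; apply: (pge) => g Gg; rewrite lerBlDr [leRHS]addrC -lerBlDr.
    apply: (pge) => h Gh; rewrite lerBlDr; apply: le_trans (ple _ _ (GD Gg Gh)) _.
    by rewrite addrACA addrC (proj1 ns) // addrC; have := proj1 ns (x + g) (y + h); lra.
  rewrite mulrC -ler_pdivrMr //; apply: (pge) => g Gg; rewrite ler_pdivrMr // mulrC.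
  apply: le_trans (ple _ _ (GZ t0 Gg)) _; rewrite -scalerDr; exact: (proj2 ns).
have [F [FD FZ Fp Fw]] := sublinear_majorized (- w) ps.
have F0 : F 0 = 0 by have := FZ 0 0; rewrite scaler0 mul0r.
have FN x : F (- x) = - F x by apply/eqP; rewrite -addr_eq0 -FD addNr F0.
have Fn x : F x <= n x by apply: le_trans (Fp x) _; have := ple x 0 G0; rewrite addr0.
exists F; split=> //.
- by move=> x; rewrite ler_norml Fn andbT -(nN x) lerNl -FN Fn.
- move=> g Gg; rewrite -oppr_le0 -FN; apply: le_trans (Fp _) _.
  have := ple (- g) g Gg; by rewrite addNr (sublinear0 ns).
- rewrite -oppr_gt0 -FN Fw; apply: lt_le_trans d0 _; apply: pge => g Gg.
  by rewrite -nN opprD opprK; exact: wd.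
Qed.

End ConeSeparation.

Section Hermitization.
Context {R : realType} (V : lmodType R[i]) (st : V -> V).
Hypothesis st_lin : forall (c : R[i]) x y, st (c *: x + y) = c^* *: st x + st y.
Hypothesis stK : involutive st.
Variable F : V -> R.
Hypotheses (FD : forall x y, F (x + y) = F x + F y).
Hypothesis FZ : forall (t : R) x, F (t%:C%C *: x) = t * F x.

(* The hermitian complex-linear functional agreeing with F on the elements fixed by st *)
Definition hermitize (x : V) : R[i] :=
  ((F x + F (st x)) / 2)%:C%C + 'i%C * ((F ('i%C *: st x) - F ('i%C *: x)) / 2)%:C%C.

Let st0 : st 0 = 0.
Proof.
have := st_lin 1 0 0; rewrite conjC1 !scale1r addr0 => /eqP.
by rewrite -[X in X == _]addr0 (inj_eq (addrI _)) eq_sym => /eqP.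
Qed.

Let stD x y : st (x + y) = st x + st y.
Proof. by have := st_lin 1 x y; rewrite conjC1 !scale1r. Qed.

Let stZ c x : st (c *: x) = c^* *: st x.
Proof. by have := st_lin c x 0; rewrite st0 !addr0. Qed.

Let FN x : F (- x) = - F x.
Proof.
have F0 : F 0 = 0 by have := FZ 0 0; rewrite scaler0 mul0r.
by apply/eqP; rewrite -addr_eq0 -FD addNr F0.
Qed.

Lemma hermitizeD x y : hermitize (x + y) = hermitize x + hermitize y.
Proof.
rewrite /hermitize !stD !scalerDr !FD.
by apply/eqP; rewrite eq_complex /=; apply/andP; split; apply/eqP; field.
Qed.

Lemma hermitizeZr (t : R) x : hermitize (t%:C%C *: x) = t%:C%C * hermitize x.
Proof.
rewrite /hermitize stZ conjC_real ![_ *: (t%:C%C *: _)]scalerA ![_ * t%:C%C]mulrC -!scalerA !FZ.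
by apply/eqP; rewrite eq_complex /=; apply/andP; split; apply/eqP; field.
Qed.

Lemma hermitizeZi x : hermitize ('i%C *: x) = 'i%C * hermitize x.
Proof.
rewrite /hermitize stZ conj_i scalerA [X in _ + _ * X]/= !scalerA mulrN mul_ii opprK.
rewrite scale1r scaleN1r scaleNr !FN.
by apply/eqP; rewrite eq_complex /=; apply/andP; split; apply/eqP; field.
Qed.

Lemma hermitize_lin : scalar hermitize.
Proof.
move=> c x y; rewrite hermitizeD; congr (_ + _).
have -> : c = (complex.Re c)%:C%C + (complex.Im c)%:C%C * 'i%C.
  by case: c => a b; apply/eqP; rewrite eq_complex /=; apply/andP; split; apply/eqP; ring.
rewrite scalerDl hermitizeD hermitizeZr -scalerA hermitizeZr hermitizeZi.
by rewrite /GRing.scale /=; ring.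
Qed.

Lemma hermitize_star x : hermitize (st x) = (hermitize x)^*.
Proof.
rewrite /hermitize stK.
by apply/eqP; rewrite eq_complex /=; apply/andP; split; apply/eqP; field.
Qed.

Lemma hermitize_fix x : st x = x -> hermitize x = (F x)%:C%C.
Proof.
move=> xx; rewrite /hermitize xx.
by apply/eqP; rewrite eq_complex /=; apply/andP; split; apply/eqP; field.
Qed.

Lemma hermitize_bound (n : V -> R) : (forall x, `|F x| <= n x) -> (forall x, n (st x) = n x) ->
  (forall x, n ('i%C *: x) = n x) -> forall x, nc (hermitize x) <= 2 * n x.
Proof.
move=> Fn ns ni x; apply: (le_trans (ncD _ _)).
have half : `|2^-1 : R| = 2^-1 by rewrite ger0_norm // invr_ge0 ler0n.
rewrite ncM !nc_real !normrM half.
rewrite nc_i.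
have h1 := ler_normD (F x) (F (st x)); have h2 := ler_normB (F ('i%C *: st x)) (F ('i%C *: x)).
have := Fn x; have := Fn (st x); have := Fn ('i%C *: st x); have := Fn ('i%C *: x).
rewrite !ni !ns; lra.
Qed.

End Hermitization.

Section Sandwich.
Context {R : realType}.

Lemma msand_lin (X : lmodType R[i]) (a b : Moo R[i]) (c : R[i]) (x y : Moo X) :
  msand a (c *: x + y) b = c *: msand a x b + msand a y b.
Proof.
have [n xn] := moo_finsupp x; have [m ym] := moo_finsupp y.
have xM := Mn_le (leq_addr m n) xn; have yM := Mn_le (leq_addl n m) ym.
apply: mooP => i j; rewrite mooD mooZ !(@msandE _ _ (n + m) (n + m)) //; last exact: MnD (MnZ c xM) yM.
rewrite scaler_sumr -big_split; apply: eq_bigr => k _ /=.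
rewrite scaler_sumr -big_split; apply: eq_bigr => l _ /=.
rewrite -[LHS]/(((a k i)^* * b l j) *: (c *: x k l + y k l)).
by rewrite scalerDr !scalerA [c * _]mulrC.
Qed.

Lemma msandZ (X : lmodType R[i]) (s t : R[i]) (a b : Moo R[i]) (x : Moo X) :
  msand (s *: a) x (t *: b) = (s^* * t) *: msand a x b.
Proof.
have [n xn] := moo_finsupp x.
apply: mooP => i j; rewrite mooZ !(@msandE _ _ n n) //.
rewrite scaler_sumr; apply: eq_bigr => k _; rewrite scaler_sumr; apply: eq_bigr => l _.
rewrite !mooZ scalerA; congr (_ *: _); rewrite /GRing.scale /= conjM; ring.
Qed.

Lemma madjmulZ (s t : R[i]) (a b : Moo R[i]) :
  madjmul (s *: a) (t *: b) = (s^* * t) *: madjmul a b.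
Proof.
have [n an] := moo_finsupp a.
have an' k l : (n <= k)%N -> a k l = 0 by move=> nk; rewrite an ?nk.
apply: mooP => i j; rewrite mooZ !(@madjmulE _ n) //; last first.
  by move=> k l nk; rewrite mooZ an' ?scaler0.
rewrite scaler_sumr; apply: eq_bigr => k _.
by rewrite !mooZ /GRing.scale /= conjM; ring.
Qed.

Section Star.
Variables (X : smosData R).
Hypothesis star_lin : forall (c : R[i]) (x y : X), star X (c *: x + y) = c^* *: star X x + star X y.
Hypothesis starK : involutive (star X).

Lemma star0 : star X 0 = 0.
Proof.
have := star_lin 1 0 0; rewrite conjC1 !scale1r addr0 => /eqP.
by rewrite -[X in X == _]addr0 (inj_eq (addrI _)) eq_sym => /eqP.
Qed.

Lemma starD x y : star X (x + y) = star X x + star X y.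
Proof. by have := star_lin 1 x y; rewrite conjC1 !scale1r. Qed.

Lemma starZ (c : R[i]) x : star X (c *: x) = c^* *: star X x.
Proof. by have := star_lin c x 0; rewrite star0 !addr0. Qed.

Lemma star_sum (I : Type) (r : seq I) (P : pred I) (F : I -> X) :
  star X (\sum_(k <- r | P k) F k) = \sum_(k <- r | P k) star X (F k).
Proof. by apply: (big_morph (star X)); [exact: starD|exact: star0]. Qed.

Lemma mstarEE (x : Moo X) i j : mstar x i j = star X (x j i).
Proof. by apply: mstarE; exact: star0. Qed.

Lemma mstar_lin (c : R[i]) (x y : Moo X) : mstar (c *: x + y) = c^* *: mstar x + mstar y.
Proof. by apply: mooP => i j; rewrite mooD mooZ !mstarEE mooD mooZ star_lin. Qed.

Lemma mstarK : involutive (@mstar _ X).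
Proof. by move=> x; apply: mooP => i j; rewrite !mstarEE starK. Qed.

Lemma mstar_Mn n (x : Moo X) : Mn n x -> Mn n (mstar x).
Proof. by move=> xn i j ij; rewrite mstarEE xn ?star0 // orbC. Qed.

Lemma mstar_msand a (x : Moo X) b : mstar (msand a x b) = msand b (mstar x) a.
Proof.
have [n xn] := moo_finsupp x; have sxn := mstar_Mn xn.
apply: mooP => i j; rewrite mstarEE !(@msandE _ _ n n) // star_sum exchange_big.
apply: eq_bigr => k _ /=; rewrite star_sum; apply: eq_bigr => l _.
by rewrite starZ mstarEE; congr (_ *: _); rewrite conjM conjCK mulrC.
Qed.

Lemma msa_msand a (x : Moo X) : msa x -> msa (msand a x a).
Proof. by rewrite /msa /= => xs; rewrite mstar_msand xs. Qed.

Lemma mstar_mx1 (x : X) : mstar (mx1 x) = mx1 (star X x).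
Proof.
by apply: mooP => i j; rewrite mstarEE !mx1E andbC; case: ifP => //; rewrite star0.
Qed.

End Star.
End Sandwich.

Section ScalarMatrices.
Context {R : realType}.

Lemma cf_lin (c : R[i]) (a b : Moo R[i]) m v w :
  cf (c *: a + b) m v w = c * cf a m v w + cf b m v w.
Proof.
rewrite /cf mulr_sumr -big_split; apply: eq_bigr => k _ /=.
rewrite mulr_sumr -big_split; apply: eq_bigr => l _ /=.
rewrite -[LHS]/((w k)^* * (c * a k l + b k l) * v l); ring.
Qed.

Lemma cnormD (a b : Moo R[i]) : cnorm (a + b) <= cnorm a + cnorm b.
Proof.
apply: cnorm_le => [|m v w v1 w1]; first by rewrite addr_ge0 ?cnorm_ge0.
have := cf_lin 1 a b m v w; rewrite scale1r mul1r => ->.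
have s1 (u : nat -> R[i]) : \sum_(i < m) nc (u i) ^+ 2 <= 1 -> Num.sqrt (\sum_(i < m) nc (u i) ^+ 2) <= 1.
  by move=> h; rewrite -sqrtr1 ler_wsqrtr.
have h (d : Moo R[i]) : nc (cf d m v w) <= cnorm d.
  apply: le_trans (cnorm_form _ _ _ _) _; rewrite ler_piMr ?cnorm_ge0 //.
  by rewrite -[X in _ <= X]mulr1 ler_pM ?sqrtr_ge0 ?(s1 v) ?(s1 w).
by apply: le_trans (ncD _ _) _; rewrite lerD.
Qed.

Lemma cnormZ (c : R[i]) (a : Moo R[i]) : cnorm (c *: a) <= nc c * cnorm a.
Proof.
apply: cnorm_le => [|m v w v1 w1]; first by rewrite mulr_ge0 ?nc_ge0 ?cnorm_ge0.
have := cf_lin c a 0 m v w; rewrite addr0 => ->.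
have -> : cf 0 m v w = 0.
  by apply: big1 => i _; apply: big1 => j _; rewrite moo0 mulr0 mul0r.
rewrite addr0 ncM ler_wpM2l ?nc_ge0 //.
have s1 (u : nat -> R[i]) : \sum_(i < m) nc (u i) ^+ 2 <= 1 -> Num.sqrt (\sum_(i < m) nc (u i) ^+ 2) <= 1.
  by move=> h; rewrite -sqrtr1 ler_wsqrtr.
apply: le_trans (cnorm_form _ _ _ _) _; rewrite ler_piMr ?cnorm_ge0 //.
by rewrite -[X in _ <= X]mulr1 ler_pM ?sqrtr_ge0 ?(s1 v) ?(s1 w).
Qed.

Lemma cnormN (a : Moo R[i]) : cnorm (- a) = cnorm a.
Proof.
have h (b : Moo R[i]) : cnorm (- b) <= cnorm b.
  by rewrite -scaleN1r; apply: le_trans (cnormZ _ _) _; rewrite ncN nc1 mul1r.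
have := h a; have := h (- a); rewrite opprK; move: (cnorm a) (cnorm (- a)) => s t; lra.
Qed.

(** The scalars as an instance of [smosData], so that the lemmas on [mstar] apply to adjoints of
    scalar matrices; the empty cone is a placeholder. *)
Definition Cdata : smosData R := @SmosData R R[i] cnorm Num.conj set0.

Lemma Cstar_lin (c : R[i]) (x y : Cdata) : star Cdata (c *: x + y) = c^* *: star Cdata x + star Cdata y.
Proof. by rewrite /= conjD conjM. Qed.

Lemma CstarK : involutive (star Cdata).
Proof. by move=> x; rewrite /= conjCK. Qed.

Definition madj (a : Moo R[i]) : Moo R[i] := @mstar R Cdata a.

Lemma madjE (a : Moo R[i]) i j : madj a i j = (a j i)^*.
Proof. exact: (mstarEE Cstar_lin). Qed.

Lemma madj_lin (c : R[i]) (a b : Moo R[i]) : madj (c *: a + b) = c^* *: madj a + madj b.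
Proof. exact: (mstar_lin Cstar_lin). Qed.

Lemma madjK : involutive madj.
Proof. exact: (mstarK Cstar_lin CstarK). Qed.

Lemma rows_finsupp (a : Moo R[i]) : exists n, forall i j, (n <= i)%N -> a i j = 0.
Proof. by have [n an] := moo_finsupp a; exists n => i j ni; rewrite an ?ni. Qed.

Lemma madj_madjmul (a b : Moo R[i]) : madj (madjmul a b) = madjmul b a.
Proof.
have [n an] := rows_finsupp a; have [m bm] := rows_finsupp b.
have an' k l : (n + m <= k)%N -> a k l = 0 by move=> h; apply: an; exact: leq_trans (leq_addr _ _) h.
have bm' k l : (n + m <= k)%N -> b k l = 0 by move=> h; apply: bm; exact: leq_trans (leq_addl _ _) h.
apply: mooP => i j; rewrite madjE !(@madjmulE _ (n + m)) // conj_sum.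
by apply: eq_bigr => k _; rewrite conjM conjCK mulrC.
Qed.

Lemma madjmul_linr (a b d : Moo R[i]) (c : R[i]) :
  madjmul a (c *: b + d) = c *: madjmul a b + madjmul a d.
Proof.
have [n an] := rows_finsupp a.
apply: mooP => i j; rewrite mooD mooZ !(@madjmulE _ n) //.
rewrite scaler_sumr -big_split; apply: eq_bigr => k _ /=.
rewrite -[LHS]/((a k i)^* * (c * b k j + d k j)).
by rewrite /GRing.scale /=; ring.
Qed.

Lemma madjmul_psd r (a : 'I_r -> Moo R[i]) m (v : nat -> R[i]) :
  0 <= complex.Re (cf (\sum_(k < r) madjmul (a k) (a k)) m v v).
Proof.
have [N aN] := rows_common a; rewrite (cf_sumsq _ _ aN) /=.
by apply: sumr_ge0 => k _; apply: sumr_ge0 => l _; exact: sqr_ge0.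
Qed.

Lemma cf_mone n m (v : nat -> R[i]) : complex.Re (cf (mone n) m v v) <= \sum_(i < m) nc (v i) ^+ 2.
Proof.
rewrite /cf Re_sum; apply: ler_sum => i _.
rewrite (bigD1 i) //= big1 ?addr0; last first.
  move=> j; rewrite -val_eqE /= => /negbTE ji.
  by rewrite moneE eq_sym ji /= mulr0 mul0r.
rewrite moneE eqxx /=; case: (i < n)%N.
  by rewrite mulr1 mulrC -sqr_nc.
by rewrite mulr0 mul0r sqr_ge0.
Qed.

Lemma msandE_supp (X : lmodType R[i]) m (a : Moo R[i]) (x : Moo X) (b : Moo R[i]) i j :
  (forall k l, (m <= k)%N -> a k l = 0) -> (forall k l, (m <= k)%N -> b k l = 0) ->
  msand a x b i j = \sum_(k < m) \sum_(l < m) ((a k i)^* * b l j) *: x k l.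
Proof.
move=> am bm; have [n xn] := moo_finsupp x; rewrite (@msandE _ _ n n) //.
pose F k l := ((a k i)^* * b l j) *: x k l.
transitivity (\sum_(k < n) \sum_(l < m) F k l).
  apply: eq_bigr => k _; apply: (@eq_sum_ord _ _ _ (F k)) => l h.
    by rewrite /F xn ?h ?orbT // scaler0.
  by rewrite /F bm // mulr0 scale0r.
apply: (@eq_sum_ord _ _ _ (fun k => \sum_(l < m) F k l)) => k h; apply: big1 => l _.
  by rewrite /F xn ?h // scaler0.
by rewrite /F am // conjC0 mul0r scale0r.
Qed.

(** A row vector as the first row of a matrix: [madjmul (rowm v) (rowm u)] is then the rank one
    matrix v^* u, and sandwiching [mx1 x] by rows spreads x over a matrix. *)
Definition rowm n (v : 'rV[R[i]]_n) : Moo R[i] :=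
  mtr n.+1 (fun i j => if i == 0%N then natfun (v 0) j else 0).

Lemma rowmE n (v : 'rV[R[i]]_n) i j : rowm v i j = if i == 0%N then natfun (v 0) j else 0.
Proof.
rewrite mtrE; case: ifP => // /negbT; rewrite negb_and -!leqNgt.
case: eqP => // -> /orP[//|nj]; rewrite natfun0 // ltnW //.
Qed.

Lemma rowm_lin n (c : R[i]) (u v : 'rV[R[i]]_n) : rowm (c *: u + v) = c *: rowm u + rowm v.
Proof.
apply: mooP => i j; rewrite mooD mooZ !rowmE.
case: eqP => _; last by rewrite scaler0 addr0.
rewrite /natfun; case: insubP => [k _ _|_]; last by rewrite scaler0 addr0.
by rewrite !mxE.
Qed.

End ScalarMatrices.

Section SmosAxioms.
Context {R : realType} (X : smosData R).
Hypothesis HX : is_smos X.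

Lemma smos_norm : matrix_norm (mnorm X). Proof. by case: HX. Qed.
Lemma smos_star_lin (c : R[i]) (x y : X) : star X (c *: x + y) = c^* *: star X x + star X y.
Proof. by case: HX => _ [h _] _ _ _; exact: h. Qed.
Lemma smos_starK : involutive (star X). Proof. by case: HX => _ []. Qed.
Lemma smos_norm_star (x : Moo X) : mnorm X (mstar x) = mnorm X x.
Proof. by case: HX => _ _ h _ _; exact: h. Qed.
Lemma smos_cone_sa (x : Moo X) : mcone X x -> msa x.
Proof. by case: HX => _ _ _ [h _] _; exact: h. Qed.
Lemma smos_cone_closed : norm_closed (mnorm X) (mcone X).
Proof. by case: HX => _ _ _ [_ h] _. Qed.
Lemma smos_cone_sand m (a : 'I_m -> Moo R[i]) (x : 'I_m -> Moo X) :
  (forall k, mcone X (x k)) -> mcone X (\sum_(k < m) msand (a k) (x k) (a k)).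
Proof. by case: HX => _ _ _ _ h; exact: h. Qed.

Lemma smos_cone_sand1 (a : Moo R[i]) (x : Moo X) : mcone X x -> mcone X (msand a x a).
Proof. by move=> xp; have := @smos_cone_sand 1 (fun=> a) (fun=> x) (fun=> xp); rewrite big_ord1. Qed.

Lemma smos_cone0 : mcone X 0.
Proof. by have := @smos_cone_sand 0 (fun=> 0) (fun=> 0); rewrite big_ord0; apply; case. Qed.

Lemma smos_normZ (c : R[i]) (x : Moo X) : mnorm X (c *: x) = nc c * mnorm X x.
Proof. by case: smos_norm => _ _ h _; exact: h. Qed.

Lemma smos_normD (x y : Moo X) : mnorm X (x + y) <= mnorm X x + mnorm X y.
Proof. by case: smos_norm => _ h _ _; exact: h. Qed.

Lemma smos_normZr (t : R) (x : Moo X) : mnorm X (t%:C%C *: x) = `|t| * mnorm X x.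
Proof. by rewrite smos_normZ nc_real. Qed.

End SmosAxioms.

(** Since e <= 1, the first bound gives d <= e (2 + nx), which the second makes at most d / 2. *)
Lemma far_arith (R : realFieldType) (nx e d : R) : d <= e + e * (nx + e) ->
  e * (2 + nx) <= d / 2 -> e <= 1 -> 0 < e -> 0 < d -> False.
Proof. by move=> *; nra. Qed.

Section MatrixSeparation.
Context {R : realType} (X : smosData R).
Hypothesis HX : is_smos X.
Local Notation X' := (bdfun (@norm1 R X)).
Local Notation N := (mnorm X).
Variable K : set (Moo X).
Hypothesis K_conv : forall m (a : 'I_m -> Moo R[i]) (x : 'I_m -> Moo X),
  (forall k, K (x k)) -> cnorm (\sum_(k < m) madjmul (a k) (a k)) <= 1 ->
  K (\sum_(k < m) msand (a k) (x k) (a k)).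
Variables (x0 : Moo X) (d : R).
Hypothesis d_gt0 : 0 < d.
Hypothesis x0_far : forall y, K y -> d <= N (x0 - y).

Let HN := smos_norm HX.
Let N_ge0 := matrix_norm_ge0 HN.

Let W := (Moo X * Moo R[i])%type.

Let nW (w : W) : R := N w.1 + cnorm w.2.

Let nW_sublinear : sublinear nW.
Proof.
split=> [w w'|t w t0]; rewrite /nW /=.
  by rewrite addrACA; apply: lerD; [exact: smos_normD|exact: cnormD].
rewrite (smos_normZr HX) gtr0_norm // mulrDr lerD2l.
by apply: le_trans (cnormZ _ _) _; rewrite nc_real gtr0_norm.
Qed.

Let nW_ge0 w : 0 <= nW w. Proof. by rewrite addr_ge0 ?N_ge0 ?cnorm_ge0. Qed.

Let nWN w : nW (- w) = nW w.
Proof. by rewrite /nW /= (matrix_normN HN) cnormN. Qed.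

(* The pairs (sum a_k^* x_k a_k, b) with x_k in K and sum a_k^* a_k <= b. *)
Let Gam : set W := [set w | exists m (a : 'I_m -> Moo R[i]) (x : 'I_m -> Moo X),
  [/\ forall k, K (x k), w.1 = \sum_(k < m) msand (a k) (x k) (a k) &
      forall m' v, complex.Re (cf (\sum_(k < m) madjmul (a k) (a k)) m' v v) <=
                   complex.Re (cf w.2 m' v v)]].

Let cf0 m (v : nat -> R[i]) : cf 0 m v v = 0.
Proof. by apply: big1 => i _; apply: big1 => j _; rewrite moo0 mulr0 mul0r. Qed.

Let ReCfD (a b : Moo R[i]) m (v : nat -> R[i]) :
  complex.Re (cf (a + b) m v v) = complex.Re (cf a m v v) + complex.Re (cf b m v v).
Proof. by have := cf_lin 1 a b m v v; rewrite scale1r mul1r => ->; rewrite ReD. Qed.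

Let ReCfZ (t : R) (a : Moo R[i]) m (v : nat -> R[i]) :
  complex.Re (cf (t%:C%C *: a) m v v) = t * complex.Re (cf a m v v).
Proof. by have := cf_lin t%:C%C a 0 m v v; rewrite addr0 => ->; rewrite cf0 addr0 ReZ. Qed.

Let Gam0 : Gam 0.
Proof.
exists 0%N, (fun=> 0), (fun=> 0); split; [by case|by rewrite big_ord0|].
by move=> m' v; rewrite big_ord0.
Qed.

Let GamD w w' : Gam w -> Gam w' -> Gam (w + w').
Proof.
move=> [m [a [x [Kx w1 w2]]]] [m' [a' [x' [Kx' w1' w2']]]].
exists (m + m')%N,
  (fun k => match fintype.split k with inl i => a i | inr j => a' j end),
  (fun k => match fintype.split k with inl i => x i | inr j => x' j end).
have sl (i : 'I_m) : fintype.split (lshift m' i) = inl i by exact: (@unsplitK m m' (inl i)).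
have sr (i : 'I_m') : fintype.split (rshift m i) = inr i by exact: (@unsplitK m m' (inr i)).
split.
- by move=> k; case: (fintype.split k).
- rewrite /= w1 w1' big_split_ord /=; congr (_ + _).
    by apply: eq_bigr => k _; rewrite sl.
  by apply: eq_bigr => k _; rewrite sr.
- move=> M v; rewrite /= ReCfD; apply: le_trans (lerD (w2 M v) (w2' M v)).
  rewrite -ReCfD big_split_ord /= le_eqVlt; apply/predU1l; congr (complex.Re (cf (_ + _) _ _ _)).
    by apply: eq_bigr => k _; rewrite sl.
  by apply: eq_bigr => k _; rewrite sr.
Qed.

Let sqrtC_real (t : R) : 0 <= t ->
  ((Num.sqrt t)%:C%C : R[i])^* * (Num.sqrt t)%:C%C = t%:C%C.
Proof. by move=> t0; rewrite conjC_real -rcM -expr2 sqr_sqrtr. Qed.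

Let GamZ (t : R) w : 0 < t -> Gam w -> Gam (t%:C%C *: w).
Proof.
move=> t0 [m [a [x [Kx w1 w2]]]]; exists m, (fun k => (Num.sqrt t)%:C%C *: a k), x; split=> //.
  rewrite /= w1 scaler_sumr; apply: eq_bigr => k _.
  by rewrite msandZ sqrtC_real // ltW.
move=> m' v; rewrite [leRHS]ReCfZ (eq_bigr (fun k : 'I_m => t%:C%C *: madjmul (a k) (a k))); last first.
  by move=> k _; rewrite madjmulZ sqrtC_real // ltW.
by rewrite -scaler_sumr ReCfZ; apply: ler_wpM2l; [exact: ltW|exact: w2].
Qed.

Let n0 := projT1 (cid (moo_finsupp x0)).
Let x0n : Mn n0 x0 := projT2 (cid (moo_finsupp x0)).

Let e := Num.min 1 (d / (2 * (2 + N x0))).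

Let e_gt0 : 0 < e.
Proof. by rewrite /e lt_min ltr01 divr_gt0 // mulr_gt0 // ltr_wpDr ?N_ge0. Qed.

(** If (y, b) in Gam were within e of (x0, 1_n0), then sum a_k^* a_k <= b <= 1 + e, so y / (1 + e)
    would lie in K and too close to x0. The size of e is chosen to contradict the distance d. *)
Let Gam_far g : Gam g -> e <= nW (((x0, mone n0) : W) - g).
Proof.
case: g => y b [m [a [x [Kx /= yE bE]]]].
rewrite leNgt; apply/negP; rewrite /nW /= => lt_e.
have e1 : e <= 1 by rewrite /e ge_min lexx.
have e2 : e * (2 + N x0) <= d / 2.
  have p0 : 0 < 2 + N x0 by rewrite ltr_wpDr ?N_ge0.
  rewrite -ler_pdivlMr // -mulrA -invfM; rewrite /e ge_min.
  by apply/orP; right.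
have s_gt0 : 0 < 1 + e by rewrite addr_gt0.
have cb : cnorm (mone n0 - b) <= e by apply: ltW; apply: le_lt_trans lt_e; rewrite lerDr N_ge0.
have cy : N (x0 - y) <= e by apply: ltW; apply: le_lt_trans lt_e; rewrite lerDl cnorm_ge0.
have [L aL] := rows_common a.
have rb : rowbd (fun k => a k : nat -> nat -> R[i]) L (1 + e).
  move=> m' v.
  have := bE m' v; rewrite (cf_sumsq _ _ aL) /= => h; apply: le_trans h _.
  have -> : b = mone n0 - (mone n0 - b) by rewrite opprB addrC subrK.
  rewrite ReCfD mulrDl mul1r lerD ?cf_mone //.
  apply: le_trans (Re_le_nc _) _; apply: le_trans (cnorm_form _ _ _ _) _.
  rewrite cnormN -expr2 sqr_sqrtr; last by apply: sumr_ge0 => i _; exact: sqr_ge0.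
  by apply: ler_wpM2r => //; apply: sumr_ge0 => i _; exact: sqr_ge0.
pose r := Num.sqrt (1 + e)^-1.
have r2 : r ^+ 2 = (1 + e)^-1 by rewrite sqr_sqrtr // invr_ge0 ltW.
(* The scalar 1 / (1 + e) is absorbed into the a_k through its square root r, after which the column
   has norm at most 1 and matrix convexity applies. *)
have Ky : K (((1 + e)^-1)%:C%C *: y).
  rewrite yE scaler_sumr (eq_bigr (fun k => msand (r%:C%C *: a k) (x k) (r%:C%C *: a k))); last first.
    by move=> k _; rewrite msandZ sqrtC_real // invr_ge0 ltW.
  apply: K_conv => //.
  apply: (cnorm_rowbd (N := L)) => [k i j Li|m' v].
    by rewrite mooZ aL // scaler0.
  rewrite mul1r.
  have -> : \sum_(k < m) \sum_(l < L) nc (\sum_(j < m') (r%:C%C *: a k) l j * v j) ^+ 2 =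
    (1 + e)^-1 * \sum_(k < m) \sum_(l < L) nc (\sum_(j < m') a k l j * v j) ^+ 2.
    rewrite mulr_sumr; apply: eq_bigr => k _; rewrite mulr_sumr; apply: eq_bigr => l _.
    rewrite -r2 -[r ^+ 2]real_normK ?num_real // -nc_real -exprMn -ncM; congr (nc _ ^+ 2).
    by rewrite mulr_sumr; apply: eq_bigr => j _; rewrite mulrA.
  by rewrite ler_pdivrMl // rb.
have := x0_far Ky.
have -> : x0 - ((1 + e)^-1)%:C%C *: y = (x0 - y) + ((1 - (1 + e)^-1)%:C%C *: y).
  have -> : ((1 - (1 + e)^-1)%:C%C : R[i]) = 1 - ((1 + e)^-1)%:C%C.
    by apply/eqP; rewrite eq_complex /= subr0 !eqxx.
  by rewrite scalerBl scale1r addrA subrK.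
have h1 := smos_normD HX (x0 - y) ((1 - (1 + e)^-1)%:C%C *: y).
have t0 : 1 - (1 + e)^-1 = e / (1 + e) by field; rewrite gt_eqF.
have t1 : `|1 - (1 + e)^-1| <= e.
  rewrite t0 ger0_norm ?divr_ge0 ?(ltW e_gt0) ?(ltW s_gt0) // ler_pdivrMr //.
  by rewrite ler_peMr ?(ltW e_gt0) // lerDl (ltW e_gt0).
rewrite (smos_normZr HX) in h1.
have yN : N y <= N x0 + e.
  have -> : y = x0 - (x0 - y) by rewrite opprB addrC subrK.
  by apply: le_trans (matrix_normB HN _ _) _; rewrite lerD2l.
have h2 : `|1 - (1 + e)^-1| * N y <= e * (N x0 + e).
  by rewrite ler_pM ?N_ge0.
move=> /le_trans /(_ h1) h3.
have h4 : d <= e + e * (N x0 + e) by apply: le_trans h3 _; rewrite lerD.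
exact: (far_arith h4 e2 e1 e_gt0 d_gt0).
Qed.

(** Separating in the product with M_oo(C) replaces the constant 1 of ordinary convex separation by
    the positive functional rho, which bounds G simultaneously on all compressions a^* x a. *)
Lemma matrix_separation_real : exists (G : Moo X -> R) (rho : Moo R[i] -> R) (n : nat),
  [/\ (forall x y, G (x + y) = G x + G y) /\ (forall (t : R) x, G (t%:C%C *: x) = t * G x),
      (forall x y, rho (x + y) = rho x + rho y) /\ (forall (t : R) x, rho (t%:C%C *: x) = t * rho x),
      forall x, `|G x| <= N x,
      (forall x a, K x -> G (msand a x a) <= rho (madjmul a a)) /\
      (forall b, (forall m v, 0 <= complex.Re (cf b m v v)) -> 0 <= rho b) &
      Mn n x0 /\ rho (mone n) < G x0].
Proof.
have [F [FD FZ Fn Fp Fw]] := cone_separation nW_sublinear nW_ge0 nWN Gam0 GamD GamZ e_gt0 Gam_far.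
have F0 : F 0 = 0 by have := FZ 0 0; rewrite scaler0 mul0r.
have FN x : F (- x) = - F x by apply/eqP; rewrite -addr_eq0 -FD addNr F0.
have pD (x y : Moo X) (b c : Moo R[i]) : ((x + y, b + c) : W) = (x, b) + (y, c) by [].
(* With G the negative of the first component of F, positivity on Gam reads G (a^* x a) <= rho (a^*
   a), and F (x0, 1_n) < 0 reads rho 1_n < G x0. *)
exists (fun x => - F (x, 0)), (fun b => F (0, b)), n0; split.
- split=> [x y|t x]; first by rewrite -opprD -FD -pD addr0.
  by rewrite mulrN -FZ; congr (- F _); rewrite -[RHS]/(t%:C%C *: x, t%:C%C *: 0) scaler0.
- split=> [x y|t x]; first by rewrite -FD -pD addr0.
  by rewrite -FZ; congr (F _); rewrite -[RHS]/(t%:C%C *: 0, t%:C%C *: x) scaler0.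
- move=> x; rewrite normrN; apply: le_trans (Fn _) _; rewrite /nW /=.
  rewrite (_ : cnorm 0 = 0) ?addr0 //.
  have := cnormZ 0 (0 : Moo R[i]); rewrite scaler0 nc0 mul0r.
  by move=> h; apply/eqP; rewrite eq_le h cnorm_ge0.
- split=> [x a Kx|b bp].
    have : 0 <= F (msand a x a, madjmul a a).
      apply: Fp; exists 1%N, (fun=> a), (fun=> x); split=> //=; first by rewrite big_ord1.
      by move=> m' v; rewrite big_ord1.
    have -> : ((msand a x a, madjmul a a) : W) = (msand a x a, 0) + (0, madjmul a a).
      by rewrite -pD addr0 add0r.
    by rewrite FD => h; rewrite -subr_ge0 opprK addrC.
  apply: Fp; exists 0%N, (fun=> 0), (fun=> 0); split=> //=; first by case.
    by rewrite big_ord0.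
  by move=> m' v; rewrite big_ord0 cf0.
- split; first exact: x0n.
  move: Fw; have -> : ((x0, mone n0) : W) = (x0, 0) + (0, mone n0).
    by rewrite -pD addr0 add0r.
  by rewrite FD => h; rewrite -subr_lt0 opprK addrC.
Qed.

End MatrixSeparation.

Section SandwichZero.
Context {R : realType} (X : lmodType R[i]).

Lemma msand0a (x : Moo X) (b : Moo R[i]) : msand 0 x b = 0.
Proof.
have [n xn] := moo_finsupp x; apply: mooP => i j; rewrite (@msandE _ _ n n) //.
by apply: big1 => k _; apply: big1 => l _; rewrite moo0 conjC0 mul0r scale0r.
Qed.

Lemma msanda0 (x : Moo X) (a : Moo R[i]) : msand a x 0 = 0.
Proof.
have [n xn] := moo_finsupp x; apply: mooP => i j; rewrite (@msandE _ _ n n) //.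
by apply: big1 => k _; apply: big1 => l _; rewrite moo0 mulr0 scale0r.
Qed.

End SandwichZero.

Section FunctionalFromState.
Context {R : realType} (X : smosData R).
Hypothesis HX : is_smos X.
Local Notation X' := (bdfun (@norm1 R X)).
Local Notation N := (mnorm X).
Variable K : set (Moo X).
Hypothesis K_sa : forall x, K x -> msa x.
Variables (G : Moo X -> R) (rho : Moo R[i] -> R) (n : nat) (x0 : Moo X).
Hypotheses (GD : forall x y, G (x + y) = G x + G y).
Hypotheses (GZ : forall (t : R) x, G (t%:C%C *: x) = t * G x).
Hypotheses (rD : forall x y, rho (x + y) = rho x + rho y).
Hypotheses (rZ : forall (t : R) x, rho (t%:C%C *: x) = t * rho x).
Hypotheses (GN : forall x, `|G x| <= N x).
Hypotheses (Grho : forall x a, K x -> G (msand a x a) <= rho (madjmul a a)).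
Hypotheses (rho_ge0 : forall b, (forall m v, 0 <= complex.Re (cf b m v v)) -> 0 <= rho b).
Hypotheses (x0_sa : msa x0) (x0n : Mn n x0) (Gx0 : rho (mone n) < G x0).

Let sl := smos_star_lin HX.
Let sK := smos_starK HX.
Let psiG := hermitize (@mstar _ X) G.
Let psiR := hermitize (@madj R) rho.

Let psiG_lin : scalar psiG.
Proof. exact: (hermitize_lin (mstar_lin sl) GD GZ). Qed.

Let psiR_lin : scalar psiR.
Proof. exact: (hermitize_lin (@madj_lin R) rD rZ). Qed.

Let psiG_bound x : nc (psiG x) <= 2 * N x.
Proof.
apply: (hermitize_bound GN) => y; first exact: smos_norm_star.
rewrite (smos_normZ HX) (_ : nc 'i%C = 1) ?mul1r //.
by rewrite /Normc.normc /= expr0n expr1n add0r sqrtr1.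
Qed.

(** The perturbation adds eps n in total at the identity of M_n(C), and n / (n + 1) < 1 keeps the
    separation strict. *)
Let eps := (G x0 - rho (mone n)) / (n.+1)%:R.

Let eps_gt0 : 0 < eps.
Proof. by rewrite divr_gt0 ?subr_gt0 // ltr0Sn. Qed.

(** The form of the state rho on C^n, as in the GNS construction; the summand eps <u, v> replaces
    passing to the quotient by null vectors. *)
Let bb (u v : 'rV[R[i]]_n) : R[i] :=
  psiR (madjmul (rowm v) (rowm u)) + eps%:C%C * dotmx u v.

Let bb_lin c u v w : bb (c *: u + v) w = c * bb u w + bb v w.
Proof.
rewrite /bb rowm_lin madjmul_linr psiR_lin dotDl dotZl.
by rewrite /GRing.scale /=; ring.
Qed.

Let bb_herm u v : bb v u = (bb u v)^*.
Proof.
rewrite /bb conjD conjM conjC_real -(dot_conj (@dotmx _ n)); congr (_ + _).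
rewrite -(madj_madjmul (rowm v) (rowm u)).
exact: (hermitize_star (@madjK R)).
Qed.

Let psiR_sq (a : Moo R[i]) : psiR (madjmul a a) = (rho (madjmul a a))%:C%C.
Proof. by apply: hermitize_fix; rewrite ?madj_madjmul //; exact: rZ. Qed.

Let rho_sq_ge0 (a : Moo R[i]) : 0 <= rho (madjmul a a).
Proof.
apply: rho_ge0 => m v; have := madjmul_psd (fun _ : 'I_1 => a) m v.
by rewrite big_ord1.
Qed.

Let bb_diag u : bb u u = (rho (madjmul (rowm u) (rowm u)) +
   eps * \sum_(p < n) nc (u 0 p) ^+ 2)%:C%C.
Proof. by rewrite /bb psiR_sq dot_sqr dotmx_norm -rcM -rcD. Qed.

Let bb_pos u : u != 0 -> 0 < bb u u.
Proof.
move=> u0; rewrite bb_diag ltcE /= eqxx /= -dotmx_norm.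
rewrite ltr_wpDl // mulr_gt0 // exprn_gt0 // lt0r hnorm_ge0 andbT.
by apply: contraNneq u0 => /hnorm_eq0 ->.
Qed.

(** The entries of f are x |-> G (y_i^* x y_j) for a [bb]-orthonormal basis y of C^n, with G made
    complex linear. The form of theta_f(x) at eta is then G (A^* x A), where the rows of A have
    coordinates eta in that basis, so rho (A^* A) is at most the squared length of eta. *)
Lemma functional_from_state : exists f : Moo X',
  [/\ forall i j x, f i j (star X x) = (f j i x)^*,
      forall x, K x -> forall m n eta, complex.Re (afm (parr f x) m n eta eta) <= n2 m n eta &
      exists m n eta, n2 m n eta < complex.Re (afm (parr f x0) m n eta eta)].
Proof.
have [r [xi [S [xo eS]]]] := gram_schmidt bb_lin bb_herm bb_pos
  (fun k => \row_(q < n) (k == q)%:R) n.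
(* Zero beyond r, so that the truncated matrix f agrees with the formula g at all indices. *)
pose y j : 'rV[R[i]]_n := if (j < r)%N then xi j else 0.
have rowm0 : rowm (0 : 'rV[R[i]]_n) = 0.
  exact: (@lin0 _ _ _ (@rowm R n) (fun c u v => rowm_lin c u v)).
have mx1_lin c (x z : X) : mx1 (c *: x + z) = c *: mx1 x + mx1 z by rewrite mx1D mx1Z.
pose g i j (x : X) := psiG (msand (rowm (y i)) (mx1 x) (rowm (y j))).
have g_lin i j : scalar (g i j).
  by move=> c x z; rewrite /g mx1_lin msand_lin psiG_lin.
have g_bd i j : exists L, forall x, nc (g i j x) <= L * norm1 x.
  pose s (v : 'rV[R[i]]_n) := Num.sqrt (cnorm (\sum_(k < 1) madjmul (rowm v) (rowm v))).
  exists (2 * (s (y i) * s (y j))) => x; apply: le_trans (psiG_bound _) _.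
  rewrite -mulrA ler_wpM2l // /s.
  apply: (matrix_norm_sand1 (smos_norm HX)) => L.
    exact: (rowbd_cnorm (fun _ : 'I_1 => rowm (y i)) L).
  exact: (rowbd_cnorm (fun _ : 'I_1 => rowm (y j)) L).
pose f : Moo X' := mtr r (fun i j => insubd (0 : X') (g i j)).
have psiG0 : psiG 0 = 0 by exact: (@lin0 _ _ R[i]^o _ psiG_lin).
have fE i j x : f i j x = g i j x.
  rewrite /f mtrE; case: ifP => [_|]; first exact: bd_insub.
  rewrite bd_fun0 /g /y => /negbT; rewrite negb_and => /orP[] /negbTE ->; rewrite rowm0 ?msand0a ?msanda0 psiG0 //.
(* Row k of A is the vector with coordinates [eta k] in the basis y. *)
pose u (eta : nat -> nat -> R[i]) n' k : 'rV[R[i]]_n := \sum_(a < n') eta k a *: y a.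
pose A eta n' m : Moo R[i] := mtr (m + n).+1 (fun k p => if (k < m)%N then rowm (u eta n' k) 0%N p else 0).
have AE eta n' m k p : A eta n' m k p = if (k < m)%N then rowm (u eta n' k) 0%N p else 0.
  rewrite /A mtrE; case: ifP => // /negbT; rewrite negb_and -!leqNgt => kp.
  case: ifP => // km; case/orP: kp => h.
    by have := leq_ltn_trans h (leq_trans km (leq_trans (leq_addr n m) (leqnSn _))); rewrite ltnn.
  by rewrite rowmE /= natfun0 // (leq_trans _ h) // (leq_trans (leq_addl m n)).
have rowmu eta n' k p : rowm (u eta n' k) 0%N p = \sum_(a < n') eta k a * rowm (y a) 0%N p.
  rewrite (@lin_sum _ _ _ (@rowm R n) (fun c u v => rowm_lin c u v)) moo_sum.
  apply: eq_bigr => a _.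
  by rewrite (@linZ _ _ _ (@rowm R n) (fun c u v => rowm_lin c u v)) mooZ.
have afmE x eta m n' : afm (parr f x) m n' eta eta = psiG (msand (A eta n' m) x (A eta n' m)).
  pose Y a b := \sum_(k < m) \sum_(l < m) ((eta k a)^* * eta l b) *: x k l.
  have -> : msand (A eta n' m) x (A eta n' m) =
      \sum_(a < n') \sum_(b < n') msand (rowm (y a)) (mx1 (Y a b)) (rowm (y b)).
    apply: mooP => p q; rewrite moo_sum.
    under eq_bigr do rewrite moo_sum.
    rewrite (@msandE_supp _ _ m); first last.
    - by move=> k l mk; rewrite AE ltnNge mk.
    - by move=> k l mk; rewrite AE ltnNge mk.
    have E (a b : nat) : msand (rowm (y a)) (mx1 (Y a b)) (rowm (y b)) p q =
      \sum_(k < m) \sum_(l < m) ((rowm (y a) 0%N p)^* * rowm (y b) 0%N q) *: (((eta k a)^* * eta l b) *: x k l).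
      rewrite (@msandE _ _ 1 1); last by move=> k l kl; exact: Mn_mx1.
      rewrite !big_ord1 mx1E /= scaler_sumr; apply: eq_bigr => k _.
      by rewrite scaler_sumr.
    under [RHS]eq_bigr do (under eq_bigr do rewrite E).
    rewrite (exchange4 (fun a b k l => ((rowm (y a) 0%N p)^* * rowm (y b) 0%N q) *: (((eta k a)^* * eta l b) *: x k l))).
    apply: eq_bigr => k _; apply: eq_bigr => l _.
    rewrite !AE !ltn_ord !rowmu conj_sum mulr_suml scaler_suml; apply: eq_bigr => a _.
    rewrite mulr_sumr scaler_suml; apply: eq_bigr => b _.
    by rewrite scalerA conjM; congr (_ *: _); ring.
  rewrite (@lin_sum _ _ R[i]^o _ psiG_lin) afm_parr; apply: eq_bigr => a _.
  rewrite (@lin_sum _ _ R[i]^o _ psiG_lin); apply: eq_bigr => b _.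
  by rewrite fE.
have bbu eta n' k : bb (u eta n' k) (u eta n' k) =
    (\sum_(a < n') if (a < r)%N then nc (eta k a) ^+ 2 else 0)%:C%C.
  have bl w := fun c u v => bb_lin c u v w.
  rewrite {1}/u (@lin_sum _ _ R[i]^o (fun v => bb v _) (bl _)).
  rewrite (big_morph (fun t : R => t%:C%C : R[i]) (@rcD R) (erefl _)).
  apply: eq_bigr => a _; rewrite (@linZ _ _ R[i]^o (fun v => bb v _) (bl _)).
  rewrite bb_herm /u (@lin_sum _ _ R[i]^o (fun v => bb v _) (bl _)) (bigD1 a) //= big1 ?addr0.
    rewrite (@linZ _ _ R[i]^o (fun v => bb v _) (bl _)) /y; case: ifP => ar.
      by rewrite xo // eqxx /GRing.scale /= mulr1 sqr_nc.
    have -> : bb 0 0 = 0 by exact: (@lin0 _ _ R[i]^o (fun v => bb v 0) (bl 0)).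
    by rewrite /GRing.scale /= mulr0 conjC0 mulr0.
  move=> b; rewrite -val_eqE /= => /negbTE ba.
  rewrite (@linZ _ _ R[i]^o (fun v => bb v _) (bl _)) /y.
  have b0 v : bb 0 v = 0 by exact: (@lin0 _ _ R[i]^o (fun v' => bb v' v) (bl v)).
  case: ifP => br; last by rewrite b0 /GRing.scale /= mulr0.
  case: ifP => ar; last by rewrite bb_herm b0 conjC0 /GRing.scale /= mulr0.
  by rewrite xo // ba /GRing.scale /= mulr0.
have AAE eta n' m : rho (madjmul (A eta n' m) (A eta n' m)) =
    \sum_(k < m) rho (madjmul (rowm (u eta n' k)) (rowm (u eta n' k))).
  have r0 : rho 0 = 0 by have := rZ 0 0; rewrite scaler0 mul0r.
  rewrite -(big_morph rho rD r0); congr rho; apply: mooP => p q; rewrite moo_sum.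
  rewrite (@madjmulE _ m); last by move=> k l mk; rewrite AE ltnNge mk.
  apply: eq_bigr => k _; rewrite (@madjmulE _ 1).
    by rewrite big_ord1 !AE ltn_ord.
  by move=> [|k'] l // _; rewrite rowmE.
have bbuE eta n' k : rho (madjmul (rowm (u eta n' k)) (rowm (u eta n' k))) +
    eps * \sum_(p < n) nc (u eta n' k 0 p) ^+ 2 = \sum_(a < n') if (a < r)%N then nc (eta k a) ^+ 2 else 0.
  by have := bb_diag (u eta n' k); rewrite bbu => /(congr1 (@complex.Re R)).
have GE x (B : Moo R[i]) : msa x -> complex.Re (psiG (msand B x B)) = G (msand B x B).
  move=> xs; rewrite /psiG hermitize_fix //; exact: (msa_msand sl B xs).
exists f; split.
- move=> i j x; rewrite !fE /g -(mstar_mx1 sl) -{1}(mstar_msand sl).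
  exact: (hermitize_star (mstarK sl sK)).
- move=> x Kx m n' eta; rewrite afmE (GE _ _ (K_sa Kx)); apply: le_trans (Grho _ Kx) _.
  rewrite AAE; apply: ler_sum => k _; apply: (@le_trans _ _ (\sum_(a < n') if (a < r)%N then nc (eta k a) ^+ 2 else 0)).
    rewrite -bbuE lerDl mulr_ge0 ?(ltW eps_gt0) //.
    by apply: sumr_ge0 => p _; exact: sqr_ge0.
  by apply: ler_sum => a _; case: ifP => // _; exact: sqr_ge0.
(* S holds the coordinates of the standard basis, so A is the identity of M_n(C): the form at S is G
   x0, and the squared length of S is rho 1_n + eps n, which is smaller. *)
- exists n, r, S; rewrite afmE (GE _ _ x0_sa).
  have uE (k : 'I_n) : u S r k = \row_(q < n) (nat_of_ord k == q)%:R.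
    rewrite /u eS //; apply: eq_bigr => j _; rewrite /y ltn_ord //.
  have AS : A S r n = mone n.
    apply: mooP => p q; rewrite AE moneE; case: ifP => pn; rewrite ?andbF ?andbT //.
    rewrite (uE (Ordinal pn)) rowmE /natfun /=; case: insubP => [q' _ <-|]; rewrite ?mxE //.
    by rewrite -leqNgt => nq; rewrite ltn_eqF // (leq_trans pn).
  rewrite AS msand_mone -(Mn_mtr x0n).
  have -> : n2 n r S = rho (madjmul (mone n) (mone n)) + eps * n%:R.
    rewrite -AS AAE /n2 mulr_natr -[n in eps *+ n]card_ord -sumr_const -big_split /=.
    apply: eq_bigr => k _.
    rewrite (eq_bigr (fun a : 'I_r => if (a < r)%N then nc (S k a) ^+ 2 else 0)) => [|a _]; last by rewrite ltn_ord.
    rewrite -bbuE uE; congr (_ + _); rewrite -[RHS]mulr1; congr (_ * _).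
    rewrite (bigD1 k) //= big1 ?addr0 ?mxE ?eqxx ?nc1 ?expr1n // => q.
    by rewrite -val_eqE eq_sym /= mxE => /negbTE ->; rewrite nc0 expr0n.
  have -> : madjmul (mone n) (mone n) = mone n :> Moo R[i].
    apply: mooP => p q; rewrite (@madjmulE _ n); last first.
      by move=> k l nk; rewrite moneE [(k < n)%N]ltnNge nk andbF.
    rewrite moneE; have [pn|pn] := ltnP p n; last first.
      rewrite andbF big1 // => k _; rewrite moneE (_ : (_ == p) = false) /= ?conjC0 ?mul0r //.
      by rewrite ltn_eqF // (leq_trans _ pn).
    rewrite (bigD1 (Ordinal pn)) //= big1 ?addr0 => [|k]; last first.
      by rewrite -val_eqE /= => /negbTE kp; rewrite moneE kp /= conjC0 mul0r.
    by rewrite !moneE eqxx pn /= conjC1 mul1r andbT.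
  have : eps * n%:R < G x0 - rho (mone n).
    rewrite /eps mulrAC ltr_pdivrMr ?ltr0Sn // ltr_pM2l ?subr_gt0 //.
    by rewrite ltr_nat.
  by rewrite ltrBrDl.
Qed.

End FunctionalFromState.

(** * Bipolar theorem and norm duality *)

Section Duality.
Context {R : realType} (X : smosData R).
Hypothesis HX : is_smos X.
Local Notation X' := (bdfun (@norm1 R X)).
Local Notation N := (mnorm X).

Let sl := smos_star_lin HX.
Let sK := smos_starK HX.
Let HN := smos_norm HX.
Let N_ge0 := matrix_norm_ge0 HN.

Theorem matrix_separation (K : set (Moo X)) (x0 : Moo X) :
  (forall x, K x -> msa x) ->
  (forall m (a : 'I_m -> Moo R[i]) (x : 'I_m -> Moo X), (forall k, K (x k)) ->
     cnorm (\sum_(k < m) madjmul (a k) (a k)) <= 1 ->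
     K (\sum_(k < m) msand (a k) (x k) (a k))) ->
  msa x0 -> ~ norm_closure N K x0 -> exists f : Moo X',
  [/\ forall i j x, f i j (star X x) = (f j i x)^*,
      forall x, K x -> forall m n eta, complex.Re (afm (parr f x) m n eta eta) <= n2 m n eta &
      exists m n eta, n2 m n eta < complex.Re (afm (parr f x0) m n eta eta)].
Proof.
move=> K_sa K_conv x0_sa /existsNP[d /not_implyP[d0 far]].
have x0_far y : K y -> d <= N (x0 - y).
  by move=> Ky; rewrite leNgt; apply/negP => h; apply: far; exists y.
have [G [rho [n [[GD GZ] [rD rZ] GN [Gr rp] [x0n Gx0]]]]] :=
  matrix_separation_real HX K_conv d0 x0_far.
exact: (functional_from_state HX K_sa GD GZ rD rZ GN Gr rp x0_sa x0n Gx0).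
Qed.

Lemma norm1_star (x : X) : norm1 (star X x) = norm1 x.
Proof. by rewrite /norm1 -(mstar_mx1 sl) smos_norm_star. Qed.

Lemma dual_starE (f : X') x : dual_star f x = (f (star X x))^*.
Proof.
apply: bd_insub.
  move=> c y z; rewrite sl bdD bdZ conjD conjM conjCK.
  by [].
have [K K0 fK] := bd_bound HN f; exists K => y.
by rewrite nc_conj -(norm1_star y).
Qed.

Lemma dual_star0 : dual_star (0 : X') = 0.
Proof. by apply: bd_ext => x; rewrite dual_starE bd_fun0 conjC0. Qed.

Lemma dual_starEE (f : Moo X') i j : minf (fun i j => dual_star (f j i)) i j = dual_star (f j i).
Proof.
have [n fn] := moo_finsupp f; apply: (@minfE _ _ _ n) => k l; rewrite orbC => /fn ->.
exact: dual_star0.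
Qed.

Lemma dual_saP (f : Moo X') : minf (fun i j => dual_star (f j i)) = f <->
  forall i j x, f i j (star X x) = (f j i x)^*.
Proof.
split=> [fs i j x|fs].
  by rewrite -{1}fs dual_starEE dual_starE sK.
by apply: mooP => i j; apply: bd_ext => x; rewrite dual_starEE dual_starE fs conjCK.
Qed.

Lemma dual_coneP (f : Moo X') : dual_cone f <->
  (forall i j x, f i j (star X x) = (f j i x)^*) /\ forall x, mcone X x -> apos (parr f x).
Proof.
split=> [[/dual_saP fs [_ fp]]|[fs fp]].
  by split=> // x /fp /mcone_theta.
split; first exact/dual_saP.
split; last by move=> x /fp h; apply/mcone_theta.
split; first exact: theta_linear.
move=> x; apply: mooP => i j; have [n fn] := moo_finsupp (theta f x).
rewrite thetaE fs; apply/esym; rewrite [LHS](@minfE _ _ _ n) ?thetaE //.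
by move=> k l; rewrite orbC => /fn ->; rewrite conjC0.
Qed.

Lemma parr_star (f : Moo X') (x : Moo X) :
  (forall i j y, f i j (star X y) = (f j i y)^*) ->
  parr f (mstar x) = fun k l p q => (parr f x l k q p)^*.
Proof. by move=> fs; apply: arrP => k l p q; rewrite /parr (mstarEE sl) fs. Qed.

Lemma afm_herm (f : Moo X') (x : Moo X) m n eta :
  (forall i j y, f i j (star X y) = (f j i y)^*) -> msa x ->
  afm (parr f x) m n eta eta = (complex.Re (afm (parr f x) m n eta eta))%:C%C.
Proof.
move=> fs xs; have := afm_conj (parr f x) m n eta eta.
rewrite -(parr_star x fs) xs; case: (afm _ _ _ _ _) => a b /= /eqP.
rewrite eq_complex /= eqxx /= => /eqP h; congr (_ +i* _)%C; lra.
Qed.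

Lemma parrN (f : Moo X') x : parr (- f) x = fun k l a b => -1 * parr f x k l a b + 0.
Proof. by apply: arrP => k l a b; rewrite /parr mooN bd_funN mulN1r addr0. Qed.

Lemma afmN (y : nat -> nat -> nat -> nat -> R[i]) m n xi eta :
  afm (fun k l a b => -1 * y k l a b + 0) m n xi eta = - afm y m n xi eta.
Proof.
have := afm_lin (-1) y (fun _ _ _ _ => 0) m n xi eta => ->.
rewrite (_ : afm (fun _ _ _ _ => 0) m n xi eta = 0) ?addr0 ?mulN1r //.
by apply: big1 => k _; do 3! (apply: big1 => ? _); rewrite mulr0 mul0r.
Qed.

Lemma afm_parrN (f : Moo X') x m n xi eta :
  afm (parr (- f) x) m n xi eta = - afm (parr f x) m n xi eta.
Proof. by rewrite parrN afmN. Qed.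

Lemma afm_parrZ (f : Moo X') (c : R[i]) x m n xi eta :
  afm (parr f (c *: x)) m n xi eta = c * afm (parr f x) m n xi eta.
Proof.
have := parr_linx f c x 0; rewrite addr0 => ->; rewrite afm_lin.
rewrite (_ : afm (parr f 0) m n xi eta = 0) ?addr0 //.
by apply: big1 => k _; do 3! (apply: big1 => ? _); rewrite /parr bd0 mulr0 mul0r.
Qed.

Lemma afm_parrD (f : Moo X') x y m n xi eta :
  afm (parr f (x + y)) m n xi eta = afm (parr f x) m n xi eta + afm (parr f y) m n xi eta.
Proof. by have := parr_linx f 1 x y; rewrite scale1r => ->; rewrite afm_lin mul1r. Qed.

Lemma msandZ_real (X0 : lmodType R[i]) (t : R) (a : Moo R[i]) (x : Moo X0) : 0 <= t ->
  msand ((Num.sqrt t)%:C%C *: a) x ((Num.sqrt t)%:C%C *: a) = t%:C%C *: msand a x a.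
Proof. by move=> t0; rewrite msandZ conjC_real -rcM -expr2 sqr_sqrtr. Qed.

Lemma msand_moneE (x : Moo X) n : Mn n x -> msand (mone n) x (mone n) = x.
Proof. by move=> xn; rewrite msand_mone -Mn_mtr. Qed.

Lemma coneZ (t : R) (x : Moo X) : 0 <= t -> mcone X x -> mcone X (t%:C%C *: x).
Proof.
move=> t0 xp; have [n xn] := moo_finsupp x.
by rewrite -{1}(msand_moneE xn) -(msandZ_real _ _ t0); exact: smos_cone_sand1.
Qed.

Lemma coneD (x y : Moo X) : mcone X x -> mcone X y -> mcone X (x + y).
Proof.
move=> xp yp; have [n xn] := moo_finsupp x; have [m ym] := moo_finsupp y.
have := @smos_cone_sand _ X HX 2 (fun=> mone (n + m)) (fun k => if k == 0 then x else y).
rewrite !big_ord_recl big_ord0 addr0 /= !msand_moneE; first by apply => k; case: ifP.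
  exact: Mn_le (leq_addl _ _) ym.
exact: Mn_le (leq_addr _ _) xn.
Qed.

(** A separating f is bounded above on the cone, hence nonpositive there by scaling, so - f is a
    positive matrix of functionals that is negative at x0. *)
Theorem cone_bipolar (x0 : Moo X) : msa x0 ->
  (forall f : Moo X', dual_cone f -> apos (parr f x0)) -> mcone X x0.
Proof.
move=> xs h; apply: (smos_cone_closed HX); apply: contrapT => ncl.
have [||f [fs fK [m [n [eta f0]]]]] := matrix_separation _ _ xs ncl.
- exact: smos_cone_sa.
- by move=> r a x xp _; exact: smos_cone_sand.
have fneg : dual_cone (- f).
  apply/dual_coneP; split=> [i j x|x xp m' n' eta'].
    by rewrite !mooN !bd_funN fs conjN.
  rewrite afm_parrN (afm_herm _ _ _ fs (smos_cone_sa HX xp)).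
  rewrite oppr_ge0 lecE /= eqxx /= leNgt; apply/negP => p0.
  (* If the form were p > 0 at x, then at t x it would be t p = n2 + 1, above the bound n2. *)
  set p := complex.Re _ in p0; pose t := (n2 m' n' eta' + 1) / p.
  have t0 : 0 <= t by rewrite divr_ge0 ?addr_ge0 ?n2_ge0 // ltW.
  have := fK _ (coneZ t0 xp) m' n' eta'.
  by rewrite afm_parrZ ReZ -/p /t divfK ?gt_eqF // gerDl ler10.
have := h _ fneg m n eta; rewrite afm_parrN oppr_ge0 lecE => /andP[_] /=.
by apply/negP; rewrite -ltNge; apply: le_lt_trans f0; exact: n2_ge0.
Qed.

Lemma afm_parr_sand (f : Moo X') (a : Moo R[i]) (x : Moo X) (b : Moo R[i]) L m n xi eta : Mn L x ->
  afm (parr f (msand a x b)) m n xi eta =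
  afm (parr f x) L n (fun l q => \sum_(j < m) b l j * xi j q) (fun l p => \sum_(i < m) a l i * eta i p).
Proof.
move=> xL; have := @afm_sand R 1 L (fun _ => a) (fun _ => b) (fun _ => parr f x) m n xi eta.
rewrite big_ord1 => <-; apply: eq_afm => k l p q; rewrite big_ord1 /parr (@msandE _ _ L L) //.
rewrite bd_sum; apply: eq_bigr => i _; rewrite bd_sum; apply: eq_bigr => j _.
by rewrite bdZ.
Qed.

(** [mone L] and [shiftm L] are the block rows [1, 0] and [0, 1] with blocks of size L. *)
Definition shiftm L : Moo R[i] := mtr (L + L) (fun k j => ((k < L) && (j == L + k))%N%:R).

Lemma shiftmE L k j : shiftm L k j = ((k < L) && (j == L + k))%N%:R.
Proof.
rewrite mtrE; case: (boolP ((k < L) && (j == L + k))%N) => [/andP[kL /eqP ->]|]; last by case: ifP.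
by rewrite ltn_add2l kL (leq_trans kL) // leq_addr.
Qed.

Lemma shiftm_sum L l m (v : nat -> R[i]) : (l < L)%N -> (L + L <= m)%N ->
  \sum_(j < m) shiftm L l j * v j = v (L + l)%N.
Proof.
move=> lL mL; under eq_bigr do rewrite shiftmE lL /=.
by rewrite sum_delta (leq_trans _ mL) // ltn_add2l.
Qed.

Lemma mone_sum L l m (v : nat -> R[i]) : (l < L)%N -> (L <= m)%N ->
  \sum_(j < m) mone L l j * v j = v l.
Proof.
move=> lL mL; under eq_bigr do rewrite moneE eq_sym lL andbT.
by rewrite sum_delta (leq_trans lL mL).
Qed.

Lemma sumsq_pair L m (v : nat -> R[i]) :
  \sum_(l < L) (nc (\sum_(j < m) mone L l j * v j) ^+ 2 + nc (\sum_(j < m) shiftm L l j * v j) ^+ 2) <=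
  \sum_(j < m) nc (v j) ^+ 2.
Proof.
pose w j := if (j < m)%N then nc (v j) ^+ 2 else 0.
have E1 (l : 'I_L) : nc (\sum_(j < m) mone L l j * v j) ^+ 2 = w l.
  under eq_bigr do rewrite moneE eq_sym ltn_ord andbT.
  by rewrite sum_delta /w; case: ifP; rewrite ?nc0 ?expr0n.
have E2 (l : 'I_L) : nc (\sum_(j < m) shiftm L l j * v j) ^+ 2 = w (L + l)%N.
  under eq_bigr do rewrite shiftmE ltn_ord /=.
  by rewrite sum_delta /w; case: ifP; rewrite ?nc0 ?expr0n.
under eq_bigr do rewrite E1 E2.
rewrite big_split /=.
have -> : \sum_(i < L) w i + \sum_(i < L) w (L + i)%N = \sum_(i < L + L) w i.
  by rewrite big_split_ord.
rewrite [leRHS](_ : _ = \sum_(i < m) w i); last by apply: eq_bigr => i _; rewrite /w ltn_ord.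
apply: le_sum_ord => k; first by rewrite /w; case: ifP => // _; exact: sqr_ge0.
by rewrite /w ltnNge => ->.
Qed.

(* The block matrix [[0, x], [x^*, 0]], for x in M_L(X). *)
Definition offdiag L (x : Moo X) := msand (mone L) x (shiftm L) + msand (shiftm L) (mstar x) (mone L).

Lemma norm_offdiag L x : N (offdiag L x) <= N x.
Proof.
pose a (k : 'I_2) : Moo R[i] := if k == 0 then mone L else shiftm L.
pose b (k : 'I_2) : Moo R[i] := if k == 0 then shiftm L else mone L.
pose y (k : 'I_2) := if k == 0 then x else mstar x.
have aL k i j : (L <= i)%N -> a k i j = 0.
  by rewrite /a leqNgt => /negbTE h; case: ifP; rewrite ?moneE ?shiftmE h ?andbF.
have bL k i j : (L <= i)%N -> b k i j = 0.
  by rewrite /b leqNgt => /negbTE h; case: ifP; rewrite ?moneE ?shiftmE h ?andbF.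
have := @matrix_norm_sand _ _ _ HN 2 a b y 1 1 (N x).
rewrite sqrtr1 !mul1r !big_ord_recl !big_ord0 !addr0 /=; apply => //.
- have := cnorm_rowbd aL (B := 1); rewrite !big_ord_recl big_ord0 addr0; apply => m v.
  rewrite mul1r !big_ord_recl big_ord0 addr0 /= -big_split.
  exact: sumsq_pair.
- have := cnorm_rowbd bL (B := 1); rewrite !big_ord_recl big_ord0 addr0; apply => m v.
  rewrite mul1r !big_ord_recl big_ord0 addr0 /= addrC -big_split.
  exact: sumsq_pair.
- by move=> k; rewrite /y; case: ifP => // _; rewrite (smos_norm_star HX).
Qed.

Lemma offdiag_sa L x : msa (offdiag L x).
Proof.
rewrite /msa /= /offdiag -[X in mstar (X + _)]scale1r (mstar_lin sl) conjC1 scale1r.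
by rewrite !(mstar_msand sl) (mstarK sl sK) addrC.
Qed.

(** The 2 x 2 trick: the off-diagonal matrix of x is self-adjoint with norm at most that of x, and
    its form at the vector (eta, c xi) is twice the real part of c <x xi, eta>. The phase c turns
    this into twice the modulus, while the vector has squared length at most 2. *)
Lemma ale_of_sa (f : Moo X') : (forall i j x, f i j (star X x) = (f j i x)^*) ->
  (forall x, msa x -> N x <= 1 -> forall m n eta,
     complex.Re (afm (parr f x) m n eta eta) <= n2 m n eta) ->
  forall x, N x <= 1 -> ale (parr f x) 1.
Proof.
move=> fs fK x x1 m n xi eta xi1 eta1.
have [M xM] := moo_finsupp x; pose L := (M + m)%N.
have xL : Mn L x := Mn_le (leq_addr m M) xM.
have sxL : Mn L (mstar x) := mstar_Mn sl xL.
have [c c1 cE] := phase (afm (parr f x) m n xi eta).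
pose zeta (k p : nat) : R[i] := if (k < L)%N then (if (k < m)%N then eta k p else 0)
  else if (k - L < m)%N then c * xi (k - L)%N p else 0.
pose x2 (k p : nat) := if (k < m)%N then c * xi k p else 0.
pose e2 (k p : nat) := if (k < m)%N then eta k p else 0.
have z1 l p : (l < L)%N -> zeta l p = e2 l p by rewrite /zeta => ->.
have z2 l p : (l < L)%N -> zeta (L + l)%N p = x2 l p.
  by move=> lL; rewrite /zeta ltnNge leq_addr /= addKn.
have := fK _ (offdiag_sa L x) (le_trans (norm_offdiag L x) x1) (L + L)%N n zeta.
rewrite /offdiag afm_parrD (afm_parr_sand _ _ _ _ _ _ _ xL) (afm_parr_sand _ _ _ _ _ _ _ sxL).
have -> : afm (parr f x) L n (fun l q => \sum_(j < L + L) shiftm L l j * zeta j q)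
             (fun l p => \sum_(i < L + L) mone L l i * zeta i p) = afm (parr f x) L n x2 e2.
  apply: eq_afmv => l p lL _; first by rewrite (@shiftm_sum L l _ (fun j => zeta j p)) ?z2.
  by rewrite (@mone_sum L l _ (fun j => zeta j p)) ?z1 ?leq_addr.
have -> : afm (parr f (mstar x)) L n (fun l q => \sum_(j < L + L) mone L l j * zeta j q)
    (fun l p => \sum_(i < L + L) shiftm L l i * zeta i p) = afm (parr f (mstar x)) L n e2 x2.
  apply: eq_afmv => l p lL _; last by rewrite (@shiftm_sum L l _ (fun j => zeta j p)) ?z2.
  by rewrite (@mone_sum L l _ (fun j => zeta j p)) ?z1 ?leq_addr.
rewrite (parr_star x fs) -afm_conj ReD Re_conj.
have -> : afm (parr f x) L n x2 e2 = c * afm (parr f x) m n xi eta.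
  transitivity (afm (parr f x) m n x2 e2).
    pose Y k l p q := if (p < n)%N && (q < n)%N then parr f x k l p q else 0.
    have YE M' : afm (parr f x) M' n x2 e2 = afm Y M' n x2 e2.
      apply: eq_bigr => k _; apply: eq_bigr => l _; apply: eq_bigr => p _.
      by apply: eq_bigr => q _; rewrite /Y !ltn_ord.
    rewrite !YE; apply: afm_resize => k l p q.
      move=> /or4P[] h; rewrite /Y /x2 /e2 /parr.
      - by rewrite xL ?h // bd0 if_same mulr0 mul0r.
      - by rewrite xL ?h ?orbT // bd0 if_same mulr0 mul0r.
      - by rewrite [(p < n)%N]ltnNge h /= mulr0 mul0r.
      - by rewrite [(q < n)%N]ltnNge h andbF mulr0 mul0r.
    move=> /or4P[] h; rewrite /Y /x2 /e2 /parr.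
    - by rewrite ltnNge h /= conjC0 !mul0r.
    - by rewrite [(l < m)%N]ltnNge h /= mulr0.
    - by rewrite [(p < n)%N]ltnNge h /= mulr0 mul0r.
    - by rewrite [(q < n)%N]ltnNge h andbF mulr0 mul0r.
  rewrite -[RHS]mulr1 -[X in _ = _ * X]conjC1 mulrAC -afmZ; apply: eq_afmv => k p km _.
    by rewrite /x2 km.
  by rewrite /e2 km mul1r.
rewrite cE /= => h.
have bd (v w : nat -> nat -> R[i]) : (forall k p, (k < m)%N -> nc (v k p) = nc (w k p)) ->
    (forall k p, (m <= k)%N -> v k p = 0) -> n2 m n w <= 1 ->
    \sum_(i < L) \sum_(p < n) nc (v i p) ^+ 2 <= 1.
  move=> vw v0 w1; apply: le_trans w1.
  apply: (le_trans (@le_sum_ord _ L m (fun k => \sum_(p < n) nc (v k p) ^+ 2) _ _)).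
  - by move=> k; apply: sumr_ge0 => p _; exact: sqr_ge0.
  - by move=> k mk; rewrite big1 // => p _; rewrite v0 // nc0 expr0n.
  by apply: ler_sum => k _; apply: ler_sum => p _; rewrite vw.
have nz : n2 (L + L) n zeta <= 1 + 1.
  rewrite /n2 big_split_ord /=; apply: lerD.
    have := bd e2 eta _ _ eta1.
    rewrite (eq_bigr (fun i : 'I_L => \sum_(p < n) nc (zeta i p) ^+ 2)); last first.
      by move=> i _; apply: eq_bigr => p _; rewrite z1.
    apply=> k p km; first by rewrite /e2 km.
    by rewrite /e2 ltnNge km.
  have := bd x2 xi _ _ xi1.
  rewrite (eq_bigr (fun i : 'I_L => \sum_(p < n) nc (zeta (L + i)%N p) ^+ 2)); last first.
    by move=> i _; apply: eq_bigr => p _; rewrite z2.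
  apply=> k p km; first by rewrite /x2 km ncM c1 mul1r.
  by rewrite /x2 ltnNge km.
have := le_trans h nz; move: (nc _) => r; lra.
Qed.

(** Otherwise x0 / c has norm above 1 and is separated from the self-adjoint part of the unit ball.
    The separating f is self-adjoint, so [ale_of_sa] extends its bound to the whole ball and f has
    dual norm at most 1. *)
Theorem sa_norm_duality (x0 : Moo X) (c : R) : msa x0 -> 0 < c ->
  (forall f : Moo X', (forall i j x, f i j (star X x) = (f j i x)^*) ->
     dual_norm N f <= 1 -> ale (parr f x0) c) -> N x0 <= c.
Proof.
move=> xs c0 h; rewrite leNgt; apply/negP => x0c.
pose K : set (Moo X) := [set x | msa x /\ N x <= 1].
pose t := c^-1; have t0 : 0 < t by rewrite invr_gt0.
pose x1 := t%:C%C *: x0.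
have x1s : msa x1.
  have := mstar_lin sl t%:C%C x0 0; rewrite !addr0 conjC_real xs.
  have -> : mstar (0 : Moo X) = 0 by apply: mooP => i j; rewrite (mstarEE sl) (star0 sl).
  by rewrite addr0.
have x1n : 1 < N x1 by rewrite (smos_normZr HX) gtr0_norm // /t ltr_pdivlMl // mulr1.
have ncl : ~ norm_closure N K x1.
  move=> /(_ (N x1 - 1)); rewrite subr_gt0 => /(_ x1n) [y [_ y1]].
  rewrite ltrBrDl; apply/negP; rewrite -leNgt.
  have := smos_normD HX (x1 - y) y; rewrite subrK => /le_trans; apply.
  by rewrite addrC lerD2r.
have [||f [fs fK [m [n [eta f0]]]]] := matrix_separation _ _ x1s ncl.
- by move=> x [].
- move=> r a x xp a1; split.
    elim/big_ind: _ => [|y z ys zs|k _].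
    + by apply: mooP => i j; rewrite (mstarEE sl) (star0 sl).
    + by have := mstar_lin sl 1 y z; rewrite conjC1 !scale1r ys zs.
    + by apply: (msa_msand sl); case: (xp k).
  have := @matrix_norm_sand _ _ _ HN r a a x 1 1 1 a1 a1 ler01.
  by rewrite sqrtr1 !mul1r; apply => k; case: (xp k).
have f1 : dual_norm N f <= 1.
  apply: (dual_norm_le ler01) => x; apply: ale_of_sa => // y ys y1.
  exact: fK.
have := ale_form (h f fs f1) m n eta eta; rewrite -expr2 sqr_sqrtr ?n2_ge0 //.
apply/negP; rewrite -ltNge.
move: f0; rewrite afm_parrZ ReZ mulrC ltr_pdivlMr // mulrC => /lt_le_trans; apply.
exact: Re_le_nc.
Qed.

Lemma norming_functional (x0 : X) : exists f : X',
  (forall x, nc (f x) <= norm1 x) /\ f x0 = (norm1 x0)%:C%C.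
Proof.
have sp : sublinear (@norm1 R X).
  split=> [x y|t x t0]; first exact: norm1D.
  by rewrite norm1Z // nc_real gtr0_norm.
have [F [FD FZ Fp F0]] := sublinear_majorized x0 sp.
pose g x := (F x)%:C%C - 'i%C * (F ('i%C *: x))%:C%C.
have FN x : F (- x) = - F x.
  have F00 : F 0 = 0 by have := FZ 0 0; rewrite scaler0 mul0r.
  by apply/eqP; rewrite -addr_eq0 -FD addNr F00.
have gRe x : complex.Re (g x) = F x by rewrite /g /=; ring.
have g_lin : scalar g.
  move=> c x y.
  have gD u v : g (u + v) = g u + g v.
    by rewrite /g scalerDr !FD !rcD; ring.
  have gr (t : R) u : g (t%:C%C *: u) = t%:C%C * g u.
    by rewrite /g scalerA [_ * t%:C%C]mulrC -scalerA !FZ !rcM; ring.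
  have gi u : g ('i%C *: u) = 'i%C * g u.
    rewrite /g scalerA mul_ii scaleN1r FN.
    by apply/eqP; rewrite eq_complex /=; apply/andP; split; apply/eqP; ring.
  rewrite gD; congr (_ + _).
  have -> : c = (complex.Re c)%:C%C + (complex.Im c)%:C%C * 'i%C.
    by case: c => a b; apply/eqP; rewrite eq_complex /=; apply/andP; split; apply/eqP; ring.
  rewrite scalerDl gD gr -scalerA gr gi.
  by rewrite /GRing.scale /=; ring.
have gb x : nc (g x) <= norm1 x.
  have [u u1 uE] := phase (g x).
  have := Fp (u *: x); rewrite norm1Z // u1 mul1r -gRe.
  by have -> : g (u *: x) = u * g x; [exact: (@linZ _ _ R[i]^o _ g_lin)|rewrite uE].
have [||f fE] := @bd_ex _ _ (@norm1 R X) g; first exact: g_lin.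
  by exists 1 => x; rewrite mul1r.
exists f; split=> [x|]; first by rewrite fE.
have h := gb x0; rewrite fE.
(* The real part of g x0 already equals the bound on its modulus, which leaves no room for an
   imaginary part. *)
move: (gRe x0); rewrite F0; case: (g x0) h => a b /= h ab; subst a.
congr (_ +i* _)%C; move: h; rewrite /Normc.normc.
rewrite -[X in _ <= X]ger0_norm; last exact: norm1_ge0.
rewrite -sqrtr_sqr ler_sqrt ?sqr_ge0 // gerDl => b0.
by apply/eqP; rewrite -sqrf_eq0 eq_le b0 sqr_ge0.
Qed.

Lemma functionals_separate (x : X) : (forall f : X', f x = 0) -> x = 0.
Proof.
move=> h; have [f [_ fx]] := norming_functional x; apply: (norm1_eq0 HN).
by move: fx; rewrite h => /(congr1 (@complex.Re R)).
Qed.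

Lemma ale_mx1 (f : X') : (forall x, nc (f x) <= norm1 x) -> forall x, ale (parr (mx1 f) x) (N x).
Proof.
move=> f1 x m n xi eta xi1 eta1; rewrite afm_parr.
case: n xi1 eta1 => [|n] xi1 eta1; first by rewrite big_ord0 nc0.
rewrite big_ord_recl [X in _ + X]big1 ?addr0; last first.
  by move=> a _; apply: big1 => b _; rewrite mx1E bd_fun0.
rewrite big_ord_recl [X in _ + X]big1 ?addr0; last first.
  by move=> a _; rewrite mx1E bd_fun0.
rewrite mx1E /=; apply: le_trans (f1 _) _.
apply: (le_trans (norm_comb HN m x (fun k => eta k 0%N) (fun k => xi k 0%N))).
have s1 (v : nat -> nat -> R[i]) : n2 m n.+1 v <= 1 -> Num.sqrt (\sum_(k < m) nc (v k 0%N) ^+ 2) <= 1.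
  move=> v1; rewrite -sqrtr1 ler_wsqrtr //; apply: le_trans v1.
  rewrite /n2; apply: ler_sum => k _; rewrite big_ord_recl lerDl.
  by apply: sumr_ge0 => i _; exact: sqr_ge0.
rewrite -[X in _ <= X]mul1r ler_wpM2r ?N_ge0 //.
by rewrite -[X in _ <= X]mul1r ler_pM ?sqrtr_ge0 // ?(s1 eta) ?(s1 xi).
Qed.

End Duality.

(** * Weak topologies *)

Section WeakTopologies.
Context {R : realType}.

(** Balls of [R[i]^o] have complex radii; this lemma and the next pass to the real-valued
    modulus. *)
Lemma nbhs_nc (z : R[i]^o) (e : R) : 0 < e -> nbhs z [set w : R[i]^o | nc (z - w) < e].
Proof.
move=> e0; apply/nbhs_ballP; exists e%:C%C => /=; first by rewrite ltcE /= eqxx.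
move=> w; rewrite /ball /= => h.
have {h} : ((nc (z - w))%:C%C : R[i]) < e%:C%C by exact: h.
by rewrite ltcE /= => /andP[].
Qed.

Lemma nbhs_ncP (z : R[i]^o) (A : set R[i]^o) : nbhs z A ->
  exists2 e : R, 0 < e & forall w, nc (z - w) < e -> A w.
Proof.
move=> /nbhs_ballP[e /= e0 zA]; move: (e0); rewrite ltcE /= => /andP[/eqP ei er].
exists (complex.Re e) => // w zw; apply: zA; rewrite /ball /=.
have -> : e = (complex.Re e)%:C%C by move: ei; case: (e) => a b /= ->.
have h : ((nc (z - w))%:C%C : R[i]) < (complex.Re e)%:C%C by rewrite ltcE /= eqxx.
exact: h.
Qed.

Lemma cvg_nc (T : Type) (F : set_system T) (FF : Filter F) (g : T -> R[i]^o) (z : R[i]^o) :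
  (forall e : R, 0 < e -> F [set t | nc (z - g t) < e]) -> g @ F --> z.
Proof.
move=> h A /nbhs_ncP[e e0 zA]; apply: (@filterS _ F FF _ _ _ (h _ e0)) => t gt.
exact: (zA _ gt).
Qed.

Section WeakTopologyOf.
Variables (V : choiceType) (Fs : set (V -> R[i])).
Local Notation W := (weak_topology_of Fs).

(** The universal property of the initial topology, through the product of copies of C with
    pointwise convergence. *)
Lemma weak_cvg (F : set_system V) (FF : Filter F) (v : V) :
  (forall g, Fs g -> (g : V -> R[i]^o) @ F --> (g v : R[i]^o)) -> F --> (v : W).
Proof.
move=> gF A; rewrite nbhsE => -[B [Bop Bv] BA].
case: Bop Bv BA => C Cop <- /= Cv CA.
set h := (fun x : V => _) in Cv CA.
have hF : h @ F --> (h v : {ptws set_type Fs -> R[i]^o}).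
  apply/cvg_sup => i A'; rewrite nbhsE => -[B' [B'op B'v] BA'].
  case: B'op B'v BA' => D Dop <- /= Dv DA'.
  have : nbhs (h v i : R[i]^o) D by apply: open_nbhs_nbhs.
  move=> /(gF _ (set_valP i)) FD; apply: (@filterS _ F FF _ _ _ FD) => x Dx.
  exact: DA'.
apply: (@filterS _ F FF (h @^-1` C) _ CA); apply: hF.
by apply: open_nbhs_nbhs.
Qed.

Lemma weak_continuous (g : V -> R[i]) : Fs g -> continuous (g : W -> R[i]^o).
Proof.
move=> Fg v A; rewrite nbhsE => -[D [Dop Dv] DA].
pose i : set_type Fs := exist _ g (mem_set Fg).
pose h := (fun (x : V) => (fun g : set_type Fs => \val g x) : {ptws set_type Fs -> R[i]^o}).
have hc : continuous (h : W -> {ptws set_type Fs -> R[i]^o}) by exact: initial_continuous.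
have pc := @proj_continuous (set_type Fs) (fun=> R[i]^o : topologicalType) i (h v).
have : nbhs (h v) (proj i @^-1` D) by apply: pc; apply: open_nbhs_nbhs.
move=> /hc hD; change (nbhs (v : W) (g @^-1` A)).
by apply: (@filterS _ (nbhs (v : W)) _ _ _ _ hD) => x; exact: DA.
Qed.

Lemma weak_continuousP (T : topologicalType) (f : T -> W) :
  (forall g, Fs g -> continuous (g \o f : T -> R[i]^o)) -> continuous f.
Proof.
move=> gf t; apply: weak_cvg => g Fg; exact: (gf g Fg t).
Qed.

Lemma continuous_near (T : topologicalType) (g : T -> R[i]^o) : continuous g ->
  forall t (e : R), 0 < e -> nbhs t [set s | nc (g t - g s) < e].
Proof. by move=> gc t e e0; exact: (gc t _ (nbhs_nc (g t) e0)). Qed.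

Lemma closure_approx (T : topologicalType) (A : set T) (t : T) (g : T -> R[i]^o) :
  closure A t -> continuous g -> forall e : R, 0 < e -> exists2 a, A a & nc (g t - g a) < e.
Proof.
by move=> At gc e e0; have [a [Aa h]] := At _ (continuous_near gc t e0); exists a.
Qed.

End WeakTopologyOf.

Section FiniteDual.
Variable V : lmodType R[i].

(** Induction on r. Either g_r vanishes on the common kernel of the others and is redundant, or some
    v in that kernel has g_r v <> 0, and subtracting the multiple t of g_r reduces to the case r. *)
Lemma functional_combination (r : nat) (g : nat -> V -> R[i]) (psi : V -> R[i]) :
  (forall i, scalar (g i)) -> scalar psi ->
  (forall v, (forall i, (i < r)%N -> g i v = 0) -> psi v = 0) ->
  exists c : nat -> R[i], forall v, psi v = \sum_(i < r) c i * g i v.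
Proof.
move=> gl; elim: r psi => [|r IH] psi pl h.
  by exists (fun=> 0) => v; rewrite big_ord0 h.
have [h'|/existsNP[v /not_implyP[v0 gv]]] :=
    pselect (forall v, (forall i, (i < r)%N -> g i v = 0) -> g r v = 0).
  have [v vr|c cE] := IH psi pl.
    apply: h => i; rewrite ltnS leq_eqVlt => /predU1P[->|]; [exact: h'|exact: vr].
  exists (fun i => if i == r then 0 else c i) => v.
  rewrite big_ord_recr /= eqxx mul0r addr0 cE.
  by apply: eq_bigr => i _; rewrite (ltn_eqF (ltn_ord i)).
pose t := psi v / g r v.
have gv0 : g r v != 0 by apply/eqP.
have [|u u0|c cE] := IH (fun u => psi u - t * g r u).
- move=> a x y; rewrite pl gl.
  by rewrite /GRing.scale /=; ring.
- pose w := u - (g r u / g r v) *: v.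
  have gw i : g i w = g i u - g r u / g r v * g i v.
    by rewrite /w (@linB _ _ R[i]^o _ (gl i)) (@linZ _ _ R[i]^o _ (gl i)).
  have : psi w = 0.
    apply: h => i; rewrite ltnS leq_eqVlt => /predU1P[->|ir]; rewrite gw.
      by rewrite divfK // subrr.
    by rewrite (u0 _ ir) (v0 _ ir); ring.
  rewrite /w (@linB _ _ R[i]^o _ pl) (@linZ _ _ R[i]^o _ pl) => /eqP.
  by rewrite subr_eq0 => /eqP ->; rewrite /t /GRing.scale /=; apply/eqP; rewrite subr_eq0; apply/eqP; field.
exists (fun i => if i == r then t else c i) => u.
rewrite big_ord_recr /= eqxx [X in X + _](_ : _ = \sum_(i < r) c i * g i u).
  by rewrite -cE subrK.
by apply: eq_bigr => i _; rewrite (ltn_eqF (ltn_ord i)).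
Qed.

(* A weakly continuous functional is controlled near 0, hence annihilated, by finitely many elements of Fs. *)
Lemma weak_functional (Fs : set (V -> R[i])) (psi : V -> R[i]) :
  (forall g, Fs g -> scalar g) -> scalar psi ->
  continuous (psi : weak_topology_of Fs -> R[i]^o) ->
  exists r (g : nat -> V -> R[i]) (c : nat -> R[i]),
    (forall i, (i < r)%N -> Fs (g i)) /\ forall v, psi v = \sum_(i < r) c i * g i v.
Proof.
move=> Fl pl pc.
have p0 : psi 0 = 0 by exact: (@lin0 _ _ R[i]^o _ pl).
pose G : set_system V := [set A | exists r (g : nat -> V -> R[i]) (e : R),
  [/\ 0 < e, forall i, (i < r)%N -> Fs (g i) &
      forall v, (forall i, (i < r)%N -> nc (g i v) < e) -> A v]].
have GF : Filter G.
  split.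
  - by exists 0%N, (fun _ _ => 0), 1; split.
  - move=> A B [r [g [e [e0 Fg gA]]]] [r' [g' [e' [e0' Fg' gB]]]].
    exists (r + r')%N, (fun i => if (i < r)%N then g i else g' (i - r)%N), (Num.min e e').
    split; first by rewrite lt_min e0.
      move=> i ir; case: ifP => [/Fg //|/negbT]; rewrite -leqNgt => ri.
      by apply: Fg'; rewrite ltn_subLR.
    move=> v vg; split.
      apply: gA => i ir; have := vg i (leq_trans ir (leq_addr _ _)).
      by rewrite ir lt_min => /andP[].
    apply: gB => i ir; have := vg (r + i)%N; rewrite ltn_add2l ir => /(_ isT).
    by rewrite ltnNge leq_addr /= addKn lt_min => /andP[].
  - move=> A B AB [r [g [e [e0 Fg gA]]]]; exists r, g, e; split=> // v /gA; exact: AB.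
have G0 : G --> (0 : weak_topology_of Fs).
  apply: weak_cvg => g Fg; apply: cvg_nc => e e0; exists 1%N, (fun=> g), e; split=> // v /(_ 0%N isT).
  by rewrite /= (@lin0 _ _ R[i]^o _ (Fl _ Fg)) sub0r ncN.
have [r [g [e [e0 Fg gA]]]] : G [set v | nc (psi 0 - psi v) < 1].
  by apply: G0; apply: (continuous_near pc).
pose g' i := if (i < r)%N then g i else (fun=> 0).
have [|||c cE] := @functional_combination r g' psi.
- move=> i; rewrite /g'; case: ifP => [/Fg /Fl //|_ a x y].
  by rewrite /GRing.scale /= mulr0 addr0.
- exact: pl.
- move=> v v0; apply: Normc.eq0_normc; apply/eqP; rewrite eq_le nc_ge0 andbT leNgt.
  apply/negP => pv; pose t := ((nc (psi v))^-1)%:C%C : R[i].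
  have := gA (t *: v); rewrite /= p0 sub0r ncN (@linZ _ _ R[i]^o _ pl) => h.
  have : nc (t * psi v) < 1.
    apply: h => i ir; rewrite (@linZ _ _ R[i]^o _ (Fl _ (Fg _ ir))).
    by have := v0 i ir; rewrite /g' ir => ->; rewrite scaler0 nc0.
  by rewrite ncM nc_real ger0_norm ?invr_ge0 ?nc_ge0 // mulVf ?gt_eqF // ltxx.
exists r, g, c; split=> // v; rewrite cE; apply: eq_bigr => i _.
by rewrite /g' ltn_ord.
Qed.

End FiniteDual.
End WeakTopologies.

Section Subspaces.
Context {R : realType} (V : lmodType R[i]) (T : submodClosed V).

Lemma subsp_val_lin (c : R[i]) (s t : subsp T) :
  subsp_val (c *: s + t) = c *: subsp_val s + subsp_val t.
Proof. by []. Qed.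

Lemma subsp_ext (s t : subsp T) : subsp_val s = subsp_val t -> s = t.
Proof. exact: val_inj. Qed.

Lemma subsp_val_sum (J : Type) (r : seq J) (P : pred J) (F : J -> subsp T) :
  subsp_val (\sum_(k <- r | P k) F k) = \sum_(k <- r | P k) subsp_val (F k).
Proof. by apply: (big_morph (@subsp_val _ _ T)). Qed.

End Subspaces.

Section EvaluationPredicate.
Context {R : realType} (X : smosData R) (nu : Moo (bdfun (@norm1 R X)) -> R).

Definition ev_pred : {pred bdfun (@norm1 R (dual_with nu))} :=
  fun phi => `[< @predual R X nu phi >].

Lemma ev_submod_closed : submod_closed ev_pred.
Proof.
split=> [|c phi psi].
  by apply/asboolP; exists 0 => f; rewrite bd_fun0 bd0.
move=> /asboolP[x xE] /asboolP[y yE]; apply/asboolP; exists (c *: x + y) => f.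
by rewrite bd_funD bd_funZ xE yE bdD bdZ.
Qed.

HB.instance Definition _ := GRing.isSubmodClosed.Build R[i]
  (bdfun (@norm1 R (dual_with nu))) ev_pred ev_submod_closed.

End EvaluationPredicate.

(** * The dual space with an equivalent norm as a dual SMOS *)

Section DualSmos.
Context {R : realType} (X : smosData R).
Hypothesis HX : is_smos X.
Local Notation X' := (bdfun (@norm1 R X)).
Local Notation N := (mnorm X).

Let sl := smos_star_lin HX.
Let sK := smos_starK HX.
Let HN := smos_norm HX.
Let N_ge0 := matrix_norm_ge0 HN.

Lemma norm1_le_of_functionals (x : X) c :
  (forall f : X', (forall y, nc (f y) <= norm1 y) -> nc (f x) <= c) -> norm1 x <= c.
Proof.
move=> h; have [f [f1 fx]] := norming_functional HX x.
by have := h f f1; rewrite fx nc_real ger0_norm // norm1_ge0.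
Qed.

Lemma bd_unit (f : X') : exists2 K : R, 0 < K &
  exists g : X', (forall y, nc (g y) <= norm1 y) /\ forall y, f y = K%:C%C * g y.
Proof.
have [K K0 fK] := bd_bound HN f.
have K1 : 0 < K + 1 by rewrite ltr_wpDl.
exists (K + 1) => //; exists (((K + 1)^-1)%:C%C *: f); split=> y.
  rewrite bd_funZ ncM nc_real ger0_norm ?invr_ge0 ?(ltW K1) // ler_pdivrMl //.
  by apply: le_trans (fK y) _; rewrite ler_wpM2r ?norm1_ge0 // lerDl.
by rewrite bd_funZ mulrA -rcM mulfV ?gt_eqF // rc1 mul1r.
Qed.

Hypothesis HXc : complete_smos X.

(** A function that is approximated by evaluations uniformly on the unit ball of the dual is itself
    an evaluation: the approximating points are Cauchy because functionals compute the norm of X,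
    and X is complete. *)
Lemma ev_closed (psi : X' -> R[i]) :
  (forall (c : R[i]) f, psi (c *: f) = c * psi f) ->
  (forall e : R, 0 < e -> exists x : X, forall f : X', (forall y, nc (f y) <= norm1 y) ->
     nc (psi f - f x) <= e) ->
  exists x : X, forall f, psi f = f x.
Proof.
move=> psiZ h.
have inv0 n : 0 < (n.+1%:R)^-1 :> R by rewrite invr_gt0 ltr0Sn.
pose u n := projT1 (cid (h _ (inv0 n))).
have uP n := projT2 (cid (h _ (inv0 n))).
have uu n m : norm1 (u n - u m) <= (n.+1%:R)^-1 + (m.+1%:R)^-1.
  apply: norm1_le_of_functionals => f f1; rewrite bdB.
  have -> : f (u n) - f (u m) = (psi f - f (u m)) - (psi f - f (u n)) by ring.
  by apply: le_trans (ncB _ _) _; rewrite addrC lerD // uP.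
have [l lim] : exists l, forall e, 0 < e -> exists n0, forall n, (n0 <= n)%N -> norm1 (u n - l) < e.
  apply: HXc => e e0; have e2 : 0 < e / 2 by rewrite divr_gt0.
  have [n0 n0P] := inv_small e2; exists n0 => n m n0n n0m.
  by apply: le_lt_trans (uu n m) _; rewrite [e]splitr ltrD ?n0P.
exists l => f; have [K K0 [g [g1 fg]]] := bd_unit f.
have gE : psi g = g l.
  apply/eqP; rewrite -subr_eq0; apply/eqP; apply: Normc.eq0_normc; apply/eqP.
  rewrite eq_le nc_ge0 andbT; apply: le_eps => e e0; rewrite add0r.
  have e2 : 0 < e / 2 by rewrite divr_gt0.
  have [n0 n0P] := inv_small e2; have [n1 n1P] := lim _ e2.
  pose n := maxn n0 n1.
  have -> : psi g - g l = (psi g - g (u n)) + (g (u n) - g l) by ring.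
  apply: le_trans (ncD _ _) _; rewrite [e]splitr; apply: lerD.
    by apply: le_trans (uP n g g1) _; rewrite ltW // n0P // leq_maxl.
  rewrite -bdB; apply: le_trans (g1 _) _.
  by rewrite ltW // n1P // leq_maxr.
have -> : f = K%:C%C *: g by apply: bd_ext => y; rewrite bd_funZ fg.
by rewrite psiZ gE bd_funZ.
Qed.

Section EquivalentNorm.
Variables (lam : Moo X -> R) (C : R).
Hypotheses (Hlam : matrix_norm lam) (lam_ge : forall x, N x <= lam x).
Hypothesis lam_le : forall x, lam x <= C * N x.

Let nu : Moo X' -> R := dual_norm lam.
Let D := dual_with nu.
Hypothesis nu_star : forall f : Moo D, nu (mstar f) = nu f.

Let Hnu : matrix_norm nu. Proof. exact: (dual_norm_matrix HN Hlam lam_ge). Qed.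
Let nu_ale (f : Moo X') x : ale (parr f x) (nu f * lam x) := dual_norm_ale HN Hlam lam_ge f x.
Let lam_ge0 := matrix_norm_ge0 Hlam.

Lemma dual_star_lin (c : R[i]) (f g : D) : star D (c *: f + g) = c^* *: star D f + star D g.
Proof.
apply: bd_ext => x; rewrite bd_funD bd_funZ.
rewrite !(dual_starE HX) -[(c *: f + g) _]/(c * (f : X') (star X x) + (g : X') (star X x)).
by rewrite conjD conjM.
Qed.

Lemma dual_starK : involutive (star D).
Proof. by move=> f; apply: bd_ext => x; rewrite !(dual_starE HX) sK conjCK. Qed.

Lemma is_smos_dual_with : is_smos D.
Proof.
split.
- exact: Hnu.
- by split; [exact: dual_star_lin|exact: dual_starK].
- exact: nu_star.
- split; first by move=> f [fs _].
  move=> f fcl.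
  have fs i j x : f i j (star X x) = (f j i x)^*.
    suff fsa : mstar f = f by apply/(dual_saP HX): i j x; exact: fsa.
    have msB (g h : Moo D) : mstar (g - h) = mstar g - mstar h.
      have := mstar_lin dual_star_lin (-1) h g; rewrite conjN conjC1 !scaleN1r.
      by rewrite [- h + g]addrC [- mstar h + _]addrC.
    apply/eqP; rewrite -subr_eq0; apply/eqP; case: (Hnu) => h0 _ _ _; apply: h0.
    apply/eqP; rewrite eq_le (matrix_norm_ge0 Hnu) andbT; apply: le_eps => e e0.
    have e2 : 0 < e / 2 by rewrite divr_gt0.
    have [g [gs _] fg] := fcl _ e2.
    have gsa : mstar g = g by exact: gs.
    have -> : mstar f - f = mstar (f - g) - (f - g).
      by rewrite msB gsa opprB addrA subrK.
    rewrite add0r; apply: le_trans (matrix_normB Hnu _ _) _.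
    by rewrite nu_star [e]splitr lerD // ltW.
  apply/(dual_coneP HX); split=> // x xp m n eta.
  rewrite (afm_herm HX _ _ _ fs (smos_cone_sa HX xp)) lecE /= eqxx /=.
  rewrite -oppr_le0; apply: le_eps => e e0; rewrite add0r.
  (* The form of f - g at eta is at most nu (f - g) times lam x |eta|^2, so approximating f within e
     / B changes it by at most e. *)
  pose B := lam x * (n2 m n eta) + 1.
  have B0 : 0 < B by rewrite ltr_wpDl ?mulr_ge0 ?n2_ge0.
  have eB : 0 < e / B by rewrite divr_gt0.
  have [g /(dual_coneP HX)[gs gp] fg] := fcl _ eB.
  have := gp x xp m n eta; rewrite lecE => /andP[_ /= g0].
  have -> : - complex.Re (afm (parr f x) m n eta eta) =
    - complex.Re (afm (parr (f - g) x) m n eta eta) - complex.Re (afm (parr g x) m n eta eta).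
    have := parr_linf 1 (f - g) g x; rewrite scale1r subrK => ->.
    by rewrite afm_lin mul1r ReD opprD.
  rewrite -[X in _ <= X]addr0 lerD ?oppr_le0 //.
  rewrite -ReN; apply: le_trans (Re_le_nc _) _; rewrite ncN.
  apply: le_trans (ale_form (nu_ale (f - g) x) m n eta eta) _.
  rewrite -expr2 sqr_sqrtr ?n2_ge0 // -mulrA.
  apply: (@le_trans _ _ (e / B * (lam x * n2 m n eta))).
    by rewrite ler_wpM2r ?mulr_ge0 ?n2_ge0 // ltW.
  rewrite -mulrA mulrC ler_piMl ?(ltW e0) // mulrC ler_pdivrMr // mul1r.
  by rewrite /B lerDl.
- move=> m a f fp.
  have fp' k : (forall i j x, f k i j (star X x) = (f k j i x)^*) /\ forall x, mcone X x -> apos (parr (f k) x).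
    by apply/(dual_coneP HX); exact: fp.
  apply/(dual_coneP HX); split.
    apply/(dual_saP HX); suff : msa (\sum_(k < m) msand (a k) (f k) (a k) : Moo D) by [].
    elim/big_ind: _ => [|g h gs hs|k _].
    + by apply: mooP => i j; rewrite (mstarEE dual_star_lin) (star0 dual_star_lin).
    + by have := mstar_lin dual_star_lin 1 g h; rewrite conjC1 !scale1r gs hs.
    + by apply: (msa_msand dual_star_lin); case: (fp k).
  move=> x xp; have [L fL] := common_Mn f.
  (* The scalar matrices act on the indices of f, which are the inner ones in [parr]; hence the flip
     before and after. *)
  have := @apos_sand _ m L (fun k => a k) (fun k i j k' l' => parr (f k) x k' l' i j).
  move=> /(_ (fun k => apos_flip ((fp' k).2 x xp))) /apos_flip.
  congr apos; apply: arrP => k l p q; rewrite /parr moo_sum bd_fun_sum; apply: eq_bigr => i _.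
  rewrite (@msandE _ _ L L); last exact: fL.
  rewrite bd_fun_sum; apply: eq_bigr => s _; rewrite bd_fun_sum; apply: eq_bigr => t _.
  by rewrite bd_funZ.
Qed.

Let HD := is_smos_dual_with.

Lemma predual_value (phi : bdfun (@norm1 R D)) (f : D) :
  nc (phi f) <= @norm1 R (dual D) phi * norm1 f.
Proof.
have := ale_entry 0 0 0 0 (dual_norm_ale (smos_norm HD) (smos_norm HD) (fun x => lexx _) (mx1 phi) (mx1 f)).
by rewrite /parr !mx1E.
Qed.

Lemma ev_exists (x : X) : exists phi : bdfun (@norm1 R D), forall f : X', phi f = f x.
Proof.
apply: bd_ex => [c f g|].
  by rewrite bd_funD bd_funZ.
exists (lam (mx1 x)) => f; have := ale_entry 0 0 0 0 (nu_ale (mx1 f) (mx1 x)).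
by rewrite /parr !mx1E /= mulrC.
Qed.

Lemma norm_ev (Phi : Moo (dual D)) (x : Moo X) :
  (forall i j (f : X'), (Phi i j : bdfun (@norm1 R D)) f = f (x i j)) ->
  mnorm (dual D) Phi <= lam x.
Proof.
move=> PhiE; apply: (dual_norm_le (lam_ge0 x)) => F F1.
have -> : parr Phi F = fun k l a b => parr F x a b k l.
  by apply: arrP => k l a b; rewrite /parr PhiE.
apply: (@ale_flip _ (parr F x)); apply: aleW (nu_ale F x).
by rewrite ler_piMl ?lam_ge0.
Qed.

Lemma norm1_dual_le1 (f : X') : (forall y, nc (f y) <= norm1 y) -> @norm1 R D f <= 1.
Proof.
move=> f1; apply: (dual_norm_le ler01) => x x1; apply: aleW (ale_mx1 HX f1 x).
exact: le_trans (lam_ge x) x1.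
Qed.

Local Notation S := (@ev_pred R X nu : submodClosed (dual D)).

Lemma sub_matrix_norm (Y : smosData R) (T : submodClosed Y) :
  matrix_norm (mnorm Y) -> matrix_norm (mnorm (sub_smos (X := Y) T)).
Proof.
move=> [h1 h2 h3 h4].
have vE (x : Moo (subsp T)) i j : mmap (subsp_val (S := T)) x i j = subsp_val (x i j).
  by apply: mmapE.
have vD (x y : Moo (subsp T)) : mmap (subsp_val (S := T)) (x + y) = mmap (subsp_val (S := T)) x + mmap (subsp_val (S := T)) y.
  by apply: mooP => i j; rewrite mooD !vE.
have vZ (c : R[i]) (x : Moo (subsp T)) : mmap (subsp_val (S := T)) (c *: x) = c *: mmap (subsp_val (S := T)) x.
  by apply: mooP => i j; rewrite mooZ !vE.
have v0 : mmap (subsp_val (S := T)) (0 : Moo (subsp T)) = 0.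
  by apply: mooP => i j; rewrite vE.
have vS (I : Type) (r : seq I) (P : pred I) (F : I -> Moo (subsp T)) :
  mmap (subsp_val (S := T)) (\sum_(k <- r | P k) F k) = \sum_(k <- r | P k) mmap (subsp_val (S := T)) (F k).
  by apply: (big_morph _ vD v0).
split.
- move=> x /h1 x0; apply: mooP => i j; apply: val_inj.
  by rewrite -[LHS]/(subsp_val (x i j)) -vE x0.
- by move=> x y; rewrite /= vD h2.
- by move=> c x; rewrite /= vZ h3.
- move=> m a b x; rewrite /= vS.
  rewrite (eq_bigr (fun k => msand (a k) (mmap (subsp_val (S := T)) (x k)) (b k))) ?h4 // => k _.
  have [n xn] := moo_finsupp (x k).
  apply: mooP => i j; rewrite vE !(@msandE _ _ n n) //; last by move=> p q /xn h; rewrite vE h.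
  rewrite subsp_val_sum; apply: eq_bigr => p _; rewrite subsp_val_sum; apply: eq_bigr => q _.
  by rewrite vE.
Qed.

Lemma ev_sub (x : X) : exists s : subsp S,
  forall f : X', (subsp_val s : bdfun (@norm1 R D)) f = f x.
Proof.
have [phi phiE] := ev_exists x.
have phiS : phi \in (S : {pred dual D}) by apply/asboolP; exists x.
by exists (SubSp phiS).
Qed.

Lemma sub_ev (s : subsp S) : exists x : X,
  forall f : X', (subsp_val s : bdfun (@norm1 R D)) f = f x.
Proof. by case: s => phi /= /asboolP. Qed.

Let HDD : matrix_norm (mnorm (dual D)).
Proof. exact: (dual_norm_matrix (smos_norm HD) (smos_norm HD) (fun x => lexx _)). Qed.

Let HS : matrix_norm (mnorm (sub_smos (X := dual D) S)) := @sub_matrix_norm (dual D) S HDD.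

Lemma norm1_sub (s : subsp S) :
  @norm1 R (sub_smos (X := dual D) S) s = @norm1 R (dual D) (subsp_val s).
Proof.
rewrite /norm1 /=; congr (dual_norm _ _); apply: mooP => i j.
by rewrite mmapE // !mx1E; case: ifP.
Qed.

Lemma canonical_mapE (f : D) (s : subsp S) :
  (canonical_map S f : bdfun (@norm1 R (sub_smos (X := dual D) S))) s =
  (subsp_val s : bdfun (@norm1 R D)) f.
Proof.
apply: bd_insub.
  by move=> c t t'; rewrite subsp_val_lin bd_funD bd_funZ.
exists (norm1 f) => t; rewrite norm1_sub mulrC; exact: predual_value.
Qed.

(** The predual consists of the evaluations at points of X; it is closed by [ev_closed]. A
    functional g on it is the image of x |-> g (ev x). For the isometry, one bound is the definition
    of the norm in the dual of D, and the other follows since ev x has norm at most lam x, which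
    leaves enough test matrices. *)
Lemma predual_is_predual : is_predual (@predual R X nu : set (dual D)).
Proof.
exists S; split.
- by move=> phi; split=> /asboolP.
- move=> phi [x xE]; exists (star X x) => f.
  have := dual_starE HD phi f; rewrite -[dual_star phi]/(star (dual D) phi) => ->.
  rewrite xE; have := dual_starE HX f x; rewrite -[dual_star f]/(star D f) => ->.
  by rewrite conjCK.
- move=> phi phicl.
  have [|e e0|x xE] := @ev_closed (fun f => phi f); last by exists x.
  + by move=> c f; rewrite bdZ.
  + have [psi [x xE] dist] := phicl e e0; exists x => f f1.
    rewrite -xE -[phi f - psi f]/((phi - psi) f).
    apply: le_trans (predual_value (phi - psi) f) _.
    rewrite -[e]mulr1 ler_pM ?(norm1_ge0 HDD) ?(norm1_ge0 Hnu) ?norm1_dual_le1 //.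
      exact: (@norm1_ge0 R D Hnu f).
    exact: ltW.
- move=> g.
  pose EV x := projT1 (cid (ev_sub x)).
  have EVE x (f : X') : (subsp_val (EV x) : bdfun (@norm1 R D)) f = f x := projT2 (cid (ev_sub x)) f.
  have EVl (c : R[i]) x y : EV (c *: x + y) = c *: EV x + EV y.
    apply: subsp_ext; rewrite subsp_val_lin; apply: bd_ext => f.
    by rewrite bd_funD bd_funZ !EVE bdD bdZ.
  have [K K0 gK] := bd_bound HS g.
  have [||f fE] := @bd_ex _ _ (@norm1 R X) (fun x => (g : bdfun _) (EV x)).
  + by move=> c x y; rewrite EVl bdD bdZ.
  + exists (K * C) => x; apply: le_trans (gK _) _; rewrite -mulrA ler_wpM2l //.
    rewrite norm1_sub; apply: le_trans (lam_le _).
    apply: norm_ev => i j h; rewrite !mx1E; case: ifP => _; first exact: EVE.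
    by rewrite bd0.
  exists f; apply: bd_ext => s; rewrite canonical_mapE.
  have [x xE] := sub_ev s; rewrite xE fE; congr ((g : bdfun _) _).
  by apply: subsp_ext; apply: bd_ext => h; rewrite EVE -xE.
- move=> F.
  pose cF : Moo (bdfun (@norm1 R (sub_smos (X := dual D) S))) := mmap (canonical_map S) F.
  have can0 : canonical_map S (0 : D) = 0.
    by apply: bd_ext => s; rewrite canonical_mapE bd0 bd_fun0.
  have cFE i j s : cF i j s = (subsp_val s : bdfun (@norm1 R D)) (F i j).
    by rewrite /cF mmapE // canonical_mapE.
  have vE (P : Moo (subsp S)) i j : mmap (subsp_val (S := S)) P i j = subsp_val (P i j).
    by apply: mmapE.
  rewrite -/cF; apply/eqP; rewrite eq_le; apply/andP; split.
    apply: (dual_norm_le (matrix_norm_ge0 Hnu F)) => P P1.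
    pose Q : Moo (bdfun (@norm1 R D)) := mmap (subsp_val (S := S)) P.
    have QE k l : Q k l = subsp_val (P k l) := vE P k l.
    have -> : parr cF P = fun k l a b => parr Q F a b k l.
      apply: arrP => k l a b.
      exact: (etrans (cFE a b (P k l)) (congr1 (fun h : bdfun (@norm1 R D) => h (F a b)) (esym (QE k l)))).
    apply: (@ale_flip _ (parr Q F)).
    have := dual_norm_ale (smos_norm HD) (smos_norm HD) (fun x => lexx _) Q F.
    apply: aleW; apply: ler_piMl; [exact: (matrix_norm_ge0 Hnu)|exact: P1].
  apply: (dual_norm_le (dual_norm_ge0 HS HS (fun x => lexx _) cF)) => x x1.
  pose EV x := projT1 (cid (ev_sub x)).
  have EVE y (f : X') : (subsp_val (EV y) : bdfun (@norm1 R D)) f = f y := projT2 (cid (ev_sub y)) f.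
  have EV0 : EV 0 = 0.
    by apply: subsp_ext; apply: bd_ext => f; rewrite EVE bd0.
  pose P : Moo (subsp S) := mmap EV x.
  have PE i j : P i j = EV (x i j) by apply: mmapE.
  have P1 : mnorm (sub_smos (X := dual D) S) P <= 1.
    pose Q : Moo (bdfun (@norm1 R D)) := mmap (subsp_val (S := S)) P.
    have QE i j : Q i j = subsp_val (EV (x i j)).
      by have := vE P i j; rewrite PE.
    have QV i j (f : X') : Q i j f = f (x i j) by rewrite QE EVE.
    exact: (le_trans (norm_ev QV) x1).
  have -> : parr F x = parr cF P.
    apply: arrP => k l a b; rewrite /parr.
    by have := cFE a b (P k l); rewrite PE EVE => ->.
  apply: aleW (dual_norm_ale HS HS (fun x => lexx _) cF P).
  apply: ler_piMr; [exact: (dual_norm_ge0 HS HS (fun x => lexx _))|exact: P1].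
Qed.

(** Self-adjointness and each positivity condition involve only finitely many evaluations at points
    of X, and these are weak-* continuous. *)
Lemma cone_weak_closed : closed (mcone D : set (Moo_weakstar (@predual R X nu : set (dual D)))).
Proof.
pose MW := Moo_weakstar (@predual R X nu : set (dual D)).
move=> f fcl.
have evc i j (x : X) : continuous ((fun F : Moo X' => F i j x) : MW -> R[i]^o).
  have [phi phiE] := ev_exists x.
  apply: weak_continuous; exists phi; first by exists x.
  by exists i, j; apply/funext => F; rewrite phiE.
have fs i j x : f i j (star X x) = (f j i x)^*.
  apply/eqP; rewrite -subr_eq0; apply/eqP; apply: Normc.eq0_normc; apply/eqP.
  rewrite eq_le nc_ge0 andbT; apply: le_eps => e e0; rewrite add0r.
  have e2 : 0 < e / 2 by rewrite divr_gt0.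
  have c1 := continuous_near (evc i j (star X x)) f e2.
  have c2 := continuous_near (evc j i x) f e2.
  have [g [/(dual_coneP HX)[gs _] [/= h1 h2]]] := fcl _ (filterI c1 c2).
  have -> : f i j (star X x) - (f j i x)^* = (f i j (star X x) - g i j (star X x)) - (f j i x - g j i x)^*.
    rewrite gs conjD conjN; ring.
  apply: le_trans (ncB _ _) _; rewrite nc_conj [e]splitr lerD //; exact: ltW.
apply/(dual_coneP HX); split=> // x xp m n eta.
have afc : continuous ((fun F : Moo X' => afm (parr F x) m n eta eta) : MW -> R[i]^o).
  have sc (I : Type) (r : seq I) (G : I -> MW -> R[i]^o) : (forall i, continuous (G i)) ->
      continuous ((fun F => \sum_(i <- r) G i F) : MW -> R[i]^o).
    move=> Gc; elim: r => [|i r IH].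
      rewrite (_ : (fun F : MW => _) = (fun=> 0 : R[i]^o)); first exact: cst_continuous.
      by apply/funext => F; rewrite big_nil.
    rewrite (_ : (fun F : MW => _) = (fun F => G i F + \sum_(j <- r) G j F)).
      by move=> F; exact: (cvgD (Gc i F) (IH F)).
    by apply/funext => F; rewrite big_cons.
  do 4! (apply: (sc) => ?).
  move=> F; apply: (cvgM (cvgM _ (evc _ _ _ F)) _); exact: cvg_cst.
rewrite (afm_herm HX _ _ _ fs (smos_cone_sa HX xp)) lecE /= eqxx /=.
rewrite -oppr_le0; apply: le_eps => e e0; rewrite add0r.
have [g /(dual_coneP HX)[_ gp] fg] := closure_approx fcl afc e0.
have := gp x xp m n eta; rewrite lecE => /andP[_ /= g0].
have h := le_trans (Re_le_nc _) (ltW fg).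
have := Re_le_nc (afm (parr g x) m n eta eta - afm (parr f x) m n eta eta).
rewrite -ncN opprB => /le_trans /(_ (ltW fg)); rewrite ReB.
by rewrite lerBlDr => /(le_trans g0); rewrite -lerBlDr sub0r.
Qed.

End EquivalentNorm.
End DualSmos.

(** * Operators on Hilbert spaces *)

Section Riesz.
Context {R : realType} (H : hilbert R).
Local Notation dot := (hdot H).
Local Notation hn := (hnorm (hdot H)).

Lemma scalar_Re0 (V : lmodType R[i]) (g : V -> R[i]) : scalar g ->
  (forall v, complex.Re (g v) = 0) -> forall v, g v = 0.
Proof.
move=> gl g0 v; have := g0 ('i%C *: v); rewrite (@linZ _ _ R[i]^o _ gl).
have := g0 v; case: (g v) => a b /= ->.
rewrite /GRing.scale /= => h; apply/eqP; rewrite eq_complex /= eqxx /=; apply/eqP.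
by move: h; lra.
Qed.

(* The representing vector minimizes |v|^2 - 2 Re g(v). *)
Theorem riesz (g : H -> R[i]) K : scalar g -> (forall v, nc (g v) <= K * hn v) ->
  exists w, forall v, g v = dot v w.
Proof.
move=> gl gK.
pose q v := hn v ^+ 2 - 2 * complex.Re (g v).
have gD u v : g (u + v) = g u + g v := @linD _ _ R[i]^o _ gl u v.
have gZ c v : g (c *: v) = c * g v := @linZ _ _ R[i]^o _ gl c v.
have hD u v : hn (u + v) ^+ 2 = hn u ^+ 2 + hn v ^+ 2 + 2 * complex.Re (dot u v).
  rewrite [LHS]hnorm_sqr dnormD !ReD -!hnorm_sqr Re_conj; ring.
have qlb v : - K ^+ 2 <= q v.
  have := le_trans (Re_le_nc _) (gK v); rewrite /q.
  have := sqr_ge0 (hn v - K); nra.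
pose E := [set q v | v in [set: H]].
have Elb : has_lbound E by exists (- K ^+ 2) => _ [v _ <-]; exact: qlb.
pose m := inf E.
have mq v : m <= q v by apply: ge_inf => //; exists v.
have inv0 n : 0 < (n.+1%:R)^-1 :> R by rewrite invr_gt0 ltr0Sn.
have vex n : exists v, q v < m + (n.+1%:R)^-1.
  have hE : has_inf E by split=> //; exists (q 0), 0.
  by have [_ [v _ <-] h] := inf_adherent (inv0 n) hE; exists v.
pose v n := projT1 (cid (vex n)).
have vP n : q (v n) < m + (n.+1%:R)^-1 := projT2 (cid (vex n)).
(* The parallelogram identity makes every minimizing sequence Cauchy. *)
have par u w : hn (u - w) ^+ 2 <= 2 * (q u - m) + 2 * (q w - m).
  have := mq ((2^-1)%:C%C *: (u + w)); rewrite /q hnormZ nc_real gZ ReZ gD ReD.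
  rewrite ger0_norm ?invr_ge0 // exprMn hD.
  have -> : hn (u - w) ^+ 2 = hn u ^+ 2 + hn w ^+ 2 - 2 * complex.Re (dot u w).
    rewrite hD hnormN -scaleN1r dotZr ?conjN ?conjC1 mulN1r ReN; ring.
  lra.
have [l lim] : exists l, forall e, 0 < e -> exists n0, forall n, (n0 <= n)%N -> hn (v n - l) < e.
  apply: (hilbert_complete (h := H)) => e e0.
  have e4 : 0 < e ^+ 2 / 4 by rewrite divr_gt0 ?exprn_gt0.
  have [n0 n0P] := inv_small e4; exists n0 => i j i0 j0.
  rewrite -(@ltr_pXn2r _ 2) ?nnegrE ?hnorm_ge0 ?(ltW e0) //.
  apply: le_lt_trans (par _ _) _.
  have h1 := vP i; have h2 := vP j; have h3 := n0P i i0; have h4 := n0P j j0.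
  move: {e4 n0P} (q (v i)) (q (v j)) (i.+1%:R^-1) (j.+1%:R^-1) (e ^+ 2) h1 h2 h3 h4 => qi qj ri rj E2 h1 h2 h3 h4.
  lra.
exists l.
(* Minimality of q at l, obtained from q (v n + w) >= m in the limit. *)
have var w : 0 <= hn w ^+ 2 + 2 * complex.Re (dot w l - g w).
  rewrite -oppr_le0; apply: le_eps => e e0; rewrite add0r.
  pose d := e / (4 * (1 + hn w)).
  have w1 : 0 < 1 + hn w by rewrite ltr_pwDl ?hnorm_ge0.
  have d0 : 0 < d by rewrite divr_gt0 // mulr_gt0.
  have e2 : 0 < e / 2 by rewrite divr_gt0.
  have [n0 n0P] := inv_small e2; have [n1 n1P] := lim _ d0.
  pose n := maxn n0 n1.
  have h1 := mq (v n + w); have h2 := vP n; have h3 := n0P n (leq_maxl _ _).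
  have h4 := n1P n (leq_maxr _ _).
  move: h1; rewrite /q hD gD ReD => h1.
  have h5 : complex.Re (dot (v n) w) - complex.Re (dot w l) <= d * hn w.
    have -> : complex.Re (dot w l) = complex.Re (dot l w) by rewrite dot_conj Re_conj.
    rewrite -ReB -dotBl; apply: le_trans (Re_le_nc _) _; apply: le_trans (dot_CS _ _ _) _.
    by rewrite ler_wpM2r ?hnorm_ge0 // ltW.
  have h6 : 2 * (d * hn w) <= e / 2.
    have -> : 2 * (d * hn w) = e / 2 * (hn w / (1 + hn w)) by rewrite /d; field; rewrite gt_eqF.
    rewrite -[X in _ <= X]mulr1.
    by rewrite ler_pM2l // ler_pdivrMr // mul1r lerDr.
  move: h2; rewrite /q => h2; rewrite ReB.
  move: (_^-1) (d * hn w) h1 h2 h3 h5 h6 => r dw h1 h2 h3 h5 h6; lra.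
have lz := @scalar_Re0 H (fun w => dot w l - g w).
(* The quadratic term is removed by inserting t u with t small: the choice t = - r / s makes t |u|^2
   at most - r, which contradicts r < 0. *)
have z w : complex.Re (dot w l - g w) = 0.
  have pos u : 0 <= complex.Re (dot u l - g u).
    rewrite leNgt; apply/negP => neg.
    set r := complex.Re _ in neg.
    pose s := hn u ^+ 2 + 1; have s0 : 0 < s by rewrite ltr_wpDl ?sqr_ge0.
    pose t := - r / s; have t0 : 0 < t by rewrite divr_gt0 // oppr_gt0.
    have := var (t%:C%C *: u); rewrite hnormZ nc_real gZ dotZl -mulrBr ReZ -/r.
    rewrite gtr0_norm // exprMn => h.
    have ts : t * s = - r by rewrite /t divfK // gt_eqF.
    have : 0 <= t * (t * hn u ^+ 2 + 2 * r) by nra.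
    rewrite pmulr_rge0 // => h'.
    have : t * hn u ^+ 2 <= t * s by rewrite ler_pM2l // /s lerDl.
    by rewrite ts; lra.
  apply/eqP; rewrite eq_le pos andbT.
  have := pos (- w); rewrite -scaleN1r dotZl gZ -mulrBr mulN1r ReN; lra.
move=> w; apply/eqP; rewrite eq_sym -subr_eq0; apply/eqP; apply: lz => // c x y.
by rewrite dotDl dotZl gD gZ /GRing.scale /=; ring.
Qed.

End Riesz.

Section BoundedOperators.
Context {R : realType} (H : hilbert R).
Local Notation dot := (hdot H).
Local Notation hn := (hnorm (hdot H)).
Implicit Types (T : bdop H).

Lemma opP T : linear T /\ op_bounded dot T.
Proof. by case: T => T TP; exact/asboolP. Qed.

Lemma op_lin T : linear T. Proof. by case: (opP T). Qed.

Lemma op_bd T : exists2 K : R, 0 <= K & forall v, hn (T v) <= K * hn v.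
Proof.
have [_ [K TK]] := opP T; exists (Num.max 0 K); first by rewrite le_max lexx.
move=> v; apply: le_trans (TK v) _; apply: ler_wpM2r; first exact: hnorm_ge0.
by rewrite le_max lexx orbT.
Qed.

Lemma opD T v w : T (v + w) = T v + T w. Proof. exact: (linD (op_lin T)). Qed.
Lemma opZ T (c : R[i]) v : T (c *: v) = c *: T v. Proof. exact: (linZ (op_lin T)). Qed.
Lemma op_sum T (I : Type) (r : seq I) (P : pred I) (F : I -> H) :
  T (\sum_(k <- r | P k) F k) = \sum_(k <- r | P k) T (F k).
Proof. exact: (lin_sum (op_lin T)). Qed.

Lemma op_ex (f : H -> H) : linear f -> op_bounded dot f -> exists T' : bdop H, forall v, T' v = f v.
Proof.
by move=> Tl Tb; have TP : f \in @bounded_operator R H by [apply/asboolP]; exists (BdOp TP).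
Qed.

Lemma op_ext (T U : bdop H) : (forall v, T v = U v) -> T = U.
Proof. by move=> TU; apply/val_inj/funext. Qed.

Lemma op_fun_lin (c : R[i]) (T U : bdop H) v : (c *: T + U) v = c *: T v + U v. Proof. by []. Qed.
Lemma op_fun0 v : (0 : bdop H) v = 0. Proof. by []. Qed.

Lemma dot_ext (v w : H) : (forall u, dot u v = dot u w) -> v = w.
Proof.
move=> h; apply/eqP; rewrite -subr_eq0; apply/eqP; apply: (@hnorm_eq0 _ _ dot).
apply/eqP; rewrite -sqrf_eq0 hnorm_sqr dotBr.
by rewrite h subrr.
Qed.

Lemma adjointP T v w : dot (T v) w = dot v (adjoint T w).
Proof.
suff ex : exists T' : bdop H, forall v w, dot (T v) w = dot v (T' w).
  have := @xgetPex _ 0 [set T' : bdop H | forall v w, dot (T v) w = dot v (T' w)] ex.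
  exact.
have [K K0 TK] := op_bd T.
have r w' : exists u, forall v', dot (T v') w' = dot v' u.
  apply: (@riesz _ _ (fun v' => dot (T v') w') (K * hn w')) => [c x y|v'].
    by rewrite opD opZ dotDl dotZl.
  apply: le_trans (dot_CS _ _ _) _.
  by rewrite [leRHS]mulrAC ler_wpM2r ?hnorm_ge0.
pose T' w' := projT1 (cid (r w')).
have T'P w' v' : dot (T v') w' = dot v' (T' w') := projT2 (cid (r w')) v'.
have [||U UE] := @op_ex T'; last by exists U => v' w'; rewrite UE T'P.
  move=> c x y; apply: dot_ext => u; rewrite -T'P dotDr dotZr.
  by rewrite [RHS]dotDr dotZr !T'P.
exists K => u; have [->|h0] := eqVneq (hn (T' u)) 0.
  by rewrite mulr_ge0 ?hnorm_ge0.
have hp : 0 < hn (T' u) by rewrite lt0r h0 hnorm_ge0.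
rewrite -(ler_pM2l hp) -expr2 hnorm_sqr -T'P.
apply: le_trans (Re_le_nc _) _; apply: le_trans (dot_CS _ _ _) _.
rewrite mulrA ler_wpM2r ?hnorm_ge0 // mulrC; exact: TK.
Qed.

Lemma adjoint_unique (T U : bdop H) : (forall v w, dot (T v) w = dot v (U w)) -> adjoint T = U.
Proof.
by move=> h; apply: op_ext => w; apply: dot_ext => v; rewrite -adjointP h.
Qed.

Lemma LH_form (y : Moo (bdop H)) m (xi eta : 'I_m -> H) :
  nc (opf dot (@bdop_val R H) y xi eta) <=
  mnorm (LH H) y * (Num.sqrt (hsq dot xi) * Num.sqrt (hsq dot eta)).
Proof.
have [n yn] := moo_finsupp y.
apply: (@op_mnorm_form _ _ _ _ (@bdop_val R H) y n) => [i j ij v|i j|i j].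
- by rewrite yn.
- exact: op_lin.
- by have [K _ yK] := op_bd (y i j); exists K.
Qed.

End BoundedOperators.

Section WeakStarFunctionals.
Context {R : realType} (X : smosData R) (nu : Moo (bdfun (@norm1 R X)) -> R).
Local Notation X' := (bdfun (@norm1 R X)).

(** Such a functional is a finite combination of evaluations, which is again the evaluation at one
    point of X. *)
Lemma weakstar_functional (psi : X' -> R[i]) : scalar psi ->
  continuous (psi : weakstar (@predual R X nu : set (dual (dual_with nu))) -> R[i]^o) ->
  exists x : X, forall f, psi f = f x.
Proof.
move=> pl pc.
have [g|r [g [c [gF psiE]]]] := weak_functional _ pl pc.
  by move=> [phi _ ->] a f h; rewrite bdD bdZ.
have xe i : exists x : X, (i < r)%N -> forall f : X', g i f = f x.
  case: (ltnP i r) => [ir|_]; last by exists 0.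
  by have [phi [x xE] gE] := gF i ir; exists x => _ f; rewrite gE xE.
pose x i := projT1 (cid (xe i)).
exists (\sum_(i < r) c i *: x i) => f; rewrite psiE bd_sum; apply: eq_bigr => i _.
by rewrite bdZ (projT2 (cid (xe i))).
Qed.

End WeakStarFunctionals.

Section Orthonormal.
Context {R : realType} {H : lmodType R[i]} (dot : {dot H for Num.conj}).

(** The sequence e is orthonormal below r and zero from r on, so that it can be used as the index
    range of a finitely supported matrix. *)
Lemma norm_orthonormal (e : nat -> H) r m (c : nat -> R[i]) :
  (forall i j, dot (e i) (e j) = ((i == j) && (i < r)%N)%:R) ->
  hnorm dot (\sum_(l < m) c l *: e l) ^+ 2 = \sum_(l < m | (l < r)%N) nc (c l) ^+ 2.
Proof.
move=> eo; rewrite hnorm_sqr dot_suml Re_sum [RHS]big_mkcond /=; apply: eq_bigr => k _.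
rewrite dot_sumr (bigD1 k) //= big1 ?addr0 => [|l lk].
  rewrite dotZl dotZr eo eqxx /=; case: (k < r)%N; last by rewrite !mulr0.
  by rewrite mulr1 -sqr_nc.
by rewrite dotZl dotZr eo eq_sym val_eqE (negbTE lk) !mulr0.
Qed.

End Orthonormal.

(** * Compressions of a representation to finite orthonormal families *)

Section Representations.
Context {R : realType} (X : smosData R).
Hypothesis HX : is_smos X.
Local Notation X' := (bdfun (@norm1 R X)).
Local Notation N := (mnorm X).
Variable H : hilbert R.
Local Notation dot := (hdot H).
Variable Phi : X' -> bdop H.
Hypothesis Phi_lin : linear Phi.
Hypothesis Phi_star : forall f, Phi (dual_star f) = adjoint (Phi f).
Hypothesis Phi_pos : forall F : Moo X', dual_cone F -> mcone (LH H) (mmap Phi F).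
Variable K : R.
Hypothesis K0 : 0 < K.
Hypothesis Phi_norm : forall F : Moo X', mnorm (LH H) (mmap Phi F) <= K * dual_norm N F.
Hypothesis Phi_ev : forall xi eta : H, exists x : X, forall f, dot (Phi f xi) eta = f x.

(* x_kl represents the functional f |-> <Phi f e_l, e_k>. *)
Lemma compression (e : nat -> H) r :
  (forall i j, dot (e i) (e j) = ((i == j) && (i < r)%N)%:R) ->
  exists x, [/\ mcone X x, N x <= K & forall (F : Moo X') m n xi eta,
    afm (parr F x) m n xi eta =
    opf dot (@bdop_val R H) (mmap Phi F) (fun b : 'I_n => \sum_(l < m) xi l b *: e l)
       (fun a : 'I_n => \sum_(k < m) eta k a *: e k)].
Proof.
move=> eo.
have e0 l : (r <= l)%N -> e l = 0.
  move=> rl; apply: (@hnorm_eq0 _ _ dot); apply/eqP; rewrite -sqrf_eq0 hnorm_sqr eo eqxx /=.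
  by rewrite ltnNge rl.
pose g k l := projT1 (cid (Phi_ev (e l) (e k))).
have gE k l (f : X') : dot (Phi f (e l)) (e k) = f (g k l) := projT2 (cid (Phi_ev (e l) (e k))) f.
pose x := minf g.
have xE k l : x k l = g k l.
  apply: (@minfE _ _ _ r) => i j ij; apply: (functionals_separate HX) => f; rewrite -gE.
  by case/orP: ij => /e0 ->; rewrite ?dot0r // (lin0 (op_lin _)) dot0l.
have form (F : Moo X') m n xi eta : afm (parr F x) m n xi eta =
    opf dot (@bdop_val R H) (mmap Phi F) (fun b : 'I_n => \sum_(l < m) xi l b *: e l)
       (fun a : 'I_n => \sum_(k < m) eta k a *: e k).
  rewrite /afm /opf.
  rewrite (@exchange4 _ m m n n (fun k l p q => (eta k p)^* * parr F x k l p q * xi l q)).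
  apply: eq_bigr => p _; apply: eq_bigr => q _; rewrite mmapE ?(lin0 Phi_lin) //.
  rewrite op_sum dot_suml exchange_big /=; apply: eq_bigr => l _.
  rewrite dot_sumr; apply: eq_bigr => k _; rewrite opZ dotZl dotZr gE /parr xE; ring.
have hz m n (xi : nat -> nat -> R[i]) :
    hsq dot (fun b : 'I_n => \sum_(l < m) xi l b *: e l) <= n2 m n xi.
  rewrite n2_flip; apply: ler_sum => b _.
  rewrite (norm_orthonormal _ (fun l => xi l b) eo) big_mkcond.
  by apply: ler_sum => l _; case: ifP => // _; exact: sqr_ge0.
have xs : msa x.
  apply: mooP => k l; rewrite (mstarEE (smos_star_lin HX)) !xE.
  apply/eqP; rewrite -subr_eq0; apply/eqP; apply: (functionals_separate HX) => f.
  have := dual_starE HX f (g l k); rewrite -gE Phi_star => /(congr1 Num.conj).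
  by rewrite conjCK -dot_conj -adjointP gE bdB => ->; rewrite subrr.
exists x; split=> //.
(* The forms of theta_F(x) are forms of Phi F on vectors of the same or smaller length, so
   positivity of Phi gives x in the cone, and in the next item its norm bound gives the norm of
   x. *)
- apply: (cone_bipolar HX xs) => F Fp m n xi; rewrite form.
  exact: (Phi_pos Fp).
- apply: (sa_norm_duality HX xs K0) => F _ F1 m n xi eta x1 e1; rewrite form.
  apply: le_trans (LH_form _ _ _) _; rewrite -[leRHS]mulr1.
  apply: ler_pM; rewrite ?mulr_ge0 ?sqrtr_ge0 ?op_mnorm_ge0 //.
    by apply: le_trans (Phi_norm F) _; rewrite ler_piMr // ltW.
  rewrite mulr_ile1 ?sqrtr_ge0 // -[leRHS]sqrtr1 ler_wsqrtr //; exact: le_trans (hz _ _ _) _.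
Qed.

(** A single form of Phi F involves 2 m vectors, zeta and zeta'. On an orthonormal basis of their
    joint span the form is computed by one matrix x from [compression]. *)
Lemma op_mnorm_compressions (F : Moo X') B : 0 <= B ->
  (forall x, mcone X x -> N x <= K -> ale (parr F x) B) -> mnorm (LH H) (mmap Phi F) <= B.
Proof.
move=> B0 FB; apply: op_mnorm_le => // m zeta zeta' z1 z1'.
pose z k := if (k < m)%N then natfun zeta k else natfun zeta' (k - m).
have [|||r [y [S [yo zS]]]] := @gram_schmidt _ H (hdot H) _ _ _ z (m + m).
- by move=> c u v w; rewrite dotDl dotZl.
- by move=> u v; exact: dot_conj.
- move=> u u0; rewrite dot_sqr ltcE /= eqxx /= exprn_gt0 // lt0r hnorm_ge0 andbT.
  by apply: contra_neq u0; exact: hnorm_eq0.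
pose e j := if (j < r)%N then y j else 0.
have eo i j : dot (e i) (e j) = ((i == j) && (i < r)%N)%:R.
  rewrite /e; case: ifP => ir; last by rewrite dot0l andbF.
  rewrite andbT; case: ifP => jr; first by rewrite yo.
  by rewrite dot0r; case: eqP => // ij; rewrite -ij ir in jr.
have [x [xp x1 xF]] := compression eo.
have zE (w : 'I_m -> H) (s : nat) : (forall b : 'I_m, z (s + b)%N = w b) -> (s <= m)%N ->
    w = fun b : 'I_m => \sum_(l < r) S (s + b)%N l *: e l.
  move=> zw sm; apply/funext => b; rewrite -zw zS.
    by apply: eq_bigr => l _; rewrite /e ltn_ord.
  by rewrite (leq_trans _ (leq_add sm (ltn_ord b))) // addnS.
have n2E (w : 'I_m -> H) (s : nat) : w = (fun b : 'I_m => \sum_(l < r) S (s + b)%N l *: e l) ->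
    n2 r m (fun l b => S (s + b)%N l) = hsq dot w.
  move=> ->; rewrite n2_flip; apply: eq_bigr => b _.
  rewrite (norm_orthonormal _ (fun l => S (s + b)%N l) eo) [RHS]big_mkcond.
  by apply: eq_bigr => l _; rewrite ltn_ord.
have zz : zeta = fun b : 'I_m => \sum_(l < r) S (0 + b)%N l *: e l.
  by apply: zE => // b; rewrite /z add0n ltn_ord natfunE.
have zz' : zeta' = fun b : 'I_m => \sum_(l < r) S (m + b)%N l *: e l.
  by apply: zE => // b; rewrite /z ltnNge leq_addr /= addKn natfunE.
have := FB x xp x1 r m (fun l b => S (0 + b)%N l) (fun l b => S (m + b)%N l).
by rewrite (n2E _ _ zz) (n2E _ _ zz') xF -zz -zz'; apply.
Qed.

End Representations.

(** * The unit ball of the cone *)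

Section Polarization.
Context {R : realType}.
Implicit Types (xi eta : nat -> nat -> R[i]).

Lemma n2_parallelogram m n xi eta :
  n2 m n (fun k p => xi k p + eta k p) + n2 m n (fun k p => xi k p - eta k p) =
  2 * n2 m n xi + 2 * n2 m n eta.
Proof.
rewrite /n2 !mulr_sumr -!big_split; apply: eq_bigr => k _ /=.
rewrite !mulr_sumr -!big_split; apply: eq_bigr => p _ /=.
case: (xi k p) => a b; case: (eta k p) => c d.
by rewrite /Normc.normc /= !sqr_sqrtr ?addr_ge0 ?sqr_ge0 //; ring.
Qed.

Lemma afm_polarization y m n xi eta :
  afm y m n (fun k p => xi k p + eta k p) (fun k p => xi k p + eta k p) =
  afm y m n (fun k p => xi k p - eta k p) (fun k p => xi k p - eta k p) +
  2 * afm y m n xi eta + 2 * afm y m n eta xi.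
Proof.
rewrite /afm; do 4! (rewrite !mulr_sumr -!big_split; apply: eq_bigr => ? _ /=).
by rewrite !conjD !conjN; ring.
Qed.

End Polarization.

Lemma half_pow_small (R : realType) (e : R) : 0 < e ->
  exists n0, forall n, (n0 <= n)%N -> 2^-1 ^+ n < e.
Proof.
move=> e0; have [n0 n0P] := inv_small e0; exists n0 => n /n0P; apply: le_lt_trans.
rewrite exprVn lef_pV2 ?posrE ?exprn_gt0 ?ltr0Sn // -natrX ler_nat.
exact: ltn_expl.
Qed.

Section UnitBall.
Context {R : realType} (X : smosData R).
Hypothesis HX : is_smos X.
Local Notation X' := (bdfun (@norm1 R X)).
Local Notation N := (mnorm X).
Let HN := smos_norm HX.
Let N_ge0 := matrix_norm_ge0 HN.

(** For a hermitian form, 4 Re <xi, eta> is the difference of the quadratic values at xi + eta and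
    xi - eta, and the parallelogram identity bounds their lengths. A phase makes the form real
    first, so the constant B is kept. *)
Lemma ale_polarization (f : Moo X') (x : Moo X) (B : R) :
  (forall i j y, f i j (star X y) = (f j i y)^*) -> msa x ->
  (forall m n eta, `|complex.Re (afm (parr f x) m n eta eta)| <= B * n2 m n eta) ->
  ale (parr f x) B.
Proof.
move=> fs xs fB m n xi0 eta x1 e1; have [u u1 uE] := phase (afm (parr f x) m n xi0 eta).
pose xi k p := u * xi0 k p.
have AE : afm (parr f x) m n xi eta = (nc (afm (parr f x) m n xi0 eta))%:C%C.
  have := afmZ (parr f x) m n u 1 xi0 eta; rewrite conjC1 mulr1 uE => <-.
  by apply: eq_afmv => // k p _ _; rewrite mul1r.
have n2xi : n2 m n xi <= 1 by rewrite /xi n2Z u1 expr1n mul1r.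
have sw : complex.Re (afm (parr f x) m n eta xi) = complex.Re (afm (parr f x) m n xi eta).
  rewrite -[LHS]Re_conj afm_conj; congr complex.Re; apply: eq_afm => k l p q.
  by rewrite -{1}(xs : mstar x = x) (parr_star HX x fs) conjCK.
have := congr1 (@complex.Re R) (afm_polarization (parr f x) m n xi eta).
have tw : (2 : R[i]) = 2%:C%C by rewrite -[2]/(1 + 1) rcD.
rewrite !ReD tw !ReZ sw AE /= => pol.
have B0 : 0 <= B.
  have := fB 1%N 1%N (fun _ _ => 1); rewrite /n2 !big_ord1 nc1 expr1n mulr1.
  by apply: le_trans; exact: normr_ge0.
have h1 := le_trans (ler_norm _) (fB m n (fun k p => xi k p + eta k p)).
have h2 := fB m n (fun k p => xi k p - eta k p); rewrite -normrN in h2.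
have {}h2 := le_trans (ler_norm _) h2.
have := n2_parallelogram m n xi eta.
move: h1 h2 pol; move: (complex.Re _) (complex.Re _) (nc _) (n2 _ _ (fun k p => xi k p + eta k p)) (n2 _ _ (fun k p => xi k p - eta k p)) => p q z a b h1 h2 pol par.
have : B * (a + b) <= B * 4 by rewrite ler_wpM2l // par; move: n2xi e1; lra.
by move: h1 h2 pol; lra.
Qed.

Lemma unit_cone_convex m (a : 'I_m -> Moo R[i]) (x : 'I_m -> Moo X) :
  (forall k, unit_cone (x k)) -> cnorm (\sum_(k < m) madjmul (a k) (a k)) <= 1 ->
  unit_cone (\sum_(k < m) msand (a k) (x k) (a k)).
Proof.
move=> xu a1; split; first by apply: (smos_cone_sand HX) => k; case: (xu k).
apply: le_trans (matrix_norm_sand HN a1 a1 ler01 (fun k => (xu k).2)) _.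
by rewrite sqrtr1 !mulr1.
Qed.

Lemma unit_cone0 : unit_cone (0 : Moo X).
Proof. by split; [exact: (smos_cone0 HX)|rewrite (matrix_norm0 HN)]. Qed.

Lemma msa_B (u v : Moo X) : msa u -> msa v -> msa (u - v).
Proof.
move=> us vs; have := mstar_lin (smos_star_lin HX) (-1) v u.
by rewrite conjN conjC1 !scaleN1r us vs [- v + u]addrC.
Qed.

Lemma msaZ (t : R) (u : Moo X) : msa u -> msa (t%:C%C *: u).
Proof.
move=> us; apply: mooP => i j; rewrite (mstarEE (smos_star_lin HX)) !mooZ (starZ (smos_star_lin HX)).
by rewrite conjC_real -(mstarEE (smos_star_lin HX)) (us : mstar u = u).
Qed.

(** If x of norm below 1 / M were outside the closure of U_X, a separating F would be bounded by 1
    on the unit cone but exceed 1 at x, although its dual norm is at most M. *)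
Lemma U_zero_nbhd (M : R) : 0 < M ->
  (forall F : Moo X', (forall i j x, F i j (star X x) = (F j i x)^*) ->
     (forall x, unit_cone x -> ale (parr F x) 1) -> dual_norm N F <= M) ->
  zero_nbhd_sa (norm_closure N (U_ X)).
Proof.
move=> M0 h; exists M^-1; first by rewrite invr_gt0.
move=> x xs xM; apply: contrapT => ncl.
have Usa y : U_ X y -> msa y.
  by move=> [u [v [[up _] [vp _] ->]]]; apply: msa_B; exact: (smos_cone_sa HX).
have Uconv m (a : 'I_m -> Moo R[i]) (y : 'I_m -> Moo X) : (forall k, U_ X (y k)) ->
    cnorm (\sum_(k < m) madjmul (a k) (a k)) <= 1 -> U_ X (\sum_(k < m) msand (a k) (y k) (a k)).
  move=> yU a1.
  pose u k := projT1 (cid (yU k)); pose v k := projT1 (cid (projT2 (cid (yU k)))).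
  have uvP k : [/\ unit_cone (u k), unit_cone (v k) & y k = u k - v k] := projT2 (cid (projT2 (cid (yU k)))).
  exists (\sum_(k < m) msand (a k) (u k) (a k)); exists (\sum_(k < m) msand (a k) (v k) (a k)).
  split; try by apply: unit_cone_convex => // k; case: (uvP k).
  rewrite -sumrB; apply: eq_bigr => k _; case: (uvP k) => _ _ ->.
  have := msand_lin (a k) (a k) (-1) (v k) (u k).
  by rewrite !scaleN1r [- v k + _]addrC [- msand _ _ _ + _]addrC.
have [F [Fs FU [m [n [eta big]]]]] := matrix_separation HX Usa Uconv xs ncl.
have F1 y : unit_cone y -> ale (parr F y) 1.
  move=> yu; apply: ale_polarization => //; first by apply: (smos_cone_sa HX); case: yu.
  move=> m' n' eta'; rewrite mul1r ler_norml; apply/andP; split; last first.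
    by apply: FU; exists y; exists 0; split=> //; [exact: unit_cone0|rewrite subr0].
  rewrite lerNl.
  (* Both y = y - 0 and - y = 0 - y belong to U_X, which bounds the form from both sides. *)
  have : U_ X (0 - y) by exists 0; exists y; split=> //; exact: unit_cone0.
  move=> /FU /(_ m' n' eta'); rewrite sub0r -scaleN1r afm_parrZ mulN1r ReN.
  exact.
have FM := h F Fs F1.
have := ale_form (dual_norm_ale HN HN (fun x => lexx _) F x) m n eta eta.
rewrite -expr2 sqr_sqrtr ?n2_ge0 // => /(le_trans (Re_le_nc _)) /(lt_le_trans big).
apply/negP; rewrite -leNgt ler_piMl ?n2_ge0 //.
apply: (@le_trans _ _ (M * N x)); first by rewrite ler_wpM2r.
by rewrite -ler_pdivlMl // mulr1 ltW.
Qed.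

Lemma unit_coneP n (u : Moo X) : unit_cone u -> unit_cone (mtr n u).
Proof.
move=> [up u1]; split; first by rewrite -msand_mone; exact: (smos_cone_sand1 HX).
exact: le_trans (norm_mtr HN n u) u1.
Qed.

Hypothesis HXc : complete_smos X.

(** On M_n(X) the norm is dominated by the sum of the n^2 entry norms, so entrywise limits suffice;
    d is e divided by slightly more than n^2. *)
Lemma Mn_complete n (s : nat -> Moo X) : (forall m, Mn n (s m)) ->
  (forall e, 0 < e -> exists n0, forall m l, (n0 <= m)%N -> (n0 <= l)%N -> N (s m - s l) < e) ->
  exists2 l, Mn n l & forall e, 0 < e -> exists n0, forall m, (n0 <= m)%N -> N (s m - l) < e.
Proof.
move=> sn sC.
have lim i j : exists z, forall e, 0 < e -> exists n0, forall m, (n0 <= m)%N -> norm1 (s m i j - z) < e.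
  apply: HXc => e /sC[n0 n0P]; exists n0 => m l m0 l0.
  by apply: le_lt_trans (norm_entry HN (s m - s l) i j) _; exact: n0P.
pose g i j := projT1 (cid (lim i j)).
have gP i j := projT2 (cid (lim i j)).
exists (mtr n g); first exact: mtr_Mn.
move=> e e0; pose d := e / (n%:R * n%:R + 1).
have D0 : 0 < n%:R * n%:R + 1 :> R by rewrite ltr_wpDl ?mulr_ge0 ?ler0n.
have d0 : 0 < d by rewrite divr_gt0.
pose n0 i j := projT1 (cid (gP i j d d0)).
have n0P i j := projT2 (cid (gP i j d d0)).
exists (\max_(i < n) \max_(j < n) n0 i j) => m mn.
have Mnd : Mn n (s m - mtr n g) by apply: MnD => //; apply: MnN; exact: mtr_Mn.
apply: le_lt_trans (norm_le_entries HN Mnd) _.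
apply: (@le_lt_trans _ _ (\sum_(i < n) \sum_(j < n) d)).
  apply: ler_sum => i _; apply: ler_sum => j _.
  rewrite -/(norm1 _); apply: ltW.
  have -> : (s m - mtr n g) i j = s m i j - g i j.
    by rewrite mooD mooN mtrE !ltn_ord.
  apply: n0P; apply: leq_trans mn.
  apply: leq_trans (leq_bigmax i); exact: (leq_bigmax (F := fun j : 'I_n => n0 i j) j).
rewrite !sumr_const card_ord -mulrnA -mulr_natl natrM /d mulrA ltr_pdivrMr //.
by rewrite mulrC ltr_pM2l // ltrDl.
Qed.

(** The partial sums of sum_k 2^-k w_k stay in the closed cone, and the weights sum up to 2. *)
Lemma series_Mn n (w : nat -> Moo X) : (forall k, Mn n (w k)) -> (forall k, unit_cone (w k)) ->
  exists2 l, [/\ Mn n l, mcone X l & N l <= 2] &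
    forall e, 0 < e -> exists n0, forall m, (n0 <= m)%N ->
      N (\sum_(k < m) (2^-1 ^+ k)%:C%C *: w k - l) < e.
Proof.
move=> wn wu; pose s m := \sum_(k < m) (2^-1 ^+ k)%:C%C *: w k.
have t0 k : 0 <= 2^-1 ^+ k :> R by rewrite exprn_ge0 // invr_ge0.
have sn m : Mn n (s m).
  by apply: big_ind => [i j _||k _]; [by []|exact: MnD|exact: MnZ].
have sp m : mcone X (s m).
  apply: big_ind => [||k _]; [exact: (smos_cone0 HX)|exact: (coneD HX)|].
  by apply: (coneZ HX) => //; case: (wu k).
have tail l d : N (s (l + d)%N - s l) <= 2 * 2^-1 ^+ l - 2 * 2^-1 ^+ (l + d).
  elim: d => [|d IH]; first by rewrite addn0 !subrr (matrix_norm0 HN).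
  rewrite addnS {1}/s big_ord_recr /= -/(s _) addrAC.
  apply: le_trans (smos_normD HX _ _) _; rewrite (smos_normZr HX) ger0_norm // exprS.
  have h : 2^-1 ^+ (l + d) * N (w (l + d)%N) <= 2^-1 ^+ (l + d).
    by rewrite ler_piMr //; case: (wu (l + d)%N).
  rewrite mulrA mulfV // mul1r; apply: le_trans (lerD IH h) _.
  by move: (_ ^+ l) (_ ^+ (l + d)) => a b; lra.
have cau : forall e, 0 < e -> exists n0, forall m l, (n0 <= m)%N -> (n0 <= l)%N -> N (s m - s l) < e.
  move=> e e0; have e4 : 0 < e / 4 by rewrite divr_gt0.
  have [n0 n0P] := half_pow_small e4; exists n0.
  have near m : (n0 <= m)%N -> N (s m - s n0) < e / 2.
    move=> /subnKC <-; apply: le_lt_trans (tail n0 _) _.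
    have := n0P n0 (leqnn _); have := t0 (n0 + (m - n0))%N.
    by move: (_ ^+ (n0 + _)) (_ ^+ n0) => a b; lra.
  move=> m l m0 l0; have -> : s m - s l = (s m - s n0) - (s l - s n0).
    by rewrite opprB addrA subrK.
  apply: le_lt_trans (matrix_normB HN _ _) _.
  by rewrite [e]splitr ltrD ?near.
have [l ln lP] := Mn_complete sn cau; exists l => //; split=> //.
  apply: (smos_cone_closed HX) => e /lP[n0 /(_ n0 (leqnn _)) h].
  by exists (s n0) => //; rewrite (matrix_norm_distC HN).
apply: le_eps => e /lP[n0 /(_ n0 (leqnn _)) h].
have -> : l = (s n0 - s 0%N) - (s n0 - l).
  by rewrite /s big_ord0 subr0 opprB addrCA subrr addr0.
apply: le_trans (matrix_normB HN _ _) _; rewrite lerD ?(ltW h) //.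
apply: le_trans (tail 0%N n0) _; rewrite expr0 mulr1.
by rewrite gerBl mulr_ge0.
Qed.

(** Successive approximation as in the open mapping theorem. Everything is compressed to M_n(X), n a
    size of x0, because only there the series are known to converge. Starting from 2 x0 explains the
    radius e / 2 and leaves 2 x0 = u - v with u and v of norm at most 2, hence x0 in U_X. *)
Lemma U_closure_nbhd : zero_nbhd_sa (norm_closure N (U_ X)) -> zero_nbhd_sa (U_ X).
Proof.
move=> [e e0 eU]; exists (e / 2); first by rewrite divr_gt0.
move=> x0 xs0 xe; have [n xn0] := moo_finsupp x0.
have e2 : 0 < e / 2 by rewrite divr_gt0.
have step (y : Moo X) : exists uv : Moo X * Moo X, [/\ msa y, Mn n y & N y < e] ->
    [/\ unit_cone uv.1, unit_cone uv.2, Mn n uv.1, Mn n uv.2 & N (y - (uv.1 - uv.2)) < e / 2].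
  have [[ys yn ye]|no] := pselect [/\ msa y, Mn n y & N y < e]; last by exists (0, 0).
  have [_ [u [v [uu vu ->]]] uv] := eU y ys ye _ e2.
  (* Compression to the corner fixes y and does not increase the distance. *)
  exists (mtr n u, mtr n v) => _; split=> /=; try exact: unit_coneP; try exact: mtr_Mn.
  apply: le_lt_trans uv; apply: le_trans (norm_mtr HN n _).
  rewrite le_eqVlt (_ : y - _ = mtr n (y - (u - v))) ?eqxx //.
  apply: mooP => i j; rewrite [in LHS](Mn_mtr yn) !(mooD, mooN, mtrE).
  by case: ifP => _; rewrite ?oppr0 ?addr0 ?subrr.
pose F y := projT1 (cid (step y)).
have FP y := projT2 (cid (step y)).
(* The remainder has norm below e / 2 and is doubled, so the next step again starts with norm below
   e; the doublings account for the weights 2^-k. *)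
pose nxt y : Moo X := 2%:C%C *: (y - ((F y).1 - (F y).2)).
pose y k := iter k nxt (2%:C%C *: x0).
have yP k : [/\ msa (y k), Mn n (y k) & N (y k) < e].
  elim: k => [|k IH].
    split; [exact: msaZ|exact: MnZ|].
    by rewrite /y /= (smos_normZr HX) ger0_norm // mulrC -ltr_pdivlMr.
  have [ys yn ye] := IH; have [[up _] [vp _] un vn small] := FP _ IH.
  rewrite /y iterS -/(y k) /nxt; split.
  - by apply: msaZ; do !apply: msa_B => //; exact: (smos_cone_sa HX).
  - by apply/MnZ/MnD => //; apply/MnN/MnD => //; exact: MnN.
  - by rewrite (smos_normZr HX) ger0_norm // mulrC -ltr_pdivlMr.
have w1 k : unit_cone (F (y k)).1 by case: (FP _ (yP k)).
have wn k : Mn n (F (y k)).1 by case: (FP _ (yP k)).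
have z1 k : unit_cone (F (y k)).2 by case: (FP _ (yP k)).
have zn k : Mn n (F (y k)).2 by case: (FP _ (yP k)).
have [u [un up u2] ulim] := series_Mn wn w1; have [v [vn vp v2] vlim] := series_Mn zn z1.
pose s (w : nat -> Moo X) m := \sum_(k < m) (2^-1 ^+ k)%:C%C *: w k.
have part m : 2%:C%C *: x0 = s (fun k => (F (y k)).1) m - s (fun k => (F (y k)).2) m + (2^-1 ^+ m)%:C%C *: y m.
  elim: m => [|m ->]; first by rewrite /s !big_ord0 subrr add0r expr0 scale1r.
  have sS w : s w m.+1 = s w m + (2^-1 ^+ m)%:C%C *: w m by rewrite /s big_ord_recr.
  have -> : y m.+1 = 2%:C%C *: (y m - ((F (y m)).1 - (F (y m)).2)) by [].
  rewrite !sS scalerA -rcM exprS mulrAC mulVf // mul1r !scalerBr.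
  move: (s _ m) (s _ m) (_ *: y m) (_ *: _.1) (_ *: _.2) => B A a b c.
  by rewrite [- (B + c)]opprD [A + b + _]addrACA -[RHS]addrA [b - c + _]addrC subrK.
have lim0 : 2%:C%C *: x0 = u - v.
  apply/eqP; rewrite -subr_eq0; apply/eqP; case: (HN) => h0 _ _ _; apply: h0.
  apply/eqP; rewrite eq_le N_ge0 andbT; apply: le_eps => d d0; rewrite add0r.
  have d3 : 0 < d / 3 by rewrite divr_gt0.
  have de : 0 < d / 3 / e by rewrite divr_gt0.
  have [n1 n1P] := ulim _ d3; have [n2 n2P] := vlim _ d3; have [n3 n3P] := half_pow_small de.
  pose m := maxn n1 (maxn n2 n3).
  have h1 := n1P m (leq_maxl _ _).
  have h2 : N (s (fun k => (F (y k)).2) m - v) < d / 3 by apply: n2P; rewrite leq_max leq_maxl orbT.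
  have h3 : 2^-1 ^+ m < d / 3 / e by apply: n3P; rewrite !leq_max leqnn !orbT.
  rewrite (part m).
  have -> : s (fun k => (F (y k)).1) m - s (fun k => (F (y k)).2) m + (2^-1 ^+ m)%:C%C *: y m - (u - v) =
    (s (fun k => (F (y k)).1) m - u) - (s (fun k => (F (y k)).2) m - v) + (2^-1 ^+ m)%:C%C *: y m.
    move: (s _ m) (s _ m) (_ *: y m) => B A c.
    by rewrite [LHS]addrAC [- (u - v)]opprD [- (B - v)]opprD !opprK [A - B + _]addrACA.
  apply: le_trans (smos_normD HX _ _) _; rewrite (smos_normZr HX) ger0_norm ?exprn_ge0 ?invr_ge0 //.
  have h4 : 2^-1 ^+ m * N (y m) <= d / 3.
    have [_ _ ye] := yP m; apply: (@le_trans _ _ (d / 3 / e * e)); last by rewrite divfK // gt_eqF.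
    by rewrite ler_pM ?exprn_ge0 ?invr_ge0 // ltW.
  have h5 := matrix_normB HN (s (fun k => (F (y k)).1) m - u) (s (fun k => (F (y k)).2) m - v).
  move: h1 h2 h4 h5; rewrite -/(s (fun k => (F (y k)).1) m).
  move: (N (s _ m - u)) (N (s _ m - v)) (_ * N _) (N (_ - _)) => a b c f; lra.
have half (w : Moo X) : mcone X w -> N w <= 2 -> unit_cone (2^-1%:C%C *: w).
  move=> wp w2; split; first by apply: (coneZ HX) => //; rewrite invr_ge0.
  by rewrite (smos_normZr HX) ger0_norm ?invr_ge0 // ler_pdivrMl // mulr1.
exists (2^-1%:C%C *: u); exists (2^-1%:C%C *: v); split; [exact: half|exact: half|].
by rewrite -scalerBr -lim0 scalerA -rcM mulVf // scale1r.
Qed.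

End UnitBall.

(** * Weak-* continuous representations *)

Section NormalFunctionals.
Context {R : realType} (H : hilbert R).
Local Notation dot := (hdot H).

Lemma series_finite (K : numFieldType) (V : pseudoMetricNormedZmodType K) m (u : nat -> V) :
  (forall k, (m <= k)%N -> u k = 0) -> series u @ \oo --> \sum_(k < m) u k.
Proof.
move=> um; apply: cvg_near_cst; near=> n.
have mn : (m <= n)%N by near: n; exists m.
rewrite /series /= (big_cat_nat (leq0n m) mn) /= [X in _ + X]big1_seq ?addr0 ?big_mkord // => k.
by rewrite mem_index_iota => /andP[_ /andP[/um -> _]].
Unshelve. all: by end_near. Qed.

Lemma normal_finite m (xi eta : nat -> H) :
  @normal_functionals R H (fun T => \sum_(k < m) dot (T (xi k)) (eta k)).
Proof.
pose cut (v : nat -> H) k := if (k < m)%N then v k else 0.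
have cut0 v k : (m <= k)%N -> cut v k = 0 by rewrite /cut ltnNge => ->.
exists (cut xi); exists (cut eta); split.
- apply: cvgP; apply: (@series_finite _ _ m) => k /cut0 ->.
  by rewrite hnorm0 expr0n.
- apply: cvgP; apply: (@series_finite _ _ m) => k /cut0 ->.
  by rewrite hnorm0 expr0n.
move=> T; rewrite (eq_bigr (fun k : 'I_m => dot (T (cut xi k)) (cut eta k))); last first.
  by move=> k _; rewrite /cut ltn_ord.
apply: (@series_finite _ R[i]^o m (fun k => dot (T (cut xi k)) (cut eta k))) => k km.
by rewrite (cut0 eta _ km) dot0r.
Qed.

End NormalFunctionals.

Section InducedStructure.
Context {R : realType} (Z : smosData R) (T : submodClosed Z) (Y : Moo (sub_smos T)).

Lemma sub_mnormE : mnorm (sub_smos T) Y = mnorm Z (mmap (subsp_val (S := T)) Y).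
Proof. by []. Qed.

Lemma sub_mconeE : mcone (sub_smos T) Y = mcone Z (mmap (subsp_val (S := T)) Y).
Proof. by []. Qed.

End InducedStructure.

Section DualRepresentation.
Context {R : realType} (X : smosData R) (nu : Moo (bdfun (@norm1 R X)) -> R).
Local Notation X' := (bdfun (@norm1 R X)).
Local Notation D := (dual_with nu).
Variables (H : hilbert R) (W : submodClosed (LH H)) (phi : D -> sub_smos W).
Hypothesis rep : @dual_representation R D (@predual R X nu) H W phi.
Local Notation dot := (hdot H).

Definition rep_op (f : X') : bdop H := subsp_val (phi f).

Lemma rep_star_linear : star_linear phi.
Proof. by case: rep => _ _ [_ [h _ _] _] _. Qed.

Lemma rep_op_lin : linear rep_op.
Proof. by move=> c f g; case: rep_star_linear => h _; rewrite /rep_op (h c f g). Qed.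

Lemma rep_op_star (f : X') : rep_op (dual_star f) = adjoint (rep_op f).
Proof.
case: rep => Wst _ _ _; case: rep_star_linear => _ /(_ f) /(congr1 subsp_val) /= h.
rewrite /rep_op h /insubd insubT //=.
by apply: Wst; case: (phi f).
Qed.

Lemma rep_mmap (F : Moo X') : mmap (subsp_val (S := W)) (mmap phi F) = mmap rep_op F.
Proof.
have p0 : phi 0 = 0 by case: rep_star_linear => h _; exact: (lin0 h).
by apply: mooP => i j; rewrite !mmapE // /rep_op p0.
Qed.

Lemma rep_norm (F : Moo X') : mnorm (sub_smos W) (mmap phi F) = mnorm (LH H) (mmap rep_op F).
Proof. exact: (etrans (sub_mnormE _) (congr1 (mnorm (LH H)) (rep_mmap F))). Qed.

Lemma rep_op_pos (F : Moo X') : dual_cone F -> mcone (LH H) (mmap rep_op F).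
Proof.
move=> Fp; rewrite -rep_mmap -sub_mconeE; case: rep => _ _ [_ [_ _ h] _] _.
have Fs : @msa R D F by case: Fp => Fs _; exact: Fs.
by have [h' _] := h F Fs; exact: (h' Fp).
Qed.

(** A vector functional is a one-term normal functional, so its composition with the representation
    is weak-* continuous and comes from X. *)
Lemma rep_op_ev (xi eta : H) : exists x : X, forall f, dot (rep_op f xi) eta = f x.
Proof.
apply: (@weakstar_functional R X nu).
  move=> c f g; rewrite rep_op_lin.
  by rewrite op_fun_lin dotDl dotZl.
have [_ _ _ [phic _]] := rep.
have sc : continuous (subsp_val : subsp_weakstar W -> LH_weakstar H) by exact: initial_continuous.
have nc : continuous ((fun T : bdop H => dot (T xi) eta) : LH_weakstar H -> R[i]^o).
  apply: weak_continuous.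
  have := normal_finite 1 (fun=> xi) (fun=> eta).
  by under eq_fun do rewrite big_ord1.
have pc : continuous ((fun s => dot ((subsp_val s : bdop H) xi) eta) : subsp_weakstar W -> R[i]^o).
  by move=> s; exact: (continuous_comp (sc s) (nc _)).
move=> f; exact: (continuous_comp (phic f) (pc _)).
Qed.

End DualRepresentation.

Lemma complete_embedding_below (R : realType) (V W : lmodType R[i]) (NV : Moo V -> R)
  (NW : Moo W -> R) (phi : V -> W) : complete_embedding NV NW phi ->
  exists2 c, 0 < c & forall x, NV x = 1 -> c <= NW (mmap phi x).
Proof.
move=> [_]; set E := [set _ | _ in _] => E0.
have Elb x : NV x = 1 -> (ereal_inf E <= (NW (mmap phi x))%:E)%E.
  by move=> x1; apply: ereal_inf_lbound; exists x.
case: (ereal_inf E) E0 Elb => [r||] // E0 Elb.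
  by exists r => // x /Elb; rewrite lee_fin.
by exists 1 => // x /Elb; rewrite leye_eq.
Qed.

Lemma matrix_norm_normalize (R : realType) (V : lmodType R[i]) (nu : Moo V -> R) (x : Moo V) :
  matrix_norm nu -> 0 < nu x -> nu ((nu x)^-1%:C%C *: x) = 1.
Proof.
by move=> [_ _ -> _] x0; rewrite nc_real ger0_norm ?invr_ge0 ?ltW // mulVf // gt_eqF.
Qed.

Lemma ale_parrZ (R : realType) (V : lmodType R[i]) (p : V -> R) (c : R[i]) (f : Moo (bdfun p))
  (x : Moo V) (K : R) : ale (parr f x) K -> ale (parr (c *: f) x) (nc c * K).
Proof.
move=> fK; have -> : parr (c *: f) x = fun k l a b => c * parr f x k l a b.
  by apply: arrP => k l a b; rewrite /parr mooZ bd_funZ.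
exact: ale_scale.
Qed.

Section RepresentationBounds.
Context {R : realType} (X : smosData R).
Hypothesis HX : is_smos X.
Local Notation X' := (bdfun (@norm1 R X)).
Local Notation N := (mnorm X).
Let HN := smos_norm HX.
Let N_ge0 := matrix_norm_ge0 HN.

(** The matrices produced by the compressions have norm at most K, so they are K times elements of
    the unit cone. *)
Lemma rep_bound (nu : Moo X' -> R) (H : hilbert R) (W : submodClosed (LH H))
    (phi : dual_with nu -> sub_smos W) (K : R) (F : Moo X') (b : R) :
  @dual_representation R (dual_with nu) (@predual R X nu) H W phi -> 0 < K ->
  (forall G : Moo X', mnorm (sub_smos W) (mmap phi G) <= K * dual_norm N G) ->
  0 <= b -> (forall x, unit_cone x -> ale (parr F x) b) ->
  mnorm (sub_smos W) (mmap phi F) <= K * b.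
Proof.
move=> rep K0 phiK b0 Fb; rewrite (rep_norm rep).
apply: (op_mnorm_compressions HX (rep_op_lin rep) (rep_op_star rep) _ K0 _ (rep_op_ev rep)).
- by move=> G; exact: (rep_op_pos rep).
- by move=> G; rewrite -(rep_norm rep).
- by rewrite mulr_ge0 // ltW.
move=> x xp xK; have u : unit_cone (K^-1%:C%C *: x).
  split; first by apply: (coneZ HX) => //; rewrite invr_ge0 ltW.
  by rewrite (smos_normZr HX) ger0_norm ?invr_ge0 ?(ltW K0) // ler_pdivrMl // mulr1.
have := ale_scale K%:C%C (Fb _ u); rewrite nc_real ger0_norm ?(ltW K0) //.
congr (ale _ _); apply: arrP => k l p q.
by rewrite /parr mooZ bdZ mulrA -rcM mulfV ?gt_eqF // rc1 mul1r.
Qed.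

Lemma quasi_nbhd : dual_quasi_operator_system (dual_predual X) ->
  zero_nbhd_sa (norm_closure N (U_ X)).
Proof.
move=> [_ [H [W [phi rep]]]].
have [_ _ [_ _ emb] _] := rep; have [[K0 phiK0] _] := emb.
have [c c0 cP] := complete_embedding_below emb.
pose nu : Moo X' -> R := dual_norm N.
have nu0 F : 0 <= nu F := dual_norm_ge0 HN HN (fun x => lexx _) F.
have Hnu : matrix_norm nu := dual_norm_matrix HN HN (fun x => lexx _).
pose K := Num.max 1 K0; have Kp : 0 < K by rewrite lt_max ltr01.
have phiK (G : Moo X') : mnorm (sub_smos W) (mmap phi G) <= K * dual_norm N G.
  by apply: le_trans (phiK0 G) _; rewrite ler_wpM2r ?nu0 // le_max lexx orbT.
apply: (@U_zero_nbhd _ _ HX (K / c)); first by rewrite divr_gt0.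
move=> F _ F1; rewrite -/(nu F).
have [->|F0] := eqVneq (nu F) 0; first by rewrite divr_ge0 ?ltW.
have Fp : 0 < nu F by rewrite lt0r F0 nu0.
pose G := (nu F)^-1%:C%C *: F.
have G1 : nu G = 1 := matrix_norm_normalize Hnu Fp.
have i0 : 0 <= (nu F)^-1 by rewrite invr_ge0.
have Gb x : unit_cone x -> ale (parr G x) (nu F)^-1.
  move=> /F1 Fx; have := ale_parrZ (nu F)^-1%:C%C Fx.
  by rewrite nc_real (ger0_norm i0) mulr1.
(* For the normalized G, c <= |phi G| <= K / nu F, that is, nu F <= K / c. *)
have := le_trans (cP G G1) (rep_bound rep Kp phiK i0 Gb).
by rewrite ler_pdivlMr // ler_pdivlMr // mulrC.
Qed.

Lemma N_sys_maximal (nu : Moo X' -> R) (F : Moo X') (b : R) : N_sys X nu -> 0 <= b ->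
  (forall x, unit_cone x -> ale (parr F x) b) -> nu F <= b.
Proof.
move=> [[lam [Hlam lam_ge _ nuE]] [_ [H [W [phi [rep iso]]]]]] b0 Fb.
have isoE (G : Moo X') : mnorm (sub_smos W) (mmap phi G) = nu G := iso G.
have h (G : Moo X') : mnorm (sub_smos W) (mmap phi G) <= 1 * dual_norm N G; last first.
  by rewrite -isoE -[b]mul1r; exact: (rep_bound rep ltr01 h b0 Fb).
rewrite mul1r isoE nuE; apply: dual_norm_le.
  exact: (dual_norm_ge0 HN HN (fun x => lexx _)).
move=> x x1; have xN : N x <= 1 by exact: le_trans x1.
have := dual_norm_ale1 HN (fun x => lexx _) G xN.
exact.
Qed.

End RepresentationBounds.

(** * Square summable families *)

Section Rectangles.
Context {I : choiceType}.

(** The filter of large rectangles: a finite set of indices in I times an initial segment of the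
    naturals. Rectangles can be made wide enough to contain entire blocks, see [rects_max]. *)
Definition rects : set_system ({fset I} * nat) :=
  filter_from setT (fun A => [set B | (A.1 `<=` B.1)%fset && (A.2 <= B.2)%N]).

#[export] Instance rects_filter : ProperFilter rects.
Proof.
split; first by move=> [A _ /(_ A)]; apply; rewrite /= fsubset_refl leqnn.
apply: filter_from_filter; first by exists (fset0, 0%N).
move=> A B _ _; exists (A.1 `|` B.1, maxn A.2 B.2)%fset => // C /=.
by rewrite fsubUset geq_max => /andP[/andP[-> ->] /andP[-> ->]].
Qed.

Definition psum (V : nmodType) (f : I -> nat -> V) (A : {fset I} * nat) : V :=
  \sum_(x <- A.1) \sum_(i < A.2) f x i.

Section RealSums.
Context {R : realType}.
Variable g : I -> nat -> R.
Hypothesis g0 : forall x i, 0 <= g x i.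

Lemma psum_ge0 A : 0 <= psum g A.
Proof. by apply: sumr_ge0 => x _; apply: sumr_ge0. Qed.

Lemma psum_le A B : (A.1 `<=` B.1)%fset -> (A.2 <= B.2)%N -> psum g A <= psum g B.
Proof.
move=> AB1 AB2; pose h x := if x \in A.1 then \sum_(i < A.2) g x i else 0.
apply: (@le_trans _ _ (\sum_(x <- A.1) h x)).
  by rewrite le_eqVlt; apply/orP; left; apply/eqP; apply: eq_big_seq => x xA; rewrite /h xA.
rewrite (big_fset_incl _ AB1) => [|x _ /negbTE xA]; last by rewrite /h xA.
apply: ler_sum => x _; rewrite /h; case: ifP => _; last exact: sumr_ge0.
exact: le_sum_widen.
Qed.

Lemma rects_sup K : (forall A, psum g A <= K) -> exists s, [/\ s <= K,
  forall A, psum g A <= s & forall e, 0 < e -> rects [set A | s - e < psum g A]].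
Proof.
move=> gK; pose E := [set psum g A | A in [set: {fset I} * nat]].
have E0 : E !=set0 by exists (psum g (fset0, 0%N)); exists (fset0, 0%N).
have Eub : has_ubound E by exists K => _ [A _ <-].
have les A : psum g A <= sup E by apply: ub_le_sup => //; exists A.
exists (sup E); split=> //; first by apply: ge_sup => // _ [A _ <-].
move=> e e0; have [_ [A _ <-] Ae] := sup_adherent e0 (conj E0 Eub).
exists A => // B /andP[AB1 AB2]; exact: lt_le_trans Ae (psum_le AB1 AB2).
Qed.

End RealSums.

Section ComplexSums.
Context {R : realType}.
Implicit Types (f : I -> nat -> R[i]) (g : I -> nat -> R).

Definition has_sum f (z : R[i]) := (fun A => psum f A : R[i]^o) @ rects --> (z : R[i]^o).

Lemma psum_lin (c : R[i]) f h A :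
  psum (fun x i => c * f x i + h x i) A = c * psum f A + psum h A.
Proof.
rewrite /psum mulr_sumr -big_split; apply: eq_bigr => x _ /=.
by rewrite mulr_sumr -big_split.
Qed.

Lemma has_sum_lin (c : R[i]) f h z w : has_sum f z -> has_sum h w ->
  has_sum (fun x i => c * f x i + h x i) (c * z + w).
Proof.
move=> fz hw; rewrite /has_sum; under eq_fun do rewrite psum_lin.
exact: (cvgD (cvgM (cvg_cst (c : R[i]^o)) fz) hw).
Qed.

Lemma has_sum_unique f z w : has_sum f z -> has_sum f w -> z = w.
Proof. by move=> fz fw; apply: (cvg_unique _ fz fw); exact: (@norm_hausdorff _ R[i]^o). Qed.

Lemma has_sum_conj f z : has_sum f z -> has_sum (fun x i => (f x i)^*) z^*.
Proof.
move=> fz; apply: cvg_nc => e e0; apply: (@filterS _ rects _ _ _ _ (fz _ (nbhs_nc z e0))) => A /=; rewrite -[X in X < e]nc_conj conjD conjN.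
suff -> : (psum f A)^* = psum (fun x i => (f x i)^*) A by [].
by rewrite /psum conj_sum; apply: eq_bigr => x _; rewrite conj_sum.
Qed.

Lemma has_sum_near f z (e : R) : has_sum f z -> 0 < e -> rects [set A | nc (z - psum f A) < e].
Proof. by move=> fz e0; exact: (fz _ (nbhs_nc z e0)). Qed.

Lemma psum_real g A : psum (fun x i => (g x i)%:C%C) A = (psum g A)%:C%C :> R[i].
Proof.
rewrite /psum (big_morph _ (@rcD R) (erefl _)); apply: eq_bigr => x _.
by rewrite (big_morph _ (@rcD R) (erefl _)).
Qed.

Lemma has_sum_real g K : (forall x i, 0 <= g x i) -> (forall A, psum g A <= K) ->
  exists s, [/\ s <= K, forall A, psum g A <= s & has_sum (fun x i => (g x i)%:C%C) s%:C%C].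
Proof.
move=> g0 gK; have [s [sK ls sn]] := rects_sup g0 gK; exists s; split=> //.
apply: cvg_nc => e e0; apply: (@filterS _ rects _ _ _ _ (sn _ e0)) => A /= Ae.
have -> : s%:C%C - psum (fun x i => (g x i)%:C%C) A = (s - psum g A)%:C%C.
  by rewrite psum_real; apply/eqP; rewrite eq_complex /= subr0 !eqxx.
by rewrite nc_real ger0_norm ?subr_ge0 // ltrBlDr -ltrBlDl.
Qed.

(** The real and imaginary parts are split into positive and negative parts, which gives four
    families with bounded nonnegative partial sums. *)
Lemma has_sum_ex f g K : (forall x i, nc (f x i) <= g x i) -> (forall A, psum g A <= K) ->
  exists z, has_sum f z.
Proof.
move=> fg gK.
pose part (h : I -> nat -> R) x i := Num.max 0 (h x i).
have part_sum h : (forall x i, `|h x i| <= nc (f x i)) ->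
    exists s : R, has_sum (fun x i => (part h x i)%:C%C) s%:C%C.
  move=> hf; have [||s [_ _ hs]] := @has_sum_real (part h) K; last by exists s.
  - by move=> x i; rewrite le_max lexx.
  - move=> A; apply: le_trans (gK A); apply: ler_sum => x _; apply: ler_sum => i _.
    rewrite ge_max (le_trans (normr_ge0 _) (le_trans (hf x i) (fg x i))) /=.
    by apply: le_trans (ler_norm _) (le_trans (hf x i) (fg x i)).
pose a x i := complex.Re (f x i); pose b x i := complex.Im (f x i).
have af x i : `|a x i| <= nc (f x i).
  rewrite /a; case: (f x i) => p q; rewrite -sqrtr_sqr ler_wsqrtr //= lerDl; exact: sqr_ge0.
have bf x i : `|b x i| <= nc (f x i).
  rewrite /b; case: (f x i) => p q; rewrite -sqrtr_sqr ler_wsqrtr //= lerDr; exact: sqr_ge0.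
have [s1 h1] := part_sum a af; have [s2 h2] := part_sum b bf.
have [|s3 h3] := part_sum (fun x i => - a x i); first by move=> x i; rewrite normrN.
have [|s4 h4] := part_sum (fun x i => - b x i); first by move=> x i; rewrite normrN.
exists (- 'i%C * s4%:C%C + ('i%C * s2%:C%C + (- 1 * s3%:C%C + s1%:C%C))).
have := has_sum_lin (c := - 'i%C) h4 (has_sum_lin (c := 'i%C) h2 (has_sum_lin (c := - 1) h3 h1)).
congr (has_sum _ _); apply/funext => x; apply/funext => i.
have pm (t : R) : Num.max 0 t - Num.max 0 (- t) = t.
  have [t0|t0] := leP 0 t; first by rewrite max_l ?subr0 // oppr_le0.
  by rewrite max_r ?oppr_ge0 ?ltW // sub0r opprK.
rewrite /part -/(a x i) -/(b x i).
have -> : f x i = (a x i)%:C%C + 'i%C * (b x i)%:C%C.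
  by rewrite /a /b; case: (f x i) => p q; apply/eqP; rewrite eq_complex /=; apply/andP; split; apply/eqP; ring.
rewrite -{3}(pm (a x i)) -{3}(pm (b x i)) !rcD.
move: (Num.max 0 (a x i)) (Num.max 0 (- a x i)) (Num.max 0 (b x i)) (Num.max 0 (- b x i)) => p q r t.
by apply/eqP; rewrite eq_complex /=; apply/andP; split; apply/eqP; ring.
Qed.

End ComplexSums.
End Rectangles.

Section SquareSummable.
Context {R : realType} {I : choiceType}.

Definition sqs (v : I -> nat -> R[i]) := psum (fun x i => nc (v x i) ^+ 2).

Definition l2_pred : {pred (I -> nat -> R[i])} :=
  fun v => `[< exists K : R, forall A, sqs v A <= K >].

Lemma nc_sqrD (z w : R[i]) : nc (z + w) ^+ 2 <= 2 * nc z ^+ 2 + 2 * nc w ^+ 2.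
Proof.
have := ncD z w; have := nc_ge0 (z + w); have := sqr_ge0 (nc z - nc w).
have := nc_ge0 z; have := nc_ge0 w; nra.
Qed.

Lemma l2_submod_closed : submod_closed l2_pred.
Proof.
split=> [|c v w].
  apply/asboolP; exists 0 => A; rewrite /sqs /psum big1 // => x _.
  by rewrite big1 // => i _; rewrite nc0 expr0n.
move=> /asboolP[K vK] /asboolP[L wL]; apply/asboolP.
exists (2 * nc c ^+ 2 * K + 2 * L) => A.
apply: (@le_trans _ _ (2 * nc c ^+ 2 * sqs v A + 2 * sqs w A)); last first.
  have c0 : 0 <= 2 * nc c ^+ 2 by rewrite mulr_ge0 // sqr_ge0.
  apply: lerD; first exact: (ler_wpM2l c0 (vK A)).
  exact: (ler_wpM2l (ler0n _ 2) (wL A)).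
rewrite /sqs /psum !mulr_sumr -big_split; apply: ler_sum => x _ /=.
rewrite !mulr_sumr -big_split; apply: ler_sum => i _ /=.
apply: le_trans (nc_sqrD _ _) _; rewrite lerD2r.
by rewrite -[c *: v]/(fun x i => c * v x i) ncM exprMn mulrA.
Qed.

HB.instance Definition _ :=
  GRing.isSubmodClosed.Build R[i] (I -> nat -> R[i]) l2_pred l2_submod_closed.

Record l2 := L2 { l2_val :> I -> nat -> R[i]; _ : l2_val \in l2_pred }.

HB.instance Definition _ := [isSub for l2_val].
HB.instance Definition _ := [Choice of l2 by <:].
HB.instance Definition _ := [SubChoice_isSubLmodule of l2 by <:].

Implicit Types v w : l2.

Lemma l2P v : exists K : R, forall A, sqs v A <= K.
Proof. by case: v => v /= /asboolP. Qed.

Lemma l2_ex (f : I -> nat -> R[i]) K : (forall A, sqs f A <= K) -> exists v, forall x i, v x i = f x i.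
Proof.
by move=> fK; have fP : f \in l2_pred by [apply/asboolP; exists K]; exists (L2 fP).
Qed.

Lemma l2_ext v w : (forall x i, v x i = w x i) -> v = w.
Proof. by move=> vw; apply: val_inj; apply/funext => x; apply/funext => i; exact: vw. Qed.

Lemma l2D v w x i : (v + w) x i = v x i + w x i. Proof. by []. Qed.
Lemma l2N v x i : (- v) x i = - v x i. Proof. by []. Qed.
Lemma l2Z (c : R[i]) v x i : (c *: v) x i = c * v x i. Proof. by []. Qed.
(** The default 0 of [xget] is not taken: the sum exists because |z w| <= |z|^2 + |w|^2. *)
Definition l2dot v w : R[i] := xget 0 [set z | has_sum (fun x i => v x i * (w x i)^*) z].

Lemma l2dotP v w : has_sum (fun x i => v x i * (w x i)^*) (l2dot v w).
Proof.
have [K vK] := l2P v; have [L wL] := l2P w.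
have [||z zP] := @has_sum_ex I R (fun x i => v x i * (w x i)^*)
  (fun x i => nc (v x i) ^+ 2 + nc (w x i) ^+ 2) (K + L).
- move=> x i; rewrite ncM nc_conj.
  have := nc_ge0 (v x i); have := nc_ge0 (w x i); nra.
- move=> A; apply: le_trans (lerD (vK A) (wL A)); rewrite /sqs /psum -big_split.
  by rewrite le_eqVlt; apply/orP; left; apply/eqP; apply: eq_bigr => x _; rewrite /= -big_split.
have := @xgetPex _ 0 [set z | has_sum (fun x i => v x i * (w x i)^*) z].
by apply; exists z.
Qed.

Lemma l2dot_lin (c : R[i]) u v w : l2dot (c *: u + v) w = c * l2dot u w + l2dot v w.
Proof.
apply: (has_sum_unique (@l2dotP _ _)).
have := has_sum_lin (c := c) (@l2dotP u w) (@l2dotP v w).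
by congr (has_sum _ _); apply/funext => x; apply/funext => i; rewrite l2D l2Z mulrDl mulrA.
Qed.

Lemma l2dot_conj v w : l2dot v w = (l2dot w v)^*.
Proof.
apply: (has_sum_unique (@l2dotP _ _)).
have := has_sum_conj (@l2dotP w v).
by congr (has_sum _ _); apply/funext => x; apply/funext => i; rewrite conjM conjCK mulrC.
Qed.

Lemma l2dot_sqr v : exists s : R, [/\ l2dot v v = s%:C%C, forall A, sqs v A <= s &
  forall K, (forall A, sqs v A <= K) -> s <= K].
Proof.
have [L vL] := l2P v.
have g0 x i : 0 <= nc (v x i) ^+ 2 by exact: sqr_ge0.
have [s [_ ls hs]] := has_sum_real g0 vL.
have E : l2dot v v = s%:C%C.
  apply: (has_sum_unique (@l2dotP _ _)); move: hs; congr (has_sum _ _).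
  by apply/funext => x; apply/funext => i; rewrite sqr_nc.
exists s; split=> // K vK; have [s' [s'K _ hs']] := has_sum_real g0 vK.
by have /(congr1 (@complex.Re R)) /= -> := has_sum_unique hs hs'.
Qed.

Fact l2dot_bilinear : bilinear_for (GRing.Scale.Law.clone _ _ ( *%R ) _)
  (GRing.Scale.Law.clone _ _ (Num.conj \; *%R) _) l2dot.
Proof.
split=> [w c u v|w c u v] /=.
  exact: l2dot_lin.
by rewrite l2dot_conj l2dot_lin conjD conjM -!l2dot_conj.
Qed.

Fact l2dot_hermitian v w : l2dot v w = (-1) ^+ false * (l2dot w v)^*.
Proof. by rewrite expr0 mul1r l2dot_conj. Qed.

Fact l2dot_pos v : v != 0 -> 0 < l2dot v v.
Proof.
move=> v0; have [s [-> ls _]] := l2dot_sqr v; rewrite ltcE /= eqxx /= lt0r.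
have s0 : 0 <= s by apply: le_trans (ls (fset0, 0%N)); apply: psum_ge0 => x i; exact: sqr_ge0.
rewrite s0 andbT; apply: contra_neq v0 => s00; apply: l2_ext => x i.
have := ls ([fset x]%fset, i.+1); rewrite s00 /sqs /psum /= big_seq_fset1.
rewrite big_ord_recr /= => h; apply: Normc.eq0_normc.
have := nc_ge0 (v x i); have : 0 <= \sum_(j < i) nc (v x j) ^+ 2 by apply: sumr_ge0 => j _; exact: sqr_ge0.
by move: h; move: (\sum_(j < i) _) (nc _) => a b; nra.
Qed.

HB.instance Definition _ := bilinear_isBilinear.Build R[i] l2 l2 R[i]
  (GRing.Scale.Law.clone _ _ ( *%R ) _) (GRing.Scale.Law.clone _ _ (Num.conj \; *%R) _) l2dot l2dot_bilinear.
HB.instance Definition _ := isHermitianSesquilinear.Build R[i] l2 false Num.conj l2dot l2dot_hermitian.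
HB.instance Definition _ := isDotProduct.Build R[i] l2 l2dot l2dot_pos.

Definition l2form : {dot l2 for Num.conj} := l2dot.

End SquareSummable.

Section ComplexCompleteness.
Context {R : realType}.

Lemma real_complete (a : nat -> R) :
  (forall e, 0 < e -> exists n0, forall n m, (n0 <= n)%N -> (n0 <= m)%N -> `|a n - a m| < e) ->
  a @ \oo --> lim (a @ \oo).
Proof.
move=> aC; have : cauchy (a @ \oo).
  apply: cauchy_exP => e e0; have [n0 n0P] := aC e e0.
  exists (a n0); exists n0 => // n /= n0n.
  by rewrite /ball /=; exact: n0P.
by move=> /cauchy_cvg.
Qed.

Lemma complex_complete (u : nat -> R[i]) :
  (forall e, 0 < e -> exists n0, forall n m, (n0 <= n)%N -> (n0 <= m)%N -> nc (u n - u m) < e) ->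
  exists l, forall e, 0 < e -> exists n0, forall n, (n0 <= n)%N -> nc (u n - l) < e.
Proof.
move=> uC.
have ab (z : R[i]) : `|complex.Re z| <= nc z /\ `|complex.Im z| <= nc z.
  by case: z => p q; rewrite -!sqrtr_sqr !ler_wsqrtr //= ?lerDl ?lerDr ?sqr_ge0.
have ul (z : R[i]) : nc z <= `|complex.Re z| + `|complex.Im z|.
  case: z => p q /=; have -> : (p +i* q)%C = p%:C%C + 'i%C * q%:C%C.
    by apply/eqP; rewrite eq_complex /=; apply/andP; split; apply/eqP; ring.
  apply: le_trans (ncD _ _) _; rewrite ncM !nc_real.
  rewrite nc_i.
  by rewrite mul1r.
have lr : (fun n => complex.Re (u n)) @ \oo --> lim ((fun n => complex.Re (u n)) @ \oo).
  apply: real_complete => e /uC[n0 n0P]; exists n0 => n m nn mm.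
  rewrite -ReB; exact: le_lt_trans (ab _).1 (n0P _ _ nn mm).
have li : (fun n => complex.Im (u n)) @ \oo --> lim ((fun n => complex.Im (u n)) @ \oo).
  apply: real_complete => e /uC[n0 n0P]; exists n0 => n m nn mm.
  have -> : complex.Im (u n) - complex.Im (u m) = complex.Im (u n - u m).
    by case: (u n) => p q; case: (u m) => p' q'.
  exact: le_lt_trans (ab _).2 (n0P _ _ nn mm).
set lre := lim _ in lr; set lim_ := lim _ in li.
exists (lre +i* lim_)%C => e e0; have e2 : 0 < e / 2 by rewrite divr_gt0.
have [n1 _ n1P] := (@cvgrPdist_lt _ _ _ _ _ _ _).1 lr _ e2.
have [n2 _ n2P] := (@cvgrPdist_lt _ _ _ _ _ _ _).1 li _ e2.
exists (maxn n1 n2) => n; rewrite geq_max => /andP[h1 h2].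
have := n1P n h1; have := n2P n h2 => /=.
rewrite distrC [X in _ -> X < _ -> _]distrC => k2 k1.
apply: le_lt_trans (ul _) _; rewrite [e]splitr.
by move: k1 k2; case: (u n) => p q /= k1 k2; rewrite ltrD.
Qed.

End ComplexCompleteness.

Section SquareSummableSpace.
Context {R : realType} {I : choiceType}.
Local Notation l2 := (@l2 R I).
Local Notation dot := (@l2form R I).
Local Notation hn := (hnorm (@l2form R I)).
Implicit Types v w : l2.

Lemma sqs_le v A : sqs v A <= hn v ^+ 2.
Proof. by rewrite hnorm_sqr; have [s [E h _]] := l2dot_sqr v; rewrite -[dot v v]/(l2dot v v) E. Qed.

Lemma hn_sqr_le v K : (forall A, sqs v A <= K) -> hn v ^+ 2 <= K.
Proof. by rewrite hnorm_sqr; have [s [E _ h]] := l2dot_sqr v; rewrite -[dot v v]/(l2dot v v) E => /h. Qed.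

Lemma hn_le v K : 0 <= K -> (forall A, sqs v A <= K ^+ 2) -> hn v <= K.
Proof.
by move=> K0 /hn_sqr_le; rewrite ler_pXn2r ?nnegrE ?hnorm_ge0.
Qed.

Lemma entry_le v x i : nc (v x i) <= hn v.
Proof.
rewrite -(@ler_pXn2r _ 2) ?nnegrE ?hnorm_ge0 ?nc_ge0 //.
apply: le_trans (sqs_le v ([fset x]%fset, i.+1)).
rewrite /sqs /psum big_seq_fset1 big_ord_recr /= lerDr.
by apply: sumr_ge0 => j _; exact: sqr_ge0.
Qed.

Lemma sqs_lim (u : nat -> l2) v (l : I -> nat -> R[i]) A (K : R) :
  (forall x i e, 0 < e -> exists n0, forall n, (n0 <= n)%N -> nc (u n x i - l x i) < e) ->
  (exists n0, forall n, (n0 <= n)%N -> sqs (v - u n) A <= K) ->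
  sqs (fun x i => v x i - l x i) A <= K.
Proof.
move=> ul [n0 vK].
have cs (J : Type) (r : seq J) (F : J -> nat -> R) (L : J -> R) :
    (forall j, F j @ \oo --> L j) -> (fun n => \sum_(j <- r) F j n) @ \oo --> \sum_(j <- r) L j.
  move=> FL; elim: r => [|j r IH].
    by rewrite big_nil; under eq_fun do rewrite big_nil; exact: cvg_cst.
  rewrite big_cons; under eq_fun do rewrite big_cons; exact: (cvgD (FL j) IH).
have c : (fun n => sqs (v - u n) A) @ \oo --> sqs (fun x i => v x i - l x i) A.
  apply: (cs) => x; apply: (cs) => i.
  suff h : (fun n => nc (v x i - u n x i)) @ \oo --> nc (v x i - l x i) by exact: (cvgM h h).
  apply/cvgrPdist_lt => e /(ul x i)[n1 n1P]; exists n1 => // n /= /n1P.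
  apply: le_lt_trans.
  move: (v x i) (u n x i) (l x i) => a b c.
  rewrite ler_norml; apply/andP; split.
    have -> : a - b = (a - c) - (b - c) by ring.
    by have := ncB (a - c) (b - c); lra.
  have {1}-> : a - c = (a - b) + (b - c) by ring.
  by have := ncD (a - b) (b - c); lra.
apply: le_eps => e e0.
have [n1 _ n1P] := (@cvgrPdist_lt _ _ _ _ _ _ _).1 c _ e0.
have := n1P (maxn n0 n1) (leq_maxr _ _); have := vK (maxn n0 n1) (leq_maxl _ _).
by move=> /= h; rewrite ltr_norml => /andP[_ h']; move: h h'; lra.
Qed.

Lemma l2_complete : norm_complete (hnorm dot).
Proof.
move=> u uC.
have pc x i : exists z, forall e, 0 < e -> exists n0, forall n, (n0 <= n)%N -> nc (u n x i - z) < e.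
  apply: complex_complete => e /uC[n0 n0P]; exists n0 => n m nn mm.
  by apply: le_lt_trans (n0P n m nn mm); exact: (entry_le (u n - u m)).
pose l x i := projT1 (cid (pc x i)); have lP x i := projT2 (cid (pc x i)).
have near e : 0 < e -> exists n0, forall n A, (n0 <= n)%N -> sqs (fun x i => u n x i - l x i) A <= e ^+ 2.
  move=> e0; have [n0 n0P] := uC e e0; exists n0 => n A nn.
  apply: (@sqs_lim u) => //; exists n0 => m mm; apply: le_trans (sqs_le _ _) _.
  by rewrite ler_pXn2r ?nnegrE ?hnorm_ge0 ?(ltW e0) // ltW // n0P.
have [n1 n1P] := near 1 ltr01.
have [d dE] := @l2_ex R I _ _ (fun A => n1P n1 A (leqnn _)).
(* The entrywise limit l is not yet known to be square summable, but d = u n1 - l is. *)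
exists (u n1 - d) => e e0; have e2 : 0 < e / 2 by rewrite divr_gt0.
have [n0 n0P] := near _ e2; exists n0 => n nn.
apply: (@le_lt_trans _ _ (e / 2)); last by rewrite ltr_pdivrMr // mulr_natr mulr2n ltrDl.
apply: hn_le; first exact: ltW.
move=> A; apply: le_trans (n0P n A nn).
rewrite /sqs le_eqVlt; apply/orP; left; apply/eqP; apply: eq_bigr => x _; apply: eq_bigr => i _.
by rewrite !(l2D, l2N) dE; congr (nc _ ^+ 2); ring.
Qed.

Definition l2_hilbert : hilbert R := @Hilbert R l2 dot l2_complete.

(** The second side of a rectangle can be enlarged after its first side is fixed, so it may depend
    on the indices that occur. *)
Lemma rects_max (P : set ({fset I} * nat)) (M : I -> nat) : rects P ->
  exists A, P A /\ forall x, x \in A.1 -> (M x <= A.2)%N.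
Proof.
move=> [A _ AP]; exists (A.1, maxn A.2 (\max_(x <- A.1) M x)); split=> [|x xA].
  by apply: AP => /=; rewrite fsubset_refl leq_maxl.
by rewrite leq_max (leq_bigmax_seq _ xA) ?orbT.
Qed.

Section Truncation.
Variable A : {fset I} * nat.
Local Notation inA x i := ((x \in A.1) && (i < A.2)%N).

Lemma truncation v : exists w, forall x i, w x i = if inA x i then v x i else 0.
Proof.
have [K vK] := l2P v; apply: (@l2_ex _ _ _ K) => B; apply: le_trans (vK B).
apply: ler_sum => x _; apply: ler_sum => i _; case: ifP => // _.
by rewrite nc0 expr0n sqr_ge0.
Qed.

Lemma psum_restrict (V : nmodType) (f : I -> nat -> V) B :
  (A.1 `<=` B.1)%fset -> (A.2 <= B.2)%N ->
  psum (fun x i => if inA x i then f x i else 0) B = psum f A.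
Proof.
move=> AB1 AB2; rewrite /psum -(big_fset_incl _ AB1) => [|x _ /negbTE xA]; last first.
  by rewrite big1 // => i _; rewrite xA.
apply: eq_big_seq => x xA; rewrite xA /= (big_ord_widen _ _ AB2) [RHS]big_mkcond.
by apply: eq_bigr.
Qed.

Lemma dot_truncation v w w' : (forall x i, w' x i = if inA x i then w x i else 0) ->
  dot v w' = psum (fun x i => v x i * (w x i)^*) A.
Proof.
move=> w'E; apply: (has_sum_unique (@l2dotP _ _ v w')).
apply: cvg_nc => e e0; exists A => // B /andP[AB1 AB2] /=.
rewrite -(psum_restrict _ AB1 AB2) /= (_ : _ - _ = 0) ?nc0 //.
apply/eqP; rewrite subr_eq0; apply/eqP; apply: eq_bigr => x _; apply: eq_bigr => i _.
by rewrite w'E; case: ifP => // _; rewrite conjC0 mulr0.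
Qed.

Lemma sqs_truncation v w : (forall x i, w x i = if inA x i then v x i else 0) ->
  forall K, (forall B, sqs v B <= K) -> hn (v - w) ^+ 2 <= K - sqs v A.
Proof.
move=> wE K vK; apply: hn_sqr_le => B.
pose C := ((A.1 `|` B.1)%fset, maxn A.2 B.2).
have sq0 (u : I -> nat -> R[i]) x i : 0 <= nc (u x i) ^+ 2 by exact: sqr_ge0.
apply: (@le_trans _ _ (sqs (v - w) C)).
  by apply: psum_le => //=; [exact: fsubsetUr|exact: leq_maxr].
rewrite lerBrDr; apply: le_trans (vK C).
rewrite /sqs -(@psum_restrict _ _ C); [|exact: fsubsetUl|exact: leq_maxl].
rewrite /psum -big_split; apply: ler_sum => x _ /=; rewrite -big_split; apply: ler_sum => i _; cbv beta.
rewrite -[X in X + _ <= _]/(nc (v x i - w x i) ^+ 2) wE; case: ifP => _; first by rewrite subrr nc0 expr0n add0r.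
by rewrite subr0 addr0.
Qed.

End Truncation.

Lemma truncation_dense v (e : R) : 0 < e -> rects [set A : {fset I} * nat | forall w,
  (forall x i, w x i = if (x \in A.1) && (i < A.2)%N then v x i else 0) -> hn (v - w) <= e].
Proof.
move=> e0; have [L vL] := l2P v.
have g0 x i : 0 <= nc (v x i) ^+ 2 by exact: sqr_ge0.
have [s [_ ls sn]] := rects_sup g0 vL.
have e2 : 0 < e ^+ 2 by rewrite exprn_gt0.
apply: (@filterS _ rects _ _ _ _ (sn _ e2)) => A /= Ae w wE.
rewrite -(@ler_pXn2r _ 2) ?nnegrE ?hnorm_ge0 ?(ltW e0) //.
by apply: le_trans (sqs_truncation wE ls) _; rewrite lerBlDl -lerBlDr ltW.
Qed.

End SquareSummableSpace.

Section FiniteVectors.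
Context {R : realType} {I : choiceType}.

Lemma finite_vector (A : {fset I} * nat) (g : I -> nat -> R[i]) : exists w : @l2 R I,
  (forall x i, w x i = if (x \in A.1) && (i < A.2)%N then g x i else 0) /\
  hnorm (@l2form R I) w ^+ 2 <= sqs g A.
Proof.
pose f x i := if (x \in A.1) && (i < A.2)%N then g x i else 0.
have fA B : sqs f B <= sqs g A.
  pose C := ((A.1 `|` B.1)%fset, maxn A.2 B.2).
  apply: (@le_trans _ _ (sqs f C)).
    apply: psum_le => [x i|/=|/=]; [exact: sqr_ge0|exact: fsubsetUr|exact: leq_maxr].
  rewrite /sqs -(@psum_restrict _ A _ _ C); [|exact: fsubsetUl|exact: leq_maxl].
  rewrite le_eqVlt; apply/orP; left; apply/eqP; apply: eq_bigr => x _; apply: eq_bigr => i _.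
  by rewrite /f; case: ifP => // _; rewrite nc0 expr0n.
have [w wE] := l2_ex fA; exists w; split=> //; apply: hn_sqr_le => B.
apply: le_trans (fA B); rewrite le_eqVlt; apply/orP; left; apply/eqP.
by apply: eq_bigr => x _; apply: eq_bigr => i _; rewrite wE.
Qed.

Lemma has_sum_big (J : Type) (r : seq J) (F : J -> I -> nat -> R[i]) (z : J -> R[i]) :
  (forall j, has_sum (F j) (z j)) ->
  has_sum (fun x i => \sum_(j <- r) F j x i) (\sum_(j <- r) z j).
Proof.
move=> Fz; elim: r => [|j r IH].
  rewrite big_nil; apply: cvg_nc => e e0; apply: filterE => A /=.
  rewrite /psum big1 ?subr0 ?nc0 // => x _; rewrite big1 // => i _.
  by rewrite big_nil.
have := has_sum_lin (c := 1) (Fz j) IH; rewrite mul1r big_cons.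
by congr (has_sum _ _); apply/funext => x; apply/funext => i; rewrite big_cons mul1r.
Qed.

Lemma has_sum_approx (f : I -> nat -> R[i]) z (M : I -> nat) (e : R) : has_sum f z -> 0 < e ->
  exists A, nc (z - psum f A) < e /\ forall x, x \in A.1 -> (M x <= A.2)%N.
Proof. by move=> fz e0; exact: (rects_max M (has_sum_near fz e0)). Qed.

(** Partial sums of block expressions agree only on rectangles that contain whole blocks; such
    rectangles occur in every large set, which suffices to compare the sums. *)
Lemma has_sum_unique_high (f g : I -> nat -> R[i]) z w (M : I -> nat) : has_sum f z -> has_sum g w ->
  (forall A, (forall x, x \in A.1 -> (M x <= A.2)%N) -> psum f A = psum g A) -> z = w.
Proof.
move=> fz gw fg; apply/eqP; rewrite -subr_eq0; apply/eqP; apply: Normc.eq0_normc; apply/eqP.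
rewrite eq_le nc_ge0 andbT; apply: le_eps => e e0; rewrite add0r.
have h : has_sum (fun x i => -1 * g x i + f x i) (-1 * w + z) := has_sum_lin gw fz.
have [A [Ae AM]] := has_sum_approx M h e0.
have -> : z - w = (-1 * w + z) - psum (fun x i => -1 * g x i + f x i) A.
  by rewrite psum_lin (fg A AM); ring.
exact: ltW.
Qed.

End FiniteVectors.

(** * The direct sum of the blocks over the unit cone *)

Section BlockOperators.
Context {R : realType} (X : smosData R).
Hypothesis HX : is_smos X.
Local Notation X' := (bdfun (@norm1 R X)).
Local Notation N := (mnorm X).
Local Notation H := (@l2_hilbert R (Moo X)).
Local Notation l2 := (@l2 R (Moo X)).
Local Notation dot := (@l2form R (Moo X)).
Local Notation hn := (hnorm (@l2form R (Moo X))).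
Let HN := smos_norm HX.
Let N_ge0 := matrix_norm_ge0 HN.

Definition msize (x : Moo X) : nat := projT1 (cid (moo_finsupp x)).

Lemma msizeP x : Mn (msize x) x. Proof. exact: (projT2 (cid (moo_finsupp x))). Qed.

(* Blocks are indexed by all of M_oo(X); those off the unit cone are 0. *)
Definition block (f : X') (v : Moo X -> nat -> R[i]) (x : Moo X) (i : nat) : R[i] :=
  if `[< unit_cone x >] then \sum_(j < msize x) f (x i j) * v x j else 0.

Lemma blockE f v x i M : unit_cone x -> (msize x <= M)%N ->
  block f v x i = \sum_(j < M) f (x i j) * v x j.
Proof.
move=> /asboolP xu xM; rewrite /block xu; apply: (@eq_sum_ord _ _ _ (fun j => f (x i j) * v x j)) => j jM.
  by rewrite (@msizeP x) ?jM ?orbT // bd0 mul0r.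
by rewrite (@msizeP x) ?(leq_trans xM jM) ?orbT // bd0 mul0r.
Qed.

(** Testing the form with w = a v gives |a v|^2 <= K |v| |a v|. *)
Lemma row_bound (a : nat -> nat -> R[i]) (v : nat -> R[i]) (K : R) M : 0 <= K ->
  (forall w : nat -> R[i], nc (\sum_(k < M) \sum_(l < M) (w k)^* * a k l * v l) <=
     K * (Num.sqrt (\sum_(l < M) nc (v l) ^+ 2) * Num.sqrt (\sum_(k < M) nc (w k) ^+ 2))) ->
  \sum_(k < M) nc (\sum_(l < M) a k l * v l) ^+ 2 <= K ^+ 2 * \sum_(l < M) nc (v l) ^+ 2.
Proof.
move=> K0 aK; pose w k := \sum_(l < M) a k l * v l.
set V := \sum_(l < M) nc (v l) ^+ 2; set S := \sum_(k < M) nc (\sum_(l < M) a k l * v l) ^+ 2.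
have S0 : 0 <= S by apply: sumr_ge0 => k _; exact: sqr_ge0.
have V0 : 0 <= V by apply: sumr_ge0 => k _; exact: sqr_ge0.
have := aK w; rewrite -/V -/S.
have -> : \sum_(k < M) \sum_(l < M) (w k)^* * a k l * v l = S%:C%C.
  rewrite /S (big_morph _ (@rcD R) (erefl _)); apply: eq_bigr => k _.
  transitivity ((w k)^* * w k); last by rewrite [LHS]mulrC -sqr_nc.
  by rewrite {2}/w mulr_sumr; apply: eq_bigr => l _; rewrite mulrA.
rewrite nc_real ger0_norm // => h.
have [->|Sn] := eqVneq S 0; first by rewrite mulr_ge0 // sqr_ge0.
have sS : 0 < Num.sqrt S by rewrite sqrtr_gt0 lt0r Sn.
have h' : Num.sqrt S <= K * Num.sqrt V.
  by rewrite -(ler_pM2r sS) -expr2 sqr_sqrtr // -mulrA.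
rewrite -[S]sqr_sqrtr // -[V]sqr_sqrtr // -exprMn ler_pXn2r ?nnegrE ?mulr_ge0 ?sqrtr_ge0 //.
Qed.

Lemma block_bound (f : X') (x : Moo X) (v : nat -> R[i]) M : unit_cone x ->
  \sum_(i < M) nc (\sum_(j < M) f (x i j) * v j) ^+ 2 <=
  (dual_norm N (mx1 f : Moo X')) ^+ 2 * \sum_(j < M) nc (v j) ^+ 2.
Proof.
move=> [_ x1]; have K0 := dual_norm_ge0 HN HN (fun x => lexx _) (mx1 f).
apply: (@row_bound (fun i j => f (x i j))) => // w.
have := dual_norm_ale1 HN (fun x => lexx _) (mx1 f) x1.
move=> /ale_form /(_ M 1%N (fun l _ => v l) (fun k _ => w k)).
rewrite /n2; under [X in Num.sqrt X * _]eq_bigr do rewrite big_ord1.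
under [X in _ * Num.sqrt X]eq_bigr do rewrite big_ord1.
apply: le_trans; rewrite le_eqVlt; apply/orP; left; apply/eqP; congr nc.
apply: eq_bigr => k _; apply: eq_bigr => l _; rewrite !big_ord1.
by rewrite /parr mx1E.
Qed.

Lemma block_sqs (f : X') (v : l2) A : sqs (block f v) A <= (dual_norm N (mx1 f : Moo X') * hn v) ^+ 2.
Proof.
(* The rectangle is widened until it contains the full blocks of all its indices; a narrower one
   would cut the sums over j. *)
pose M := maxn A.2 (\max_(x <- A.1) msize x).
rewrite exprMn; apply: (@le_trans _ _ (dual_norm N (mx1 f : Moo X') ^+ 2 * sqs v (A.1, M))); last first.
  by rewrite ler_wpM2l ?sqr_ge0 // sqs_le.
rewrite /sqs /psum mulr_sumr /=.
rewrite big_seq [X in _ <= X]big_seq; apply: ler_sum => x xA.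
have [xu|xu] := pselect (unit_cone x); last first.
  rewrite big1 => [|i _].
    by apply: mulr_ge0; [exact: sqr_ge0|apply: sumr_ge0 => i _; exact: sqr_ge0].
  by rewrite /block asboolF // nc0 expr0n.
have xM : (msize x <= M)%N by rewrite leq_max (leq_bigmax_seq _ xA) ?orbT.
apply: le_trans (block_bound f (v x) M xu).
rewrite (eq_bigr (fun i : 'I_A.2 => nc (\sum_(j < M) f (x i j) * v x j) ^+ 2)); last first.
  by move=> i _; rewrite (blockE _ _ _ xu xM).
apply: (@le_sum_widen _ _ _ (fun i => nc (\sum_(j < M) f (x i j) * v x j) ^+ 2)) => [|i].
  exact: leq_maxl.
exact: sqr_ge0.
Qed.

Lemma block_op_ex (f : X') : exists T : bdop H, forall v x i, (T v : l2) x i = block f (v : l2) x i.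
Proof.
have ex (v : l2) : exists w : l2, forall x i, w x i = block f v x i.
  by apply: l2_ex => A; exact: block_sqs.
pose T v : l2 := projT1 (cid (ex v)); have TE v := projT2 (cid (ex v)).
have [||U UE] := @op_ex R H T.
- move=> c v w; apply: l2_ext => x i; rewrite l2D l2Z !TE /block; case: asboolP => _.
    rewrite mulr_sumr -big_split; apply: eq_bigr => j _.
    by rewrite l2D l2Z /=; ring.
  by rewrite mulr0 addr0.
- exists (dual_norm N (mx1 f : Moo X')) => v; apply: hn_le.
    by rewrite mulr_ge0 ?hnorm_ge0 //; exact: (dual_norm_ge0 HN HN (fun x => lexx _)).
  move=> A; apply: le_trans (block_sqs f v A); rewrite le_eqVlt; apply/orP; left; apply/eqP.
  by apply: eq_bigr => x _; apply: eq_bigr => i _; rewrite TE.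
- by exists U => v x i; rewrite UE TE.
Qed.

Definition block_op (f : X') : bdop H := projT1 (cid (block_op_ex f)).

Lemma block_opE f v x i : (block_op f v : l2) x i = block f (v : l2) x i.
Proof. exact: (projT2 (cid (block_op_ex f))). Qed.

Lemma block_op_lin : linear block_op.
Proof.
move=> c f g; apply: op_ext => v; apply: l2_ext => x i.
rewrite op_fun_lin l2D l2Z !block_opE /block; case: asboolP => _; last by rewrite mulr0 addr0.
rewrite mulr_sumr -big_split; apply: eq_bigr => j _.
by rewrite bd_funD bd_funZ /=; ring.
Qed.

(** Elements of the unit cone are self-adjoint, so the adjoint of the block [f(x_ij)] is the block
    of the dual star of f. *)
Lemma block_op_star f : block_op (dual_star f) = adjoint (block_op f).
Proof.
apply/esym/adjoint_unique => v w.
apply: (has_sum_unique_high (M := msize) (@l2dotP _ _ (block_op f v) w) (@l2dotP _ _ v (block_op (dual_star f) w))).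
move=> A AM; apply: eq_big_seq => x /AM xM.
have [xu|xu] := pselect (unit_cone x); last first.
  rewrite !big1 // => i _; rewrite block_opE /block asboolF ?conjC0 ?mulr0 ?mul0r //.
have xs : msa x := smos_cone_sa HX xu.1.
rewrite (eq_bigr (fun i : 'I_A.2 => \sum_(j < A.2) f (x i j) * (v : l2) x j * ((w : l2) x i)^*)); last first.
  by move=> i _; rewrite block_opE (blockE _ _ _ xu xM) mulr_suml.
rewrite exchange_big /=; apply: eq_bigr => j _.
rewrite block_opE (blockE _ _ _ xu xM) conj_sum mulr_sumr; apply: eq_bigr => i _.
rewrite conjM (dual_starE HX) conjCK -(mstarEE (smos_star_lin HX)) (xs : mstar x = x); ring.
Qed.

End BlockOperators.

Lemma ge0_approx (R : realType) (z : R[i]) :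
  (forall e : R, 0 < e -> exists2 p : R[i], 0 <= p & nc (z - p) < e) -> 0 <= z.
Proof.
move=> h; rewrite ge0_complexE; apply/andP; split.
  rewrite -oppr_le0; apply: le_eps => e /h[p]; rewrite ge0_complexE => /andP[p0 _] zp.
  have := Re_le_nc (p - z); rewrite -ncN opprB => /le_trans /(_ (ltW zp)).
  by rewrite ReB; move: p0; lra.
rewrite -normr_eq0 eq_le normr_ge0 andbT; apply: le_eps => e /h[p].
rewrite ge0_complexE => /andP[_ /eqP p0] zp; rewrite add0r; apply: le_trans (ltW zp).
have -> : complex.Im z = complex.Im (z - p) by move: p0; case: (z) => a b; case: (p) => c d /= ->; rewrite subr0.
by case: (z - p) => a b; rewrite -sqrtr_sqr ler_wsqrtr //= lerDr sqr_ge0.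
Qed.

Section BlockForms.
Context {R : realType} (X : smosData R).
Hypothesis HX : is_smos X.
Local Notation X' := (bdfun (@norm1 R X)).
Local Notation N := (mnorm X).
Local Notation H := (@l2_hilbert R (Moo X)).
Local Notation l2 := (@l2 R (Moo X)).
Local Notation dot := (@l2form R (Moo X)).
Local Notation hn := (hnorm (@l2form R (Moo X))).
Local Notation Phi := (block_op HX).
Let HN := smos_norm HX.
Let N_ge0 := matrix_norm_ge0 HN.

(** The part in block x of an n-tuple of vectors, arranged as a vector of C^m (x) C^n, on which
    theta_F(x) acts. *)
Definition coords n (xi : 'I_n -> l2) (x : Moo X) (l b : nat) : R[i] := (natfun xi b : l2) x l.

Lemma block_form_sum (F : Moo X') n (xi eta : 'I_n -> l2) :
  has_sum (fun x i => \sum_(a < n) \sum_(b < n) block (F a b) (xi b) x i * (eta a x i)^*)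
    (opf (hdot H) (@bdop_val R H) (mmap Phi F) xi eta).
Proof.
rewrite /opf; apply: (has_sum_big (F := fun (a : 'I_n) x i => \sum_(b < n) block (F a b) (xi b) x i * (eta a x i)^*)) => a.
apply: (has_sum_big (F := fun (b : 'I_n) x i => block (F a b) (xi b) x i * (eta a x i)^*)) => b.
rewrite mmapE ?(lin0 (block_op_lin HX)) //.
have := @l2dotP _ _ (Phi (F a b) (xi b)) (eta a).
by congr (has_sum _ _); apply/funext => x; apply/funext => i; rewrite block_opE.
Qed.

Lemma block_form_psum (F : Moo X') n (xi eta : 'I_n -> l2) (A : {fset Moo X} * nat) :
  (forall x, x \in A.1 -> (msize x <= A.2)%N) ->
  psum (fun x i => \sum_(a < n) \sum_(b < n) block (F a b) (xi b) x i * (eta a x i)^*) A =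
  \sum_(x <- A.1) if `[< unit_cone x >] then afm (parr F x) A.2 n (coords xi x) (coords eta x) else 0.
Proof.
move=> AM; apply: eq_big_seq => x /AM xM; case: asboolP => xu; last first.
  by rewrite big1 // => i _; rewrite big1 // => a _; rewrite big1 // => b _; rewrite /block asboolF // mul0r.
apply: eq_bigr => i _; rewrite [RHS]exchange_big; apply: eq_bigr => a _ /=.
rewrite [RHS]exchange_big; apply: eq_bigr => b _ /=.
rewrite (blockE _ _ _ xu xM) mulr_suml; apply: eq_bigr => j _.
by rewrite /parr /coords !natfunE; ring.
Qed.

Lemma coords_sqs n (xi : 'I_n -> l2) (A : {fset Moo X} * nat) :
  \sum_(x <- A.1) n2 A.2 n (coords xi x) <= hsq (hdot H) xi.
Proof.
rewrite (eq_bigr (fun x => \sum_(b < n) \sum_(i < A.2) nc (xi b x i) ^+ 2)); last first.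
  move=> x _; rewrite n2_flip; apply: eq_bigr => b _; apply: eq_bigr => i _.
  by rewrite /coords natfunE.
by rewrite exchange_big; apply: ler_sum => b _; exact: (sqs_le (xi b) A).
Qed.

(** Up to e, the form is a finite sum of the forms of the blocks. Each is bounded by B, and
    Cauchy-Schwarz over the blocks recombines the lengths. *)
Lemma block_norm_le (F : Moo X') (B : R) : 0 <= B -> (forall x, unit_cone x -> ale (parr F x) B) ->
  mnorm (LH H) (mmap Phi F) <= B.
Proof.
move=> B0 FB; apply: op_mnorm_le => // n xi eta x1 e1; apply: le_eps => e e0.
have [A [Ae AM]] := has_sum_approx (@msize R X) (@block_form_sum F n xi eta) e0.
set z := opf _ _ _ _ _ in Ae *; set p := psum _ A in Ae.
have -> : z = (z - p) + p by ring.
apply: le_trans (ncD _ _) _; rewrite addrC lerD //; last exact: ltW.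
rewrite /p (block_form_psum F xi eta AM).
apply: (@le_trans _ _ (\sum_(x <- A.1) B * (Num.sqrt (n2 A.2 n (coords xi x)) * Num.sqrt (n2 A.2 n (coords eta x))))).
  apply: le_trans (nc_sum _ _ _) _; apply: ler_sum => x _; case: asboolP => xu.
    exact: (ale_form (FB x xu)).
  by rewrite nc0 mulr_ge0 // mulr_ge0 ?sqrtr_ge0.
rewrite -mulr_sumr -[leRHS]mulr1 ler_wpM2l //.
apply: le_trans (real_CS _ _ _) _.
have bd (zeta : 'I_n -> l2) : hsq (hdot H) zeta <= 1 ->
    Num.sqrt (\sum_(x <- A.1) Num.sqrt (n2 A.2 n (coords zeta x)) ^+ 2) <= 1.
  move=> z1; rewrite -sqrtr1 ler_wsqrtr //.
  under eq_bigr do rewrite sqr_sqrtr ?n2_ge0 //.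
  exact: le_trans (coords_sqs _ _) z1.
by rewrite mulr_ile1 ?sqrtr_ge0 ?bd.
Qed.

Lemma block_pos (F : Moo X') : (forall x, unit_cone x -> apos (parr F x)) -> mcone (LH H) (mmap Phi F).
Proof.
move=> Fp n xi; apply: ge0_approx => e e0.
have [A [Ae AM]] := has_sum_approx (@msize R X) (@block_form_sum F n xi xi) e0.
eexists; last exact: Ae.
rewrite (block_form_psum F xi xi AM); apply: sumr_ge0 => x _; case: asboolP => // xu.
exact: Fp.
Qed.

Lemma unit_vector (x : Moo X) m (xi : nat -> R[i]) : exists w : l2,
  (forall y i, w y i = if (y == x) && (i < m)%N then xi i else 0) /\
  hn w ^+ 2 <= \sum_(i < m) nc (xi i) ^+ 2.
Proof.
have [w [wE wb]] := finite_vector ([fset x]%fset, m) (fun _ i => xi i).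
exists w; split=> [y i|]; first by rewrite wE in_fset1.
by move: wb; rewrite /sqs /psum big_seq_fset1.
Qed.

Lemma block_dot (f : X') (x : Moo X) m xi eta (w w' : l2) : unit_cone x ->
  (forall y i, w y i = if (y == x) && (i < m)%N then xi i else 0) ->
  (forall y i, w' y i = if (y == x) && (i < m)%N then eta i else 0) ->
  dot (Phi f w) w' = \sum_(i < m) \sum_(j < m) (eta i)^* * f (x i j) * xi j.
Proof.
move=> xu wE w'E.
rewrite (@dot_truncation _ _ ([fset x]%fset, m) _ w') => [|y i]; last first.
  by rewrite w'E /= in_fset1; case: ifP.
rewrite /psum big_seq_fset1; apply: eq_bigr => i _.
rewrite w'E eqxx ltn_ord block_opE /block asboolT // mulr_suml.
rewrite (@eq_sum_ord _ _ m (fun j => f (x i j) * w x j * (eta i)^*)) => [|j jx|j jm].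
- by apply: eq_bigr => j _; rewrite wE eqxx ltn_ord /=; ring.
- by rewrite (@msizeP _ _ x) ?jx ?orbT // bd0 !mul0r.
- by rewrite wE ltnNge jm andbF mulr0 mul0r.
Qed.

Lemma opf_block (F : Moo X') (x : Moo X) m n xi eta (w w' : 'I_n -> l2) : unit_cone x ->
  (forall b y i, w b y i = if (y == x) && (i < m)%N then xi i (b : nat) else 0) ->
  (forall b y i, w' b y i = if (y == x) && (i < m)%N then eta i (b : nat) else 0) ->
  opf (hdot H) (@bdop_val R H) (mmap Phi F) w w' = afm (parr F x) m n xi eta.
Proof.
move=> xu wE w'E; rewrite /opf /afm.
rewrite (@exchange4 _ m m n n (fun k l p q => (eta k p)^* * parr F x k l p q * xi l q)).
apply: eq_bigr => p _; apply: eq_bigr => q _; rewrite mmapE ?(lin0 (block_op_lin HX)) //.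
exact: (block_dot _ xu (wE q) (w'E p)).
Qed.

Lemma block_vectors (x : Moo X) m n (xi : nat -> nat -> R[i]) : exists w : 'I_n -> l2,
  (forall b y i, w b y i = if (y == x) && (i < m)%N then xi i (b : nat) else 0) /\
  hsq (hdot H) w <= n2 m n xi.
Proof.
have ex (b : 'I_n) := unit_vector x m (fun i => xi i b).
exists (fun b => projT1 (cid (ex b))); split=> [b|]; first by case: (projT2 (cid (ex b))).
by rewrite n2_flip; apply: ler_sum => b _; case: (projT2 (cid (ex b))).
Qed.

(** Vectors supported in the single block x recover the form of theta_F(x). *)
Lemma block_norm_ge (F : Moo X') x : unit_cone x -> ale (parr F x) (mnorm (LH H) (mmap Phi F)).
Proof.
move=> xu m n xi eta x1 e1.
have [w [wE wb]] := block_vectors x m n xi; have [w' [w'E w'b]] := block_vectors x m n eta.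
rewrite -(opf_block F xu wE w'E); apply: le_trans (LH_form _ _ _) _.
rewrite -[leRHS]mulr1 ler_wpM2l ?op_mnorm_ge0 // mulr_ile1 ?sqrtr_ge0 // -[leRHS]sqrtr1 ler_wsqrtr //.
  exact: le_trans wb x1.
exact: le_trans w'b e1.
Qed.

Lemma block_pos_inv (F : Moo X') x : unit_cone x -> mcone (LH H) (mmap Phi F) -> apos (parr F x).
Proof.
move=> xu Fp m n xi; have [w [wE _]] := block_vectors x m n xi.
by rewrite -(opf_block F xu wE wE); exact: Fp.
Qed.

End BlockForms.

Section BasisVectors.
Context {R : realType} {I : choiceType}.
Local Notation l2 := (@l2 R I).
Local Notation dot := (@l2form R I).
Local Notation hn := (hnorm (@l2form R I)).

Lemma basis_vector_ex (x : I) (i : nat) : exists w : l2,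
  (forall y j, w y j = ((y == x) && (j == i))%:R) /\ hn w <= 1.
Proof.
have [w [wE wb]] := finite_vector ([fset x]%fset, i.+1) (fun _ j => (j == i)%:R : R[i]).
exists w; split=> [y j|].
  rewrite wE in_fset1; case: eqP => //= _; rewrite ltnS.
  by case: (ltngtP j i) => // h; case: ifP.
rewrite -(@ler_pXn2r _ 2) ?nnegrE ?hnorm_ge0 ?ler01 // expr1n; apply: le_trans wb _.
rewrite /sqs /psum big_seq_fset1 big_ord_recr /= eqxx nc1 expr1n big1 ?add0r // => j _.
by rewrite (ltn_eqF (ltn_ord j)) nc0 expr0n.
Qed.

Definition basis_vector x i : l2 := projT1 (cid (basis_vector_ex x i)).

Lemma basis_vectorE x i y j : basis_vector x i y j = ((y == x) && (j == i))%:R.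
Proof. by have [h _] := projT2 (cid (basis_vector_ex x i)); exact: h. Qed.

Lemma basis_vector_norm x i : hn (basis_vector x i) <= 1.
Proof. by have [_] := projT2 (cid (basis_vector_ex x i)). Qed.

Lemma dot_basis (v : l2) x i : dot v (basis_vector x i) = v x i.
Proof.
rewrite (@dot_truncation _ _ ([fset x]%fset, i.+1) _ (basis_vector x i)) => [|y j]; last first.
  rewrite basis_vectorE in_fset1 /=; case: eqP => //= _; rewrite ltnS.
  by case: (ltngtP j i).
rewrite /psum big_seq_fset1 big_ord_recr /= basis_vectorE !eqxx conjC1 mulr1 big1 ?add0r // => j _.
by rewrite basis_vectorE (ltn_eqF (ltn_ord j)) andbF conjC0 mulr0.
Qed.

(** Truncations of v are finite combinations of basis vectors and approximate v in norm; the bound K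
    of S controls the remainder. *)
Lemma op_basis0 (S : bdop (@l2_hilbert R I)) :
  (forall x j y i, dot (S (basis_vector x j)) (basis_vector y i) = 0) -> forall v, S v = 0.
Proof.
move=> S0 v; have Sb x j : S (basis_vector x j) = 0.
  by apply: l2_ext => y i; rewrite -dot_basis S0.
have [K K0 SK] := op_bd S.
apply: (@hnorm_eq0 _ _ (hdot (@l2_hilbert R I))); apply/eqP; rewrite eq_le hnorm_ge0 andbT.
apply: le_eps => e e0; rewrite add0r.
have K1 : 0 < K + 1 by rewrite ltr_wpDl.
have d0 : 0 < e / (K + 1) by rewrite divr_gt0.
have [A [AP _]] := rects_max (fun=> 0%N) (truncation_dense v d0).
have [w wE] := truncation A v.
have -> : S v = S (v - w).
  have -> : w = \sum_(x <- A.1) \sum_(i < A.2) (v : l2) x i *: (basis_vector x i : l2_hilbert).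
    apply: l2_ext => y j; rewrite wE.
    have ev (J : Type) (r : seq J) (F : J -> l2) : (\sum_(k <- r) F k) y j = \sum_(k <- r) F k y j.
      by elim: r => [|k r IH]; rewrite ?big_nil // !big_cons l2D IH.
    rewrite (ev _ _ (fun x => \sum_(i < A.2) (v : l2) x i *: basis_vector x i)).
    have E x : (\sum_(i < A.2) (v : l2) x i *: basis_vector x i) y j =
        if (y == x) && (j < A.2)%N then (v : l2) x j else 0.
      rewrite (ev _ _ (fun i : 'I_A.2 => (v : l2) x i *: basis_vector x i)).
      under eq_bigr do rewrite l2Z basis_vectorE.
      case: eqP => [_|_] /=; last by rewrite big1 // => i _; rewrite mulr0.
      case: ifP => [jA|jA].
        rewrite (bigD1 (Ordinal jA)) //= eqxx mulr1 big1 ?addr0 // => i ij.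
        by rewrite eq_sym -val_eqE /= in ij; rewrite (negbTE ij) mulr0.
      by rewrite big1 // => i _; case: eqP => [ji|]; rewrite ?mulr0 //; rewrite ji ltn_ord in jA.
    under eq_bigr do rewrite E.
    case: (boolP (y \in A.1)) => yA /=; last first.
      by rewrite big_seq big1 // => x xA; case: eqP => // yx; rewrite yx xA in yA.
    rewrite (big_fsetD1 y) //= eqxx /= big_seq big1 ?addr0 // => x.
    by rewrite in_fsetD1 eq_sym; case: eqP.
  rewrite opD (linN (op_lin S)) op_sum big1 ?subr0 // => x _.
  by rewrite op_sum big1 // => i _; rewrite opZ Sb scaler0.
apply: le_trans (SK _) _; apply: (@le_trans _ _ (K * (e / (K + 1)))).
  by rewrite ler_wpM2l //; exact: AP.
by rewrite mulrCA ler_piMr ?(ltW e0) // ler_pdivrMr // mul1r lerDl.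
Qed.

End BasisVectors.

Section BlockWeakStar.
Context {R : realType} (X : smosData R).
Hypothesis HX : is_smos X.
Local Notation X' := (bdfun (@norm1 R X)).
Local Notation N := (mnorm X).
Local Notation H := (@l2_hilbert R (Moo X)).
Local Notation l2 := (@l2 R (Moo X)).
Local Notation dot := (@l2form R (Moo X)).
Local Notation hn := (hnorm (@l2form R (Moo X))).
Local Notation Phi := (block_op HX).
Let HN := smos_norm HX.

Lemma block_op_unit (f : X') (v : l2) : (forall y, nc (f y) <= norm1 y) -> hn (Phi f v) <= hn v.
Proof.
move=> f1; have K1 : dual_norm N (mx1 f : Moo X') <= 1.
  by apply: (dual_norm_le ler01) => x x1; apply: aleW (ale_mx1 HX f1 x).
apply: hn_le; first exact: hnorm_ge0.
move=> A; apply: (@le_trans _ _ (sqs (block f v) A)).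
  by rewrite le_eqVlt; apply/orP; left; apply/eqP; apply: eq_bigr => x _; apply: eq_bigr => i _; rewrite block_opE.
apply: le_trans (block_sqs HX f v A) _.
have D0 := dual_norm_ge0 HN HN (fun x => lexx _) (mx1 f : Moo X').
rewrite ler_pXn2r ?nnegrE ?mulr_ge0 ?hnorm_ge0 //.
by rewrite ler_piMl ?hnorm_ge0.
Qed.

Lemma block_psum_ev (xi eta : l2) A : exists z : X, forall f : X',
  psum (fun x i => block f xi x i * (eta x i)^*) A = f z.
Proof.
exists (\sum_(x <- A.1) \sum_(i < A.2) if `[< unit_cone x >] then
  \sum_(j < msize x) ((eta x i)^* * xi x j) *: x i j else 0) => f.
rewrite bd_sum; apply: eq_bigr => x _; rewrite bd_sum; apply: eq_bigr => i _.
rewrite /block; case: asboolP => _; last by rewrite mul0r bd0.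
rewrite mulr_suml bd_sum; apply: eq_bigr => j _; rewrite bdZ; ring.
Qed.

Lemma block_basis (f : X') u : unit_cone u ->
  dot (Phi f (basis_vector u 0)) (basis_vector u 0) = f (u 0%N 0%N).
Proof.
move=> uu; rewrite dot_basis block_opE (blockE _ _ _ uu (leqnSn _)) big_ord_recl basis_vectorE !eqxx mulr1.
by rewrite big1 ?addr0 // => j _; rewrite basis_vectorE andbF mulr0.
Qed.

Hypothesis HXc : complete_smos X.

(** If eta is cut to a rectangle, the pairing is evaluation at a finite combination of entries. The
    error is at most |xi| |eta - w| uniformly on the unit ball of the dual, so the limit is an
    evaluation by [ev_closed]. *)
Lemma block_ev (xi eta : l2) : exists z : X, forall f : X', dot (Phi f xi) eta = f z.
Proof.
apply: (ev_closed HX HXc) => [c f|e e0].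
  by rewrite (linZ (block_op_lin HX)) -[(c *: Phi f) xi]/(c *: (Phi f xi)) dotZl.
have K1 : 0 < hn xi + 1 by rewrite ltr_wpDl ?hnorm_ge0.
have d0 : 0 < e / (hn xi + 1) by rewrite divr_gt0.
have [A [AP _]] := rects_max (fun=> 0%N) (truncation_dense eta d0).
have [w wE] := truncation A eta; have [z zE] := block_psum_ev xi eta A.
exists z => f f1; have -> : f z = dot (Phi f xi) w.
  rewrite -zE (dot_truncation _ wE); apply: eq_bigr => x _; apply: eq_bigr => i _.
  by rewrite block_opE.
rewrite -dotBr; apply: le_trans (dot_CS _ _ _) _.
apply: (@le_trans _ _ (hn xi * (e / (hn xi + 1)))).
  by apply: ler_pM; rewrite ?hnorm_ge0 //; [exact: block_op_unit|exact: AP].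
by rewrite mulrCA ler_piMr ?(ltW e0) // ler_pdivrMr // mul1r lerDl.
Qed.

Lemma square_summable_tail (xi : nat -> H) (e : R) : square_summable xi -> 0 < e ->
  exists n0, forall m, (n0 <= m)%N -> \sum_(n0 <= k < m) hn (xi k) ^+ 2 <= e.
Proof.
move=> xis e0; have e2 : 0 < e / 2 by rewrite divr_gt0.
have [n0 _ n0P] := (@cvgrPdist_lt _ _ _ _ _ _ _).1 xis _ e2.
exists n0 => m nm; have := n0P n0 (leqnn _); have := n0P m nm.
have -> : \sum_(n0 <= k < m) hn (xi k) ^+ 2 =
  series (fun k => hn (xi k) ^+ 2) m - series (fun k => hn (xi k) ^+ 2) n0.
  by rewrite /series /= (big_cat_nat (leq0n n0) nm) /= addrAC subrr add0r.
move=> /= h1 h2; have := ler_normB; move: h1 h2; move: (lim _) (series _ m) (series _ n0) => l a b.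
rewrite !ltr_norml => /andP[h1 h1'] /andP[h2 h2'] _; lra.
Qed.

(** Finite partial sums are evaluations by [block_ev]. On the unit ball of the dual the tails are at
    most sum (|xi_k|^2 + |eta_k|^2), hence uniformly small, and [ev_closed] applies. *)
Lemma normal_ev (g : bdop H -> R[i]) : normal_functionals g ->
  exists z : X, forall f : X', g (Phi f) = f z.
Proof.
move=> [xi [eta [xis etas gE]]].
pose S n T := \sum_(k < n) dot (T (xi k)) (eta k).
have SE n T : series (fun k => dot (T (xi k)) (eta k)) n = S n T.
  by rewrite /series /= big_mkord.
have near T (e : R) : 0 < e -> exists n0, forall n, (n0 <= n)%N -> nc (g T - S n T) < e.
  move=> e0; have [n0 _ n0P] := gE T _ (nbhs_nc (g T) e0); exists n0 => n nn.
  by rewrite -SE; exact: n0P.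
apply: (ev_closed HX HXc) => [c f|e e0].
  apply/eqP; rewrite -subr_eq0; apply/eqP; apply: Normc.eq0_normc; apply/eqP.
  rewrite eq_le nc_ge0 andbT; apply: le_eps => e e0; rewrite add0r.
  have c1 : 0 < nc c + 1 by rewrite ltr_wpDl ?nc_ge0.
  have d0 : 0 < e / 2 / (nc c + 1) by rewrite !divr_gt0.
  have e2 : 0 < e / 2 by rewrite divr_gt0.
  have [n1 n1P] := near (Phi (c *: f)) _ e2; have [n2 n2P] := near (Phi f) _ d0.
  pose n := maxn n1 n2.
  have -> : g (Phi (c *: f)) - c * g (Phi f) =
      (g (Phi (c *: f)) - S n (Phi (c *: f))) - c * (g (Phi f) - S n (Phi f)).
    have -> : S n (Phi (c *: f)) = c * S n (Phi f).
      rewrite /S mulr_sumr; apply: eq_bigr => k _; rewrite (linZ (block_op_lin HX)).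
      by rewrite -[(c *: Phi f) (xi k)]/(c *: (Phi f (xi k))) dotZl.
    ring.
  apply: le_trans (ncB _ _) _; rewrite [e]splitr ncM; apply: lerD.
    by apply/ltW/n1P; exact: leq_maxl.
  have h : nc (g (Phi f) - S n (Phi f)) <= e / 2 / (nc c + 1) by apply/ltW/n2P; exact: leq_maxr.
  apply: le_trans (ler_wpM2l (nc_ge0 c) h) _.
  by rewrite mulrCA ler_piMr ?(ltW e2) // ler_pdivrMr // mul1r lerDl.
have e2 : 0 < e / 2 by rewrite divr_gt0.
have [n1 n1P] := square_summable_tail xis e2; have [n2 n2P] := square_summable_tail etas e2.
pose n := maxn n1 n2.
have ex k := block_ev (xi k) (eta k).
exists (\sum_(k < n) projT1 (cid (ex k))) => f f1.
have -> : f (\sum_(k < n) projT1 (cid (ex k))) = S n (Phi f).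
  by rewrite bd_sum; apply: eq_bigr => k _; rewrite -(projT2 (cid (ex k)) f).
apply: le_eps => d d0; have [n3 n3P] := near (Phi f) _ d0.
pose m := maxn n n3; have nm : (n <= m)%N := leq_maxl _ _.
have -> : g (Phi f) - S n (Phi f) = (S m (Phi f) - S n (Phi f)) + (g (Phi f) - S m (Phi f)) by ring.
apply: le_trans (ncD _ _) _; apply: lerD; last by apply/ltW/n3P; exact: leq_maxr.
have -> : S m (Phi f) - S n (Phi f) = \sum_(n <= k < m) dot (Phi f (xi k)) (eta k).
  by rewrite -!SE /series /= (big_cat_nat (leq0n n) nm) /= addrAC subrr add0r.
apply: le_trans (nc_sum _ _ _) _.
have tail (zeta : nat -> H) n' : (n' <= n)%N -> (forall m', (n' <= m')%N -> \sum_(n' <= k < m') hn (zeta k) ^+ 2 <= e / 2) ->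
    \sum_(n <= k < m) hn (zeta k) ^+ 2 <= e / 2.
  move=> n'n /(_ m (leq_trans n'n nm)); apply: le_trans; rewrite (big_cat_nat n'n nm) /= lerDr.
  by apply: sumr_ge0 => k _; exact: sqr_ge0.
apply: (@le_trans _ _ (\sum_(n <= k < m) (hn (xi k) ^+ 2 + hn (eta k) ^+ 2))); last first.
  rewrite big_split [e]splitr; apply: lerD; apply: tail.
  - exact: leq_maxl.
  - exact: n1P.
  - exact: leq_maxr.
  - exact: n2P.
apply: ler_sum => k _; apply: le_trans (dot_CS _ _ _) _.
apply: (@le_trans _ _ (hn (xi k) * hn (eta k))).
  by rewrite ler_wpM2r ?hnorm_ge0 //; exact: block_op_unit.
have amgm (b c : R) : b * c <= b ^+ 2 + c ^+ 2.
  have := sqr_ge0 (b - c); have := sqr_ge0 (b + c); nra.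
exact: amgm.
Qed.

End BlockWeakStar.

(** * The linear span of the unit cone *)

Section Spanning.
Context {R : realType} (X : smosData R).
Hypothesis HX : is_smos X.
Local Notation N := (mnorm X).
Let sl := smos_star_lin HX.
Let sK := smos_starK HX.
Let HN := smos_norm HX.
Let N_ge0 := matrix_norm_ge0 HN.

Lemma msa_re (x : Moo X) : msa (x + mstar x).
Proof. by apply: mooP => i j; rewrite (mstarEE sl) !mooD !(mstarEE sl) (starD sl) sK addrC. Qed.

Lemma msa_im (x : Moo X) : msa ('i%C *: (mstar x - x)).
Proof.
apply: mooP => i j; rewrite (mstarEE sl) !mooZ !mooD !mooN !(mstarEE sl) (starZ sl) (starD sl) sK.
by rewrite -[- x j i]scaleN1r (starZ sl) conjN conjC1 scaleN1r conj_i scaleNr -scalerN opprB addrC.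
Qed.

(** The real and imaginary parts of x have norm at most |x|. Scaled to norm at most e / 2 they lie
    in U_X, and each is then a difference of two elements of the unit cone, which gives four terms
    with coefficients of modulus 2 |x| / e. *)
Lemma unit_cone_span : zero_nbhd_sa (U_ X) -> exists2 C, 0 < C &
  forall x : Moo X, exists (c : nat -> R[i]) (u : nat -> Moo X),
    [/\ forall k, unit_cone (u k), forall k, nc (c k) <= C * N x & x = \sum_(k < 4) c k *: u k].
Proof.
move=> [e e0 eU]; exists (2 / e); first by rewrite divr_gt0.
move=> x; have [x0|xn] := eqVneq (N x) 0.
  exists (fun=> 0); exists (fun=> 0); split.
  - by move=> k; exact: (unit_cone0 HX).
  - by move=> k; rewrite nc0 x0 mulr0.
  - have [h0 _ _ _] := HN; rewrite (h0 _ x0) big1 // => k _; exact: scaler0.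
have Np : 0 < N x by rewrite lt0r xn N_ge0.
pose t := e / 2 / N x; have t0 : 0 < t by rewrite !divr_gt0.
have tN : t * N x = e / 2 by rewrite /t divfK.
have small (h : Moo X) : msa h -> N h <= N x -> exists u v, [/\ unit_cone u, unit_cone v & h = t^-1%:C%C *: (u - v)].
  move=> hs hx; have [|u [v [uu vu th]]] := eU (t%:C%C *: h) (msaZ HX t hs).
    rewrite (smos_normZr HX) (gtr0_norm t0).
    apply: (@le_lt_trans _ _ (e / 2)); first by rewrite -tN ler_pM2l.
    by rewrite ltr_pdivrMr // mulr_natr mulr2n ltrDl.
  exists u; exists v; split=> //.
  by rewrite -th scalerA -rcM mulVf ?gt_eqF // rc1 scale1r.
have half (h : Moo X) : N h <= N x + N x -> N (2^-1%:C%C *: h) <= N x.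
  by move=> hx; rewrite (smos_normZr HX) ger0_norm ?invr_ge0 // ler_pdivrMl // mulr_natl mulr2n.
have [||u1 [v1 [u1u v1u h1]]] := small (2^-1%:C%C *: (x + mstar x)).
- by apply: (msaZ HX); exact: msa_re.
- apply: half; apply: le_trans (smos_normD HX _ _) _; by rewrite (smos_norm_star HX).
have [||u2 [v2 [u2u v2u h2]]] := small (2^-1%:C%C *: ('i%C *: (mstar x - x))).
- by apply: (msaZ HX); exact: msa_im.
- apply: half; rewrite (smos_normZ HX) nc_i mul1r.
  by apply: le_trans (matrix_normB HN _ _) _; rewrite (smos_norm_star HX).
pose s : R[i] := t^-1%:C%C.
exists (nth 0 [:: s; - s; 'i%C * s; - ('i%C * s)]); exists (nth 0 [:: u1; v1; u2; v2]); split.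
- by case=> [|[|[|[|k]]]] //=; rewrite nth_nil; exact: (unit_cone0 HX).
- have ns : nc s <= 2 / e * N x.
    rewrite nc_real ger0_norm ?invr_ge0 ?(ltW t0) // /t !invfM !invrK.
    by rewrite le_eqVlt; apply/orP; left; apply/eqP; ring.
  have b0 : 0 <= 2 / e * N x by rewrite mulr_ge0 // divr_ge0 // ltW.
  by case=> [|[|[|[|k]]]] /=; rewrite ?ncN ?ncM ?nc_i ?mul1r // nth_nil nc0.
rewrite !big_ord_recl big_ord0 addr0 /=.
have -> : x = 2^-1%:C%C *: (x + mstar x) + 'i%C *: (2^-1%:C%C *: ('i%C *: (mstar x - x))).
  rewrite !scalerA mulrAC mul_ii mulN1r scaleNr -scalerBr opprB addrACA subrr addr0.
  have -> : x + x = 2%:C%C *: x by rewrite -[2]/(1 + 1) rcD rc1 scalerDl scale1r.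
  by rewrite scalerA -rcM mulVf // rc1 scale1r.
rewrite h1 h2 -/s !scalerBr !scalerA !scaleNr -!addrA.
by [].
Qed.

End Spanning.

Lemma continuous_lin (R : realType) (V : topologicalType) (a : R[i]) (f g : V -> R[i]^o) :
  continuous f -> continuous g -> continuous ((fun t => a * f t + g t) : V -> R[i]^o).
Proof. by move=> fc gc t; exact: (cvgD (cvgM (cvg_cst (a : R[i]^o)) (fc t)) (gc t)). Qed.

Lemma continuous_sub (R : realType) (V : topologicalType) (f g : V -> R[i]^o) :
  continuous f -> continuous g -> continuous ((fun t => f t - g t) : V -> R[i]^o).
Proof. by move=> fc gc t; exact: (cvgB (fc t) (gc t)). Qed.

(** * The range of the block representation *)

Section BlockImage.
Context {R : realType} (X : smosData R).
Hypothesis HX : is_smos X.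
Local Notation X' := (bdfun (@norm1 R X)).
Local Notation N := (mnorm X).
Local Notation H := (@l2_hilbert R (Moo X)).
Local Notation l2 := (@l2 R (Moo X)).
Local Notation dot := (@l2form R (Moo X)).
Local Notation hn := (hnorm (@l2form R (Moo X))).
Local Notation Phi := (block_op HX).
Let HN := smos_norm HX.

Definition block_image : {pred bdop H} := fun T => `[< exists f, T = Phi f >].

Lemma block_image_submod : submod_closed block_image.
Proof.
split=> [|c T U].
  by apply/asboolP; exists 0; rewrite (lin0 (block_op_lin HX)).
move=> /asboolP[f ->] /asboolP[g ->]; apply/asboolP; exists (c *: f + g).
by rewrite (block_op_lin HX).
Qed.

HB.instance Definition _ := GRing.isSubmodClosed.Build R[i] (bdop H) block_image block_image_submod.

Lemma vector_functional_continuous (xi eta : H) :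
  continuous ((fun T : bdop H => dot (T xi) eta) : LH_weakstar H -> R[i]^o).
Proof.
apply: weak_continuous; have := normal_finite 1 (fun=> xi) (fun=> eta).
by under eq_fun do rewrite big_ord1.
Qed.

(** A weak-* continuous functional on L(H) which recovers the value f(x) from the operator of f when
    x is the corner entry of sum_k c_k u_k; four terms suffice by [unit_cone_span]. *)
Definition corner_functional (c : nat -> R[i]) (u : nat -> Moo X) (T : bdop H) : R[i] :=
  \sum_(k < 4) c k * dot (T (basis_vector (u k) 0)) (basis_vector (u k) 0).

Lemma corner_functional_continuous c u :
  continuous (corner_functional c u : LH_weakstar H -> R[i]^o).
Proof.
rewrite /corner_functional; under eq_fun do rewrite !big_ord_recl big_ord0.
do 4! (apply: continuous_lin; first exact: vector_functional_continuous).
exact: (@cst_continuous (LH_weakstar H) R[i]^o 0).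
Qed.

Lemma corner_functional_block c u (f : X') : (forall k, unit_cone (u k)) ->
  corner_functional c u (Phi f) = f (\sum_(k < 4) c k *: u k 0%N 0%N).
Proof.
move=> uu; rewrite bd_sum; apply: eq_bigr => k _.
by rewrite bdZ (block_basis HX).
Qed.

Lemma closure_vanish (T : bdop H) (G : bdop H -> R[i]) :
  closure ([set S | S \in block_image] : set (LH_weakstar H)) T ->
  continuous (G : LH_weakstar H -> R[i]^o) -> (forall f, G (Phi f) = 0) -> G T = 0.
Proof.
move=> Tcl Gc G0; apply: Normc.eq0_normc; apply/eqP; rewrite eq_le nc_ge0 andbT.
apply: le_eps => e e0; rewrite add0r.
have [_ /asboolP[f ->]] := closure_approx Tcl Gc e0.
by rewrite G0 subr0 => /ltW.
Qed.

Hypothesis U0 : zero_nbhd_sa (U_ X).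

Lemma corner_span : exists2 C, 0 < C & forall x : X, exists (c : nat -> R[i]) (u : nat -> Moo X),
    [/\ forall k, unit_cone (u k), forall k, nc (c k) <= C * norm1 x
      & x = \sum_(k < 4) c k *: u k 0%N 0%N].
Proof.
have [C C0 span] := unit_cone_span HX U0; exists C => // x.
have [c [u [uu cb xE]]] := span (mx1 x); exists c; exists u; split=> //.
have := congr1 (fun y : Moo X => y 0%N 0%N) xE; rewrite /= mx1E /= => ->.
by rewrite moo_sum; apply: eq_bigr => k _; rewrite mooZ.
Qed.

Lemma block_op_inj : injective Phi.
Proof.
move=> f g fg; have [C C0 span] := corner_span.
apply: bd_ext => x; have [c [u [uu _ ->]]] := span x.
by rewrite -!corner_functional_block // fg.
Qed.

Hypothesis HXc : complete_smos X.

(** For T in the closure, f(x) is defined as the corner functional of x at T. Linearity of f and the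
    equality of T with the operator of f are identities between weak-* continuous functionals that
    hold on the range, so they pass to its closure. *)
Lemma block_image_closed : closed ([set T | T \in block_image] : set (LH_weakstar H)).
Proof.
move=> T Tcl; have [C C0 span] := corner_span.
pose c x := projT1 (cid (span x)); pose u x := projT1 (cid (projT2 (cid (span x)))).
have cuP x : [/\ forall k, unit_cone (u x k), forall k, nc (c x k) <= C * norm1 x
      & x = \sum_(k < 4) c x k *: u x k 0%N 0%N] := projT2 (cid (projT2 (cid (span x)))).
pose G x := corner_functional (c x) (u x).
have Gc x : continuous (G x : LH_weakstar H -> R[i]^o) by exact: corner_functional_continuous.
have GPhi x f : G x (Phi f) = f x.
  by have [uu _ xE] := cuP x; rewrite /G corner_functional_block // -xE.
have Glin : scalar (fun x => G x T).
  move=> a x y; rewrite /GRing.scale /=.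
  apply/eqP; rewrite -subr_eq0; apply/eqP.
  apply: (@closure_vanish T (fun S => G (a *: x + y) S - (a * G x S + G y S)) Tcl) => [|f].
    by apply: continuous_sub; [exact: Gc|apply: continuous_lin; exact: Gc].
  by rewrite !GPhi bdD bdZ subrr.
have [K K0 TK] := op_bd T.
have [f fE] : exists f : X', forall x, f x = G x T.
  (* Four terms with coefficients at most C |x|, each multiplied by a matrix entry of T, which is at
     most K. *)
  apply: bd_ex Glin _; exists (4 * (C * K)) => x.
  have [_ cb _] := cuP x; apply: le_trans (nc_sum _ _ _) _.
  apply: (@le_trans _ _ (\sum_(k < 4) C * norm1 x * K)); last first.
    by rewrite sumr_const card_ord -mulr_natl le_eqVlt; apply/orP; left; apply/eqP; ring.
  apply: ler_sum => k _; rewrite ncM; apply: ler_pM; rewrite ?nc_ge0 ?cb //.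
  apply: le_trans (dot_CS _ _ _) _.
  have b1 := basis_vector_norm (u x k) 0; have b0 := hnorm_ge0 dot (basis_vector (u x k) 0).
  have h := TK (basis_vector (u x k) 0).
  apply: (@le_trans _ _ (hn (T (basis_vector (u x k) 0)))).
    by apply: ler_piMr; [exact: hnorm_ge0|exact: b1].
  by apply: le_trans h _; apply: ler_piMr; [exact: K0|exact: b1].
apply/asboolP; exists f; apply/eqP; rewrite -subr_eq0; apply/eqP; apply: op_ext => v.
rewrite op_fun0; apply: op_basis0 => x j y i.
have [z zE] := block_ev HX HXc (basis_vector x j) (basis_vector y i).
have -> : (T - Phi f) (basis_vector x j) = T (basis_vector x j) - Phi f (basis_vector x j) by [].
rewrite dotBl zE fE.
apply: (@closure_vanish T (fun S => dot (S (basis_vector x j)) (basis_vector y i) - G z S) Tcl) => [|g].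
  by apply: continuous_sub; [exact: vector_functional_continuous|exact: Gc].
by rewrite GPhi zE subrr.
Qed.

End BlockImage.

Section BlockRepresentation.
Context {R : realType} (X : smosData R).
Hypothesis HX : is_smos X.
Hypothesis HXc : complete_smos X.
Hypothesis U0 : zero_nbhd_sa (U_ X).
Local Notation X' := (bdfun (@norm1 R X)).
Local Notation N := (mnorm X).
Local Notation H := (@l2_hilbert R (Moo X)).
Local Notation Phi := (block_op HX).
Local Notation W := (block_image HX : submodClosed (LH H)).
Let HN := smos_norm HX.

Definition block_norm (F : Moo X') : R := mnorm (LH H) (mmap Phi F).

Variables (lam : Moo X -> R) (C1 C2 : R).
Hypotheses (Hlam : matrix_norm lam) (lam_ge : forall x, N x <= lam x).

Let nu : Moo X' -> R := dual_norm lam.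
Let D := dual_with nu.
Hypothesis norm_le : forall F, block_norm F <= C1 * nu F.
Hypothesis C2_gt0 : 0 < C2.
Hypothesis norm_ge : forall F, nu F <= C2 * block_norm F.

Lemma block_op_image f : Phi f \in W.
Proof. by apply/asboolP; exists f. Qed.

Definition block_rep (f : X') : subsp W := SubSp (block_op_image f).

Lemma block_rep_mmap (F : Moo X') : mmap (subsp_val (S := W)) (mmap block_rep F) = mmap Phi F.
Proof.
have p0 : block_rep 0 = 0 by apply: subsp_ext; exact: (lin0 (block_op_lin HX)).
by apply: mooP => i j; rewrite !mmapE // ?(lin0 (block_op_lin HX)) // p0.
Qed.

Lemma block_rep_norm (F : Moo X') : mnorm (sub_smos W) (mmap block_rep F) = block_norm F.
Proof. exact: (etrans (sub_mnormE _) (congr1 (mnorm (LH H)) (block_rep_mmap F))). Qed.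

Lemma block_rep_cone (F : Moo X') : mcone (sub_smos W) (mmap block_rep F) = mcone (LH H) (mmap Phi F).
Proof. exact: (etrans (sub_mconeE _) (congr1 (mcone (LH H)) (block_rep_mmap F))). Qed.

Lemma block_rep_preimage (s : subsp W) : exists f, block_rep f = s.
Proof.
case: s => T TW; have [f fT] : exists f, T = Phi f by apply/asboolP; exact: TW.
by exists f; apply: subsp_ext; rewrite /= fT.
Qed.

Definition block_rep_inv (s : subsp W) : X' := projT1 (cid (block_rep_preimage s)).

Lemma block_rep_invK : cancel block_rep_inv block_rep.
Proof. by move=> s; exact: (projT2 (cid (block_rep_preimage s))). Qed.

Lemma block_repK : cancel block_rep block_rep_inv.
Proof.
move=> f; apply: (block_op_inj U0).
exact: (congr1 (@subsp_val _ _ W) (block_rep_invK (block_rep f))).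
Qed.

Lemma block_rep_cone_iff (F : Moo X') : @msa R D F ->
  dual_cone F <-> mcone (LH H) (mmap Phi F).
Proof.
move=> Fs; split=> [/(dual_coneP HX)[_ Fp]|Fp].
  by apply: block_pos => x [xp _]; exact: Fp.
apply/(dual_coneP HX); split; first by apply/(dual_saP HX); exact: Fs.
move=> x xp m n eta; have N0 := matrix_norm_ge0 HN x.
pose t := (N x + 1)^-1; have t0 : 0 < t by rewrite invr_gt0 ltr_wpDl.
have xu : unit_cone (t%:C%C *: x).
  split; first by apply: (coneZ HX) => //; exact: ltW.
  by rewrite (smos_normZr HX) gtr0_norm // ler_pdivrMl ?mulr1 ?lerDl // ltr_wpDl.
have := block_pos_inv xu Fp m n eta; rewrite afm_parrZ pmulr_rge0 //.
by rewrite ltcE /= eqxx.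
Qed.

Lemma block_rep_representation :
  @dual_representation R D (@predual R X nu) H W block_rep.
Proof.
have lin : linear block_rep by move=> c f g; apply: subsp_ext; rewrite subsp_val_lin; exact: (block_op_lin HX).
split.
- move=> T /asboolP[f ->]; rewrite -(block_op_star HX); exact: block_op_image.
- exact: (block_image_closed U0 HXc).
- split; first by exists block_rep_inv; [exact: block_repK|exact: block_rep_invK].
    split; first split.
    + exact: lin.
    + move=> f; apply: subsp_ext; rewrite -[LHS]/(Phi (dual_star f)) (block_op_star HX).
      by rewrite /= /insubd insubT // -(block_op_star HX); exact: block_op_image.
    + exact: (can_inj block_repK).
    + move=> F Fs; have := block_rep_cone_iff Fs; rewrite -(block_rep_cone F); exact.
  split; first by exists C1 => F; rewrite (block_rep_norm F); exact: norm_le.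
  apply: (@lt_le_trans _ _ (C2^-1)%:E); first by rewrite lte_fin invr_gt0.
  apply: le_ereal_inf_tmp => _ [F F1 <-]; rewrite lee_fin (block_rep_norm F).
  have h : 1 <= C2 * block_norm F by rewrite -(F1 : nu F = 1).
  by rewrite -[C2^-1]mulr1 ler_pdivrMl.
- split.
    apply: (@continuous_comp_initial _ _ _ (subsp_val : subsp W -> LH_weakstar H)).
    apply: (@weak_continuousP R (bdop H) (@normal_functionals R H) (weakstar (@predual R X nu)) (fun f => Phi f)).
    move=> g gn; have [x xE] := normal_ev HX HXc gn.
    have [phi phiE] := ev_exists HX Hlam lam_ge x.
    have := @weak_continuous R X' [set g : X' -> R[i] | exists2 phi : bdfun (@norm1 R D), @predual R X nu phi & g = phi] (fun f => g (Phi f)).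
    apply; exists phi; first by exists x.
    by apply/funext => f; rewrite xE phiE.
  exists block_rep_inv; split; [exact: block_repK|exact: block_rep_invK|].
  (* The inverse is continuous because each evaluation f(x) is a corner functional of the operator
     of f. *)
  apply: (@weak_continuousP R X' _ (subsp_weakstar W) block_rep_inv) => g [phi [x xE] ->].
  have [c0 _ span] := corner_span HX U0; have [c [u [uu _ xsum]]] := span x.
  have sc : continuous (subsp_val : subsp_weakstar W -> LH_weakstar H) by exact: initial_continuous.
  have -> : phi \o block_rep_inv = (corner_functional c u : LH_weakstar H -> R[i]^o) \o (subsp_val : subsp_weakstar W -> LH_weakstar H).
    apply/funext => s /=; rewrite xE.
    have <- : Phi (block_rep_inv s) = subsp_val s by rewrite -{2}(block_rep_invK s).
    by rewrite corner_functional_block // -xsum.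
  by move=> s; apply: continuous_comp; [exact: sc|exact: corner_functional_continuous].
Qed.

End BlockRepresentation.

Lemma matrix_norm_max (R : realType) (V : lmodType R[i]) (N1 N2 : Moo V -> R) :
  matrix_norm N1 -> matrix_norm N2 -> matrix_norm (fun x => Num.max (N1 x) (N2 x)).
Proof.
move=> H1 H2; have p1 := matrix_norm_ge0 H1; have p2 := matrix_norm_ge0 H2.
have [d1 t1 z1 r1] := H1; have [_ t2 z2 r2] := H2.
have le (m : nat) (N : Moo V -> R) (a b : 'I_m -> Moo R[i]) (x : 'I_m -> Moo V) :
    (forall y, N y <= Num.max (N1 y) (N2 y)) ->
    Num.sqrt (cnorm (\sum_(k < m) madjmul (a k) (a k))) * Num.sqrt (cnorm (\sum_(k < m) madjmul (b k) (b k))) *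
      \big[Num.max/0]_(k < m) N (x k) <=
    Num.sqrt (cnorm (\sum_(k < m) madjmul (a k) (a k))) * Num.sqrt (cnorm (\sum_(k < m) madjmul (b k) (b k))) *
      \big[Num.max/0]_(k < m) Num.max (N1 (x k)) (N2 (x k)).
  by move=> NM; rewrite ler_wpM2l ?mulr_ge0 ?sqrtr_ge0 //; apply: le_bigmax2.
split.
- move=> x x0; apply: d1; apply/eqP; rewrite eq_le p1 andbT -x0.
  by rewrite le_max lexx.
- move=> x y; rewrite ge_max; apply/andP; split.
    by apply: le_trans (t1 x y) _; rewrite lerD // le_max lexx.
  by apply: le_trans (t2 x y) _; rewrite lerD // le_max lexx orbT.
- by move=> c x; rewrite z1 z2 maxr_pMr ?nc_ge0.
- move=> m a b x; rewrite ge_max; apply/andP; split.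
    by apply: le_trans (r1 m a b x) (le _ _ _ _ _ _) => y; rewrite le_max lexx.
  by apply: le_trans (r2 m a b x) (le _ _ _ _ _ _) => y; rewrite le_max lexx orbT.
Qed.

(** * The block norm as a dual norm *)

Section BlockDual.
Context {R : realType} (X : smosData R).
Hypothesis HX : is_smos X.
Hypothesis HXc : complete_smos X.
Hypothesis U0 : zero_nbhd_sa (U_ X).
Local Notation X' := (bdfun (@norm1 R X)).
Local Notation N := (mnorm X).
Local Notation bn := (block_norm HX).
Let sl := smos_star_lin HX.
Let HN := smos_norm HX.
Let N_ge0 := matrix_norm_ge0 HN.

Lemma block_norm_ge0 F : 0 <= bn F. Proof. exact: op_mnorm_ge0. Qed.

Lemma bn_le (F : Moo X') (B : R) : 0 <= B -> (forall x, unit_cone x -> ale (parr F x) B) -> bn F <= B.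
Proof. exact: block_norm_le. Qed.

Lemma block_normZ (t : R) (F : Moo X') : 0 <= t -> bn (t%:C%C *: F) <= t * bn F.
Proof.
move=> t0; apply: bn_le => [|y yu]; first exact: (mulr_ge0 t0 (block_norm_ge0 F)).
have yF : ale (parr F y) (bn F) by exact: block_norm_ge.
by have := ale_parrZ t%:C%C yF; rewrite nc_real (ger0_norm t0).
Qed.

Lemma parr_dual_star (F : Moo X') x :
  parr (minf (fun i j => dual_star (F j i))) x = fun k l a b => (parr F (mstar x) l k b a)^*.
Proof.
by apply: arrP => k l a b; rewrite /parr dual_starEE // (dual_starE HX) (mstarEE sl).
Qed.

Lemma dual_mstarK (F : Moo X') :
  minf (fun i j => dual_star ((minf (fun i j => dual_star (F j i))) j i)) = F.
Proof.
apply: mooP => i j; rewrite !dual_starEE //.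
by apply: bd_ext => x; rewrite !(dual_starE HX) (smos_starK HX) conjCK.
Qed.

(** For an involution, one inequality applied twice gives equality. *)
Lemma star_invariant (nu : Moo X' -> R) :
  (forall F : Moo X', nu (minf (fun i j => dual_star (F j i))) <= nu F) ->
  forall F : Moo X', nu (minf (fun i j => dual_star (F j i))) = nu F.
Proof.
move=> h F; apply/eqP; rewrite eq_le h /=.
by have := h (minf (fun i j => dual_star (F j i))); rewrite dual_mstarK.
Qed.

Lemma dual_norm_star (F : Moo X') : dual_norm N (minf (fun i j => dual_star (F j i)) : Moo X') = dual_norm N F.
Proof.
apply: star_invariant => {}F; apply: dual_norm_le => [|x x1].
  exact: (dual_norm_ge0 HN HN (fun x => lexx _)).
rewrite parr_dual_star; apply: ale_star.
by apply: (@dual_norm_ale1 _ _ HN N (fun x => lexx _) F); rewrite (smos_norm_star HX).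
Qed.

Lemma block_norm_star (F : Moo X') : bn (minf (fun i j => dual_star (F j i))) = bn F.
Proof.
apply: star_invariant => {}F; apply: bn_le => [|x xu]; first exact: block_norm_ge0.
rewrite parr_dual_star; apply: ale_star.
by rewrite (smos_cone_sa HX xu.1 : mstar x = x); exact: block_norm_ge.
Qed.

Lemma block_norm_le_dual F : bn F <= dual_norm N F.
Proof.
apply: bn_le => [|x [_ x1]]; first exact: (dual_norm_ge0 HN HN (fun x => lexx _)).
exact: (@dual_norm_ale1 _ _ HN N (fun x => lexx _) F _ x1).
Qed.

Lemma ale_parr_sum n (F : Moo X') (c : nat -> R[i]) (u : nat -> Moo X) (B : R) :
  (forall k, ale (parr F (u k)) B) ->
  ale (parr F (\sum_(k < n) c k *: u k)) (\sum_(k < n) nc (c k) * B).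
Proof.
move=> uB m p xi eta x1 e1; elim: n => [|n IH].
  rewrite !big_ord0 (_ : afm _ _ _ _ _ = 0) ?nc0 //.
  by have := afm_parrZ F 0 0 m p xi eta; rewrite scaler0 mul0r.
rewrite !big_ord_recr /= afm_parrD afm_parrZ; apply: le_trans (ncD _ _) _.
by rewrite lerD // ncM ler_wpM2l ?nc_ge0 //; exact: uB.
Qed.

(** Every x in the unit ball is a combination of four elements of the unit cone with coefficients at
    most C. *)
Lemma dual_norm_le_block : exists2 C, 0 < C & forall F, dual_norm N F <= C * bn F.
Proof.
have [C C0 span] := unit_cone_span HX U0; exists (4 * C); first by rewrite mulr_gt0.
move=> F; have b0 := block_norm_ge0 F; apply: dual_norm_le => [|x x1].
  by rewrite !mulr_ge0 // ltW.
have [c [u [uu cb ->]]] := span x.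
have ub k : ale (parr F (u k)) (bn F) by exact: block_norm_ge.
apply: aleW (@ale_parr_sum 4 F c u (bn F) ub).
rewrite -mulr_suml ler_wpM2r //.
apply: (@le_trans _ _ (\sum_(k < 4) C)); last by rewrite sumr_const card_ord mulr_natl.
apply: ler_sum => k _; apply: le_trans (cb k) _.
by rewrite ler_piMr // ltW.
Qed.

Section DualMos.
Variables (lam : Moo X -> R) (C C2 : R).
Hypotheses (Hlam : matrix_norm lam) (lam_ge : forall x, N x <= lam x).
Hypothesis lam_le : forall x, lam x <= C * N x.
Let nu : Moo X' -> R := dual_norm lam.
Let D := dual_with nu.
Hypothesis nu_star : forall f : Moo D, nu (mstar f) = nu f.
Hypothesis norm_ge : forall F, nu F <= C2 * bn F.

Lemma block_dual_mos : @dual_mos R D (@predual R X nu).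
Proof.
have Dsmos : is_smos D by exact: (is_smos_dual_with HX Hlam lam_ge nu_star).
split; first split.
- exact: Dsmos.
- exact: (predual_is_predual HX HXc Hlam lam_ge lam_le nu_star).
- exact: (cone_weak_closed HX Hlam lam_ge).
split; first exact: Dsmos.
move=> F /(dual_coneP HX)[Fs Fp] /(dual_coneP HX)[_ Fn].
have b0 : bn F <= 0.
  (* If F and - F are positive, the quadratic forms of F vanish on the cone, so by polarization F
     vanishes on the unit cone and its block norm is 0. *)
  apply: bn_le => // x [xp _]; apply: ale_polarization => //.
    exact: (smos_cone_sa HX).
  move=> m n eta; rewrite mul0r normr_le0; apply/eqP/le_anti; apply/andP; split.
    by have := Fn x xp m n eta; rewrite afm_parrN ge0_complexE ReN oppr_ge0 => /andP[].
  by have := Fp x xp m n eta; rewrite ge0_complexE => /andP[].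
have [d _ _ _] : matrix_norm nu by exact: (dual_norm_matrix HN Hlam lam_ge).
apply: d; apply/eqP; rewrite eq_le (dual_norm_ge0 HN Hlam lam_ge) andbT.
apply: le_trans (norm_ge F) _.
have -> : bn F = 0 by apply/eqP; rewrite eq_le b0 block_norm_ge0.
by rewrite mulr0.
Qed.

End DualMos.

Lemma block_quasi (lam : Moo X -> R) (C C1 C2 : R) : matrix_norm lam ->
  (forall x, N x <= lam x) -> (forall x, lam x <= C * N x) ->
  (forall F : Moo X', dual_norm lam (minf (fun i j => dual_star (F j i)) : Moo X') = dual_norm lam F) ->
  (forall F, bn F <= C1 * dual_norm lam F) -> 0 < C2 -> (forall F, dual_norm lam F <= C2 * bn F) ->
  dual_quasi_operator_system (@predual R X (dual_norm lam)).
Proof.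
move=> Hlam lam_ge lam_le nu_star le C20 ge; split.
  exact: (block_dual_mos Hlam lam_ge lam_le nu_star ge).
exists (@l2_hilbert R (Moo X)); exists (block_image HX : submodClosed (LH _)); exists (block_rep HX).
exact: (block_rep_representation HXc U0 Hlam lam_ge le C20 ge).
Qed.

Lemma dual_quasi : dual_quasi_operator_system (dual_predual X).
Proof.
have [C C0 CP] := dual_norm_le_block.
have l1 x : N x <= 1 * N x by rewrite mul1r.
have l2 (F : Moo X') : bn F <= 1 * dual_norm N F by rewrite mul1r; exact: block_norm_le_dual.
exact: (block_quasi HN (fun x => lexx _) l1 dual_norm_star l2 C0 CP).
Qed.

Definition entry_pairing (F : Moo X') (p q : nat) (y : X) : R[i] := F p q y.

(** The polar of the unit ball of the block norm suggests the supremum; the maximum with the norm of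
    X secures [lam >= N], and the smaller unit ball that results still contains the unit cone. *)
Definition block_lam (x : Moo X) : R :=
  Num.max (N x) (supN [set F : Moo X' | bn F <= 1] entry_pairing x).

Lemma block_lam_ge x : N x <= block_lam x.
Proof. by rewrite le_max lexx. Qed.

Lemma block_unit_bd : exists2 C, 0 < C & forall x (F : Moo X'), bn F <= 1 -> ale (parr F x) (C * N x).
Proof.
have [C C0 CP] := dual_norm_le_block; exists C => // x F F1.
have h : ale (parr F x) (dual_norm N F * N x) := dual_norm_ale HN HN (fun x => lexx _) F x.
apply: aleW h.
rewrite ler_wpM2r //; apply: le_trans (CP F) _.
by rewrite ler_piMr // ltW.
Qed.

Lemma block_lam_norm : matrix_norm block_lam.
Proof.
have [C C0 CP] := block_unit_bd.
apply: matrix_norm_max => //; apply: supN_matrix_norm.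
- by move=> F p q _ c x y; rewrite /entry_pairing bdD bdZ.
- by move=> x; exists (C * N x) => F F1; exact: CP.
move=> x x0; apply: (functionals_separate HX) => f.
pose t := dual_norm N (mx1 f : Moo X').
have t0 : 0 <= t by exact: (dual_norm_ge0 HN HN (fun x => lexx _)).
have t1 : 0 < (t + 1)^-1 by rewrite invr_gt0 ltr_wpDl.
have bF : bn ((t + 1)^-1%:C%C *: mx1 f) <= 1.
  apply: le_trans (block_norm_le_dual _) _.
  have [_ _ -> _] : matrix_norm (dual_norm N : Moo X' -> R) := dual_norm_matrix HN HN (fun x => lexx _).
  by rewrite nc_real (gtr0_norm t1) ler_pdivrMl ?mulr1 ?lerDl // ltr_wpDl.
have := x0 ((t + 1)^-1%:C%C *: mx1 f) 0%N 0%N bF.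
rewrite /entry_pairing mooZ bd_funZ mx1E /= => /eqP; rewrite mulf_eq0 => /orP[/eqP h|/eqP //].
have := nc_real (t + 1)^-1; rewrite h nc0 (gtr0_norm t1) => h'.
by rewrite -h' ltxx in t1.
Qed.

Lemma block_lam_le : exists C, forall x, block_lam x <= C * N x.
Proof.
have [C C0 CP] := block_unit_bd; exists (Num.max 1 C) => x.
rewrite ge_max; apply/andP; split.
  by rewrite -[leLHS]mul1r ler_wpM2r // le_max lexx.
apply: supN_le => [|F F1]; first by rewrite mulr_ge0 // le_max ler01.
by apply: aleW (CP x F F1); rewrite ler_wpM2r // le_max lexx orbT.
Qed.

Lemma block_lam_unit x : unit_cone x -> block_lam x <= 1.
Proof.
move=> xu; rewrite ge_max xu.2 /=; apply: supN_le => [|F F1]; first exact: ler01.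
by apply: aleW F1 _; exact: block_norm_ge.
Qed.

(** The unit cone lies in the unit ball of [block_lam], which gives one inequality. For the other, F
    divided by its block norm is among the test matrices that define [block_lam]. *)
Lemma block_lam_dual (F : Moo X') : dual_norm block_lam F = bn F.
Proof.
apply/eqP; rewrite eq_le; apply/andP; split; last first.
  apply: bn_le => [|x xu]; first exact: (dual_norm_ge0 HN block_lam_norm block_lam_ge).
  by apply: (@dual_norm_ale1 _ _ HN block_lam block_lam_ge F); exact: block_lam_unit.
have b0 := block_norm_ge0 F; apply: dual_norm_le => // x x1.
have [C C0 CP] := dual_norm_le_block.
(* F cannot be normalized in this case, but then it is 0, since the block norm dominates a multiple
   of the dual norm. *)
have [z|nz] := eqVneq (bn F) 0.
  have F0 : F = 0.
    have [d _ _ _] : matrix_norm (dual_norm N : Moo X' -> R) := dual_norm_matrix HN HN (fun x => lexx _).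
    apply: d; apply/eqP; rewrite eq_le (dual_norm_ge0 HN HN (fun x => lexx _)) andbT.
    by apply: le_trans (CP F) _; rewrite z mulr0.
  rewrite z F0 => m n xi eta _ _; rewrite (_ : afm _ _ _ _ _ = 0) ?nc0 //.
  rewrite /afm big1 // => k _; rewrite big1 // => l _; rewrite big1 // => p _; rewrite big1 // => q _.
  by rewrite /parr moo0 bd_fun0 mulr0 mul0r.
have bp : 0 < bn F by rewrite lt0r nz.
pose G := (bn F)^-1%:C%C *: F.
have G1 : bn G <= 1.
  by apply: le_trans (block_normZ F _) _; rewrite ?invr_ge0 // mulVf.
have Gx : ale (parr G x) 1.
  have bd y : exists K, forall K', [set F : Moo X' | bn F <= 1] K' -> ale (barr entry_pairing K' y) K.
    have [C' _ CP'] := block_unit_bd; exists (C' * N y) => K' K1; exact: (CP' y K').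
  have h := @supN_ale _ _ _ _ _ bd x G G1.
  apply: aleW h; apply: le_trans x1; by rewrite le_max lexx orbT.
have FG : F = (bn F)%:C%C *: G by rewrite /G scalerA -rcM mulfV // rc1 scale1r.
by rewrite FG; have := ale_parrZ (bn F)%:C%C Gx; rewrite nc_real (gtr0_norm bp) mulr1 -FG.
Qed.

Lemma block_norm_N_sys : N_sys X bn.
Proof.
have bnE : bn = dual_norm block_lam by apply/funext => F; rewrite block_lam_dual.
have [C lam_le] := block_lam_le.
have nu_star (F : Moo X') : dual_norm block_lam (minf (fun i j => dual_star (F j i)) : Moo X') = dual_norm block_lam F.
  by rewrite !block_lam_dual block_norm_star.
have l1 (F : Moo X') : bn F <= 1 * dual_norm block_lam F by rewrite block_lam_dual mul1r.
have l2 (F : Moo X') : dual_norm block_lam F <= 1 * bn F by rewrite block_lam_dual mul1r.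
rewrite bnE; split.
  exists block_lam; split; [exact: block_lam_norm|exact: block_lam_ge| |by []].
  have mid (x : Moo X) : mmap id x = x by apply: mooP => i j; rewrite mmapE.
  pose C' := Num.max 1 C; have C'0 : 0 < C' by rewrite lt_max ltr01.
  split; first by exists 1 => x; rewrite mid mul1r block_lam_ge.
  apply: (@lt_le_trans _ _ (C'^-1)%:E); first by rewrite lte_fin invr_gt0.
  apply: le_ereal_inf_tmp => _ [x x1 <-]; rewrite lee_fin mid -[C'^-1]mulr1 ler_pdivrMl // -x1.
  by apply: le_trans (lam_le x) _; rewrite ler_wpM2r // le_max lexx orbT.
split; first exact: (block_dual_mos block_lam_norm block_lam_ge lam_le nu_star l2).
exists (@l2_hilbert R (Moo X)); exists (block_image HX : submodClosed (LH _)); exists (block_rep HX); split.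
  exact: (block_rep_representation HXc U0 block_lam_norm block_lam_ge l1 ltr01 l2).
move=> F; rewrite (block_rep_norm HX F) -bnE.
by [].
Qed.

End BlockDual.

Lemma op_mnorm_corner (R : realType) (H : lmodType R[i]) (dot : {dot H for Num.conj})
    (V : lmodType R[i]) (act : V -> H -> H) (y : Moo V) (m : nat) (v : H) :
  (forall i j, (m <= i)%N || (m <= j)%N -> forall w, act (y i j) w = 0) ->
  (forall i j, linear (act (y i j))) ->
  (forall i j, exists K : R, forall w, hnorm dot (act (y i j) w) <= K * hnorm dot w) ->
  hnorm dot (act (y 0%N 0%N) v) <= op_mnorm dot act y * hnorm dot v.
Proof.
move=> y0 yl yb; have := op_mnorm_act y0 yl yb (fun _ : 'I_1 => v).
by rewrite /hsq !big_ord1 !sqrtr_sqr !ger0_norm ?hnorm_ge0.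
Qed.

Lemma mx_corner_bound (R : realType) n (Y : Moo 'M[R[i]]_n) (v : 'rV[R[i]]_n) :
  hnorm (@dotmx _ n) (mxact (Y 0%N 0%N) v) <= mnorm (mx_smos n) Y * hnorm (@dotmx _ n) v.
Proof.
have [m mN] := mxarr_Mn Y.
exact: (op_mnorm_corner v mN (fun k l => mxact_linear _) (fun k l => mxact_bounded _)).
Qed.

(** * Weak-* continuous maps into matrix algebras and the unit cone *)

Section UnitConeMaps.
Context {R : realType} (X : smosData R).
Hypothesis HX : is_smos X.
Local Notation X' := (bdfun (@norm1 R X)).
Local Notation N := (mnorm X).
Local Notation P := (dual_predual X).
Let sl := smos_star_lin HX.
Let HN := smos_norm HX.
Let N_ge0 := matrix_norm_ge0 HN.

Lemma WQ_linear n (phi : X' -> 'M[R[i]]_n) : @WQ R (dual X) P n phi -> linear phi.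
Proof. by move=> [[[[l _] _] _] _]; exact: l. Qed.

Lemma WQ_entry n (phi : X' -> 'M[R[i]]_n) (p q : 'I_n) : @WQ R (dual X) P n phi ->
  exists x : X, forall f, phi f p q = f x.
Proof.
move=> phiW; apply: (@weakstar_functional R X (dual_norm N) (fun f => phi f p q)).
  by move=> c f g; rewrite (WQ_linear phiW) !mxE.
move: phiW => [_ phic] f.
exact: (continuous_comp (phic f) (@coord_continuous _ _ _ p q (phi f))).
Qed.

(* The arrays of phi^(oo)(F) and of theta_F(x) differ by the flip of the tensor factors. *)
Definition represents n (phi : X' -> 'M[R[i]]_n) (x : Moo X) :=
  forall F : Moo X', mxarr (mmap phi F) = fun k l p q => parr F x p q k l.

(** Each entry of phi is a weak-* continuous functional, hence evaluation at a point of X. Complete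
    positivity of phi puts the resulting matrix into the cone by the bipolar theorem, and complete
    contractivity bounds its norm by self-adjoint norm duality. *)
Lemma WQ_unit_cone n (phi : X' -> 'M[R[i]]_n) : @WQ R (dual X) P n phi ->
  exists2 x, unit_cone x & represents phi x.
Proof.
move=> phiW; have lin := WQ_linear phiW.
pose y p q := projT1 (cid (WQ_entry p q phiW)).
have yE p q f : phi f p q = f (y p q) := projT2 (cid (WQ_entry p q phiW)) f.
pose g k l := natfun (fun p : 'I_n => natfun (fun q : 'I_n => y p q) l) k.
have g0 k l : (n <= k)%N || (n <= l)%N -> g k l = 0.
  move=> /orP[] h; rewrite /g; first by rewrite natfun0.
  by rewrite /natfun; case: insub => // ?; rewrite insubF // ltnNge h.
pose x := minf g; have xE k l : x k l = g k l := minfE g0 k l.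
have rep : represents phi x.
  move=> F; apply: arrP => k l p q; rewrite /parr xE.
  case: (ltnP p n) => pn; last by rewrite mxarr0 ?pn // g0 ?pn // bd0.
  case: (ltnP q n) => qn; last by rewrite mxarr0 ?qn ?orbT // g0 ?qn ?orbT // bd0.
  have := mxarrE (mmap phi F) k l (Ordinal pn) (Ordinal qn) => /= ->.
  rewrite mmapE ?(lin0 lin) // yE /g.
  have := natfunE (fun p : 'I_n => natfun (fun q : 'I_n => y p q) q) (Ordinal pn) => /= ->.
  by have := natfunE (fun q : 'I_n => y (Ordinal pn) q) (Ordinal qn) => /= ->.
have [[[[_ phis] phip] phin] _] := phiW.
have xs : msa x.
  apply: mooP => k l; rewrite (mstarEE sl) !xE.
  case: (boolP ((n <= k)%N || (n <= l)%N)) => [kl|].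
    by rewrite !g0 // ?(star0 sl) // orbC.
  rewrite negb_or -!ltnNge => /andP[kn ln].
  have gE (p q : 'I_n) : g p q = y p q by rewrite /g !natfunE.
  have := gE (Ordinal ln) (Ordinal kn); have := gE (Ordinal kn) (Ordinal ln) => /= -> ->.
  apply/eqP; rewrite -subr_eq0; apply/eqP; apply: (functionals_separate HX) => f.
  have h1 := dual_starE HX f (y (Ordinal ln) (Ordinal kn)).
  have := phis f => /matrixP /(_ (Ordinal ln) (Ordinal kn)).
  rewrite -[star (dual X) f]/(dual_star f) yE h1 !mxE yE => /(congr1 Num.conj).
  by rewrite !conjCK bdB => ->; rewrite subrr.
exists x => //; split.
  apply: (cone_bipolar HX xs) => F Fp.
  by have /mx_coneE := phip F Fp; rewrite (rep F) => /apos_flip.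
apply: (sa_norm_duality HX xs ltr01) => F _ F1.
have := ale_mxarr (mmap phi F); rewrite (rep F) => /ale_flip.
by apply: aleW; apply: le_trans (phin F) _.
Qed.

Lemma unit_cone_WQ (x : Moo X) : unit_cone x ->
  exists n (phi : X' -> 'M[R[i]]_n), @WQ R (dual X) P n phi /\ represents phi x.
Proof.
move=> xu; have xs : msa x := smos_cone_sa HX xu.1.
have [n xn] := moo_finsupp x; pose phi (f : X') : 'M[R[i]]_n := \matrix_(p, q) f (x p q).
have lin : linear phi by move=> c f g; apply/matrixP => p q; rewrite !mxE bd_funD bd_funZ.
have rep : represents phi x.
  move=> F; apply: arrP => k l p q; rewrite /parr.
  case: (ltnP p n) => pn; last by rewrite mxarr0 ?pn // xn ?pn // bd0.
  case: (ltnP q n) => qn; last by rewrite mxarr0 ?qn ?orbT // xn ?qn ?orbT // bd0.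
  have := mxarrE (mmap phi F) k l (Ordinal pn) (Ordinal qn) => /= ->.
  by rewrite mmapE ?(lin0 lin) // mxE.
exists n; exists phi; split=> //; split; first split; first split; first split.
- exact: lin.
- move=> f; apply/matrixP => p q; rewrite !mxE.
  have := dual_starE HX f (x p q); rewrite -[dual_star f]/(star (dual X) f) => ->.
  by rewrite -(mstarEE sl) (xs : mstar x = x).
- move=> F /(dual_coneP HX)[_ Fp]; apply/mx_coneE; rewrite (rep F).
  exact: (apos_flip (Fp x xu.1)).
- move=> F; rewrite mx_normE (rep F) (anorm_flip (parr F x)); apply: anorm_le.
  exact: (dual_norm_ale1 HN (fun x => lexx _) F xu.2).
- have entc p q : continuous ((fun f : X' => phi f p q) : weakstar P -> R[i]^o).
    have [e eE] := ev_exists HX HN (fun x => lexx _) (x p q).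
    have := @weak_continuous R X' [set g : X' -> R[i] | exists2 e : bdfun (@norm1 R (dual X)), @predual R X (dual_norm N) e & g = e] (fun f => phi f p q).
    apply; exists e; first by exists (x p q).
    by apply/funext => f; rewrite mxE eE.
  (* A neighborhood of a matrix is given by neighborhoods of its entries; the finitely many
     conditions are collected by [filter_forall], over q and then over p. *)
  move=> f A [Q fQ QA].
  pose B := nbhs (f : weakstar P); have BF : Filter B by exact: nbhs_filter.
  have hp p : B [set g : X' | forall q, Q p q (phi g p q)].
    exact: (@filter_forall _ _ (fun q => [set g : X' | Q p q (phi g p q)]) B BF (fun q => entc p q f _ (fQ p q))).
  have h := @filter_forall _ _ (fun p => [set g : X' | forall q, Q p q (phi g p q)]) B BF hp.
  exact: (@filterS _ B BF _ (phi @^-1` A) (fun g gQ => QA (phi g) gQ) h).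
Qed.

(** The default value in [mu] is not taken: complete contractivity of all the maps bounds the family
    by the norm of f. *)
Lemma linf_mu (i : WQ_index P) (f : X') : linf_val (mu P f) i = \val (projT2 i) f.
Proof.
rewrite /mu /insubd insubT //=; apply/asboolP.
exists (norm1 (X := dual X) f) => {i} [[n [phi phiS]]] v /=.
have phiW : @WQ R (dual X) P n phi by exact: set_mem phiS.
have [[[_ _] phin] _] := phiW; have p0 : phi 0 = 0 := lin0 (WQ_linear phiW).
have e00 : mmap phi (mx1 f) 0%N 0%N = phi f by rewrite mmapE // mx1E.
rewrite -e00; apply: le_trans (mx_corner_bound _ _) _.
by apply: ler_wpM2r; [exact: hnorm_ge0|exact: phin].
Qed.

Definition unit_cone_norms (F : Moo X') : set R := [set anorm (parr F x) | x in @unit_cone R X].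

Lemma d_normE (F : Moo X') : d_norm F = sup (unit_cone_norms F).
Proof.
rewrite /d_norm /=; congr sup.
have mE (i : WQ_index P) : mmap (fun y => linf_val y i) (mmap (mu P) F) = mmap (\val (projT2 i)) F.
  have l0 : linf_val (mu P (0 : X')) i = 0.
    by rewrite linf_mu; exact: (lin0 (WQ_linear (set_valP (projT2 i)))).
  have m0 : mu P (0 : X') = 0.
    apply: val_inj; apply: functional_extensionality_dep => j.
    by rewrite -[LHS]/(linf_val (mu P 0) j) linf_mu; exact: (lin0 (WQ_linear (set_valP (projT2 j)))).
  apply: mooP => k l; rewrite !mmapE ?linf_mu //.
  exact: (lin0 (WQ_linear (set_valP (projT2 i)))).
apply/seteqP; split=> r.
  move=> [i _ <-]; rewrite mE.
  have [x xu rep] := WQ_unit_cone (set_valP (projT2 i)).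
  have e : mnorm (mx_smos _) (mmap (\val (projT2 i)) F) = anorm (parr F x).
    by rewrite mx_normE (rep F) (anorm_flip (parr F x)).
  by exists x; [exact: xu|exact: (esym e)].
move=> [x xu <-]; have [n [phi [phiW rep]]] := unit_cone_WQ xu.
pose i : WQ_index P := existT _ n (exist _ phi (mem_set phiW)).
exists i; first by [].
have e : mnorm (mx_smos n) (mmap phi F) = anorm (parr F x).
  by rewrite mx_normE (rep F) (anorm_flip (parr F x)).
by rewrite (mE i); exact: e.
Qed.

Lemma unit_cone_sup (F : Moo X') : unit_cone_norms F =
  [set mnorm Moo_smos (mmap (theta F) x) | x in
     [set x : Moo X | exists n, [/\ Mn n x, mcone X x & mnorm X x <= 1]]].
Proof.
apply/seteqP; split=> r [x].
  move=> [xp x1] <-; exists x; last exact: mnorm_theta.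
  by have [n xn] := moo_finsupp x; exists n.
by move=> [n [_ xp x1]] <-; exists x => //; rewrite mnorm_theta.
Qed.

Lemma d_norm_block (F : Moo X') : d_norm F = block_norm HX F.
Proof.
rewrite d_normE; apply/eqP; rewrite eq_le; apply/andP; split.
  apply: sup_le => [|_ [x xu <-]]; first exact: op_mnorm_ge0.
  by apply: anorm_le; exact: block_norm_ge.
apply: bn_le => [|x xu]; first by apply: sup_ge0 => _ [x _ <-]; exact: anorm_ge0.
have bx y : unit_cone y -> ale (parr F y) (block_norm HX F) by move=> yu; exact: block_norm_ge.
apply: aleW (ale_anorm (bx x xu)).
apply: (@le_sup _ _ (block_norm HX F)); last by exists x.
by move=> _ [y yu <-]; apply: anorm_le; exact: bx.
Qed.

End UnitConeMaps.

(** The equivalence of lam with the norm gives lam <= c^-1 N. If F is bounded by 1 on the unit cone,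
    then nu F <= 1 by maximality, so the dual norm of F is at most c^-1. *)
Lemma N_sys_nbhd (R : realType) (X : smosData R) (HX : is_smos X) :
  N_sys X !=set0 -> zero_nbhd_sa (norm_closure (mnorm X) (U_ X)).
Proof.
move=> [nu nuS]; have [[lam [Hlam lam_ge emb nuE]] _] := nuS.
have HN := smos_norm HX.
have [c c0 cP] := complete_embedding_below emb.
have lam_le x : lam x <= c^-1 * mnorm X x.
  have [->|lx] := eqVneq (lam x) 0.
    by rewrite mulr_ge0 ?invr_ge0 ?(ltW c0) // (matrix_norm_ge0 HN).
  have lp : 0 < lam x by rewrite lt0r lx (matrix_norm_ge0 Hlam).
  have := cP _ (matrix_norm_normalize Hlam lp).
  have -> : mmap id ((lam x)^-1%:C%C *: x) = (lam x)^-1%:C%C *: x by apply: mooP => i j; rewrite mmapE.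
  rewrite (smos_normZr HX) gtr0_norm ?invr_gt0 // [_ * mnorm X x]mulrC ler_pdivlMr // => h.
  by rewrite ler_pdivlMl.
apply: (@U_zero_nbhd _ _ HX c^-1); first by rewrite invr_gt0.
move=> F _ F1; apply: dual_norm_le => [|x x1]; first by rewrite invr_ge0 ltW.
have h := dual_norm_ale HN Hlam lam_ge F x; apply: aleW h.
have nuF : dual_norm lam F <= 1 by rewrite -nuE; exact: (N_sys_maximal HX nuS ler01 F1).
have lx : lam x <= c^-1.
  by apply: le_trans (lam_le x) _; rewrite ler_piMr // invr_ge0 ltW.
rewrite -[leRHS]mul1r ler_pM ?(matrix_norm_ge0 Hlam) //.
exact: (dual_norm_ge0 HN Hlam lam_ge).
Qed.

Theorem theorem3p9 (R : realType) (X : smosData R)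
    (HX : is_smos X) (HXc : complete_smos X) :
  [<-> dual_quasi_operator_system (dual_predual X);
       zero_nbhd_sa (U_ X);
       zero_nbhd_sa (norm_closure (mnorm X) (U_ X));
       N_sys X !=set0] /\
  (dual_quasi_operator_system (dual_predual X) ->
   [/\ forall f : Moo (dual X),
         d_norm f = sup [set mnorm Moo_smos (mmap (theta f) x) | x in
                          [set x : Moo X | exists n, [/\ Mn n x, mcone X x
                                                       & mnorm X x <= 1]]],
       N_sys X (@d_norm R X)
     & forall nu, N_sys X nu -> forall f, nu f <= d_norm f]).
Proof.
have HN := smos_norm HX.
have clU : zero_nbhd_sa (norm_closure (mnorm X) (U_ X)) -> zero_nbhd_sa (U_ X).
  exact: U_closure_nbhd.
have dE : @d_norm R X = block_norm HX by apply/funext => F; exact: d_norm_block.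
split.
  tfae.
  - by move=> /(quasi_nbhd HX); exact: clU.
  (* A set lies in its closure: the approximating point is x itself. *)
  - move=> [e e0 eU]; exists e => // x xs xe d d0.
    by exists x; [exact: eU|rewrite subrr (matrix_norm0 HN)].
  - by move=> /clU U0; exists (block_norm HX); exact: block_norm_N_sys.
  - by move=> /(N_sys_nbhd HX) /clU U0; exact: dual_quasi.
move=> /(quasi_nbhd HX) /clU U0; split.
- by move=> f; rewrite (d_normE HX) unit_cone_sup.
- by rewrite dE; exact: block_norm_N_sys.
move=> nu nuS f; rewrite dE; apply: (N_sys_maximal HX nuS); first exact: op_mnorm_ge0.
by move=> x xu; exact: block_norm_ge.
Qed.
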